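(* Let $(M,\omega,J)$ be a compact toric Kähler manifold of complex dimension $n$. If $n\ge 3$, then there exists a toric fibre of $M$ (indeed, there exist infinitely many toric fibres of $M$) which is not Hamiltonian volume minimizing.
   Context: A compact toric Kähler manifold of complex dimension $n$ is a compact Kähler manifold $(M,\omega,J)$ with $\dim_{\mathbb C}M=n$ admitting an effective holomorphic action of the complex torus $(\mathbb{C}^\times)^n$ whose restriction to the real torus $T^n$ is Hamiltonian with respect to the Kähler form $\omega$. Let $\mu:M\to\Delta=\mu(M)\subset\mathbb{R}^n$ be its moment map, with image the moment polytope $\Delta$. A toric fibre of $M$ is a fibre $\mu^{-1}(\boldsymbol{a})$ with $\boldsymbol{a}\in\mathrm{Int}(\Delta)$ (the interior of $\Delta$); it is a Lagrangian torus. A diffeomorphism $\phi$ of $M$ belongs to $\mathrm{Ham}_c(M,\omega)$ if it is the time-one map of the flow $\{\phi^t_H\}_{0\le t\le 1}$, $\phi_H^0=\mathrm{id}_M$, of the time-dependent Hamiltonian vector field $X_{H_t}$ of some compactly supported smooth function $H\in C_c^\infty([0,1]\times M)$. For a closed embedded Lagrangian submanifold $L\subset M$, $\mathrm{Vol}(L)$ denotes its Riemannian volume for the metric induced from the Kähler metric of $M$. $L$ is called Hamiltonian volume minimizing if $\mathrm{Vol}(\phi(L))\ge \mathrm{Vol}(L)$ for every $\phi\in\mathrm{Ham}_c(M,\omega)$. *)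

(* Defs.v *)
From HB Require Import structures.
From mathcomp Require Import all_boot all_order all_algebra.
From mathcomp Require Import complex.
From mathcomp Require Import all_classical all_reals all_analysis.

Set Implicit Arguments.
Unset Strict Implicit.
Unset Printing Implicit Defensive.
Import Order.TTheory GRing.Theory Num.Theory.
Import numFieldNormedType.Exports.
Local Open Scope classical_set_scope.
Local Open Scope ring_scope.

(* Vectors are rows, so differentials and linear maps act on the right. *)

Fixpoint Ck_on (R : realType) (d : nat) (W : normedModType R) (k : nat)
    (U : set 'rV[R]_d) (f : 'rV[R]_d -> W) : Prop :=
  match k with
  | 0 => forall x, U x -> {for x, continuous f}
  | k'.+1 => (forall x, U x -> differentiable f x) /\
             (forall v, Ck_on k' U (fun x => 'd f x v))
  end.

(* Only meant for open U. *)
Definition smooth_on (R : realType) (d : nat) (W : normedModType R)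
    (U : set 'rV[R]_d) (f : 'rV[R]_d -> W) : Prop :=
  forall k, Ck_on k U f.

(* C^n is R^(n+n), z = x + iy being the row (x | y); multiplication by i is
   (x | y) |-> (-y | x). *)
Definition mulI (R : realType) (n : nat) : 'M[R]_(n + n) :=
  block_mx 0 1%:M (- 1%:M) 0.

Definition toC (R : realType) (n : nat) (y : 'rV[R]_(n + n)) : 'rV[R[i]]_n :=
  \row_k (lsubmx y 0 k +i* rsubmx y 0 k)%C.

Definition bilin (R : realType) (d : nat) (A : 'M[R]_d) (v w : 'rV[R]_d) : R :=
  (v *m A *m w^T) 0 0.

(* The integral over R^k as an iterated Lebesgue integral; it is only used for
   continuous functions with compact support. *)
Fixpoint integral_Rn (R : realType) (k : nat) : ('rV[R]_k -> R) -> R :=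
  match k with
  | 0 => fun f => f 0
  | k'.+1 => fun f => \int[@lebesgue_measure R]_t
      integral_Rn (fun y : 'rV[R]_k' => f (row_mx (t%:M : 'rV[R]_1) y))
  end.

Record chart (R : realType) (d : nat) (M : topologicalType) := Chart {
  cdom : set M;
  cto :> M -> 'rV[R]_d;
  cinv : 'rV[R]_d -> M;
  cdom_open : open cdom;
  cimg_open : open (cto @` cdom);
  ctoK : forall p, cdom p -> cinv (cto p) = p;
  cto_continuous : forall p, cdom p -> {for p, continuous cto};
  cinv_continuous : forall p, cdom p -> {for cto p, continuous cinv}
}.

Definition cimg (R : realType) (d : nat) (M : topologicalType)
    (c : chart R d M) : set 'rV[R]_d := c @` cdom c.

(* The atlas is indexed by the points of M, [chart_at p] being a chart around p.
   The tangent space at p is R^(n+n), read in the coordinates [chart_at p]. *)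
Record complex_manifold (R : realType) (n : nat) (M : topologicalType) :=
  ComplexManifold {
  chart_at : M -> chart R (n + n) M;
  chart_at_dom : forall p, cdom (chart_at p) p;
  transition_smooth : forall p q,
    smooth_on (chart_at p @` (cdom (chart_at p) `&` cdom (chart_at q)))
              (chart_at q \o cinv (chart_at p));
  transition_CR : forall p q r,
    cdom (chart_at p) r -> cdom (chart_at q) r ->
    let D := 'J (chart_at q \o cinv (chart_at p)) (chart_at p r) in
    mulI R n *m D = D *m mulI R n;
  cm_hausdorff : hausdorff_space M
}.

Definition smooth_into (R : realType) (n : nat) (M : topologicalType)
    (X : complex_manifold R n M) (k : nat)
    (U : set 'rV[R]_k) (f : 'rV[R]_k -> M) : Prop :=
  (forall x, U x -> {for x, continuous f}) /\
  forall q, smooth_on (U `&` f @^-1` cdom (chart_at X q)) (chart_at X q \o f).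

Definition diff_into (R : realType) (n : nat) (M : topologicalType)
    (X : complex_manifold R n M) (k : nat)
    (f : 'rV[R]_k -> M) (x : 'rV[R]_k) : 'M[R]_(k, n + n) :=
  'J (chart_at X (f x) \o f) x.

Definition smooth_self (R : realType) (n : nat) (M : topologicalType)
    (X : complex_manifold R n M) (phi : M -> M) : Prop :=
  forall q, smooth_into X (cimg (chart_at X q)) (phi \o cinv (chart_at X q)).

Definition diff_self (R : realType) (n : nat) (M : topologicalType)
    (X : complex_manifold R n M) (phi : M -> M) (p : M) : 'M[R]_(n + n) :=
  diff_into X (phi \o cinv (chart_at X p)) (chart_at X p p).

Definition diffeomorphism (R : realType) (n : nat) (M : topologicalType)
    (X : complex_manifold R n M) (phi : M -> M) : Prop :=
  exists psi : M -> M, [/\ cancel phi psi, cancel psi phi,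
    smooth_self X phi & smooth_self X psi].

Definition smooth_fun (R : realType) (n : nat) (M : topologicalType)
    (X : complex_manifold R n M) (W : normedModType R) (f : M -> W) : Prop :=
  forall q, smooth_on (cimg (chart_at X q)) (f \o cinv (chart_at X q)).

Definition diff_fun (R : realType) (n : nat) (M : topologicalType)
    (X : complex_manifold R n M) (W : normedModType R) (f : M -> W) (p : M)
    (w : 'rV[R]_(n + n)) : W :=
  'd (f \o cinv (chart_at X p)) (chart_at X p p) w.

Definition is_velocity (R : realType) (n : nat) (M : topologicalType)
    (X : complex_manifold R n M) (gamma : R -> M) (t : R)
    (v : 'rV[R]_(n + n)) : Prop :=
  {for t, continuous gamma} /\
  is_derive t 1 (chart_at X (gamma t) \o gamma) v.

(* [omega p] is the matrix of a bilinear form on the tangent space at p;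
   [local_form X omega q] is its expression in the coordinates [chart_at q]. *)
Definition local_form (R : realType) (n : nat) (M : topologicalType)
    (X : complex_manifold R n M) (omega : M -> 'M[R]_(n + n)) (q : M)
    (x : 'rV[R]_(n + n)) : 'M[R]_(n + n) :=
  let D := diff_into X (cinv (chart_at X q)) x in
  D *m omega (cinv (chart_at X q) x) *m D^T.

(* [kform_closed] is d(omega)(u, v, w) = 0 on constant vector fields, whose
   brackets vanish. *)
Record kahler_manifold (R : realType) (n : nat) (M : topologicalType) :=
  KahlerManifold {
  kcm :> complex_manifold R n M;
  kform : M -> 'M[R]_(n + n);
  kform_smooth : forall q, smooth_on (cimg (chart_at kcm q))
                                     (local_form kcm kform q);
  kform_alt : forall p, (kform p)^T = - kform p;
  kform_closed : forall q x u v w, cimg (chart_at kcm q) x ->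
    let om a b := fun y => bilin (local_form kcm kform q y) a b in
    'd (om v w) x u + 'd (om w u) x v + 'd (om u v) x w = 0 :> R;
  kform_J : forall p v w,
    bilin (kform p) (v *m mulI R n) (w *m mulI R n) = bilin (kform p) v w;
  kform_pos : forall p v, v != 0 -> 0 < bilin (kform p) v (v *m mulI R n)
}.

(* g(v, w) = omega(v, J w) *)
Definition kmetric (R : realType) (n : nat) (M : topologicalType)
    (X : kahler_manifold R n M) (p : M) : 'M[R]_(n + n) :=
  kform X p *m (mulI R n)^T.

Definition Cstar (R : realType) (n : nat) : set 'rV[R[i]]_n :=
  [set z | forall k, z 0 k != 0].
Arguments Cstar : clear implicits.

(* The point (e^(i xi_1), ..., e^(i xi_n)) of the real torus. *)
Definition expi (R : realType) (n : nat) (xi : 'rV[R]_n) : 'rV[R[i]]_n :=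
  \row_k (cos (xi 0 k) +i* sin (xi 0 k))%C.

(* The action map, in coordinates on (C^* )^n x M; [chart_at q] is used on M. *)
Definition act_map (R : realType) (n : nat) (M : topologicalType)
    (X : complex_manifold R n M) (act : 'rV[R[i]]_n -> M -> M) (q : M)
    (y : 'rV[R]_((n + n) + (n + n))) : M :=
  act (toC (lsubmx y)) (cinv (chart_at X q) (rsubmx y)).

Definition act_dom (R : realType) (n : nat) (M : topologicalType)
    (X : complex_manifold R n M) (q : M) : set 'rV[R]_((n + n) + (n + n)) :=
  [set y | Cstar R n (toC (lsubmx y)) /\ cimg (chart_at X q) (rsubmx y)].

(* Compactness of M makes second countability automatic. [act] is irrelevant
   outside [Cstar]. The moment map satisfies d<mu, xi> = omega(X_xi, .), where
   X_xi generates the action of exp(i s xi); the opposite sign convention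
   replaces mu by - mu, which does not change the fibres. *)
Record toric_kahler_manifold (R : realType) (n : nat) (M : topologicalType) :=
  ToricKahlerManifold {
  tkm :> kahler_manifold R n M;
  tk_nonempty : [set: M] !=set0;
  tk_compact : compact [set: M];
  tk_connected : connected [set: M];
  act : 'rV[R[i]]_n -> M -> M;
  act1 : forall p, act (const_mx 1) p = p;
  actM : forall z w p, Cstar R n z -> Cstar R n w ->
    act (map2_mx *%R z w) p = act z (act w p);
  act_smooth : forall q, smooth_into tkm (act_dom tkm q) (act_map tkm act q);
  act_CR : forall q y, act_dom tkm q y ->
    let D := diff_into tkm (act_map tkm act q) y in
    block_mx (mulI R n) 0 0 (mulI R n) *m D = D *m mulI R n;
  act_effective : forall z, Cstar R n z -> (forall p, act z p = p) ->
    z = const_mx 1;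
  act_symplectic : forall xi p v w,
    let D := diff_self tkm (act (expi xi)) p in
    bilin (kform tkm (act (expi xi) p)) (v *m D) (w *m D)
      = bilin (kform tkm p) v w;
  moment : M -> 'rV[R]_n;
  moment_smooth : smooth_fun tkm moment;
  moment_invariant : forall xi p, moment (act (expi xi) p) = moment p;
  moment_hamiltonian : forall xi p v w,
    is_velocity tkm (fun s : R => act (expi (s *: xi)) p) 0 v ->
    (diff_fun tkm moment p w *m xi^T) 0 0 = bilin (kform tkm p) v w
}.

Definition moment_polytope (R : realType) (n : nat) (M : topologicalType)
    (X : toric_kahler_manifold R n M) : set 'rV[R]_n :=
  range (moment X).

Definition toric_fibre (R : realType) (n : nat) (M : topologicalType)
    (X : toric_kahler_manifold R n M) (L : set M) : Prop :=
  exists2 a, interior (moment_polytope X) a & L = moment X @^-1` [set a].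

(* H is smooth on [0, 1] x M in the sense that it is smooth on J x M for some
   open interval J containing [0, 1]; M being compact, its flow is then defined
   on J. The vector field of H is given by omega(X_H, .) = dH; the opposite sign
   convention replaces H by - H. *)
Definition Ham_c (R : realType) (n : nat) (M : topologicalType)
    (X : kahler_manifold R n M) (phi : M -> M) : Prop :=
  diffeomorphism X phi /\
  exists (H : R -> M -> R) (flow : R -> M -> M) (e : R),
  [/\ 0 < e,
      forall q, smooth_on
        [set y : 'rV[R]_(1 + (n + n)) | - e < lsubmx y 0 0 < 1 + e /\
                                        cimg (chart_at X q) (rsubmx y)]
        (fun y => H (lsubmx y 0 0) (cinv (chart_at X q) (rsubmx y)) : R^o),
      exists2 K : set (R * M), compact K &
        forall t p, 0 <= t <= 1 -> ~ K (t, p) -> H t p = 0,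
      forall t p, - e < t < 1 + e -> exists2 v,
        is_velocity X (fun s => flow s p) t v &
        forall w, bilin (kform X (flow t p)) v w
                  = diff_fun X (H t : M -> R^o) (flow t p) w &
      flow 0 = id /\ flow 1 = phi].

(* f : V -> L is a local parametrization of the embedded k-dimensional
   submanifold L: an immersion which is a homeomorphism onto an open subset
   of L. *)
Definition local_param (R : realType) (n : nat) (M : topologicalType)
    (X : complex_manifold R n M) (k : nat) (L : set M)
    (V : set 'rV[R]_k) (f : 'rV[R]_k -> M) : Prop :=
  [/\ open V, smooth_into X V f,
      forall x, V x -> row_free (diff_into X f x),
      forall x y, V x -> V y -> f x = f y -> x = y &
      forall W : set 'rV[R]_k, open W -> W `<=` V ->
        exists2 O : set M, open O & f @` W = L `&` O].

(* The Riemannian density sqrt(det(g(d_a f, d_b f))). *)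
Definition vol_density (R : realType) (n : nat) (M : topologicalType)
    (X : kahler_manifold R n M) (k : nat) (f : 'rV[R]_k -> M)
    (x : 'rV[R]_k) : R :=
  let D := diff_into X f x in
  Num.sqrt (\det (D *m kmetric X (f x) *m D^T)).

(* v is the k-dimensional volume of the compact submanifold L, computed with a
   partition of unity rho subordinate to local parametrizations f j of L. *)
Definition is_volume (R : realType) (n : nat) (M : topologicalType)
    (X : kahler_manifold R n M) (k : nat) (L : set M) (v : R) : Prop :=
  exists (m : nat) (V : 'I_m -> set 'rV[R]_k) (f : 'I_m -> 'rV[R]_k -> M)
         (rho : 'I_m -> M -> R),
  [/\ forall j, local_param X L (V j) (f j),
      forall j, smooth_fun X (rho j : M -> R^o) /\ forall p, 0 <= rho j p,
      forall p, L p -> \sum_(j < m) rho j p = 1,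
      forall j, exists K : set 'rV[R]_k, [/\ compact K, K `<=` V j &
        forall p, L p -> ~ (f j @` K) p -> rho j p = 0] &
      v = \sum_(j < m) integral_Rn (fun x =>
            \1_(V j) x * (rho j (f j x) * vol_density X (f j) x))].

Definition volume (R : realType) (n : nat) (M : topologicalType)
    (X : kahler_manifold R n M) (k : nat) (L : set M) : R :=
  get (is_volume X k L).

(* For n-dimensional, e.g. Lagrangian, submanifolds L. *)
Definition hamiltonian_volume_minimizing (R : realType) (n : nat)
    (M : topologicalType) (X : kahler_manifold R n M) (L : set M) : Prop :=
  forall phi, Ham_c X phi -> volume X n L <= volume X n (phi @` L).

(* Main.v *)
(** A value m of the moment map which is extreme in a generic direction is
    attained only at fixed points of the torus. Near such a fixed point there are
    equivariant Darboux coordinates w in C^n, complex linear at the point, in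
    which the moment map is m - (1/2) (|w_j|^2)_j L^T. So the fibres over points
    near m are product tori {|w_j| = r_j}, whose density in polar angles is
    close to r_1 ... r_n because the metric at w = 0 is the standard one.

    Using the phase of w_2 to twist (w_0, w_1), a rotation of the first two
    coordinates becomes a cut-off Hamiltonian isotopy that takes the torus of
    radii (r_0, r_1, r_2, ...) to the one of radii
    (r_1, r_0, sqrt (r_2^2 - r_0^2 + r_1^2), ...). This is where n >= 3 enters.
    If r_1 < r_0 < r_2 the product of the radii drops by a factor that does not
    depend on the scale, which beats the distortion of the metric once the
    radii are small.

    Several fixed points could lie over m. The isotopy is supported near one of
    them, and the direction of (r_j^2)_j is chosen generic, so that near the
    other ones the fibre is a product torus with positive radii as well. Rescaling
    (r_j^2)_j gives infinitely many fibres. *)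

From HB Require Import structures.
Require Import Defs.
From mathcomp Require Import all_boot all_order all_algebra.
From mathcomp Require Import fingroup perm complex.
From mathcomp Require Import all_classical all_reals all_analysis.
From mathcomp Require Import ring lra zify.
Set Implicit Arguments.
Unset Strict Implicit.
Unset Printing Implicit Defensive.
Import Order.TTheory GRing.Theory Num.Theory.
Import numFieldNormedType.Exports.
Local Open Scope classical_set_scope.
Local Open Scope ring_scope.

(** No volume is ever evaluated. The isotopy acts on polar angles by an affine map of determinant 1
    or -1, so the two volumes are compared integrand by integrand in the same parameters. This
    requires the volume to be independent of the partition of unity, hence a change of variables
    formula for the iterated integral; a bisection argument gives it from one-dimensional integrals
    alone. The Darboux coordinates come without Moser's method: the action is linearized at the
    fixed point by averaging a chart over one circle after another, and each coordinate is then
    multiplied by a positive function that makes the moment map quadratic. As torus orbits are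
    isotropic and J preserves the form, the form is then already standard. The Hamiltonian flows
    used are explicit rotations, so no differential equation is solved. The relative error 1/8 in
    the squared density forces the squared product of the radii to drop below 7/9 of its value,
    because (1 + 1/8)/(1 - 1/8) = 9/7. *)

Local Notation scons s y:= (row_mx (s%:M: 'rV_1) y).

(** * Differentials and the calculus of C^k maps *)

Section DiffEps.
Context {R: realType} {V W: normedModType R}.

Lemma diff_eps (f: V -> W) x: differentiable f x -> forall e: R, 0 < e ->
 \forall h \near (0: V), `|f (x + h) - f x - 'd f x h| <= e * `|h|.
move=> /diff_locallyP[_ /eqaddoP H] e e0.
near=> h;have /= : `|(f \o shift x - (cst (f x) + 'd f x: V -> W)) h| <= e * `|h|.
 by near: h;exact: H.
rewrite /GRing.add /= /GRing.opp /= /GRing.add_fun /=.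
by rewrite opprD addrA [in f (h + x)]addrC.
Unshelve. all: by end_near. Qed.

Lemma is_diff_eps (f: V -> W) x (L: {linear V -> W}): continuous L ->
 (forall e: R, 0 < e ->
   \forall h \near (0: V), `|f (x + h) - f x - L h| <= e * `|h|) ->
 differentiable f x /\ 'd f x = L :> (V -> W).
move=> cL H.
have E: f \o shift x = cst (f x) + (L: V -> W) +o_ (0: V) id.
 apply/eqaddoP => e e0;near=> h.
 have /= : `|f (x + h) - f x - L h| <= e * `|h| by near: h;exact: H.
 rewrite /GRing.add /= /GRing.opp /= /GRing.add_fun /=.
 by rewrite opprD addrA [in f (h + x)]addrC.
have D:= diff_unique cL E.
split=> //;apply/diff_locallyP;rewrite D;split => //;exact: E.
Unshelve. all: by end_near. Qed.

Lemma near_eq_diff (f g: V -> W) x: (\forall y \near x, f y = g y) ->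
 differentiable f x -> differentiable g x /\ 'd g x = 'd f x :> (V -> W).
move=> fg df;apply: is_diff_eps;first exact: diff_continuous.
move=> e e0;have fgx: f x = g x by exact: nbhs_singleton fg.
move/nbhs0P: fg => fg;near=> h.
rewrite -fgx -(near fg h) //;near: h;exact: diff_eps.
Unshelve. all: by end_near. Qed.

Lemma near_eq_differentiable (f g: V -> W) x: (\forall y \near x, f y = g y) ->
 differentiable f x -> differentiable g x.
by move=> fg /(near_eq_diff fg)[]. Qed.

Lemma near_eq_diffE (f g: V -> W) x: (\forall y \near x, f y = g y) ->
 differentiable f x -> forall v, 'd g x v = 'd f x v.
by move=> fg /(near_eq_diff fg)[_ ->]. Qed.

End DiffEps.

Lemma linear_rV_continuous (R: realType) d (W: normedModType R)
 (L: {linear 'rV[R]_d -> W}): continuous L.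
apply/linear_bounded_continuous.
have B (v: 'rV[R]_d): `|L v| <= (\sum_i `|L (delta_mx 0 i)|) * `|v|.
 rewrite {1}(row_sum_delta v) linear_sum mulr_suml.
 apply: le_trans (ler_norm_sum _ _ _) _;apply: ler_sum => i _.
 rewrite linearZ normrZ mulrC ler_wpM2l //.
 rewrite {2}/Num.norm /= mx_normrE.
 exact: (le_bigmax _ (fun ij => `|v ij.1 ij.2|) (0, i)).
rewrite /bounded_near;near=> M;apply/nbhs_ballP;exists 1 => //= v;rewrite mx_norm_ball /ball_ /= sub0r normrN => v1.
apply: le_trans (B v) _;apply: (@le_trans _ _ (\sum_i `|L (delta_mx 0 i)|)).
 by rewrite ler_piMr ?sumr_ge0 // ltW.
by near: M;apply: nbhs_pinfty_ge;rewrite num_real.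
Unshelve. all: by end_near. Qed.

Definition mxcoord (R: realType) m n (i: 'I_m) (j: 'I_n) (N: 'M[R]_(m, n)): R :=
 N i j.
Arguments mxcoord {R m n} i j N /.

Lemma mxcoord_is_linear (R: realType) m n (i: 'I_m) (j: 'I_n) :
 linear (@mxcoord R m n i j).
by move=> a u v;rewrite /mxcoord !mxE. Qed.

HB.instance Definition _ (R: realType) m n (i: 'I_m) (j: 'I_n) :=
 GRing.isLinear.Build R 'M[R]_(m, n) R _ (@mxcoord R m n i j)
  (mxcoord_is_linear i j).

Lemma diff_compE (R: realType) (V V' W: normedModType R) (f: V -> V')
  (g: V' -> W) x v :
 differentiable f x -> differentiable g (f x) ->
 'd (g \o f) x v = 'd g (f x) ('d f x v).
by move=> df dg;rewrite diff_comp. Qed.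

Section DiffRules.
Context {R: realType} {V W: normedModType R}.

Lemma diff_mxcoordE m n (f: V -> 'M[R]_(m, n)) x v i j :
 differentiable f x -> 'd (fun y => f y i j) x v = 'd f x v i j.
move=> df;have -> : (fun y => f y i j) = mxcoord i j \o f by [].
rewrite (diff_compE (f:= f) (g:= mxcoord i j)) //;last exact: differentiable_coord.
by rewrite (diff_lin (f:= mxcoord i j)) //;exact: coord_continuous.
Qed.

Lemma differentiable_mxcoord m n (f: V -> 'M[R]_(m, n)) x i j :
 differentiable f x -> differentiable (fun y => f y i j) x.
move=> df;apply: (differentiable_comp (g:= mxcoord i j) df).
exact: differentiable_coord.
Qed.

Lemma differentiable_rV m (f: V -> 'rV[R]_m) x :
 (forall i, differentiable (fun y => f y 0 i) x) -> differentiable f x.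
move=> H;have -> : f = \sum_(i < m) (fun y => f y 0 i *: delta_mx 0 i).
 by apply/funext => y;rewrite fct_sumE;exact: row_sum_delta.
by apply: differentiable_sum => i;apply: differentiableZl;exact: H.
Qed.

Lemma diff_linE d (L: {linear 'rV[R]_d -> W}) x v: 'd L x v = L v.
by rewrite diff_lin //;exact: linear_rV_continuous. Qed.

Lemma differentiable_lin d (L: {linear 'rV[R]_d -> W}) x: differentiable L x.
by apply: linear_differentiable;exact: linear_rV_continuous. Qed.

End DiffRules.

Section CkRules.
Context {R: realType} {d: nat}.
Implicit Types (U: set 'rV[R]_d).

(** The differential at a point depends only on the germ there, so by induction on [k] the property
    may be checked on open pieces, each with its own representative. Piecewise constructions on the
    manifold rely on this. *)
Lemma Ck_local (W: normedModType R) k U (f: 'rV[R]_d -> W) :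
 (forall x, U x -> exists f' U', [/\ open U', U' x,
   (forall y, U' y -> f y = f' y) & Ck_on k U' f']) -> Ck_on k U f.
elim: k f => [|k IH] f H.
 move=> x /H[f' [U' [oU' U'x ff' cf']]].
 have fx: f x = f' x by exact: ff'.
 have nU: nbhs x U' by exact: open_nbhs_nbhs.
 suff: f @ x --> f x by [].
 rewrite fx;apply: (@cvg_trans _ (f' @ x));last exact: cf'.
 by apply: (near_eq_cvg (F:= nbhs x));near=> y;apply/esym/ff';near: y.
split=> [x /H[f' [U' [oU' U'x ff' [df' _]]]]|v].
 apply: (@near_eq_differentiable _ _ _ f');last exact: df'.
 have nU: nbhs x U' by exact: open_nbhs_nbhs.
 by near=> y;apply/esym/ff';near: y.
apply: IH => x /H[f' [U' [oU' U'x ff' [df' Cf']]]].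
exists (fun y => 'd f' y v), U';split => // [y U'y|];last exact: Cf'.
apply: near_eq_diffE;last exact: df'.
have nU: nbhs y U' by exact: open_nbhs_nbhs.
by near=> z;apply/esym/ff';near: z.
Unshelve. all: by end_near. Qed.

Lemma Ck_ext (W: normedModType R) k U (f g: 'rV[R]_d -> W): open U ->
 (forall x, U x -> f x = g x) -> Ck_on k U g -> Ck_on k U f.
by move=> oU fg Cg;apply: Ck_local => x Ux;exists g, U. Qed.

Lemma Ck_mono (W: normedModType R) k U U' (f: 'rV[R]_d -> W) :
 U' `<=` U -> Ck_on k U f -> Ck_on k U' f.
move=> UU';elim: k f => [|k IH] f;first by move=> H x /UU';exact: H.
by move=> [D H];split=> [x /UU'|v];[exact: D|exact/IH/H].
Qed.

Lemma CkS (W: normedModType R) k U (f: 'rV[R]_d -> W) :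
 Ck_on k.+1 U f -> Ck_on k U f.
elim: k f => [|k IH] f [D H];first by move=> x /D;exact: differentiable_continuous.
by split=> // v;exact/IH/H.
Qed.

Lemma Ck_cst (W: normedModType R) k U (w: W): Ck_on k U (fun=> w).
elim: k w => [|k IH] w;first by move=> x _;exact: cst_continuous.
split=> [x _|v];first exact: differentiable_cst.
have -> : (fun x: 'rV[R]_d => 'd (fun=> w) x v) = fun=> 0;last exact: IH.
by apply/funext => x;rewrite (diff_cst w x).
Qed.

Lemma Ck_lin (W: normedModType R) k U (L: {linear 'rV[R]_d -> W}) :
 Ck_on k U L.
case: k => [|k];first by move=> x _;exact: linear_rV_continuous.
split=> [x _|v];first exact: differentiable_lin.
have -> : (fun x => 'd L x v) = fun=> L v;last exact: Ck_cst.
by apply/funext => x;rewrite diff_linE.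
Qed.

Lemma CkD (W: normedModType R) k U (f g: 'rV[R]_d -> W): open U ->
 Ck_on k U f -> Ck_on k U g -> Ck_on k U (fun x => f x + g x).
move=> oU;elim: k f g => [|k IH] f g.
 by move=> cf cg x Ux;exact: (cvgD (cf x Ux) (cg x Ux)).
move=> [df Hf] [dg Hg];split=> [x Ux|v].
 by apply: differentiableD;[exact: df|exact: dg].
apply: (@Ck_ext _ _ _ _ (fun x => 'd f x v + 'd g x v)) => //;
 last exact: (IH _ _ (Hf v) (Hg v)).
by move=> x Ux;rewrite (diffD (df _ Ux) (dg _ Ux)).
Qed.

Lemma Ck_sum (W: normedModType R) k U (I: Type) (r: seq I) (P: pred I)
  (f: I -> 'rV[R]_d -> W): open U ->
 (forall i, Ck_on k U (f i)) -> Ck_on k U (fun x => \sum_(i <- r | P i) f i x).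
move=> oU H;elim: r => [|i r IH].
 by apply: (Ck_ext oU _ (Ck_cst _ _ 0)) => // x _;rewrite big_nil.
case Pi: (P i);last by apply: (Ck_ext oU _ IH) => // x _;rewrite big_cons Pi.
by apply: (Ck_ext oU _ (CkD oU (H i) IH)) => // x _;rewrite big_cons Pi.
Qed.

Lemma CkM k U (f g: 'rV[R]_d -> R): open U ->
 Ck_on k U f -> Ck_on k U g -> Ck_on k U (fun x => f x * g x).
move=> oU;elim: k f g => [|k IH] f g.
 by move=> cf cg x Ux;exact: (cvgM (cf x Ux) (cg x Ux)).
move=> Cf Cg;have [df Hf]:= Cf;have [dg Hg]:= Cg;split=> [x Ux|v].
 by apply: differentiableM;[exact: df|exact: dg].
apply: (@Ck_ext _ _ _ _ (fun x => f x * 'd g x v + g x * 'd f x v)) => //.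
 by move=> x Ux;rewrite (diffM (df _ Ux) (dg _ Ux)).
by apply: CkD => //;[exact: (IH _ _ (CkS Cf) (Hg v))|exact: (IH _ _ (CkS Cg) (Hf v))].
Qed.

Lemma CkN k U (f: 'rV[R]_d -> R): open U ->
 Ck_on k U f -> Ck_on k U (fun x => - f x).
move=> oU Cf;apply: (Ck_ext oU _ (CkM oU (Ck_cst k U (-1: R)) Cf)) => // x _.
by rewrite mulN1r.
Qed.

Lemma CkB k U (f g: 'rV[R]_d -> R): open U ->
 Ck_on k U f -> Ck_on k U g -> Ck_on k U (fun x => f x - g x).
by move=> oU Cf Cg;apply: CkD => //;exact: CkN. Qed.

Lemma Ck_prod k U (I: Type) (r: seq I) (P: pred I) (f: I -> 'rV[R]_d -> R) :
 open U -> (forall i, Ck_on k U (f i)) ->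
 Ck_on k U (fun x => \prod_(i <- r | P i) f i x).
move=> oU H;elim: r => [|i r IH].
 by apply: (Ck_ext oU _ (Ck_cst _ _ (1: R))) => // x _;rewrite big_nil.
case Pi: (P i);last by apply: (Ck_ext oU _ IH) => // x _;rewrite big_cons Pi.
by apply: (Ck_ext oU _ (CkM oU (H i) IH)) => // x _;rewrite big_cons Pi.
Qed.

(** The derivative - f^-2 df contains 1/f again, which is C^k by the induction hypothesis. [Ck_sqrt]
    bootstraps in the same way. *)
Lemma CkV k U (f: 'rV[R]_d -> R): open U -> (forall x, U x -> f x != 0) ->
 Ck_on k U f -> Ck_on k U (fun x => (f x)^-1).
move=> oU f0;elim: k => [|k IH].
 by move=> cf x Ux;exact: (cvgV (f0 x Ux) (cf x Ux)).
move=> Cf;have [df Hf]:= Cf;split=> [x Ux|v].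
 by apply: differentiableV;[exact: df|exact: f0].
apply: (@Ck_ext _ _ _ _ (fun x => - ((f x)^-1 * (f x)^-1) * 'd f x v)) => //.
 move=> x Ux;rewrite (diffV (df _ Ux) (f0 _ Ux)) /=.
 by rewrite expr2 invfM.
have CV:= IH (CkS Cf);apply: CkM => //;last exact: Hf.
by apply: CkN => //;exact: CkM.
Qed.

Lemma Ck_coord m n k U (f: 'rV[R]_d -> 'M[R]_(m, n)) i j: open U ->
 Ck_on k U f -> Ck_on k U (fun x => f x i j).
move=> oU;elim: k f => [|k IH] f.
 by move=> cf x Ux;apply: (@cvg_comp _ _ _ _ (mxcoord i j) _ (nbhs (f x)));
  [exact: (cf x Ux)|exact: coord_continuous].
move=> [df Hf];split=> [x Ux|v];first by apply: differentiable_mxcoord;exact: df.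
apply: (@Ck_ext _ _ _ _ (fun x => 'd f x v i j)) => //;last exact: (IH _ (Hf v)).
by move=> x Ux;rewrite diff_mxcoordE //;exact: df.
Qed.

Lemma Ck_rV m k U (f: 'rV[R]_d -> 'rV[R]_m): open U ->
 (forall i, Ck_on k U (fun x => f x 0 i)) -> Ck_on k U f.
move=> oU;elim: k f => [|k IH] f H.
 apply: (@Ck_ext _ 0 _ _ (fun y => \sum_(i < m) f y 0 i *: delta_mx 0 i)) => //.
  by move=> x _;exact: row_sum_delta.
 apply: Ck_sum => // i x Ux.
 exact: (@cvgZr_tmp _ _ _ _ _ _ _ _ (H i x Ux)).
split=> [x Ux|v].
 by apply: differentiable_rV => i;have [D _]:= H i;exact: D.
have D x: U x -> differentiable f x.
 by move=> Ux;apply: differentiable_rV => i;have [D _]:= H i;exact: D.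
apply: IH => i;have [Di Hi]:= H i.
apply: (Ck_ext oU _ (Hi v)) => // x Ux;rewrite diff_mxcoordE //;exact: D.
Qed.

Lemma Ck_sqrt k U (f: 'rV[R]_d -> R): open U -> (forall x, U x -> 0 < f x) ->
 Ck_on k U f -> Ck_on k U (fun x => Num.sqrt (f x)).
move=> oU f0;elim: k => [|k IH].
 move=> cf x Ux;apply: (@cvg_comp _ _ _ _ Num.sqrt _ (nbhs (f x)));
  [exact: (cf x Ux)|exact: sqrt_continuous].
move=> Cf;have [df Hf]:= Cf.
have DS x: U x -> is_derive (f x) 1 (Num.sqrt: R -> R) (2 * Num.sqrt (f x))^-1.
 by move=> Ux;apply: is_derive1_sqrt;exact: f0.
have dS x: U x -> differentiable (Num.sqrt: R -> R) (f x).
 by move=> Ux;apply/derivable1_diffP;have []:= DS _ Ux.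
split=> [x Ux|v].
 by apply: (differentiable_comp (df _ Ux));exact: dS.
apply: (@Ck_ext _ _ _ _ (fun x => (2 * Num.sqrt (f x))^-1 * 'd f x v)) => //.
 move=> x Ux;rewrite (diff_compE v (df _ Ux) (dS _ Ux)).
 rewrite diff1E;last exact: dS.
 by rewrite derive1E;have [_ ->]:= DS _ Ux;exact: mulrC.
apply: CkM => //;last exact: Hf.
apply: CkV => //.
 by move=> x Ux;rewrite mulf_neq0 // sqrtr_eq0 -ltNge;exact: f0.
by apply: CkM => //;[exact: Ck_cst|exact: (IH (CkS Cf))].
Qed.

End CkRules.

Section CkComp.
Context {R: realType} {d: nat}.
Implicit Types (U: set 'rV[R]_d).

Lemma diff_sum_coord (W: normedModType R) m (g: 'rV[R]_m -> W) y v :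
 'd g y v = \sum_i v 0 i *: 'd g y (delta_mx 0 i).
by rewrite {1}(row_sum_delta v) linear_sum;apply: eq_bigr => i _;rewrite linearZ.
Qed.

(** In coordinates the chain rule is a sum of products of partial derivatives of [g] along [f] with
    coordinates of the differential of [f]; each factor is C^k by induction. *)
Lemma Ck_compR m k U (V: set 'rV[R]_m) (f: 'rV[R]_d -> 'rV[R]_m)
  (g: 'rV[R]_m -> R): open U -> (forall x, U x -> V (f x)) ->
 Ck_on k U f -> Ck_on k V g -> Ck_on k U (g \o f).
move=> oU UV;elim: k g => [|k IH] g.
 by move=> cf cg x Ux;apply: (@continuous_comp _ _ _ f g x);
  [exact: (cf x Ux)|exact: (cg _ (UV _ Ux))].
move=> Cf Cg;have [df Hf]:= Cf;have [dg Hg]:= Cg.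
split=> [x Ux|v];first exact: (differentiable_comp (df _ Ux) (dg _ (UV _ Ux))).
apply: (@Ck_ext _ _ _ _ _ _
 (fun x => \sum_i 'd f x v 0 i * ((fun y => 'd g y (delta_mx 0 i)) \o f) x)) => //.
 move=> x Ux;rewrite (diff_compE v (df _ Ux) (dg _ (UV _ Ux))).
 by rewrite [LHS]diff_sum_coord;apply: eq_bigr.
apply: Ck_sum => // i;apply: CkM => //;first by apply: Ck_coord => //;exact: Hf.
by apply: IH;[exact: CkS|exact: Hg].
Qed.

Lemma Ck_comp m l k U (V: set 'rV[R]_m) (f: 'rV[R]_d -> 'rV[R]_m)
  (g: 'rV[R]_m -> 'rV[R]_l): open U -> open V -> (forall x, U x -> V (f x)) ->
 Ck_on k U f -> Ck_on k V g -> Ck_on k U (g \o f).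
move=> oU oV UV Cf Cg;apply: Ck_rV => // i.
by apply: (Ck_compR oU UV Cf (g:= fun y => g y 0 i));exact: Ck_coord.
Qed.

(** For a family of functions on the line that is closed under differentiation, [T i] being the
    index of the derivative of [G i], one induction treats all members at once. It serves for a cos
    + b sin, indexed by (a, b), and for p(1/x) exp(-1/x), indexed by polynomials. *)
Lemma Ck_family (I: Type) (G: I -> R -> R) (T: I -> I) :
 (forall i x, is_derive x (1: R) (G i) (G (T i) x)) ->
 forall k i U (f: 'rV[R]_d -> R), open U -> Ck_on k U f ->
  Ck_on k U (fun x => G i (f x)).
move=> HG.
have dG i x: differentiable (G i) x by apply/derivable1_diffP;have []:= HG i x.
elim=> [|k IH] i U f oU.
 move=> cf x Ux;apply: (@continuous_comp _ _ _ f (G i) x);first exact: (cf x Ux).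
 exact: differentiable_continuous.
move=> Cf;have [df Hf]:= Cf.
split=> [x Ux|v];first exact: (differentiable_comp (df _ Ux) (dG i _)).
apply: (@Ck_ext _ _ _ _ _ _ (fun x => G (T i) (f x) * 'd f x v)) => //.
 move=> x Ux;rewrite (diff_compE v (df _ Ux) (dG i _)) diff1E //.
 by rewrite derive1E;have [_ ->]:= HG i (f x);exact: mulrC.
by apply: CkM => //;[apply: IH => //;exact: CkS|exact: Hf].
Qed.

Lemma Ck_trig k U (a b: R) (f: 'rV[R]_d -> R): open U -> Ck_on k U f ->
 Ck_on k U (fun x => a * cos (f x) + b * sin (f x)).
apply: (@Ck_family (R * R) (fun c x => c.1 * cos x + c.2 * sin x)
 (fun c => (c.2, - c.1)) _ k (a, b) U f).
move=> [{}a {}b] x /=;apply: is_derive_eq.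
by rewrite /GRing.scale /=;ring.
Qed.

Lemma Ck_cos k U (f: 'rV[R]_d -> R): open U -> Ck_on k U f ->
 Ck_on k U (fun x => cos (f x)).
by move=> oU Cf;apply: (Ck_ext oU _ (Ck_trig 1 0 oU Cf)) => x _;rewrite mul1r mul0r addr0.
Qed.

Lemma Ck_sin k U (f: 'rV[R]_d -> R): open U -> Ck_on k U f ->
 Ck_on k U (fun x => sin (f x)).
by move=> oU Cf;apply: (Ck_ext oU _ (Ck_trig 0 1 oU Cf)) => x _;rewrite mul1r mul0r add0r.
Qed.

End CkComp.

(** * Flat functions and a smooth cut-off on the line *)

Section Cutoff.
Context {R: realType}.

(** The polynomial factor makes the family of functions p(1/x) exp(-1/x), extended by 0, closed
    under differentiation. *)
Definition flat (p: {poly R}) (x: R): R :=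
 if 0 < x then p.[x^-1] * expR (- x^-1) else 0.

(** With y = 1/x, one term of the exponential series gives y^m exp(-y) <= (m+2)! y^-2. A quadratic
    bound at 0 is what makes the derivative there exist and vanish. *)
Lemma flat_bound p: exists2 C: R, 0 < C & forall x, `|flat p x| <= C * x ^+ 2.
pose C: R:= 1 + \sum_(i < size p) `|p`_i| * (i.+2)`!%:R.
have C0: 0 < C by rewrite ltr_pwDl // sumr_ge0 // => i _;rewrite mulr_ge0.
exists C => // x;rewrite /flat;case: ifPn => [x0|_];last first.
 by rewrite normr0 mulr_ge0 ?sqr_ge0 // ltW.
rewrite normrM (ger0_norm (expR_ge0 _)).
have K m: x^-1 ^+ m * expR (- x^-1) <= (m.+2)`!%:R * x ^+ 2.
 have y0: 0 < x^-1 by rewrite invr_gt0.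
 have H: x^-1 ^+ m.+2 / (m.+2)`!%:R <= expR x^-1.
  by apply: le_trans (expR_ge1Dxn m.+1 (ltW y0));rewrite lerDr.
 rewrite expRN ler_pdivrMr ?expR_gt0 //.
 rewrite ler_pdivrMr ?ltr0n ?fact_gt0 // in H.
 have -> : x^-1 ^+ m = x ^+ 2 * x^-1 ^+ m.+2.
  by rewrite -(addn2 m) exprD [x^-1 ^+ 2]exprVn mulrCA mulfV ?mulr1 // expf_neq0 // gt_eqF.
 by rewrite [leRHS]mulrAC [leRHS]mulrC ler_wpM2l ?sqr_ge0 // mulrC.
rewrite horner_coef;apply: (@le_trans _ _
  ((\sum_(i < size p) `|p`_i * x^-1 ^+ i|) * expR (- x^-1))).
 by apply: ler_wpM2r;[exact: expR_ge0|exact: ler_norm_sum].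
rewrite /C mulrDl mul1r !mulr_suml;apply: ler_wpDl;first exact: sqr_ge0.
apply: ler_sum => i _;rewrite normrM [`|_ ^+ _|]ger0_norm;last first.
 by rewrite exprn_ge0 // invr_ge0 ltW.
by rewrite -!mulrA ler_wpM2l.
Qed.

(** For x > 0 and y = 1/x, differentiating p(y) exp(-y) gives y^2 (p - p')(y) exp(-y), the member of
    index X^2 (p - p'). At 0 the quadratic bound yields derivative 0. *)
Lemma is_derive_flat p x :
 is_derive x (1: R) (flat p) (flat ('X^2 * (p - p^`())) x).
have [x0|x0|<-]:= ltgtP 0 x.
- have N: \forall y \near x, p.[y^-1] * expR (- y^-1) = flat p y.
  by near=> y;rewrite /flat ifT //;near: y;exact: lt_nbhsr.
 apply: (near_eq_is_derive N).
 have D1: is_derive x (1: R) (fun y: R => y^-1) (- x ^- 2).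
  have:= @is_deriveV R id x 1 1 (lt0r_neq0 x0) (is_derive_id _ _).
  by move/is_derive_eq;apply;rewrite /GRing.scale /= mulr1.
 have D2: is_derive x (1: R) (fun y: R => - y^-1) (x ^- 2).
  by have:= is_deriveN D1;rewrite opprK.
 have D3:= is_derive1_comp (is_derive_poly p x^-1) D1.
 have D4:= is_derive1_comp (f:= expR) (g:= fun y: R => - y^-1)
  (is_derive_expR (- x^-1)) D2.
 have D5:= is_deriveM D3 D4.
 apply: (is_derive_eq D5);rewrite /flat x0 /= /GRing.scale /=.
 by rewrite hornerM hornerXn hornerD hornerN exprVn;ring.
- have N: \forall y \near x, 0 = flat p y.
  near=> y;rewrite /flat ifN // -leNgt;apply: ltW.
  by near: y;exact: lt_nbhsl.
 rewrite [flat _ x]/flat ltNge ltW //=.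
 by apply: (near_eq_is_derive N);exact: is_derive_cst.
- have [C C0 HC]:= flat_bound p.
 have f0 q: flat q 0 = 0 by rewrite /flat ltxx.
 pose L: {linear R -> R} := \0%R.
 have [D E]: differentiable (flat p) (0: R) /\ 'd (flat p) (0: R) = L :> (R -> R).
  apply: is_diff_eps;first exact: cst_continuous.
  move=> e e0;near=> h;rewrite add0r f0 !subr0.
  apply: le_trans (HC h) _.
  rewrite -(ger0_norm (sqr_ge0 h)) normrX expr2 mulrA ler_wpM2r //.
  rewrite mulrC -ler_pdivlMr //;apply: ltW;near: h.
  apply/nbhs_ballP;exists (e / C);first by rewrite /= divr_gt0.
  by move=> z;rewrite -ball_normE /ball_ /= sub0r normrN.
 split;first by apply/derivable1_diffP.
 by rewrite deriveE // E f0.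
Unshelve. all: by end_near. Qed.

(* Equal to 1 on ]-oo, 1] and to 0 on [2, +oo[. *)
Definition cutoff (x: R): R :=
 flat 1 (2 - x) / (flat 1 (2 - x) + flat 1 (x - 1)).

Lemma flat1_ge0 x: 0 <= flat 1 x.
by rewrite /flat;case: ifP => // _;rewrite hornerC mul1r expR_ge0. Qed.

Lemma flat1_gt0 x: 0 < x -> 0 < flat 1 x.
by move=> x0;rewrite /flat x0 hornerC mul1r expR_gt0. Qed.

Lemma flat_le0 p x: x <= 0 -> flat p x = 0.
by move=> x0;rewrite /flat ltNge x0. Qed.

Lemma cutoff_den_gt0 x: 0 < flat 1 (2 - x) + flat 1 (x - 1).
have [x2|x2]:= ltP x 2.
 by rewrite ltr_pwDl ?flat1_ge0 // flat1_gt0 // subr_gt0.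
by rewrite ltr_wpDl ?flat1_ge0 // flat1_gt0 //;lra.
Qed.

Lemma cutoff_ge0 x: 0 <= cutoff x.
by rewrite divr_ge0 ?flat1_ge0 // ltW // cutoff_den_gt0. Qed.

Lemma cutoff_le1 x: cutoff x <= 1.
by rewrite ler_pdivrMr ?cutoff_den_gt0 // mul1r lerDl flat1_ge0. Qed.

Lemma cutoff1 x: x <= 1 -> cutoff x = 1.
move=> x1;rewrite /cutoff [flat 1 (x - 1)]flat_le0 ?subr_le0 // addr0 divff //.
by rewrite gt_eqF // flat1_gt0;lra.
Qed.

Lemma cutoff0 x: 2 <= x -> cutoff x = 0.
by move=> x2;rewrite /cutoff flat_le0 ?mul0r // subr_le0. Qed.

Lemma Ck_cutoff d k (U: set 'rV[R]_d) (f: 'rV[R]_d -> R): open U ->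
 Ck_on k U f -> Ck_on k U (fun x => cutoff (f x)).
move=> oU Cf.
have F (g: 'rV[R]_d -> R): Ck_on k U g -> Ck_on k U (fun x => flat 1 (g x)).
 by move=> Cg;exact: (Ck_family is_derive_flat).
have F1: Ck_on k U (fun x => flat 1 (2 - f x)).
 by apply: F;apply: CkB => //;exact: Ck_cst.
apply: CkM => //;apply: CkV => //.
 by move=> x _;rewrite gt_eqF // cutoff_den_gt0.
by apply: CkD => //;apply: F;apply: CkB => //;exact: Ck_cst.
Qed.

End Cutoff.

(* Jacobian matrices, strict differentiability and the inverse function theorem *)
Local Opaque jacobian.
Section Jacobian.
Context {R: realType}.

Lemma diffJ n m (f: 'rV[R]_n -> 'rV[R]_m) x v: differentiable f x ->
 'd f x v = v *m 'J f x.
by move=> df;rewrite -deriveE // deriveEjacobian. Qed.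

Lemma row_delta_mul n m (A: 'M[R]_(n, m)) i j: (delta_mx (0: 'I_1) i *m A) 0 j = A i j.
by rewrite -rowE mxE. Qed.

Lemma mx_rV_ext n m (A B: 'M[R]_(n, m)) :
 (forall v: 'rV_n, v *m A = v *m B) -> A = B.
by move=> H;apply/row_matrixP => i;rewrite !rowE. Qed.

Lemma J_unique n m (f: 'rV[R]_n -> 'rV[R]_m) x (A: 'M[R]_(n, m)) :
 differentiable f x -> (forall v, 'd f x v = v *m A) -> 'J f x = A.
by move=> df H;apply: mx_rV_ext => v;rewrite -diffJ. Qed.

Lemma J_comp n m l (f: 'rV[R]_n -> 'rV[R]_m) (g: 'rV[R]_m -> 'rV[R]_l) x :
 differentiable f x -> differentiable g (f x) ->
 'J (g \o f) x = 'J f x *m 'J g (f x).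
move=> df dg;apply: J_unique;first exact: differentiable_comp.
by move=> v;rewrite diff_compE // !diffJ // mulmxA.
Qed.

Lemma J_near n m (f g: 'rV[R]_n -> 'rV[R]_m) x :
 (\forall y \near x, f y = g y) -> differentiable f x -> 'J g x = 'J f x.
move=> fg df;apply: J_unique;first exact: near_eq_differentiable fg df.
by move=> v;rewrite (near_eq_diffE fg df) diffJ.
Qed.

Lemma J_id n (x: 'rV[R]_n): 'J id x = 1%:M.
apply: J_unique => [|v];first exact: (differentiable_lin (@idfun 'rV[R]_n)).
by rewrite (diff_linE (@idfun 'rV[R]_n)) mulmx1.
Qed.

Lemma J_mulmx n m (A: 'M[R]_(n, m)) (x: 'rV[R]_n): 'J (mulmxr A) x = A.
apply: J_unique => [|v];first exact: differentiable_lin.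
by rewrite diff_linE.
Qed.

Lemma J_entry n m (f: 'rV[R]_n -> 'rV[R]_m) x i j: differentiable f x ->
 'J f x i j = 'd f x (delta_mx 0 i) 0 j.
by move=> df;rewrite diffJ // row_delta_mul. Qed.

Lemma Ck_J n m k (U: set 'rV[R]_n) (f: 'rV[R]_n -> 'rV[R]_m) i j: open U -> Ck_on k.+1 U f ->
 Ck_on k U (fun x => 'J f x i j).
move=> oU [df Hf];apply: (@Ck_ext _ _ _ _ _ _ (fun x => 'd f x (delta_mx 0 i) 0 j)) => //.
 by move=> x Ux;rewrite J_entry //;exact: df.
by apply: Ck_coord => //;exact: Hf.
Qed.

Lemma Ck_mulmx d n m k (U: set 'rV[R]_d) (A: 'M[R]_(n, m)) (f: 'rV[R]_d -> 'rV[R]_n): open U ->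
 Ck_on k U f -> Ck_on k U (fun x => f x *m A).
move=> oU Cf;apply: Ck_rV => // i.
apply: (@Ck_ext _ _ _ _ _ _ (fun x => \sum_j f x 0 j * A j i)) => //.
 by move=> x _;rewrite mxE.
apply: Ck_sum => // j;apply: CkM => //;[exact: Ck_coord|exact: Ck_cst].
Qed.

Lemma is_derive_comp_diff (V W: normedModType R) (g: V -> W) (gam: R -> V) (t: R) v :
 is_derive t (1: R) gam v -> differentiable g (gam t) ->
 is_derive t (1: R) (g \o gam) ('d g (gam t) v).
move=> [D E] dg.
have dgam: differentiable gam t by apply/derivable1_diffP.
split;first by apply/derivable1_diffP;exact: differentiable_comp.
rewrite deriveE;last exact: differentiable_comp.
by rewrite diff_compE // -[in RHS]E deriveE.
Qed.

Lemma mx_norm_le n m (A: 'M[R]_(n, m)) (C: R): 0 <= C ->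
 (forall i j, `|A i j| <= C) -> `|A| <= C.
move=> C0 H;rewrite /Num.norm /= mx_normrE;apply: bigmax_le => // ij _;exact: H.
Qed.

Lemma mx_norm_ge n m (A: 'M[R]_(n, m)) i j: `|A i j| <= `|A|.
rewrite [leRHS]/Num.norm /= mx_normrE.
exact: (le_bigmax _ (fun ij => `|A ij.1 ij.2|) (i, j)).
Qed.

Lemma mx_norm_lt n m (A: 'M[R]_(n, m)) (C: R): 0 < C ->
 (forall i j, `|A i j| < C) -> `|A| < C.
move=> C0 H;rewrite /Num.norm /= mx_normrE;apply: bigmax_lt => // ij _;exact: H.
Qed.

Lemma norm_rV_mul_le n m (v: 'rV[R]_n) (A: 'M[R]_(n, m)) :
 `|v *m A| <= `|v| * (n%:R * `|A|).
apply: mx_norm_le => [|i j];first by rewrite !mulr_ge0.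
rewrite mxE;apply: le_trans (ler_norm_sum _ _ _) _.
apply: (@le_trans _ _ (\sum_(k < n) `|v| * `|A|)).
 by apply: ler_sum => k _;rewrite normrM ler_pM // mx_norm_ge.
by rewrite sumr_const card_ord -[leLHS]mulr_natr -mulrA [`|A| * _]mulrC.
Qed.

Lemma is_derive_segment n (x y: 'rV[R]_n) (t: R) :
 is_derive t (1: R) (fun s: R => x + s *: (y - x)) (y - x).
have L: is_derive t (1: R) (fun s: R => s *: (y - x)) (y - x).
 split;first by apply/derivable1_diffP;apply: differentiableZl.
 rewrite deriveE;last exact: differentiableZl.
 rewrite diffZl //.
 by have:= diff_lin (f:= @idfun R) t (fun=> cvg_id);move=> /(congr1 (fun g => g 1)) /= ->;rewrite scale1r.
by have:= is_deriveD (is_derive_cst x t 1) L;rewrite add0r.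
Qed.

Lemma mvt_rV n (f: 'rV[R]_n -> R) (x y: 'rV[R]_n) :
 (forall t: R, 0 <= t <= 1 -> differentiable f (x + t *: (y - x))) ->
 exists2 t: R, 0 <= t <= 1 & f y - f x = 'd f (x + t *: (y - x)) (y - x).
move=> H;pose g (t: R):= f (x + t *: (y - x)).
have D (t: R): 0 <= t <= 1 -> is_derive t (1: R) g ('d f (x + t *: (y - x)) (y - x)).
 by move=> /H /(is_derive_comp_diff (is_derive_segment x y t)).
have [||c c01 E]:= @MVT_segment R g (fun t => 'd f (x + t *: (y - x)) (y - x)) 0 1 ler01.
- by move=> t;rewrite in_itv /= => /andP[/ltW t0 /ltW t1];apply: D;rewrite t0 t1.
- apply: derivable_within_continuous => t;rewrite in_itv /= => t01.
 by have []:= D _ t01.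
exists c;first by move: c01;rewrite in_itv.
by move: E;rewrite subr0 mulr1 /g scale0r addr0 scale1r (addrC x) subrK.
Qed.

Lemma ball_segment n (x0 x y: 'rV[R]_n) r t: ball x0 r x -> ball x0 r y ->
 0 <= t <= 1 -> ball x0 r (x + t *: (y - x)).
rewrite -ball_normE /ball_ /= => bx byy /andP[t0 t1].
have -> : x0 - (x + t *: (y - x)) = (1 - t) *: (x0 - x) + t *: (x0 - y).
 by apply/rowP => i;rewrite !mxE;ring.
apply: le_lt_trans (ler_normD _ _) _;rewrite !normrZ !ger0_norm ?subr_ge0 //.
have [->|tn0]:= eqVneq t 0;first by rewrite subr0 mul1r mul0r addr0.
have tp: 0 < t by rewrite lt_neqAle eq_sym tn0.
have: t * `|x0 - y| < t * r by rewrite ltr_pM2l.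
have: (1 - t) * `|x0 - x| <= (1 - t) * r by rewrite ler_wpM2l ?subr_ge0 // ltW.
by lra.
Qed.

(** Strict differentiability of a C^1 map: on a ball where the partial derivatives vary by at most
    e/(n+1), the mean value theorem is applied to each coordinate along the segment. Both points
    vary, which is what contraction estimates need. *)
Lemma C1_strict n m (U: set 'rV[R]_n) (f: 'rV[R]_n -> 'rV[R]_m) (x0: 'rV[R]_n) (e: R): open U -> U x0 ->
 Ck_on 1 U f -> 0 < e -> exists2 r: R, 0 < r &
  ball x0 r `<=` U /\ forall x y, ball x0 r x -> ball x0 r y ->
   `|f y - f x - (y - x) *m 'J f x0| <= e * `|y - x|.
move=> oU Ux0 C1 e0;have [df _]:= C1.
pose e':= e / (n%:R + 1).
have n0: 0 < n%:R + 1 :> R by rewrite ltr_wpDl.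
have e'0: 0 < e' by rewrite divr_gt0.
have N: \forall x \near x0, U x /\ forall i j, `|'J f x i j - 'J f x0 i j| <= e'.
 near=> x;split.
  by near: x;exact: open_nbhs_nbhs.
 near: x;apply: filter_forall => i;apply: filter_forall => j.
 have /cvgrPdist_le /(_ e' e'0):= Ck_J i j oU C1 x0 Ux0.
 by move=> H;near=> x;rewrite distrC;near: x;exact: H.
have [r r0 Hr]: exists2 r: R, 0 < r & ball x0 r `<=`
  [set x | U x /\ forall i j, `|'J f x i j - 'J f x0 i j| <= e'].
 by have /nbhs_ballP[r /= r0 Hr]:= N;exists r.
exists r => //;split=> [x /Hr[]//|x y bx byy].
apply: mx_norm_le => [|i j];first by rewrite mulr_ge0 // ltW.
have [t t01 E]: exists2 t: R, 0 <= t <= 1 & f y 0 j - f x 0 j =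
  'd (fun z => f z 0 j) (x + t *: (y - x)) (y - x).
 apply: mvt_rV => t t01;apply: differentiable_mxcoord;apply: df.
 by have []:= Hr _ (ball_segment bx byy t01).
have [Uz Hz]:= Hr _ (ball_segment bx byy t01).
rewrite (ord1 i) !mxE E diff_mxcoordE;last exact: df.
rewrite diffJ;last exact: df.
rewrite mxE -sumrB;apply: le_trans (ler_norm_sum _ _ _) _.
apply: (@le_trans _ _ (\sum_(k < n) `|y - x| * e')).
 apply: ler_sum => k _;rewrite -mulrBr normrM.
 exact: (ler_pM (normr_ge0 _) (normr_ge0 _) (mx_norm_ge _ _ _) (Hz _ _)).
rewrite sumr_const card_ord -[leLHS]mulr_natr -mulrA mulrC ler_wpM2r //.
by rewrite /e' mulrAC ler_pdivrMr // ler_wpM2l ?lerDl // ltW.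
Unshelve. all: by end_near. Qed.

End Jacobian.

Section InverseFunction.
Context {R: realType}.

Lemma Ck_det d n k (U: set 'rV[R]_d) (A: 'rV[R]_d -> 'M[R]_n): open U ->
 (forall i j, Ck_on k U (fun x => A x i j)) -> Ck_on k U (fun x => \det (A x)).
move=> oU H;rewrite /determinant.
apply: Ck_sum => // s;apply: CkM => //;first exact: Ck_cst.
by apply: Ck_prod.
Qed.

Lemma Ck_invmx d n k (U: set 'rV[R]_d) (A: 'rV[R]_d -> 'M[R]_n) i j: open U ->
 (forall x, U x -> A x \in unitmx) ->
 (forall i j, Ck_on k U (fun x => A x i j)) -> Ck_on k U (fun x => invmx (A x) i j).
move=> oU uA H.
apply: (@Ck_ext _ _ _ _ _ _ (fun x => (\det (A x))^-1 * cofactor (A x) j i)) => //.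
 by move=> x Ux;rewrite /invmx uA // !mxE.
apply: CkM => //.
 apply: CkV => //;last exact: Ck_det.
 by move=> x /uA;rewrite unitmxE unitfE.
apply: CkM => //;first exact: Ck_cst.
apply: Ck_det => // a b.
by apply: (Ck_ext oU _ (H (lift j a) (lift i b))) => x _;rewrite !mxE.
Qed.

Lemma unitmx_inj n (A: 'M[R]_n): (forall v: 'rV_n, v *m A = 0 -> v = 0) ->
 A \in unitmx.
by move=> H;rewrite -row_free_unit;apply: inj_row_free. Qed.

Local Opaque invmx.

Lemma mulmx_inv_sub n (J: 'M[R]_n) (h k: 'rV[R]_n): J \in unitmx ->
 h - k *m invmx J = - ((k - h *m J) *m invmx J).
by move=> uJ;rewrite mulmxBl -mulmxA mulmxV // mulmx1 opprB. Qed.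

Lemma closed_ball_compact n (x: 'rV[R]_n) (r: R): 0 < r ->
 compact (closed_ball x r).
move=> r0;apply: bounded_closed_compact;last exact: closed_ball_closed.
exists (`|x| + r);split;first exact: num_real.
move=> M HM y;rewrite closed_ballE // /closed_ball_ /= => xy.
apply: le_trans (ltW HM);rewrite -[y](subKr x).
by apply: le_trans (ler_normB _ _) _;rewrite lerD2l.
Qed.

Lemma open_preimage_on d m (U: set 'rV[R]_d) (f: 'rV[R]_d -> 'rV[R]_m)
 (B: set 'rV[R]_m): open U -> open B ->
 (forall x, U x -> {for x, continuous f}) -> open (U `&` f @^-1` B).
move=> oU oB cf;rewrite openE => x [Ux Bfx];apply: filterI.
 exact: open_nbhs_nbhs.
by apply: (cf _ Ux);exact: open_nbhs_nbhs.
Qed.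

(** With A the inverse Jacobian at [x0], the map x - (f x - y) A contracts by 1/2 on a ball. Its
    fixed point is found by minimizing |T x - x| on a compact ball instead of by iteration. The same
    contraction gives a lower Lipschitz bound for [f], from which injectivity, invertibility of the
    Jacobian on all of [V] and differentiability of the inverse follow. *)
Lemma inverse_function n (U: set 'rV[R]_n) (f: 'rV[R]_n -> 'rV[R]_n) (x0: 'rV[R]_n) :
 open U -> U x0 -> smooth_on U f -> 'J f x0 \in unitmx ->
 exists (V: set 'rV[R]_n) (g: 'rV[R]_n -> 'rV[R]_n),
  [/\ open V, V x0, V `<=` U & open (f @` V)] /\
  [/\ forall x, V x -> g (f x) = x, smooth_on (f @` V) g &
    forall x, V x -> 'J f x \in unitmx].
move=> oU Ux0 Sf uJ;pose A:= invmx ('J f x0).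
pose K:= n%:R * `|A| + 1.
have K0: 0 < K by rewrite ltr_wpDl // mulr_ge0.
have KA (v: 'rV_n): `|v *m A| <= K * `|v|.
 apply: le_trans (norm_rV_mul_le _ _) _;rewrite mulrC ler_wpM2r //.
 by rewrite lerDl.
clearbody K.
have e0: 0 < (2 * K)^-1 by rewrite invr_gt0 mulr_gt0.
have [r r0 [BU Hr]]:= C1_strict oU Ux0 (Sf 1%N) e0.
have [df _]:= Sf 1%N.
have contr (x y: 'rV_n): ball x0 r x -> ball x0 r y ->
  `|(y - x) - (f y - f x) *m A| <= 2^-1 * `|y - x|.
 move=> bx byy;have -> : (y - x) - (f y - f x) *m A =
   - ((f y - f x - (y - x) *m 'J f x0) *m A).
  by rewrite [in RHS]mulmxBl -[(y - x) *m _ *m _]mulmxA mulmxV // mulmx1 opprB.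
 rewrite normrN;apply: le_trans (KA _) _.
 apply: le_trans (ler_wpM2l (ltW K0) (Hr _ _ bx byy)) _.
 by rewrite mulrA ler_wpM2r // invfM mulrCA mulfV ?mulr1 ?gt_eqF.
have lip (x y: 'rV_n): ball x0 r x -> ball x0 r y ->
  `|y - x| <= 2 * K * `|f y - f x|.
 move=> bx byy;have:= contr _ _ bx byy;have:= KA (f y - f x).
 have:= ler_normB (y - x) (f y - f x *m A).
 have: `|y - x| <= `|(y - x) - (f y - f x) *m A| + `|(f y - f x) *m A|.
  by apply: le_trans (ler_normD _ _);rewrite subrK.
 by rewrite -mulrA;lra.
(* T moves [x0] by at most K s = r/8 and contracts by 1/2 on the ball of radius r/2, so T maps that
   ball into the ball of radius r/8 + r/4 = 3r/8. *)
pose s:= r / (8 * K);have s0: 0 < s by rewrite divr_gt0 // mulr_gt0.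
have r20: 0 < r / 2 by rewrite divr_gt0.
have sub2: ball x0 (r / 2) `<=` ball x0 r by apply: le_ball;lra.
pose V:= ball x0 (r / 2) `&` f @^-1` ball (f x0) s.
have oV: open V.
 apply: open_preimage_on;[exact: ball_open|exact: ball_open|].
 by move=> x /sub2 /BU /df;exact: differentiable_continuous.
have Vx0: V x0 by split;exact: ballxx.
have VU: V `<=` U by move=> x [/sub2 /BU].
have Vr x: V x -> ball x0 r x by case=> /sub2.
have fV: f @` V = ball (f x0) s.
 apply/seteqP;split=> [_ [x [_ ? <-]] //|y By].
 pose B':= closed_ball x0 (r / 2).
 have B'E x: B' x <-> `|x0 - x| <= r / 2.
  by rewrite /B' closed_ballE // /closed_ball_.
 have B'r x: B' x -> ball x0 r x.
  by move/B'E;rewrite -ball_normE /ball_ /=;lra.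
 pose T x:= x - (f x - y) *m A.
 have Tx0: `|x0 - T x0| <= r / 8.
  rewrite /T opprB addrC subrK;apply: le_trans (KA _) _.
  move: By;rewrite -ball_normE /ball_ /= => /ltW By.
  apply: le_trans (ler_wpM2l (ltW K0) By) _.
  by rewrite /s invfM mulrCA [K * _]mulrCA mulfV ?mulr1 ?gt_eqF.
 have Tc (x x': 'rV_n): B' x -> B' x' -> `|T x' - T x| <= 2^-1 * `|x' - x|.
  move=> /B'r bx /B'r bx';have:= contr _ _ bx bx'.
  have -> // : T x' - T x = x' - x - (f x' - f x) *m A.
  by rewrite /T !mulmxBl;apply/rowP => i;rewrite !mxE;ring.
 have TB x: B' x -> `|x0 - T x| <= 3 * r / 8.
  move=> Bx;have B0: B' x0 by apply/B'E;rewrite subrr normr0 ltW.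
  have:= Tc _ _ Bx B0;move/B'E: Bx => Bx.
  have:= ler_normD (x0 - T x0) (T x0 - T x);rewrite subrKA.
  by lra.
 have TB' x: B' x -> B' (T x) by move=> /TB H;apply/B'E;lra.
 have cB': compact B'.
  exact: closed_ball_compact.
 have cT x: B' x -> {for x, continuous (fun x => `|T x - x|)}.
  move=> /B'r /BU Ux.
  have -> : (fun x => `|T x - x|) = (fun v => `|v|) \o (fun x => (f x + - y) *m A).
   apply/funext => z /=;rewrite /T;apply/eqP.
   by rewrite [z - _]addrC addrK normrN.
  apply: continuous_comp;last exact: norm_continuous.
  have C0: Ck_on 0 U (fun x2 => f x2 + - y) by apply: (CkD oU (Sf 0%N));exact: Ck_cst.
  exact: (Ck_mulmx A oU C0 x Ux).
 (* If the minimizer were not fixed, T x would be a point of the ball with at most half the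
    displacement. *)
 have [|||x /set_mem Bx xmin]:= @EVT_min_rV R n (fun x => `|T x - x|) B'.
 - by exists x0;apply/B'E;rewrite subrr normr0 ltW.
 - by [].
 - by apply: continuous_in_subspaceT => x /set_mem /cT.
 have xE: T x = x.
  have:= xmin _ (mem_set (TB' _ Bx));have:= Tc _ _ Bx (TB' _ Bx).
  move=> L1 L2;apply/eqP;rewrite -subr_eq0 -normr_le0;lra.
 have E: f x = y.
  have /eqP: (f x - y) *m A = 0.
   apply/eqP;have: x - T x = 0 by rewrite xE subrr.
   by rewrite /T subKr => ->.
  move=> /eqP /(congr1 (mulmx^~ ('J f x0))).
  by rewrite mul0mx -mulmxA mulVmx // mulmx1 => /subr0_eq.
 exists x => //;split;last by rewrite /= E.
 have:= TB _ Bx;rewrite xE.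
 by rewrite -ball_normE /ball_ /=;lra.
pose g y:= xget x0 [set x | V x /\ f x = y].
have gP y: (f @` V) y -> V (g y) /\ f (g y) = y.
 by move=> [x Vx fx];apply: (@xgetPex _ x0 [set x | V x /\ f x = y]);exists x.
have gf x: V x -> g (f x) = x.
 move=> Vx;have [Vg fg]:= gP _ (imageP f Vx).
 apply/eqP;rewrite -subr_eq0 -normr_le0.
 by apply: le_trans (lip _ _ (Vr _ Vx) (Vr _ Vg)) _;rewrite fg subrr normr0 mulr0.
have oW: open (f @` V) by rewrite fV;exact: ball_open.
(* For [v] in the kernel, f(x + t v) - f x = o(t), against the bound |t v| <= 2 K |f(x + t v) - f
   x|. The constant 1/(4 K) leaves a factor 1/2. *)
have uJV x: V x -> 'J f x \in unitmx.
 move=> Vx;apply: unitmx_inj => v v0.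
 have e40: 0 < (4 * K)^-1 by rewrite invr_gt0 mulr_gt0.
 have N1:= diff_eps (df _ (VU _ Vx)) e40.
 have N2: \forall h \near (0: 'rV[R]_n), V (x + h).
  have /nbhs0P: \near x, V x by exact: open_nbhs_nbhs.
  by [].
 have N3: \forall t \near (0: R), V (x + t *: v) /\
   `|f (x + t *: v) - f x - 'd f x (t *: v)| <= (4 * K)^-1 * `|t *: v|.
  by apply: (@near0Z _ _ v (fun h => V (x + h) /\
   `|f (x + h) - f x - 'd f x h| <= (4 * K)^-1 * `|h|));exact: filterI.
 have /nbhs_ballP[q /= q0 Hq]:= N3.
 have bq: ball (0: R) q (q / 2).
  by rewrite -ball_normE /ball_ /= sub0r normrN gtr0_norm ?divr_gt0 //;lra.
 have [Vt]:= Hq _ bq;rewrite diffJ;last exact/df/VU.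
 rewrite -scalemxAl v0 scaler0 subr0.
 move=> L1;have:= lip _ _ (Vr _ Vx) (Vr _ Vt);rewrite addrC addKr.
 have: 2 * K * `|f (x + (q / 2) *: v) - f x| <= 2 * K * ((4 * K)^-1 * `|(q / 2) *: v|).
  by rewrite ler_wpM2l // mulr_ge0 // ltW.
 have -> : 2 * K * ((4 * K)^-1 * `|(q / 2) *: v|) = 2^-1 * `|(q / 2) *: v|.
  by field;rewrite gt_eqF.
 move=> L2 L3;have L4:= le_trans L3 L2;have: `|(q / 2) *: v| <= 0 by lra.
 rewrite normr_le0 scaler_eq0 => /orP[|/eqP //].
 by rewrite gt_eqF ?divr_gt0.
have dg y: (f @` V) y -> differentiable g y /\
  forall k, 'd g y k = k *m invmx ('J f (g y)).
 move=> Wy;have [Vg fg]:= gP _ Wy;set x:= g y in Vg fg *.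
 pose L: {linear 'rV[R]_n -> 'rV[R]_n} := mulmxr (invmx ('J f x)).
 suff [D E]: differentiable g y /\ 'd g y = L :> ('rV[R]_n -> 'rV[R]_n).
  by split => // k;rewrite E.
 apply: is_diff_eps;first exact: linear_rV_continuous.
 move=> e epos.
 have [C C0 CE]: exists2 C: R, 0 < C & n%:R * `|invmx ('J f x)| <= C.
  by exists (n%:R * `|invmx ('J f x)| + 1);[rewrite ltr_wpDl // mulr_ge0|rewrite lerDl].
 have e'0: 0 < e / (C * (2 * K)).
  by apply: divr_gt0 epos _;apply: mulr_gt0 C0 _;apply: mulr_gt0 => //.
 have /nbhs_ballP[q /= q0 Hq]:= diff_eps (df _ (VU _ Vg)) e'0.
 have N1: \forall k \near (0: 'rV[R]_n), (f @` V) (y + k).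
  have /nbhs0P: \near y, (f @` V) y by exact: open_nbhs_nbhs.
  by [].
 have N2: \forall k \near (0: 'rV[R]_n), `|k| < q / (2 * K).
  apply/nbhs_ballP;exists (q / (2 * K));first by rewrite /= divr_gt0 // mulr_gt0.
  by move=> z;rewrite -ball_normE /ball_ /= sub0r normrN.
 near=> k.
 have Wk: (f @` V) (y + k) by near: k.
 have kq: `|k| < q / (2 * K) by near: k.
 have [Vgk fgk]:= gP _ Wk.
 have L1:= lip _ _ (Vr _ Vg) (Vr _ Vgk).
 rewrite fgk fg [y + k - y]addrC addKr in L1.
 pose h:= g (y + k) - x.
 have bh: ball (0: 'rV[R]_n) q h.
  rewrite -ball_normE /ball_ /= sub0r normrN;apply: le_lt_trans L1 _.
  by move: kq;rewrite ltr_pdivlMr ?mulr_gt0 // mulrC.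
 have:= Hq _ bh;rewrite /= /h [x + _]addrC subrK fgk fg [y + k - y]addrC addKr.
 rewrite diffJ;last exact/df/VU.
 rewrite -/h => L2.
 have -> : h - L k = - ((k - h *m 'J f x) *m invmx ('J f x)).
  exact: mulmx_inv_sub (uJV _ Vg).
 rewrite normrN;apply: le_trans (norm_rV_mul_le _ _) _.
 apply: (@le_trans _ _ (e / (C * (2 * K)) * `|h| * C)).
  by apply: ler_pM => //;rewrite mulr_ge0.
 apply: (@le_trans _ _ (e / (C * (2 * K)) * (2 * K * `|k|) * C)).
  by rewrite ler_wpM2r ?(ltW C0) // ler_wpM2l ?(ltW e'0).
 by rewrite le_eqVlt;apply/orP;left;apply/eqP;field;rewrite !gt_eqF.
have Sg: smooth_on (f @` V) g.
 elim=> [|k IH];first by move=> y /dg[D _];exact: differentiable_continuous.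
 (* The derivative [v *m invmx ('J f (g y))] is rational in the partial derivatives of [f] at [g y],
    so it is as smooth as [g] is already known to be. *)
 split=> [y /dg[]//|v].
 apply: (@Ck_ext _ _ _ _ _ _ (fun y => v *m invmx ('J f (g y)))) => //.
  by move=> y /dg[_ ->].
 apply: Ck_rV => // i.
 apply: (@Ck_ext _ _ _ _ _ _ (fun y => \sum_j v 0 j * invmx ('J f (g y)) j i)) => //.
  by move=> y _;rewrite mxE.
 apply: Ck_sum => // j;apply: CkM => //;first exact: Ck_cst.
 have uJg y: (f @` V) y -> 'J f (g y) \in unitmx by move=> /gP[Vg _];exact: uJV.
 have CJ a b: Ck_on k V (fun x => 'J f x a b).
  exact: (Ck_J a b oV (Ck_mono VU (Sf k.+1))).
 have gV y: (f @` V) y -> V (g y) by move=> /gP[].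
 exact: (Ck_invmx j i oW uJg (fun a b => Ck_compR oW gV IH (CJ a b))).
by exists V, g;split;split.
Unshelve. all: by end_near. Qed.

End InverseFunction.

(** * Continuous functions with compact support and the iterated integral *)

Section ContinuityRules.
Context {R: realType}.
Implicit Types (T: topologicalType) (W: normedModType R).

Lemma contD T W (f g: T -> W): continuous f -> continuous g ->
 continuous (fun x => f x + g x).
by move=> cf cg x;exact: (cvgD (cf x) (cg x)). Qed.

Lemma contB T W (f g: T -> W): continuous f -> continuous g ->
 continuous (fun x => f x - g x).
by move=> cf cg x;exact: (cvgB (cf x) (cg x)). Qed.

Lemma contM T (f g: T -> R): continuous f -> continuous g ->
 continuous (fun x => f x * g x).
by move=> cf cg x;exact: (cvgM (cf x) (cg x)). Qed.

Lemma cont_cst T W (w: W): continuous (fun _: T => w).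
by move=> x;exact: cst_continuous. Qed.

Lemma cont_comp T T' T'' (f: T -> T') (g: T' -> T''): continuous f ->
 continuous g -> continuous (fun x => g (f x)).
by move=> cf cg x;apply: continuous_comp;[exact: cf|exact: cg]. Qed.

Lemma cont_norm T W (f: T -> W): continuous f -> continuous (fun x => `|f x|).
by move=> cf;apply: (cont_comp cf);exact: norm_continuous. Qed.

Lemma cont_mulmx T n m (f: T -> 'rV[R]_n) (A: 'M[R]_(n, m)): continuous f ->
 continuous (fun x => f x *m A).
by move=> cf;apply: (cont_comp cf (g:= mulmxr A));exact: linear_rV_continuous. Qed.

Lemma cont_id T: continuous (fun x: T => x).
by move=> x;exact: cvg_id. Qed.

End ContinuityRules.

Section CompactSupport.
Context {R: realType}.

Definition Cc k (f: 'rV[R]_k -> R): Prop :=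
 continuous f /\ exists2 r: R, 0 < r & forall x, r <= `|x| -> f x = 0.

(** The tube lemma, in the form of a near-property uniform over a compact set. *)
Lemma compact_near_forall (X T: topologicalType) (K: set X) (t: T)
  (P: T -> X -> Prop): compact K ->
 (forall y, K y -> \forall y' \near y & t' \near t, P t' y') ->
 \forall t' \near t, forall y, K y -> P t' y.
move=> /compact_near_coveringP cK H.
apply: filterS (cK T (nbhs t) P _ H) => t' H' y;exact: H'.
Qed.

Lemma Cc_ext k (f g: 'rV[R]_k -> R): (forall x, f x = g x) -> Cc f -> Cc g.
by move=> /funext ->. Qed.

Lemma CcD k (f g: 'rV[R]_k -> R): Cc f -> Cc g -> Cc (fun x => f x + g x).
move=> [cf [r r0 Hf]] [cg [s s0 Hg]];split.
 by move=> x;exact: (cvgD (cf x) (cg x)).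
exists (r + s) => [|x xrs];first exact: addr_gt0.
by rewrite Hf ?Hg ?addr0 //;apply: le_trans xrs;rewrite ?lerDl ?lerDr ltW.
Qed.

Lemma CcM k (f g: 'rV[R]_k -> R): Cc f -> continuous g -> Cc (fun x => f x * g x).
move=> [cf [r r0 Hf]] cg;split;first by move=> x;exact: (cvgM (cf x) (cg x)).
by exists r => // x /Hf ->;rewrite mul0r.
Qed.

Lemma CcZ k c (f: 'rV[R]_k -> R): Cc f -> Cc (fun x => c * f x).
move=> Cf;apply: (Cc_ext _ (CcM Cf (g:= fun=> c) _));last exact: cst_continuous.
by move=> x;rewrite mulrC.
Qed.

Lemma CcN k (f: 'rV[R]_k -> R): Cc f -> Cc (fun x => - f x).
by move=> /(CcZ (-1));apply: Cc_ext => x;rewrite mulN1r. Qed.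

Lemma CcB k (f g: 'rV[R]_k -> R): Cc f -> Cc g -> Cc (fun x => f x - g x).
by move=> Cf /CcN;exact: CcD. Qed.

Lemma Cc_norm k (f: 'rV[R]_k -> R): Cc f -> Cc (fun x => `|f x|).
move=> [cf [r r0 Hf]];split.
 by move=> x;apply: (@continuous_comp _ _ _ f (fun v => `|v|));[exact: cf|exact: norm_continuous].
by exists r => // x /Hf ->;rewrite normr0.
Qed.

Lemma Cc_sum k (I: Type) (s: seq I) (f: I -> 'rV[R]_k -> R) :
 (forall i, Cc (f i)) -> Cc (fun x => \sum_(i <- s) f i x).
move=> H;elim: s => [|i s IH].
 have -> : (fun x => \sum_(i <- [::]) f i x) = fun=> 0.
  by apply/funext => x;rewrite big_nil.
 by split;[exact: cst_continuous|exists 1].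
by apply: (Cc_ext _ (CcD (H i) IH)) => x;rewrite big_cons.
Qed.

Lemma norm_mul_invmx k (A: 'M[R]_k): A \in unitmx ->
 exists2 C: R, 0 < C & forall x: 'rV_k, `|x| <= C * `|x *m A|.
move=> uA;exists (k%:R * `|invmx A| + 1);first by rewrite ltr_wpDl // mulr_ge0.
move=> x;rewrite -{1}(mulmxK uA x);apply: le_trans (norm_rV_mul_le _ _) _.
by rewrite mulrC ler_wpM2r // lerDl.
Qed.

Lemma Cc_affine k (f: 'rV[R]_k -> R) (A: 'M[R]_k) (v: 'rV[R]_k): A \in unitmx -> Cc f ->
 Cc (fun x => f (x *m A + v)).
move=> uA [cf [r r0 Hf]];split.
 apply: (cont_comp _ cf);apply: contD;last exact: cont_cst.
 by apply: cont_mulmx;exact: cont_id.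
have [C C0 HC]:= norm_mul_invmx uA.
exists (C * (r + `|v|));first by rewrite mulr_gt0 // ltr_wpDr.
move=> x xr;apply: Hf;rewrite -(lerD2r `|v|).
rewrite -(ler_pM2l C0);apply: le_trans xr _;apply: le_trans (HC x) _.
by rewrite ler_pM2l // -{1}(addrK v (x *m A)) ler_normB.
Qed.

Lemma row_mx_split k (t: R) (y: 'rV[R]_k) :
 row_mx (t%:M: 'rV_1) y = t *: row_mx 1%:M 0 + y *m row_mx 0 1%:M.
by rewrite scale_row_mx scaler0 scale_scalar_mx mulr1 mul_mx_row mulmx0 mulmx1
 add_row_mx addr0 add0r.
Qed.

Lemma norm_row_mx_l k (t: R) (y: 'rV[R]_k): `|t| <= `|row_mx (t%:M: 'rV_1) y|.
have:= mx_norm_ge (scons t y) 0 (lshift k 0).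
by rewrite row_mxEl mxE eqxx mulr1n.
Qed.

Lemma norm_row_mx_r k (t: R) (y: 'rV[R]_k): `|y| <= `|row_mx (t%:M: 'rV_1) y|.
apply: mx_norm_le => // i j;rewrite (ord1 i).
by have:= mx_norm_ge (scons t y) 0 (rshift 1 j);rewrite row_mxEr.
Qed.

Lemma row_mx_near k (t: R) (y: 'rV[R]_k) (P: set 'rV[R]_(1 + k)) :
 nbhs (scons t y) P ->
 \forall y' \near y & t' \near t, P (row_mx (t'%:M: 'rV_1) y').
move=> /nbhs_ballP[e /= e0 He].
have N1: \forall y' \near y, ball y e y' by exact: nbhsx_ballx.
have N2: \forall t' \near t, ball t e t' by exact: nbhsx_ballx.
near=> y' t';apply: He.
have: ball y e y' by near: y'.
have: ball t e t' by near: t'.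
rewrite -!ball_normE /ball_ /= => ht hy;rewrite opp_row_mx add_row_mx.
apply: mx_norm_lt => // i j;rewrite (ord1 i) mxE;case: splitP => [j0 _|j0 _].
 by rewrite (ord1 j0) !mxE eqxx !mulr1n.
exact: le_lt_trans (mx_norm_ge _ _ _) hy.
Unshelve. all: by end_near. Qed.

Lemma row_mx_continuous k (t: R): continuous (fun y: 'rV[R]_k => row_mx (t%:M: 'rV_1) y).
have -> : (fun y: 'rV[R]_k => row_mx (t%:M: 'rV_1) y) =
  fun y => t *: row_mx 1%:M 0 + y *m row_mx 0 1%:M.
 by apply/funext => y;exact: row_mx_split.
apply: contD;first exact: cont_cst.
by apply: cont_mulmx;exact: cont_id.
Qed.

Lemma Cc_slice k (f: 'rV[R]_(1 + k) -> R) t: Cc f ->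
 Cc (fun y: 'rV_k => f (scons t y)).
move=> [cf [r r0 Hf]];split.
 move=> y;apply: (@continuous_comp _ _ _ (fun y => row_mx (t%:M: 'rV_1) y) f);last exact: cf.
 exact: row_mx_continuous.
exists r => // y ry;apply: Hf;exact: le_trans (norm_row_mx_r _ _).
Qed.

(** Since t + |t| = 2 max(t, 0), this is twice the positive part of 2 - |x|/r: a continuous,
    compactly supported majorant of the indicator of the ball of radius [r]. *)
Definition bump k (r: R) (x: 'rV[R]_k): R :=
 (2 - `|x| / r) + `|2 - `|x| / r|.

Lemma bump_ge0 k r (x: 'rV[R]_k): 0 <= bump r x.
by rewrite /bump addrC -[X in _ + X]opprK subr_ge0 ler_normr lexx orbT. Qed.

Lemma bump_ge1 k r (x: 'rV[R]_k): 0 < r -> `|x| <= r -> 1 <= bump r x.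
move=> r0 xr;have: `|x| / r <= 1 by rewrite ler_pdivrMr // mul1r.
by move=> H;rewrite /bump ger0_norm;lra.
Qed.

Lemma Cc_bump k (r: R): 0 < r -> Cc (bump (k:= k) r).
move=> r0.
have c1: continuous (fun x: 'rV[R]_k => 2 - `|x| / r).
 apply: contB;first exact: cont_cst.
 by apply: contM;[apply: cont_norm;exact: cont_id|exact: cont_cst].
split;first exact: (contD c1 (cont_norm c1)).
exists (2 * r);first by rewrite mulr_gt0.
move=> x xr;have: 2 <= `|x| / r by rewrite ler_pdivlMr.
by move=> H;rewrite /bump ler0_norm;lra.
Qed.

End CompactSupport.

Section Integral1.
Context {R: realType}.
Local Notation mu:= (@lebesgue_measure R).

Lemma integrable_Cc1 (f: R -> R) (r: R): continuous f -> (forall t, r <= `|t| -> f t = 0) ->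
 mu.-integrable setT (EFin \o f).
move=> cf Hf.
have I1: mu.-integrable `[- r, r] (EFin \o f).
 apply: continuous_compact_integrable;first exact: segment_compact.
 exact: continuous_subspaceT.
have I2: mu.-integrable setT ((EFin \o f) \_ `[- r, r]) by rewrite -integrable_mkcond.
apply: eq_integrable I2 => // t _.
rewrite /restrict /=;case: ifPn => //;rewrite notin_setE /= in_itv /= => /negP.
rewrite -ler_norml -ltNge => /ltW /Hf -> //.
Qed.

(** The substitution rule applied here is for nonnegative integrands, so [f] is written as |f| -
    (|f| - f). *)
Lemma Rint_affine (f: R -> R) (r a b: R): 0 < a -> continuous f ->
 (forall t, r <= `|t| -> f t = 0) ->
 \int[mu]_t f t = a * \int[mu]_t f (a * t + b).
move=> a0 cf Hf.
pose F t:= a * t + b.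
have cF: continuous F.
 by apply: contD;[apply: contM;[exact: cont_cst|exact: cont_id]|exact: cont_cst].
have dF t: is_derive t (1: R) F a.
 have:= is_deriveD (is_deriveZ a (is_derive_id t 1)) (is_derive_cst b t 1).
 by rewrite addr0 /GRing.scale /= mulr1.
have F': F^`()%classic = fun=> a.
 by apply/funext => t;rewrite derive1E;have [_ ->]:= dF t.
have rr: forall t, (r + `|b|) / a <= `|t| -> r <= `|F t|.
 move=> t;rewrite ler_pdivrMr // => H.
 rewrite -(lerD2r `|b|);apply: le_trans H _.
 rewrite mulrC -{1}(gtr0_norm a0) -normrM -{1}(addrK b (a * t));exact: ler_normB.
have pos (g: R -> R): continuous g -> (forall t, 0 <= g t) ->
  (forall t, r <= `|t| -> g t = 0) -> \int[mu]_t g t = a * \int[mu]_t g (F t).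
 move=> cg g0 Hg;rewrite /Rintegral.
 have cF': continuous F^`()%classic by rewrite F';exact: cst_continuous.
 have lF': cvg (F^`()%classic x @[x --> -oo]) by rewrite F';exact: is_cvg_cst.
 have rF': cvg (F^`()%classic x @[x --> +oo]) by rewrite F';exact: is_cvg_cst.
 have mF: {homo F: x y / x < y} by move=> x y xy;rewrite /F ltrD2r ltr_pM2l.
 have yF: F x @[x --> +oo] --> +oo.
  apply/cvgryPge => A;apply: filterS (nbhs_pinfty_ge (num_real ((A - b) / a))) => x.
  by rewrite ler_pdivrMr // mulrC lerBlDr.
 have NyF: F x @[x --> -oo] --> -oo.
  apply/cvgrNyPle => A;apply: filterS (nbhs_ninfty_le (num_real ((A - b) / a))) => x.
  by rewrite ler_pdivlMr // mulrC lerBrDr.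
 have dF' (x: R): derivable F x 1 by have []:= dF x.
 rewrite (increasing_ge0_integration_by_substitutionT mF cF' lF' rF' dF' NyF yF cg g0).
 have IF: mu.-integrable setT (EFin \o (fun t => g (F t))).
  apply: (@integrable_Cc1 _ ((r + `|b|) / a));first exact: (cont_comp cF cg).
  by move=> t /rr /Hg.
 rewrite -[RHS]/(a * \int[mu]_t g (F t)) -RintegralZl // /Rintegral;congr fine.
 by apply: eq_integral => t _;rewrite F' /= mulrC.
have cn (g: R -> R): continuous g -> continuous (fun t => `|g t|).
 exact: cont_norm.
have E (g: R -> R): g = fun t => `|g t| - (`|g t| - g t).
 by apply/funext => t;rewrite subKr.
have cn2: continuous (fun t => `|f t| - f t) by exact: (contB (cn _ cf) cf).
have H1 t: r <= `|t| -> `|f t| = 0 by move=> /Hf ->;rewrite normr0.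
have H2 t: r <= `|t| -> `|f t| - f t = 0 by move=> /Hf ->;rewrite normr0 subrr.
have S (h: R -> R) (s: R): continuous h -> (forall t, s <= `|t| -> h t = 0) ->
  \int[mu]_t h t = \int[mu]_t `|h t| - \int[mu]_t (`|h t| - h t).
 move=> ch Hh;rewrite -RintegralB //.
 - by apply: eq_Rintegral => t _;rewrite subKr.
 - by apply: (@integrable_Cc1 _ s);[exact: cn|move=> t /Hh ->;rewrite normr0].
 - apply: (@integrable_Cc1 _ s);last by move=> t /Hh ->;rewrite normr0 subrr.
  exact: (contB (cn _ ch) ch).
rewrite (S f r) // (S (f \o F) ((r + `|b|) / a)) /=;last 2 first.
- exact: (cont_comp cF cf).
- by move=> t /rr /Hf.
rewrite mulrBr;congr (_ - _).
 by apply: (pos (fun t => `|f t|)) => //;exact: cn.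
by apply: (pos (fun t => `|f t| - f t)) => // t;rewrite subr_ge0 ler_norm.
Qed.

End Integral1.

Section IntegralRn.
Context {R: realType}.
Local Notation mu:= (@lebesgue_measure R).

(** Additivity, homogeneity and monotonicity are bundled because they must be proved by one
    induction on the dimension: integrability of the slices in dimension k+1 uses all three in
    dimension k. *)
Definition linmono k: Prop :=
 [/\ forall f g: 'rV[R]_k -> R, Cc f -> Cc g ->
    integral_Rn (fun x => f x + g x) = integral_Rn f + integral_Rn g,
   forall c (f: 'rV[R]_k -> R), Cc f ->
    integral_Rn (fun x => c * f x) = c * integral_Rn f &
   forall f g: 'rV[R]_k -> R, Cc f -> Cc g -> (forall x, f x <= g x) ->
    integral_Rn f <= integral_Rn g].

Lemma integral_RnS k (f: 'rV[R]_(1 + k) -> R) :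
 integral_Rn (k:= k.+1) f =
 \int[mu]_t integral_Rn (fun y: 'rV_k => f (scons t y)).
by []. Qed.

(** The slices vary uniformly on a compact ball, and the difference of two of them is dominated by a
    small multiple of a bump. Monotonicity turns this into continuity of the integral of the
    slice. *)
Lemma slice_integral k (f: 'rV[R]_(1 + k) -> R): linmono k -> Cc f ->
 continuous (fun t => integral_Rn (fun y: 'rV_k => f (scons t y))) /\
 exists r: R, forall t, r <= `|t| ->
  integral_Rn (fun y: 'rV_k => f (scons t y)) = 0.
move=> [HD HZ HM] Cf;have [cf [r r0 Hf]]:= Cf;split;last first.
 exists r => t rt;pose b:= bump (k:= k) (1: R).
 have -> : (fun y: 'rV_k => f (scons t y)) = fun y => 0 * b y.
  by apply/funext => y;rewrite mul0r Hf //;apply: le_trans rt (norm_row_mx_l _ _).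
 by rewrite HZ ?mul0r //;exact: Cc_bump.
move=> t;apply/cvgrPdist_le => e e0.
pose b:= bump (k:= k) r;pose C:= integral_Rn b + 1.
have Cb: Cc b by exact: Cc_bump.
have Ib0: 0 <= integral_Rn b.
 have:= HM _ _ (CcZ 0 Cb) Cb;rewrite HZ // mul0r;apply => x.
 by rewrite mul0r bump_ge0.
have C0: 0 < C by rewrite ltr_wpDl.
have d0: 0 < e / C by rewrite divr_gt0.
pose P (t': R) (y: 'rV[R]_k) :=
 `|f (scons t y) - f (row_mx (t'%:M: 'rV_1) y)| <= e / C.
have N: \forall t' \near t, forall y, closed_ball 0 r y -> P t' y.
 apply: compact_near_forall;first exact: closed_ball_compact.
 move=> y _;have e20: 0 < e / C / 2 by rewrite divr_gt0.
 have /cvgrPdist_le /(_ _ e20) N1:= cf (scons t y).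
 have N3:= row_mx_near N1.
 have N4: \forall y' \near y,
   `|f (scons t y) - f (row_mx (t%:M: 'rV_1) y')| <= e / C / 2.
  by have:= @row_mx_continuous R k t y;move=> /(_ _ N1).
 have [[A B] /= [nA nB] AB]:= N3.
 exists (A `&` [set y' |
   `|f (scons t y) - f (row_mx (t%:M: 'rV_1) y')| <= e / C / 2], B) => /=.
  by split=> //;exact: filterI.
 move=> [y' t'] /= [[Ay' H1] Bt'];have:= AB (y', t') (conj Ay' Bt').
 rewrite /P /= => H2.
 apply: le_trans (ler_distD (f (scons t y)) _ _) _.
 by rewrite distrC in H1;lra.
near=> t';have Ht': forall y, closed_ball 0 r y -> P t' y by near: t'.
have S (s: R):= Cc_slice s Cf.
have Q y: `|f (scons t y) - f (row_mx (t'%:M: 'rV_1) y)| <= e / C * b y.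
 have [ry|ry]:= ltP r `|y|.
  have z s: f (scons s y) = 0.
   by apply: Hf;apply: le_trans (ltW ry) (norm_row_mx_r _ _).
  by rewrite !z subrr normr0 mulr_ge0 ?bump_ge0 // ltW.
 have By: closed_ball 0 r y by rewrite closed_ballE // /closed_ball_ /= sub0r normrN.
 apply: le_trans (Ht' _ By) _;rewrite ler_peMr ?bump_ge1 //;exact: ltW.
have CN s: Cc (fun y: 'rV_k => - f (scons s y)) by exact: CcN.
have IN s: integral_Rn (fun y: 'rV_k => - f (scons s y)) =
  - integral_Rn (fun y: 'rV_k => f (scons s y)).
 by rewrite -mulN1r -HZ //;congr integral_Rn;apply/funext => y;rewrite mulN1r.
have U (s s': R): (forall y, f (scons s y) - f (row_mx (s'%:M: 'rV_1) y)
   <= e / C * b y) ->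
  integral_Rn (fun y: 'rV_k => f (scons s y)) -
  integral_Rn (fun y: 'rV_k => f (row_mx (s'%:M: 'rV_1) y)) <= e.
 move=> H;rewrite -IN -HD //.
 apply: (@le_trans _ _ (integral_Rn (fun y => e / C * b y))).
  by apply: HM => //;[exact: CcD|exact: CcZ].
 rewrite HZ // mulrAC ler_pdivrMr // ler_wpM2l ?(ltW e0) // /C lerDl //.
rewrite ler_norml;apply/andP;split;last first.
 by apply: U => y;apply: le_trans (ler_norm _) (Q y).
rewrite lerNl opprB;apply: U => y.
by apply: le_trans (ler_norm _) _;rewrite distrC.
Unshelve. all: by end_near. Qed.

Lemma integral_Rn_linmono k: linmono k.
elim: k => [|k IH].
 by split=> // f g _ _ H;exact: H.
have IS f (Cf: Cc f): mu.-integrable setT (EFin \o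
  (fun t => integral_Rn (fun y: 'rV_k => f (scons t y)))).
 have [c [r Hr]]:= slice_integral IH Cf.
 exact: (integrable_Cc1 c Hr).
have [HD HZ HM]:= IH.
split=> [f g Cf Cg|c f Cf|f g Cf Cg fg];rewrite !integral_RnS.
- rewrite -(RintegralD _ (IS _ Cf) (IS _ Cg)) //;apply: eq_Rintegral => t _.
 by rewrite -HD //;exact: Cc_slice.
- rewrite -RintegralZl //;last exact: (IS _ Cf).
 apply: eq_Rintegral => t _.
 by rewrite -HZ //;exact: Cc_slice.
- apply: (le_Rintegral _ (IS _ Cf) (IS _ Cg)) => // t _.
 by apply: HM => //;exact: Cc_slice.
Qed.

Lemma integral_RnD k (f g: 'rV[R]_k -> R): Cc f -> Cc g ->
 integral_Rn (fun x => f x + g x) = integral_Rn f + integral_Rn g.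
by have [H _ _]:= integral_Rn_linmono k;exact: H. Qed.

Lemma integral_RnZ k c (f: 'rV[R]_k -> R): Cc f ->
 integral_Rn (fun x => c * f x) = c * integral_Rn f.
by have [_ H _]:= integral_Rn_linmono k;exact: H. Qed.

Lemma le_integral_Rn k (f g: 'rV[R]_k -> R): Cc f -> Cc g ->
 (forall x, f x <= g x) -> integral_Rn f <= integral_Rn g.
by have [_ _ H]:= integral_Rn_linmono k;exact: H. Qed.

Lemma eq_integral_Rn k (f g: 'rV[R]_k -> R): (forall x, f x = g x) ->
 integral_Rn f = integral_Rn g.
by move=> /funext ->. Qed.

Lemma integral_RnB k (f g: 'rV[R]_k -> R): Cc f -> Cc g ->
 integral_Rn (fun x => f x - g x) = integral_Rn f - integral_Rn g.
move=> Cf Cg;rewrite integral_RnD //;last exact: CcN.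
rewrite -[in RHS]mulN1r -integral_RnZ //;congr (_ + _).
by apply: eq_integral_Rn => x;rewrite mulN1r.
Qed.

Lemma Cc0 k: Cc (fun _: 'rV[R]_k => 0: R).
by apply: (Cc_ext _ (CcZ 0 (Cc_bump k ltr01))) => x;rewrite mul0r. Qed.

Lemma integral_Rn0 k: integral_Rn (fun _: 'rV[R]_k => 0: R) = 0.
rewrite -[RHS](mul0r (integral_Rn (bump (k:= k) (1: R)))) -integral_RnZ;last exact: Cc_bump.
by apply: eq_integral_Rn => x;rewrite mul0r.
Qed.

Lemma integral_Rn_ge0 k (f: 'rV[R]_k -> R): Cc f -> (forall x, 0 <= f x) ->
 0 <= integral_Rn f.
by move=> Cf H;rewrite -(integral_Rn0 k);apply: le_integral_Rn => //;exact: Cc0. Qed.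

Lemma integral_Rn_sum k (J: Type) (s: seq J) (f: J -> 'rV[R]_k -> R) :
 (forall i, Cc (f i)) ->
 integral_Rn (fun x => \sum_(i <- s) f i x) = \sum_(i <- s) integral_Rn (f i).
move=> H;elim: s => [|i s IH].
 rewrite big_nil -[RHS](integral_Rn0 k);apply: eq_integral_Rn => x.
 by rewrite big_nil.
rewrite big_cons -IH -integral_RnD //;last exact: Cc_sum.
by apply: eq_integral_Rn => x;rewrite big_cons.
Qed.

Lemma integral_Rn_norm_le k (f g: 'rV[R]_k -> R): Cc f -> Cc g ->
 (forall x, `|f x| <= g x) -> `|integral_Rn f| <= integral_Rn g.
move=> Cf Cg H;rewrite ler_norml;apply/andP;split.
 rewrite lerNl -mulN1r -integral_RnZ //;apply: le_integral_Rn => //;first exact: CcZ.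
 by move=> x;rewrite mulN1r;apply: le_trans (H x);rewrite -normrN ler_norm.
by apply: le_integral_Rn => // x;apply: le_trans (H x);rewrite ler_norm.
Qed.

Lemma unit_scalar k (a: R): a != 0 -> a%:M \in @unitmx R k.
by move=> a0;rewrite unitmxE det_scalar unitfE expf_neq0.
Qed.

Lemma Cc_scale k (f: 'rV[R]_k -> R) (d: R) v: 0 < d -> Cc f ->
 Cc (fun x => f (d *: x + v)).
move=> d0 Cf;apply: (Cc_ext _ (Cc_affine v (unit_scalar k (lt0r_neq0 d0)) Cf)) => x.
by rewrite mul_mx_scalar.
Qed.

Lemma rV_split k (v: 'rV[R]_(1 + k)) :
 v = row_mx ((v 0 0)%:M: 'rV_1) (rsubmx v).
rewrite -{1}(hsubmxK v);congr row_mx.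
rewrite [lsubmx v]mx11_scalar mxE;congr (v _ _)%:M;exact: val_inj.
Qed.

Lemma row_mx_affine k (d t: R) (y: 'rV[R]_k) (v: 'rV[R]_(1 + k)) :
 row_mx ((d * t + v 0 0)%:M: 'rV_1) (d *: y + rsubmx v) =
 d *: row_mx (t%:M: 'rV_1) y + v.
rewrite [in RHS](rV_split v) scale_row_mx add_row_mx;congr (row_mx _ _).
by apply/rowP => i;rewrite (ord1 i) !mxE eqxx !mulr1n.
Qed.

Lemma integral_Rn_scale k (f: 'rV[R]_k -> R) (d: R) v: 0 < d -> Cc f ->
 integral_Rn f = d ^+ k * integral_Rn (fun x => f (d *: x + v)).
move=> d0;elim: k f v => [|k IH] f v Cf.
 by rewrite expr0 mul1r /=;congr f;apply/rowP => -[].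
have [c [r Hr]]:= slice_integral (integral_Rn_linmono k) Cf.
rewrite !integral_RnS (Rint_affine (v 0 0) d0 c Hr).
rewrite exprS -mulrA;congr (_ * _);rewrite -RintegralZl //.
 apply: eq_Rintegral => t _;rewrite (IH _ (@rsubmx _ 1 1 k v));last exact: Cc_slice.
 congr (_ * _);apply: eq_integral_Rn => y;congr f.
 exact: row_mx_affine.
have Cg: Cc (fun x => f (d *: x + v)) by exact: Cc_scale.
have [c' [r' Hr']]:= slice_integral (integral_Rn_linmono k) Cg.
exact: (integrable_Cc1 c' Hr').
Qed.

Lemma integral_Rn_translate k (f: 'rV[R]_k -> R) v: Cc f ->
 integral_Rn f = integral_Rn (fun x => f (x + v)).
move=> Cf;rewrite (integral_Rn_scale v ltr01 Cf) expr1n mul1r.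
by apply: eq_integral_Rn => x;rewrite scale1r.
Qed.

Lemma upper_unit k (A: 'M[R]_k): (forall i j: 'I_k, (j < i)%N -> A i j = 0) ->
 (forall i, 0 < A i i) -> A \in unitmx.
move=> HA HD;rewrite -unitmx_tr unitmxE det_trig;last first.
 by apply/is_trig_mxP => i j ij;rewrite mxE HA.
rewrite unitfE;apply/prodf_neq0 => i _;rewrite mxE gt_eqF //.
Qed.

(** Vectors are rows, so with an upper triangular matrix the first coordinate of [x *m A] depends on
    the first coordinate of [x] only. One substitution treats it, and the lower right block is
    handled by induction. *)
Lemma integral_Rn_upper k (f: 'rV[R]_k -> R) (A: 'M[R]_k): Cc f ->
 (forall i j: 'I_k, (j < i)%N -> A i j = 0) -> (forall i, 0 < A i i) ->
 integral_Rn f = (\prod_i A i i) * integral_Rn (fun x => f (x *m A)).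
elim: k f A => [|k IH] f A Cf HA HD.
 by rewrite big_ord0 mul1r /=;congr f;apply/rowP => -[].
have Cg: Cc (fun x => f (x *m A)).
 by apply: (Cc_ext _ (Cc_affine 0 (upper_unit HA HD) Cf)) => x;rewrite addr0.
have [c [r Hr]]:= slice_integral (integral_Rn_linmono k) Cf.
have [c' [r' Hr']]:= slice_integral (integral_Rn_linmono k) Cg.
pose D: 'M[R]_k:= @drsubmx _ 1 k 1 k A.
pose b: 'rV[R]_k:= @ursubmx _ 1 k 1 k A.
rewrite !integral_RnS (Rint_affine 0 (HD 0) c Hr).
rewrite big_ord_recl -mulrA;congr (_ * _);rewrite -RintegralZl //;last first.
 exact: (integrable_Cc1 c' Hr').
apply: eq_Rintegral => t _;rewrite addr0.
have Cs:= Cc_slice (A 0 0 * t) Cf.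
(* The first row of [A] shifts the remaining coordinates by t b; translation invariance absorbs the
   shift. *)
rewrite (integral_Rn_translate (t *: b) Cs).
have Ct: Cc (fun y => f (row_mx ((A 0 0 * t)%:M: 'rV_1) (y + t *: b))).
 by apply: (Cc_ext _ (Cc_scale (t *: b) ltr01 Cs)) => y;rewrite scale1r.
have HA' (i j: 'I_k): (j < i)%N -> D i j = 0.
 by move=> ij;rewrite !mxE HA //= ltn_add2l.
have HD' i: 0 < D i i by rewrite !mxE.
rewrite (IH _ D Ct HA' HD');congr (_ * _).
 by apply: eq_bigr => i _;rewrite !mxE;congr (A _ _);exact: val_inj.
apply: eq_integral_Rn => y;congr f.
rewrite -[X in _ = _ *m X](@submxK R 1 k 1 k A) (@mul_row_block R 1 1 k 1 k).
have -> : @dlsubmx _ 1 k 1 k A = 0.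
 by apply/matrixP => i j;rewrite !mxE HA //= (ord1 j).
rewrite mulmx0 addr0 mul_scalar_mx mul_scalar_mx [_ + y *m _]addrC.
apply: (congr2 (@row_mx R 1 1 k)) => //.
apply/rowP => i;rewrite (ord1 i) !mxE eqxx mulr1n mulrC;congr (_ * A _ _);exact: val_inj.
Qed.

End IntegralRn.

(** * Refinable weights and the bisection argument *)

Section Bisection.
Context {R: realType} {k: nat}.

(** The hat function max(1 - |s|, 0), written as t + |t| with t = (1 - |s|)/2. *)
Definition tent (s: R): R:= (1 - `|s|) / 2 + `|(1 - `|s|) / 2|.

Lemma tent_ge0 s: 0 <= tent s.
by rewrite /tent addrC -[X in _ + X]opprK subr_ge0 ler_normr lexx orbT. Qed.

Lemma tentE s: tent s = if `|s| <= 1 then 1 - `|s| else 0.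
rewrite /tent;case: leP => H.
 by rewrite [X in _ + X]ger0_norm;lra.
by rewrite [X in _ + X]ltr0_norm;lra.
Qed.

Lemma tent_le1 s: tent s <= 1.
by rewrite tentE;have:= normr_ge0 s;case: ifP;lra. Qed.

Lemma tent0 s: 1 <= `|s| -> tent s = 0.
by rewrite tentE;case: ifP;lra. Qed.

Lemma tent_lip s t: `|tent s - tent t| <= `|s - t|.
have:= ler_dist_dist s t;rewrite !tentE.
by case: ifPn => Hs;case: ifPn => Ht;rewrite !ler_norml => /andP[H1 H2];apply/andP;lra.
Qed.

(** The mask (1/2, 1, 1/2), with shifts -1, 0, 1, of the two-scale relation of the hat function: the
    linear B-spline refines into three half-size copies of itself. *)
Definition tent_wt (e: 'I_3): R:= if e == 1 :> nat then 1 else 2^-1.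
Definition tent_shift (e: 'I_3): R:= e%:R - 1.

Lemma tent_pos s: 0 <= s <= 1 -> tent s = 1 - s.
by move=> /andP[s0 s1];rewrite tentE ger0_norm // s1. Qed.

Lemma tentN s: tent (- s) = tent s.
by rewrite /tent normrN. Qed.

Lemma tent_refine s: tent s = \sum_(e: 'I_3) tent_wt e * tent (2 * s - tent_shift e).
rewrite !big_ord_recl big_ord0 /tent_wt /tent_shift /=.
rewrite (_: 2 * s - (0 - 1) = 2 * s + 1);last by ring.
rewrite (_: 2 * s - (1 - 1) = 2 * s);last by ring.
rewrite (_: 2 * s - (2%:R - 1) = 2 * s - 1);last by ring.
wlog s0: s / 0 <= s.
 move=> H;have [|s0]:= leP 0 s;first exact: H.
 have:= H (- s);rewrite oppr_ge0 (ltW s0) tentN => /(_ isT) ->.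
 rewrite (_: 2 * - s + 1 = - (2 * s - 1));last by ring.
 rewrite (_: 2 * - s - 1 = - (2 * s + 1));last by ring.
 by rewrite mulrN !tentN;ring.
rewrite [tent (2 * s + 1)]tent0;last by rewrite ger0_norm;lra.
have [s1|s1]:= leP 1 s.
 by rewrite !tent0;[ring|rewrite ger0_norm;lra..].
rewrite (tent_pos (s:= s));last by apply/andP;lra.
have [s2|s2]:= leP 1 (2 * s).
 rewrite (tent0 (s:= 2 * s));last by rewrite ger0_norm;lra.
 by rewrite tent_pos;[lra|apply/andP;lra].
rewrite (tent_pos (s:= 2 * s));last by apply/andP;lra.
rewrite -(tentN (2 * s - 1)) tent_pos;first by lra.
by apply/andP;lra.
Qed.

Definition btent (x: 'rV[R]_k): R:= \prod_i tent (x 0 i).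

Lemma prod_itv01 (I: Type) (r: seq I) (a: I -> R): (forall i, 0 <= a i <= 1) ->
 0 <= \prod_(i <- r) a i <= 1.
move=> H;elim/big_ind: _ => //;first by rewrite ler01 lexx.
by move=> x y /andP[x0 x1] /andP[y0 y1];rewrite mulr_ge0 // mulr_ile1.
Qed.

Lemma btent_ge0 x: 0 <= btent x.
by apply: prodr_ge0 => i _;exact: tent_ge0. Qed.

Lemma btent_le1 x: btent x <= 1.
by have /andP[]:= @prod_itv01 _ (index_enum 'I_k) _ (fun i => introT andP (conj (tent_ge0 (x 0 i)) (tent_le1 (x 0 i)))).
Qed.

Lemma btent0 x: 1 <= `|x| -> btent x = 0.
move=> x1;have [H|/existsNP[i /negP]]:= pselect (forall i, `|x 0 i| < 1).
 suff: `|x| < 1 by lra.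
 by apply: mx_norm_lt => // i j;rewrite (ord1 i).
by rewrite -leNgt => H;rewrite /btent (bigD1 i) //= tent0 ?mul0r.
Qed.

Lemma prod_lip (I: finType) (a b: I -> R): (forall i, 0 <= a i <= 1) ->
 (forall i, 0 <= b i <= 1) ->
 `|\prod_i a i - \prod_i b i| <= \sum_i `|a i - b i|.
move=> Ha Hb;elim: (index_enum I) => [|i s IH].
 by rewrite !big_nil subrr normr0.
rewrite !big_cons.
set A:= \prod_(j <- s) a j;set B:= \prod_(j <- s) b j.
have B1: 0 <= B <= 1 by exact: prod_itv01.
have -> : a i * A - b i * B = a i * (A - B) + (a i - b i) * B by ring.
apply: le_trans (ler_normD _ _) _;rewrite addrC lerD // normrM.
 by rewrite ler_piMr // ger0_norm;case/andP: B1.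
by apply: le_trans IH;rewrite ler_piMl // ger0_norm;have /andP[]:= Ha i.
Qed.

Lemma btent_lip x y: `|btent x - btent y| <= k%:R * `|x - y|.
apply: le_trans (prod_lip _ _) _.
- by move=> i;rewrite tent_ge0 tent_le1.
- by move=> i;rewrite tent_ge0 tent_le1.
apply: (@le_trans _ _ (\sum_(i < k) `|x - y|)).
 apply: ler_sum => i _;apply: le_trans (tent_lip _ _) _.
 by have:= mx_norm_ge (x - y) 0 i;rewrite !mxE.
by rewrite sumr_const card_ord mulr_natl.
Qed.

Lemma btent_continuous: continuous btent.
move=> x;apply/(@cvgrPdist_le _ _ _ (nbhs x)) => e e0.
have n0: 0 < k%:R + 1 :> R by rewrite ltr_wpDl.
apply/nbhs_ballP;exists (e / (k%:R + 1));first by rewrite /= divr_gt0.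
move=> y;rewrite -ball_normE /ball_ /= ltr_pdivlMr // => /ltW xy.
apply: le_trans (btent_lip _ _) _;apply: le_trans xy.
by rewrite mulrC ler_wpM2l // lerDl.
Qed.

Lemma btent_refine x: btent x = \sum_(e: {ffun 'I_k -> 'I_3})
 (\prod_i tent_wt (e i)) * btent (2 *: x - \row_i tent_shift (e i)).
rewrite /btent (eq_bigr _ (fun i _ => tent_refine (x 0 i))) bigA_distr_bigA /=.
apply: eq_bigr => e _;rewrite -big_split /=;apply: eq_bigr => i _.
by rewrite !mxE.
Qed.

Lemma tent_wt_sum: \sum_(e: {ffun 'I_k -> 'I_3}) \prod_i tent_wt (e i) = 2 ^+ k.
rewrite -(bigA_distr_bigA (fun i: 'I_k => tent_wt)) /=.
rewrite (eq_bigr (fun=> 2)) ?prodr_const ?card_ord // => i _.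
by rewrite !big_ord_recl big_ord0 /tent_wt /=;lra.
Qed.

Lemma tent_wt_ge0 (e: {ffun 'I_k -> 'I_3}): 0 <= \prod_i tent_wt (e i).
by apply: prodr_ge0 => i _;rewrite /tent_wt;case: ifP. Qed.

Lemma norm_tent_shift (e: {ffun 'I_k -> 'I_3}): `|\row_i tent_shift (e i)| <= 1.
apply: mx_norm_le => // i j;rewrite !mxE /tent_shift.
by case: (e j) => -[|[|[|//]]] H /=;rewrite ler_norml;lra.
Qed.

Lemma tent_box_split (c: 'rV[R]_k) (d: R): d != 0 -> forall x,
 btent (d^-1 *: (x - c)) = \sum_(e: {ffun 'I_k -> 'I_3})
 (\prod_i tent_wt (e i)) *
  btent ((d / 2)^-1 *: (x - (c + (d / 2) *: \row_i tent_shift (e i)))).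
move=> d0 x;rewrite btent_refine;apply: eq_bigr => e _;congr (_ * btent _).
by apply/rowP => i;rewrite !mxE;field.
Qed.

(* Goursat's bisection argument, with the overlapping cubes |x - c| <= d
   carrying the refinable weights [btent]. *)
Lemma bisection (E: 'rV[R]_k -> R -> R) :
 (forall c d, 0 < d -> E c d = \sum_(e: {ffun 'I_k -> 'I_3})
   (\prod_i tent_wt (e i)) * E (c + (d / 2) *: \row_i tent_shift (e i)) (d / 2)) ->
 (forall x0 (eta: R), 0 < eta -> exists2 d0: R, 0 < d0 & forall c d,
   0 < d -> d < d0 -> `|c - x0| <= d -> `|E c d| <= eta * d ^+ k) ->
 forall c d, 0 < d -> E c d = 0.
move=> HE Hloc c d d0;apply: contrapT => /eqP E0.
pose eta:= `|E c d| / (2 * d ^+ k).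
have dk (a: R): 0 < a -> 0 < a ^+ k by move=> ?;rewrite exprn_gt0.
have eta0: 0 < eta by rewrite divr_gt0 ?normr_gt0 // mulr_gt0 // dk.
have step (c': 'rV[R]_k) (a: R): 0 < a -> eta * a ^+ k < `|E c' a| ->
  (* The weights of the refinement sum to 2^k while (a/2)^k = a^k / 2^k. If every half-size cube
     satisfied the bound, so would the large one; hence a bad cube contains a bad cube. *)
  exists2 c'': 'rV[R]_k, `|c'' - c'| <= a / 2 & eta * (a / 2) ^+ k < `|E c'' (a / 2)|.
 move=> a0 H;apply: contrapT => /forall2NP N.
 suff: `|E c' a| <= eta * a ^+ k by lra.
 rewrite HE //;apply: le_trans (ler_norm_sum _ _ _) _.
 apply: (@le_trans _ _ (\sum_(e: {ffun 'I_k -> 'I_3})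
   (\prod_i tent_wt (e i)) * (eta * (a / 2) ^+ k))).
  apply: ler_sum => e _;rewrite normrM ger0_norm ?tent_wt_ge0 //.
  apply: ler_wpM2l;first exact: tent_wt_ge0.
  have []:= N (c' + (a / 2) *: \row_i tent_shift (e i)).
   move=> [];rewrite addrC addKr normrZ ger0_norm ?divr_ge0 ?(ltW a0) //.
   by rewrite ler_piMr ?norm_tent_shift // divr_ge0 // ltW.
  by move/negP;rewrite -leNgt.
 by rewrite -mulr_suml tent_wt_sum mulrCA -exprMn [2 * _]mulrC divfK.
have E1: eta * d ^+ k < `|E c d|.
 rewrite /eta invfM mulrA mulfVK ?gt_eqF ?dk //.
 by have:= E0;rewrite -normr_gt0;lra.
pose S (s: 'rV[R]_k * R) (s': 'rV[R]_k * R) :=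
 [/\ s'.2 = s.2 / 2, `|s'.1 - s.1| <= s.2 / 2 &
   eta * s'.2 ^+ k < `|E s'.1 s'.2|].
pose Q (s: 'rV[R]_k * R):= 0 < s.2 /\ eta * s.2 ^+ k < `|E s.1 s.2|.
have /choice[nxt Hn]: forall s, exists s', Q s -> S s s'.
 move=> s.
 have [Qs|nQ]:= pselect (Q s);last by exists s.
 have [c'' H1 H2]:= step s.1 s.2 Qs.1 Qs.2.
 by exists (c'', s.2 / 2).
pose s n:= iter n nxt (c, d).
have Qs n: Q (s n).
 elim: n => [|n [IH1 IH2]];first by split.
 have [H1 H2 H3]:= Hn _ (conj IH1 IH2).
 by split=> //;rewrite /= H1 divr_gt0.
have Ss n: S (s n) (s n.+1) by exact: Hn.
have dn n: (s n).2 = d / 2 ^+ n.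
 elim: n => [|n IH];first by rewrite expr0 divr1.
 by have [-> _ _]:= Ss n;rewrite IH exprSr invfM mulrA.
have near0 m n: `|(s (n + m)%N).1 - (s n).1| <= (s n).2 - (s (n + m)%N).2.
 elim: m => [|m IH];first by rewrite addn0 !subrr normr0.
 have [H1 H2 _]:= Ss (n + m)%N;rewrite addnS H1.
 have:= ler_normD ((s (n + m).+1).1 - (s (n + m)%N).1) ((s (n + m)%N).1 - (s n).1).
 by rewrite subrKA;lra.
have near m n i: (s m).1 0 i - (s m).2 <= (s n).1 0 i + (s n).2.
 have [mn|nm]:= leqP m n.
  have:= near0 (n - m)%N m;rewrite subnKC // => H.
  have:= mx_norm_ge ((s n).1 - (s m).1) 0 i;rewrite !mxE ler_norml => /andP[].
  by have [? _]:= Qs n;lra.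
 have:= near0 (m - n)%N n;rewrite subnKC ?(ltnW nm) // => H.
 have:= mx_norm_ge ((s m).1 - (s n).1) 0 i;rewrite !mxE ler_norml => /andP[].
 by have [? _]:= Qs m;lra.
(* The bad cubes shrink to a point, whose coordinates are the suprema of the lower ends of the
   projected cubes. The local estimate at this point is then contradicted by a small enough cube. *)
pose x0: 'rV[R]_k:= \row_i sup [set (s m).1 0 i - (s m).2 | m in [set: nat]].
have ub i: has_ubound [set (s m).1 0 i - (s m).2 | m in [set: nat]].
 by exists ((s 0).1 0 i + (s 0).2) => _ [m _ <-];exact: near.
have xn n: `|(s n).1 - x0| <= (s n).2.
 apply: mx_norm_le => [|a i];first by have [/ltW]:= Qs n.
 rewrite (ord1 a) !mxE ler_norml.
 have H1: (s n).1 0 i - (s n).2 <= sup [set (s m).1 0 i - (s m).2 | m in [set: nat]].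
  by apply: ub_le_sup;[exact: ub|exists n].
 have H2: sup [set (s m).1 0 i - (s m).2 | m in [set: nat]] <= (s n).1 0 i + (s n).2.
  by apply: ge_sup;[exists ((s 0).1 0 i - (s 0).2);exists 0%N|move=> _ [m _ <-];exact: near].
 by apply/andP;lra.
have [d1 d10 H1]:= Hloc x0 _ eta0.
have [n Hnn]: exists n, d / 2 ^+ n < d1.
 exists (Num.bound (d / d1)).
 rewrite ltr_pdivrMr ?exprn_gt0 // mulrC -ltr_pdivrMr //;exact: upper_nthrootP.
have:= H1 (s n).1 (s n).2 (Qs n).1;rewrite dn => /(_ Hnn).
by have [_]:= Qs n;have:= xn n;rewrite dn => ? ? /(_ _);lra.
Qed.

End Bisection.

(** * Linear changes of variables *)

Section LinearChange.
Context {R: realType}.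

Lemma Cc_btent k (c: 'rV[R]_k) (d: R): 0 < d ->
 Cc (fun x => btent (d^-1 *: (x - c))).
move=> d0;split.
 have E: (fun x => btent (d^-1 *: (x - c))) = fun x => btent ((x - c) *m (d^-1)%:M).
  by apply/funext => x;rewrite mul_mx_scalar.
 rewrite E;apply: cont_comp;last exact: btent_continuous.
 by apply: cont_mulmx;apply: contB;[exact: cont_id|exact: cont_cst].
exists (d + `|c|);first by rewrite ltr_pwDl.
move=> x xd;apply: btent0;rewrite normrZ gtr0_norm ?invr_gt0 //.
rewrite ler_pdivlMl // mulr1 -(lerD2r `|c|);apply: le_trans xd _.
by rewrite -{1}(subrK c x) ler_normD.
Qed.

Lemma integral_btent_scale k (A: 'M[R]_k) (c: 'rV[R]_k) (d: R): 0 < d ->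
 A \in unitmx ->
 integral_Rn (fun x => btent (d^-1 *: (x *m A - c))) =
 d ^+ k * integral_Rn (fun x => btent (x *m A)).
move=> d0 uA;rewrite (integral_Rn_scale (c *m invmx A) d0);last first.
 by apply: (Cc_ext _ (Cc_affine 0 uA (Cc_btent c d0))) => x;rewrite addr0.
congr (_ * _);apply: eq_integral_Rn => x;congr btent.
rewrite mulmxDl mulmxKV // addrK -scalemxAl scalerA mulVf ?scale1r //.
exact: lt0r_neq0.
Qed.

Lemma Cc_btent1 k: Cc (@btent R k).
by apply: (Cc_ext _ (Cc_btent 0 ltr01)) => x;rewrite invr1 scale1r subr0.
Qed.

Lemma integral_btent_gt0 k: 0 < integral_Rn (@btent R k).
elim: k => [|k IH];first by rewrite /= /btent big_ord0.
have E t: integral_Rn (fun y: 'rV[R]_k => btent (scons t y)) =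
  tent t * integral_Rn (@btent R k).
 rewrite -integral_RnZ;last exact: Cc_btent1.
 apply: eq_integral_Rn => y;rewrite /btent (big_ord_recl k);congr (tent _ * _).
  rewrite (_: ord0 = @lshift 1 k 0);last exact: val_inj.
  by rewrite (@row_mxEl R 1 1 k) mxE eqxx mulr1n.
 apply: eq_bigr => i _;congr tent.
 rewrite (_: lift ord0 i = @rshift 1 k i);last exact: val_inj.
 by rewrite (@row_mxEr R 1 1 k).
rewrite integral_RnS (_: (fun t => _) = fun t => tent t * integral_Rn (@btent R k));
 last by apply/funext => t;exact: E.
have ct: continuous (fun t: R => tent t).
 move=> t;apply/(@cvgrPdist_le _ _ _ (nbhs t)) => e e0.
 apply/nbhs_ballP;exists e => //= s;rewrite -ball_normE /ball_ /= => /ltW st.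
 exact: le_trans (tent_lip _ _) st.
have I1: (@lebesgue_measure R).-integrable setT (EFin \o (fun t: R => tent t)).
 by apply: (@integrable_Cc1 _ _ 1 ct) => t;exact: tent0.
have -> : \int[@lebesgue_measure R]_t (tent t * integral_Rn (@btent R k)) =
  integral_Rn (@btent R k) * \int[@lebesgue_measure R]_t tent t.
 rewrite -RintegralZl //;apply: eq_Rintegral => t _;exact: mulrC.
apply: mulr_gt0 => //.
apply: (@lt_le_trans _ _ (\int[@lebesgue_measure R]_(t in `[0, 2^-1]) (2^-1))).
 have -> : \int[@lebesgue_measure R]_(t in `[0, 2^-1]) (2^-1) = 2^-1 * 2^-1 :> R.
  rewrite Rintegral_cst;last exact: measurable_itv.
  congr (_ * _);rewrite -[RHS]/(fine (2^-1)%:E);congr fine.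
  have:= @lebesgue_measure_itv R `[0, 2^-1];rewrite /= lte_fin invr_gt0 ltr0n => ->.
  by rewrite oppr0 adde0.
 lra.
rewrite Rintegral_mkcond;apply: le_Rintegral => //.
 have [H _]:= @integrable_mkcond _ _ R (@lebesgue_measure R) `[0, 2^-1]%classic
  (EFin \o (fun=> 2^-1: R)) (measurable_itv _).
 have H1: (@lebesgue_measure R).-integrable `[0, 2^-1] (EFin \o (fun=> 2^-1: R)).
  apply: continuous_compact_integrable;first exact: segment_compact.
  by apply: continuous_subspaceT => t;exact: cst_continuous.
 apply: eq_integrable (H H1) => // t _.
 by rewrite /= /patch;case: ifP.
move=> t _;rewrite /restrict /=;case: ifPn => [|_];last exact: tent_ge0.
rewrite inE /= in_itv /= => /andP[t0 t1];rewrite tent_pos;first by lra.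
by apply/andP;lra.
Qed.

Lemma btent_weight_dist k (x: 'rV[R]_k) (d: R): 0 < d ->
 `|1 - btent (d^-1 *: (x - 0))| <= k%:R * `|x| / d.
move=> d0;have E: 1 = @btent R k 0.
 by rewrite /btent big1 // => i _;rewrite mxE tent_pos ?subr0 // lexx ler01.
rewrite {1}E;apply: le_trans (btent_lip _ _) _;rewrite subr0 sub0r normrN normrZ.
by rewrite gtr0_norm ?invr_gt0 // mulrA mulrAC.
Qed.

Lemma eq0_of_le_div (a C: R): (forall d, 0 < d -> `|a| <= C / d) -> a = 0.
move=> H;apply/eqP;rewrite -normr_le0 leNgt;apply/negP => a0.
have C0: 0 <= C by have:= H 1 ltr01;rewrite divr1 => /(lt_le_trans a0) /ltW.
have D0: 0 < 2 * (C + 1) / `|a| by rewrite divr_gt0 // mulr_gt0 // ltr_wpDl.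
have:= H _ D0;rewrite invfM invrK mulrA mulrAC -[X in X <= _]mulr1.
rewrite invfM => H1.
have: `|a| * 1 <= `|a| * (C / (2 * (C + 1))) by move: H1;rewrite mulrC;congr (_ <= _);
 rewrite ?invfM;ring.
rewrite ler_pM2l // ler_pdivlMr ?mulr_gt0 ?ltr_wpDl // mul1r;lra.
Qed.

Lemma integral_weight_dist k (f w: 'rV[R]_k -> R) (e: R): Cc f ->
 Cc (fun x => f x * w x) -> (forall x, f x != 0 -> `|1 - w x| <= e) -> 
 `|integral_Rn f - integral_Rn (fun x => f x * w x)| <=
  e * integral_Rn (fun x => `|f x|).
move=> Cf Cw H;rewrite -integral_RnB // -integral_RnZ;last exact: Cc_norm.
apply: integral_Rn_norm_le;[exact: CcB|by apply: CcZ;exact: Cc_norm|move=> x].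
have [->|fx]:= eqVneq (f x) 0;first by rewrite mul0r subrr normr0 mulr0.
by rewrite -{1}(mulr1 (f x)) -mulrBr normrM mulrC ler_wpM2r // H.
Qed.

Lemma integral_dist k (F G: 'rV[R]_k -> R) (c om: R): Cc F -> Cc G ->
 (forall x, `|F x - c * G x| <= om * G x) ->
 `|integral_Rn F - c * integral_Rn G| <= om * integral_Rn G.
move=> CF CG H;rewrite -integral_RnZ // -integral_RnB //;last exact: CcZ.
by rewrite -integral_RnZ //;apply: integral_Rn_norm_le => //;[apply: CcB => //;exact: CcZ|exact: CcZ].
Qed.

(** The integral of g(x A) is proportional to that of [g], with a factor not depending on [g].
    Bisection is applied to the defect [E c d] of the proportionality localized by a weight: on a
    small cube [g] is almost constant and both terms reduce to the same multiple of [LA]. The factor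
    is identified later. *)
Lemma integral_linear_cst k (A: 'M[R]_k) (g: 'rV[R]_k -> R): A \in unitmx -> Cc g ->
 integral_Rn (fun x => g (x *m A)) =
 integral_Rn (fun x => btent (x *m A)) / integral_Rn (@btent R k) * integral_Rn g.
move=> uA Cg;have [cg [r r0 Hg]]:= Cg.
have CA f: Cc f -> Cc (fun x => f (x *m A)).
 by move=> Cf;apply: (Cc_ext _ (Cc_affine 0 uA Cf)) => x;rewrite addr0.
set LA:= integral_Rn (fun x => btent (x *m A));set L:= integral_Rn (@btent R k).
have L0: 0 < L by exact: integral_btent_gt0.
have LA0: 0 <= LA.
 by apply: integral_Rn_ge0;[apply: CA;exact: Cc_btent1|move=> x;exact: btent_ge0].
pose b (c: 'rV[R]_k) (d: R) x:= btent (d^-1 *: (x - c)).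
have Cb c d: 0 < d -> Cc (b c d) by exact: Cc_btent.
have Cgb c d: 0 < d -> Cc (fun x => g x * b c d x).
 by move=> d0;apply: CcM => //;have []:= Cb c d d0.
pose E c d:= integral_Rn (fun x => g (x *m A) * b c d (x *m A)) -
 LA / L * integral_Rn (fun x => g x * b c d x).
have E0 c d: 0 < d -> E c d = 0.
 apply: (bisection (E:= E)) => {c d} [c d d0|x0 eta eta0].
  have d20: 0 < d / 2 by rewrite divr_gt0.
  have S x: g x * b c d x = \sum_(e: {ffun 'I_k -> 'I_3})
    (\prod_i tent_wt (e i)) * (g x * b (c + (d / 2) *: \row_i tent_shift (e i)) (d / 2) x).
   rewrite /b (tent_box_split _ (lt0r_neq0 d0)) mulr_sumr;apply: eq_bigr => e _.
   by rewrite mulrCA.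
  rewrite /E (eq_integral_Rn (fun x => S x)) (eq_integral_Rn (fun x => S (x *m A))).
  rewrite !integral_Rn_sum;last 2 first.
  - by move=> e;apply: CcZ;exact: Cgb.
  - move=> e;apply: CcZ.
   exact: (CA (fun x => g x * b (c + (d / 2) *: \row_i tent_shift (e i)) (d / 2) x) (Cgb _ _ d20)).
  rewrite mulr_sumr -sumrB;apply: eq_bigr => e _.
  rewrite !integral_RnZ;[by ring|exact: Cgb|].
  exact: (CA (fun x => g x * b (c + (d / 2) *: \row_i tent_shift (e i)) (d / 2) x) (Cgb _ _ d20)).
 pose om:= eta / (2 * LA + 1).
 have om0: 0 < om by rewrite divr_gt0 // ltr_wpDl // mulr_ge0.
 have /(@cvgrPdist_le _ _ _ (nbhs x0)) /(_ om om0) /nbhs_ballP[rho /= rho0 Hrho]:= cg x0.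
 exists (rho / 2);first by rewrite divr_gt0.
 move=> c d d0 drho cx0.
 have P x: `|g x * b c d x - g x0 * b c d x| <= om * b c d x.
  rewrite -mulrBl normrM [`|b c d x|]ger0_norm ?btent_ge0 //.
  have [bx|bx]:= ltP (`|d^-1 *: (x - c)|) 1;last by rewrite /b btent0 // !mulr0.
  rewrite ler_wpM2r ?btent_ge0 // distrC;apply: Hrho.
  rewrite -ball_normE /ball_ /=.
  move: bx;rewrite normrZ gtr0_norm ?invr_gt0 // ltr_pdivrMl // mulr1 => bx.
  have:= ler_distD c x0 x;rewrite [`|x0 - c|]distrC [`|c - x|]distrC;lra.
 have I1: integral_Rn (b c d) = d ^+ k * L.
  rewrite (eq_integral_Rn (g:= fun x => btent (d^-1 *: (x *m 1%:M - c)))).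
   rewrite integral_btent_scale ?unitmx1 //;congr (_ * _).
   by apply: eq_integral_Rn => x;rewrite mulmx1.
  by move=> x;rewrite mulmx1.
 have I2: integral_Rn (fun x => b c d (x *m A)) = d ^+ k * LA.
  exact: integral_btent_scale.
 have B1: `|integral_Rn (fun x => g x * b c d x) - g x0 * (d ^+ k * L)| <= om * (d ^+ k * L).
  by rewrite -I1;apply: integral_dist => //;[exact: Cgb|exact: Cb].
 have B2: `|integral_Rn (fun x => g (x *m A) * b c d (x *m A)) - g x0 * (d ^+ k * LA)|
   <= om * (d ^+ k * LA).
  have Cx:= CA _ (Cgb c d d0);have Cy:= CA _ (Cb c d d0).
  by rewrite -I2;apply: integral_dist.
 rewrite /E.
 have B3: `|LA / L * integral_Rn (fun x => g x * b c d x) - g x0 * (d ^+ k * LA)|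
   <= om * (d ^+ k * LA).
  have -> : g x0 * (d ^+ k * LA) = LA / L * (g x0 * (d ^+ k * L)).
   by field;exact: lt0r_neq0.
  rewrite -mulrBr normrM ger0_norm ?divr_ge0 ?(ltW L0) //.
  have -> : om * (d ^+ k * LA) = LA / L * (om * (d ^+ k * L)).
   by field;rewrite !lt0r_neq0 // ltr_wpDl // mulr_ge0.
  by rewrite ler_wpM2l // divr_ge0 // ltW.
 rewrite distrC in B3.
 apply: le_trans (ler_distD (g x0 * (d ^+ k * LA)) _ _) _.
 apply: le_trans (lerD B2 B3) _.
 have -> : om * (d ^+ k * LA) + om * (d ^+ k * LA) = om * (2 * LA) * d ^+ k by ring.
 rewrite ler_wpM2r ?exprn_ge0 ?(ltW d0) //.
 by rewrite /om mulrAC ler_pdivrMr ?ler_wpM2l ?(ltW eta0) ?lerDl // ltr_wpDl // mulr_ge0.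
apply/eqP;rewrite -subr_eq0;apply/eqP.
(* It remains to remove the weight: on the support of [g] the weight of the cube of size d around 0
   differs from 1 by O(1/d), and d is arbitrary. *)
pose N1:= integral_Rn (fun x => `|g (x *m A)|).
pose N2:= LA / L * integral_Rn (fun x => `|g x|).
apply: (@eq0_of_le_div _ (k%:R * r * (N1 + N2))) => d d0.
have W x: g x != 0 -> `|1 - b 0 d x| <= k%:R * r / d.
 move=> gx;apply: le_trans (btent_weight_dist _ d0) _.
 rewrite ler_wpM2r ?invr_ge0 ?(ltW d0) // ler_wpM2l //.
 by rewrite leNgt;apply/negP => /ltW /Hg /eqP;rewrite (negPf gx).
have H1:= integral_weight_dist Cg (Cgb 0 d d0) W.
have H2:= integral_weight_dist (CA _ Cg) (CA _ (Cgb 0 d d0)) (fun x => W (x *m A)).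
have H3:= E0 0 d d0.
rewrite -/LA -/L;set G1:= integral_Rn (fun x => g (x *m A));set G2:= integral_Rn g.
have -> : G1 - LA / L * G2 =
 (G1 - integral_Rn (fun x => g (x *m A) * b 0 d (x *m A))) -
 LA / L * (G2 - integral_Rn (fun x => g x * b 0 d x)) + E 0 d.
 by rewrite /E;ring.
rewrite H3 addr0;apply: le_trans (ler_normB _ _) _.
rewrite normrM (ger0_norm (_: 0 <= LA / L));last by rewrite divr_ge0 // ltW.
have LL: 0 <= LA / L by rewrite divr_ge0 // ltW.
apply: le_trans (lerD H2 (ler_wpM2l LL H1)) _.
by rewrite le_eqVlt;apply/orP;left;apply/eqP;rewrite -/N1 /N2;ring.
Qed.

Lemma integral_Rn_gt0 k (f: 'rV[R]_k -> R) x0: Cc f -> (forall x, 0 <= f x) ->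
 0 < f x0 -> 0 < integral_Rn f.
move=> Cf f0 fx0;have [cf _]:= Cf.
have f20: 0 < f x0 / 2 by rewrite divr_gt0.
have /(@cvgrPdist_le _ _ _ (nbhs x0)) /(_ _ f20) /nbhs_ballP[r /= r0 Hr]:= cf x0.
have Cb:= Cc_btent x0 r0.
apply: (@lt_le_trans _ _ (integral_Rn (fun x => f x0 / 2 * btent (r^-1 *: (x - x0))))).
 rewrite integral_RnZ // mulr_gt0 //.
 rewrite (eq_integral_Rn (g:= fun x => btent (r^-1 *: (x *m 1%:M - x0))));last first.
  by move=> x;rewrite mulmx1.
 rewrite integral_btent_scale ?unitmx1 // mulr_gt0 ?exprn_gt0 //.
 rewrite (eq_integral_Rn (g:= @btent R k));first exact: integral_btent_gt0.
 by move=> x;rewrite mulmx1.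
apply: le_integral_Rn => //;first exact: CcZ.
move=> x;have [H|H]:= ltP `|r^-1 *: (x - x0)| 1;last by rewrite btent0 // mulr0.
have bx: ball x0 r x.
 rewrite -ball_normE /ball_ /= distrC.
 by move: H;rewrite normrZ gtr0_norm ?invr_gt0 // ltr_pdivrMl // mulr1.
apply: (@le_trans _ _ (f x0 / 2)).
 by rewrite ler_piMr ?btent_le1 // ltW.
by have:= Hr _ bx;rewrite /= ler_norml => /andP[];lra.
Qed.

Definition lin_cst k (A: 'M[R]_k): R :=
 integral_Rn (fun x => btent (x *m A)) / integral_Rn (@btent R k).

Lemma lin_cstP k (A: 'M[R]_k) g: A \in unitmx -> Cc g ->
 integral_Rn (fun x => g (x *m A)) = lin_cst A * integral_Rn g.
by move=> uA Cg;rewrite integral_linear_cst. Qed.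

Lemma Cc_mulmx k (A: 'M[R]_k) g: A \in unitmx -> Cc g -> Cc (fun x => g (x *m A)).
by move=> uA Cg;apply: (Cc_ext _ (Cc_affine 0 uA Cg)) => x;rewrite addr0.
Qed.

Lemma lin_cst_uniq k (A: 'M[R]_k) c: A \in unitmx ->
 (forall g, Cc g -> integral_Rn (fun x => g (x *m A)) = c * integral_Rn g) ->
 lin_cst A = c.
by move=> uA H;rewrite /lin_cst H ?mulfK ?gt_eqF ?integral_btent_gt0 //;exact: Cc_btent1.
Qed.

Lemma lin_cstM k (A B: 'M[R]_k): A \in unitmx -> B \in unitmx ->
 lin_cst (A *m B) = lin_cst A * lin_cst B.
move=> uA uB;apply: lin_cst_uniq;first by rewrite unitmx_mul uA.
move=> g Cg;rewrite -mulrA -lin_cstP // -(lin_cstP uA (Cc_mulmx uB Cg)).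
by apply: eq_integral_Rn => x;rewrite mulmxA.
Qed.

Lemma lin_cst1 k: lin_cst (1%:M: 'M[R]_k) = 1.
apply: lin_cst_uniq;first exact: unitmx1.
by move=> g _;rewrite mul1r;apply: eq_integral_Rn => x;rewrite mulmx1.
Qed.

Lemma lin_cst_gt0 k (A: 'M[R]_k): A \in unitmx -> 0 < lin_cst A.
move=> uA;have I0:= integral_btent_gt0 k.
have C: Cc (fun x => btent (x *m A)) by apply: Cc_mulmx => //;exact: Cc_btent1.
rewrite divr_gt0 //;apply: (integral_Rn_gt0 (x0:= 0) C) => [x|];first exact: btent_ge0.
by rewrite mul0mx /btent prodr_gt0 // => i _;rewrite mxE tent_pos ?subr0 // lexx ler01.
Qed.

Definition lin_good k (A: 'M[R]_k): Prop :=
 A \in unitmx /\ lin_cst A = `|\det A|^-1.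

Lemma lin_good_mul k (A B: 'M[R]_k): lin_good A -> lin_good B -> lin_good (A *m B).
move=> [uA HA] [uB HB];split;first by rewrite unitmx_mul uA.
by rewrite lin_cstM // HA HB det_mulmx normrM invfM.
Qed.

Lemma lin_good_cancel k (A B: 'M[R]_k): lin_good A -> B \in unitmx ->
 lin_good (A *m B) -> lin_good B.
move=> [uA HA] uB [_];rewrite lin_cstM // HA det_mulmx normrM invfM => H;split=> //.
apply: (mulfI (x:= `|\det A|^-1)) => //.
by rewrite invr_neq0 // normr_eq0 -unitfE -unitmxE.
Qed.

(** For an involution both the factor and |det A| are positive with square 1. This covers diagonal
    sign matrices. *)
Lemma lin_good_sq k (A: 'M[R]_k): A *m A = 1%:M -> lin_good A.
move=> AA;have [uA _]:= mulmx1_unit AA;split=> //.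
have H1: lin_cst A ^+ 2 = 1 by rewrite expr2 -lin_cstM // AA lin_cst1.
have H2: `|\det A| ^+ 2 = 1 by rewrite expr2 -normrM -det_mulmx AA det1 normr1.
have -> : `|\det A| = 1 by apply/eqP;rewrite -(@eqrXn2 _ 2) // H2 expr1n.
by rewrite invr1;apply/eqP;rewrite -(@eqrXn2 _ 2) // ?H1 ?expr1n // ltW // lin_cst_gt0.
Qed.

Lemma lin_good_perm k (s: {perm 'I_k}): lin_good (perm_mx s: 'M[R]_k).
split;first exact: unitmx_perm.
rewrite det_perm normrX normrN1 expr1n invr1 /lin_cst.
rewrite (eq_integral_Rn (g:= @btent R k)) ?divff ?gt_eqF ?integral_btent_gt0 // => x.
rewrite /btent (reindex_inj (@perm_inj _ s)) /=;apply: eq_bigr => i _.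
have -> : perm_mx s = perm_mx (s^-1)^-1 :> 'M[R]_k by rewrite invgK.
by rewrite -col_permE mxE permK.
Qed.

Lemma lin_good_upper k (A: 'M[R]_k) :
 (forall i j: 'I_k, (j < i)%N -> A i j = 0) -> (forall i, 0 < A i i) -> lin_good A.
move=> HA HD;have uA:= upper_unit HA HD;split=> //.
have -> : \det A = \prod_i A i i.
 rewrite -det_tr det_trig;first by apply: eq_bigr => i _;rewrite mxE.
 by apply/is_trig_mxP => i j ij;rewrite mxE HA.
have P0: 0 < \prod_i A i i by apply: prodr_gt0.
rewrite gtr0_norm //;apply: lin_cst_uniq => // g Cg.
by rewrite (integral_Rn_upper Cg HA HD) mulrA mulVf ?mul1r // gt_eqF.
Qed.

(** An LUP decomposition reduces to three kinds of matrices: permutations, which preserve the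
    symmetric weight [btent]; upper triangular matrices with positive diagonal, treated by iterated
    substitution; and sign matrices. The property is multiplicative and can be cancelled, so it
    passes to [A]. *)
Lemma lin_good_unitmx k (A: 'M[R]_k): A \in unitmx -> lin_good A.
case: k A => [|k] A uA.
 by rewrite (_: A = 1%:M);[split;rewrite ?unitmx1 // lin_cst1 det1 normr1 invr1|apply/matrixP => -[]].
have:= cormen_lup_correct A;have:= cormen_lup_perm A.
have:= @cormen_lup_lower _ _ A;have:= @cormen_lup_upper _ _ A.
case: (cormen_lup A) => -[P L] U /= HU HL /is_perm_mxP[s Ps] E.
have gP: lin_good P by rewrite Ps;exact: lin_good_perm.
have gL: lin_good L.
 (* Conjugation by the permutation that reverses the order of the coordinates makes the lower
    triangular factor upper triangular. *)
 pose w: 'M[R]_k.+1:= perm_mx (perm (@rev_ord_inj k.+1)).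
 have gw: lin_good w by exact: lin_good_perm.
 have ww: w *m w = 1%:M.
  rewrite /w -perm_mxM;have -> : (perm (@rev_ord_inj k.+1) * perm (@rev_ord_inj k.+1))%g = 1%g.
   by apply/permP => i;rewrite permM !permE rev_ordK.
  exact: perm_mx1.
 have Lw i j: (w *m L *m w) i j = L (rev_ord i) (rev_ord j).
  have -> : w = perm_mx ((perm (@rev_ord_inj k.+1))^-1)^-1 by rewrite invgK.
  rewrite -col_permE invgK -row_permE !mxE permE;congr (L _ _).
  by apply: (@perm_inj _ (perm (@rev_ord_inj k.+1)));rewrite permKV permE rev_ordK.
 have gwLw: lin_good (w *m L *m w).
  apply: lin_good_upper => [i j ij|i];rewrite Lw HL ?eqxx //=.
   by rewrite (inj_eq rev_ord_inj) -val_eqE gtn_eqF.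
  by rewrite leq_sub2l // ltnW.
 have -> : L = w *m (w *m L *m w) *m w by rewrite !mulmxA ww mul1mx -mulmxA ww mulmx1.
 by apply: lin_good_mul => //;apply: lin_good_mul.
have uPA: P *m A \in unitmx by rewrite unitmx_mul gP.1.
have uU: U \in unitmx.
 by move: uPA;rewrite -[P *m A]/(P * A) E unitmx_mul gL.1.
have detU: \det U = \prod_i U i i.
 rewrite -det_tr det_trig;first by apply: eq_bigr => i _;rewrite mxE.
 by apply/is_trig_mxP => i j ij;rewrite mxE HU.
have U0 i: U i i != 0.
 move: uU;rewrite unitmxE detU unitfE => /prodf_neq0;exact.
have gU: lin_good U.
 (* Left multiplication by the diagonal matrix of signs makes the diagonal of [U] positive. *)
 pose S: 'M[R]_k.+1:= diag_mx (\row_i Num.sg (U i i)).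
 have SS: S *m S = 1%:M.
  rewrite /S mulmx_diag;apply/matrixP => i j;rewrite !mxE -expr2.
  by have [->|//]:= eqVneq i j;rewrite sqr_sg U0.
 have gS: lin_good S by exact: lin_good_sq.
 apply: (lin_good_cancel gS) => //;apply: lin_good_upper => [i j ij|i].
  by rewrite mul_diag_mx mxE HU // mulr0.
 by rewrite mul_diag_mx mxE mxE -normrEsg normr_gt0.
apply: (lin_good_cancel gP) => //;rewrite -[P *m A]/(P * A) E;exact: lin_good_mul.
Qed.

Lemma integral_Rn_linear k (A: 'M[R]_k) g: A \in unitmx -> Cc g ->
 `|\det A| * integral_Rn (fun x => g (x *m A)) = integral_Rn g.
move=> uA Cg;rewrite lin_cstP // (lin_good_unitmx uA).2 mulrA divff ?mul1r //.
by rewrite normr_eq0 -unitfE -unitmxE.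
Qed.

End LinearChange.

(** * Change of variables along a diffeomorphism of open sets *)

Section ChangeOfVariables.
#[local] Opaque jacobian.
Context {R: realType}.

(** At a point outside [V] continuity holds because [phi] vanishes there and [beta] is bounded. *)
Lemma Cc_mul_on k (V: set 'rV[R]_k) (phi beta: 'rV[R]_k -> R): open V ->
 Cc phi -> (forall x, ~ V x -> phi x = 0) -> (forall x, V x -> {for x, continuous beta}) ->
 (forall x, 0 <= beta x <= 1) -> Cc (fun x => phi x * beta x).
move=> oV [cphi [r r0 Hphi]] phi0 cb b01;split;last first.
 by exists r => // x /Hphi ->;rewrite mul0r.
move=> x;have [Vx|nVx]:= pselect (V x).
 exact: (cvgM (cphi x) (cb x Vx)).
apply/(@cvgrPdist_le _ _ _ (nbhs x)) => e e0.
have /(@cvgrPdist_le _ _ _ (nbhs x)) /(_ e e0):= cphi x.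
apply: filterS => y;rewrite phi0 // mul0r !sub0r !normrN normrM;apply: le_trans.
by rewrite ler_piMr // ger0_norm;have /andP[]:= b01 y.
Qed.

Lemma C1_point k (k': 'rV[R]_k -> 'rV[R]_k) y0: differentiable k' y0 ->
 exists2 C: R, 0 < C & \forall y \near y0, `|k' y - k' y0| <= C * `|y - y0|.
move=> dk;exists (1 + k%:R * `|'J k' y0|);first by rewrite ltr_pwDl // mulr_ge0.
have /nbhs_ballP[r /= r0 Hr]:= diff_eps dk ltr01.
apply/nbhs_ballP;exists r => //= y;rewrite -ball_normE /ball_ /= => yr.
have b: ball (0: 'rV[R]_k) r (y - y0).
 by rewrite -ball_normE /ball_ /= sub0r normrN distrC.
have:= Hr _ b;rewrite /= [y0 + _]addrC subrK mul1r diffJ // => H.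
rewrite mulrDl mul1r;have:= norm_rV_mul_le (y - y0) ('J k' y0).
have:= ler_normD (k' y - k' y0 - (y - y0) *m 'J k' y0) ((y - y0) *m 'J k' y0).
by rewrite subrK mulrC => ? ?;lra.
Qed.

Lemma mulmx1_unitmx k (A B: 'M[R]_k): A *m B = 1%:M -> A \in unitmx.
by move=> /mulmx1_unit[]. Qed.

Lemma continuous_near_le (T: topologicalType) (W: normedModType R) (f: T -> W) x c (e: R): 0 < e ->
 {for x, continuous f} -> f x = c -> \forall y \near x, `|f y - c| <= e.
move=> e0 cf <-;have /(@cvgrPdist_le _ _ _ (nbhs x)) /(_ e e0):= cf.
by apply: filterS => y;rewrite distrC.
Qed.

(** Bisection over cubes in the target. Around y0 in [W] both localized integrals are rescaled by d
    about k'(y0) and y0; there [h] is its differential up to o(d), so the linear formula applies.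
    Around a point outside [W] the function [psi] vanishes and both integrals are 0 for small
    cubes. *)
Lemma change_of_variables k (V W: set 'rV[R]_k) (h k': 'rV[R]_k -> 'rV[R]_k)
  (phi psi: 'rV[R]_k -> R): open V -> open W ->
 (forall x, V x -> W (h x) /\ k' (h x) = x) ->
 (forall y, W y -> V (k' y) /\ h (k' y) = y) ->
 (forall x, V x -> differentiable h x) ->
 (forall x, V x -> {for x, continuous (fun z => \det ('J h z))}) ->
 (forall y, W y -> differentiable k' y) ->
 Cc phi -> Cc psi -> (forall x, ~ V x -> phi x = 0) ->
 (forall x, V x -> phi x = psi (h x) * `|\det ('J h x)|) ->
 (forall y, ~ W y -> \forall z \near y, psi z = 0) ->
 integral_Rn phi = integral_Rn psi.
move=> oV oW hV kW dh cdet dk Cphi Cpsi phi0 phiE psi0.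
have [cphi [r r0 Hphi]]:= Cphi;have [cpsi [s s0 Hpsi]]:= Cpsi.
pose b (c: 'rV[R]_k) (d: R) x:= btent (d^-1 *: (x - c)).
have Cb c d: 0 < d -> Cc (b c d) by exact: Cc_btent.
have b01 c d x: 0 <= b c d x <= 1 by rewrite btent_ge0 btent_le1.
have ch x: V x -> {for x, continuous h}.
 by move=> Vx;apply: differentiable_continuous;exact: dh.
have Cpb c d: 0 < d -> Cc (fun x => psi x * b c d x).
 by move=> d0;apply: CcM => //;have []:= Cb c d d0.
have Chb c d: 0 < d -> Cc (fun x => phi x * b c d (h x)).
 move=> d0;apply: (Cc_mul_on (V:= V)) => // x Vx.
 by apply: (@continuous_comp _ _ _ h (b c d));[exact: ch|have [H _]:= Cb c d d0;exact: H].
(* The defect of the formula, localized to the cube of centre c and size d in the target and pulled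
   back by [h] on the source. *)
pose E c d:= integral_Rn (fun x => phi x * b c d (h x)) -
 integral_Rn (fun x => psi x * b c d x).
have bdist c d y y0: 0 < d -> `|c - y0| <= d -> b c d y != 0 -> `|y - y0| < 2 * d.
 move=> d0 cy by0;have: `|d^-1 *: (y - c)| < 1.
  by rewrite ltNge;apply: contra by0 => H;rewrite /b btent0.
 rewrite normrZ gtr0_norm ?invr_gt0 // ltr_pdivrMl // mulr1 => yc.
 by have:= ler_distD c y y0;lra.
have E0 c d: 0 < d -> E c d = 0.
 apply: (bisection (E:= E)) => {c d} [c d d0|y0 eta eta0].
  have d20: 0 < d / 2 by rewrite divr_gt0.
  have S (a: R) x: a * b c d x = \sum_(e: {ffun 'I_k -> 'I_3})
    (\prod_i tent_wt (e i)) * (a * b (c + (d / 2) *: \row_i tent_shift (e i)) (d / 2) x).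
   rewrite /b (tent_box_split _ (lt0r_neq0 d0)) mulr_sumr;apply: eq_bigr => e _.
   by rewrite mulrCA.
  rewrite /E (eq_integral_Rn (fun x => S (psi x) x)) (eq_integral_Rn (fun x => S (phi x) (h x))).
  rewrite !integral_Rn_sum;last 2 first.
  - by move=> e;apply: CcZ;exact: Cpb.
  - by move=> e;apply: CcZ;exact: Chb.
  rewrite -sumrB;apply: eq_bigr => e _.
  by rewrite !integral_RnZ;[ring|exact: Cpb|exact: Chb].
 have [Wy|nWy]:= pselect (W y0);last first.
  have /nbhs_ballP[rho /= rho0 Hrho]:= psi0 _ nWy.
  exists (rho / 2);first by rewrite divr_gt0.
  move=> c d d0 drho cy.
  have Z y: psi y * b c d y = 0.
   have [->|H]:= eqVneq (b c d y) 0;first by rewrite mulr0.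
   have:= bdist _ _ _ _ d0 cy H => H1.
   rewrite (Hrho y) ?mul0r // -ball_normE /ball_ /= distrC;lra.
  have Z' x: phi x * b c d (h x) = 0.
   have [Vx|nVx]:= pselect (V x);last by rewrite phi0 // mul0r.
   by rewrite phiE // mulrAC Z mul0r.
  rewrite /E (eq_integral_Rn Z) (eq_integral_Rn Z') subrr normr0.
  by rewrite mulr_ge0 ?exprn_ge0 // ltW.
 have [Vx0 hx0]:= kW _ Wy;set x0:= k' y0 in Vx0 hx0.
 pose A:= 'J h x0.
 have uA: A \in unitmx.
  apply: (@mulmx1_unitmx _ _ ('J k' y0));rewrite /A -{1}hx0.
  rewrite -J_comp ?hx0;[|exact: dh|exact: dk].
  rewrite -(J_id x0);apply: J_near;last exact: (differentiable_lin (@idfun 'rV[R]_k)).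
  have: \forall x \near x0, V x by exact: open_nbhs_nbhs.
  by apply: filterS => x /hV[].
 have [C1 C10 HC1]:= C1_point (dk _ Wy).
 have [C2 C20 HC2]:= norm_mul_invmx uA.
 pose D:= `|\det A|;pose p0:= psi y0.
 have D0: D != 0 by rewrite normr_eq0 -unitfE -unitmxE.
 (* Beyond |u| = rho both rescaled weights vanish: 2 C1 comes from the bound |k' y - x0| <= C1 |y -
    y0|, and 2 C2 from |u| <= C2 |u A|. *)
 pose rho:= 2 * C1 + 2 * C2;have rho0: 0 < rho by rewrite addr_gt0 // mulr_gt0.
 pose Ib:= integral_Rn (@btent R k);have Ib0: 0 < Ib by exact: integral_btent_gt0.
 pose IB:= integral_Rn (bump (k:= k) rho).
 have CB: Cc (bump (k:= k) rho) by exact: Cc_bump.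
 have IB0: 0 <= IB by apply: integral_Rn_ge0 => // x;exact: bump_ge0.
 (* K collects the error factors of both rescaled integrals, so that e = eta / K gives the estimate
    with eta. *)
 pose K:= (1 + `|p0 * D| * (k%:R * rho)) * IB + Ib.
 have K0: 0 < K.
  by rewrite ltr_wpDl // mulr_ge0 // addr_ge0 // mulr_ge0 // mulr_ge0 // ltW.
 pose e:= eta / K;have e0: 0 < e by rewrite divr_gt0.
 have N1: \forall y \near y0, `|k' y - x0| <= C1 * `|y - y0| by exact: HC1.
 have N2: \forall y \near y0, `|psi y - p0| <= e.
  have /(@cvgrPdist_le _ _ _ (nbhs y0)) /(_ e e0):= cpsi y0.
  by apply: filterS => y;rewrite distrC.
 have N3: \forall x \near x0, V x by exact: open_nbhs_nbhs.
 have N4: \forall x \near x0, `|psi (h x) * `|\det ('J h x)| - p0 * D| <= e.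
  have cc: {for x0, continuous (fun x => psi (h x) * `|\det ('J h x)|)}.
   have c1: {for x0, continuous (fun x => psi (h x))}.
    by apply: (@continuous_comp _ _ _ h psi);[exact: ch|exact: cpsi].
   have c2: {for x0, continuous (fun x => `|\det ('J h x)|)}.
    apply: (@continuous_comp _ _ _ (fun x => \det ('J h x)) (fun v => `|v|)).
     exact: cdet.
    exact: norm_continuous.
   exact: (cvgM c1 c2).
  have P: psi (h x0) * `|\det ('J h x0)| = p0 * D by rewrite /p0 -hx0.
  exact: (continuous_near_le e0 cc P).
 have N5: \forall u \near (0: 'rV[R]_k), `|h (x0 + u) - y0 - u *m A| <= e * `|u|.
  have:= diff_eps (dh _ Vx0) e0;apply: filterS => u.
  by rewrite hx0 diffJ //;exact: dh.
 have N12: nbhs y0 (fun y => `|k' y - x0| <= C1 * `|y - y0| /\ `|psi y - p0| <= e).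
  exact: filterI.
 have /nbhs_ballP[r1 /= r10 Hr1]:= N12.
 have N34: nbhs x0 (fun x => V x /\ `|psi (h x) * `|\det ('J h x)| - p0 * D| <= e).
  exact: filterI.
 have /nbhs_ballP[r2 /= r20 Hr2]:= N34.
 have /nbhs_ballP[r3 /= r30 Hr3]:= N5.
 pose d1:= Num.min (r1 / 4) (Num.min (r2 / (2 * rho)) (r3 / (2 * rho))).
 have d10: 0 < d1 by rewrite !lt_min !divr_gt0 // mulr_gt0.
 exists d1 => // c d d0 dd1 cy.
 have [dr1 dr2 dr3]: [/\ d < r1 / 4, d * rho < r2 & d * rho < r3].
  move: dd1;rewrite !lt_min => /andP[H1 /andP[H2 H3]];split=> //.
   move: H2;rewrite ltr_pdivlMr ?mulr_gt0 //;move: (mulr_gt0 d0 rho0);clear;lra.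
  move: H3;rewrite ltr_pdivlMr ?mulr_gt0 //;move: (mulr_gt0 d0 rho0);clear;lra.
 pose c':= d^-1 *: (c - y0).
 have c'1: `|c'| <= 1.
  by rewrite /c' normrZ gtr0_norm ?invr_gt0 // ler_pdivrMl // mulr1.
 have bE u: b c d (d *: u + y0) = btent (u - c').
  congr btent;rewrite /c';apply/rowP => i;rewrite !mxE;field;exact: lt0r_neq0.
 have Cbt: Cc (fun u: 'rV[R]_k => btent (u - c')).
  by apply: (Cc_ext _ (Cc_btent c' ltr01)) => x;rewrite invr1 scale1r.
 have CbA: Cc (fun u => btent (u *m A - c')) by exact: (Cc_mulmx uA Cbt).
 have IbtE: integral_Rn (fun u: 'rV[R]_k => btent (u - c')) = Ib.
  by rewrite /Ib (integral_Rn_translate (- c') (Cc_btent1 k)).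
 have IbAE: D * integral_Rn (fun u => btent (u *m A - c')) = Ib.
  by rewrite -IbtE -(integral_Rn_linear uA Cbt).
 have CP:= Cc_scale x0 d0 (Chb c d d0);have CQ:= Cc_scale y0 d0 (Cpb c d d0).
 rewrite /E (integral_Rn_scale x0 d0 (Chb c d d0)) (integral_Rn_scale y0 d0 (Cpb c d d0)).
 rewrite -mulrBr normrM ger0_norm ?exprn_ge0 ?(ltW d0) // mulrC ler_wpM2r ?exprn_ge0 ?(ltW d0) //.
 have Q2: `|integral_Rn (fun u => psi (d *: u + y0) * b c d (d *: u + y0)) - p0 * Ib| <= e * Ib.
  rewrite -IbtE;apply: integral_dist => // u;rewrite bE -mulrBl normrM.
  rewrite [`|btent _|]ger0_norm ?btent_ge0 //.
  have [->|H]:= eqVneq (btent (u - c')) 0;first by rewrite !mulr0.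
  rewrite ler_wpM2r ?btent_ge0 //.
  have [] // := Hr1 (d *: u + y0).
  have H': b c d (d *: u + y0) != 0 by rewrite bE.
  have:= bdist _ _ _ _ d0 cy H'.
  by move: dr1 d0;rewrite -ball_normE /ball_ /= distrC;clear;lra.
 have Q1: `|integral_Rn (fun u => phi (d *: u + x0) * b c d (h (d *: u + x0))) - p0 * Ib|
   <= e * (1 + `|p0 * D| * (k%:R * rho)) * IB.
  have -> : p0 * Ib = p0 * D * integral_Rn (fun u => btent (u *m A - c')).
   by rewrite -mulrA IbAE.
  rewrite -integral_RnZ // -integral_RnB //;last exact: CcZ.
  rewrite -integral_RnZ //;apply: integral_Rn_norm_le;[by apply: CcB => //;exact: CcZ|exact: CcZ|].
  move=> u;set x:= d *: u + x0.
  have [ur|ur]:= leP `|u| rho;last first.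
   have -> : btent (u *m A - c') = 0.
    apply: btent0;have:= HC2 u;have:= ler_normB (u *m A - c') (- c').
    rewrite opprK subrK normrN => T1 T2.
    have: 2 * C2 < C2 * `|u *m A| by apply: lt_le_trans T2;move: ur C10;rewrite /rho;clear;lra.
    by rewrite mulrC ltr_pM2l //;move: T1 c'1;clear;lra.
   have -> : phi x * b c d (h x) = 0.
    have [Vx|nVx]:= pselect (V x);last by rewrite phi0 ?mul0r.
    have [->|H]:= eqVneq (b c d (h x)) 0;first by rewrite mulr0.
    have H1:= bdist _ _ _ _ d0 cy H.
    have []:= Hr1 (h x);first by rewrite -ball_normE /ball_ /= distrC;move: H1 dr1 d0;clear;lra.
    rewrite (hV _ Vx).2 /x addrK normrZ gtr0_norm // => H2 _.
    have H3: d * `|u| <= d * (2 * C1).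
     apply: le_trans H2 _;have -> : d * (2 * C1) = C1 * (2 * d) by ring.
     by rewrite ler_pM2l // ltW.
    by move: H3 ur C20;rewrite ler_pM2l // /rho;clear;lra.
   rewrite mulr0 subrr normr0 mulr_ge0 ?bump_ge0 // mulr_ge0 ?(ltW e0) //.
   by rewrite addr_ge0 // mulr_ge0 // mulr_ge0 // ltW.
  have du: `|d *: u| <= d * rho by rewrite normrZ gtr0_norm // ler_pM2l.
  have [Vx H4]: V x /\ `|psi (h x) * `|\det ('J h x)| - p0 * D| <= e.
   by apply: Hr2;rewrite -ball_normE /ball_ /= distrC /x addrK;move: du dr2;clear;lra.
  have H5: `|h x - y0 - (d *: u) *m A| <= e * `|d *: u|.
   rewrite /x [d *: u + x0]addrC;apply: (Hr3 (d *: u)).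
   by rewrite -ball_normE /ball_ /= sub0r normrN;move: du dr3;clear;lra.
  have H6: `|b c d (h x) - btent (u *m A - c')| <= k%:R * (e * rho).
   apply: le_trans (btent_lip _ _) _;rewrite ler_wpM2l //.
   have -> : d^-1 *: (h x - c) - (u *m A - c') = d^-1 *: (h x - y0 - (d *: u) *m A).
    rewrite -scalemxAl /c';apply/rowP => i;rewrite !mxE;field;exact: lt0r_neq0.
   rewrite normrZ gtr0_norm ?invr_gt0 // ler_pdivrMl //;apply: le_trans H5 _.
   by rewrite mulrCA ler_wpM2l // ltW.
  rewrite -phiE // in H4.
  have -> : phi x * b c d (h x) - p0 * D * btent (u *m A - c') =
   (phi x - p0 * D) * b c d (h x) + p0 * D * (b c d (h x) - btent (u *m A - c')) by ring.
  apply: le_trans (ler_normD _ _) _;rewrite !normrM.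
  apply: (@le_trans _ _ (e + `|p0| * `|D| * (k%:R * (e * rho)))).
   rewrite lerD //;last by rewrite ler_wpM2l // mulr_ge0.
   rewrite -[leRHS]mulr1 ler_pM //;have /andP[p1 p2]:= b01 c d (h x).
   by rewrite ger0_norm.
  apply: (@le_trans _ _ (e * (1 + `|p0 * D| * (k%:R * rho)))).
   by rewrite normrM le_eqVlt;apply/orP;left;apply/eqP;ring.
  rewrite -normrM;apply: ler_peMr;last exact: bump_ge1.
  rewrite mulr_ge0 ?(ltW e0) //.
  by rewrite addr_ge0 // mulr_ge0 // mulr_ge0 // ltW.
 have Q3:= ler_distD (p0 * Ib)
  (integral_Rn (fun u => phi (d *: u + x0) * b c d (h (d *: u + x0))))
  (integral_Rn (fun u => psi (d *: u + y0) * b c d (d *: u + y0))).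
 apply: le_trans Q3 _;rewrite distrC in Q2.
 apply: le_trans (lerD Q1 Q2) _.
 have -> : e * (1 + `|p0 * D| * (k%:R * rho)) * IB + e * Ib = e * K by rewrite /K;ring.
 by rewrite /e divfK // lt0r_neq0.
apply/eqP;rewrite -subr_eq0;apply/eqP.
pose N1:= integral_Rn (fun x => `|phi x|);pose N2:= integral_Rn (fun x => `|psi x|).
(* With d tending to infinity the weights tend to 1 on the supports, with error O(1/d). *)
apply: (@eq0_of_le_div _ _ (k%:R * s * (N1 + N2))) => d d0.
have W1 y: psi y != 0 -> `|1 - b 0 d y| <= k%:R * s / d.
 move=> py;apply: le_trans (btent_weight_dist _ d0) _.
 rewrite ler_wpM2r ?invr_ge0 ?(ltW d0) // ler_wpM2l //.
 by rewrite leNgt;apply/negP => /ltW /Hpsi /eqP;rewrite (negPf py).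
have H1:= integral_weight_dist Cpsi (Cpb 0 d d0) W1.
have W2 x: phi x != 0 -> `|1 - b 0 d (h x)| <= k%:R * s / d.
 move=> px;apply: W1;apply: contra_neq px => p0.
 have [Vx|nVx]:= pselect (V x);last exact: phi0.
 by rewrite phiE // p0 mul0r.
have H2:= integral_weight_dist Cphi (Chb 0 d d0) W2.
have H3:= E0 0 d d0.
set G1:= integral_Rn phi;set G2:= integral_Rn psi.
have -> : G1 - G2 =
 (G1 - integral_Rn (fun x => phi x * b 0 d (h x))) -
 (G2 - integral_Rn (fun x => psi x * b 0 d x)) + E 0 d.
 by rewrite /E;ring.
rewrite H3 addr0;apply: le_trans (ler_normB _ _) _.
apply: le_trans (lerD H2 H1) _.
by rewrite le_eqVlt;apply/orP;left;apply/eqP;rewrite -/N1 -/N2;ring.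
Qed.

End ChangeOfVariables.

(** * Calculus on the manifold: smooth functions, coordinates and self-maps *)

Section ManifoldCalculus.
#[local] Opaque jacobian invmx.
Context {R n M} (X: complex_manifold R n M).
Local Notation c:= (chart_at X).

Lemma chart_image_open (e: chart R (n + n) M) (O: set M): open O ->
 open (e @` (cdom e `&` O)).
move=> oO;rewrite openE => _ [p [ep Op] <-];rewrite /interior /=.
have N1: \forall y \near e p, (cdom e `&` O) (cinv e y).
 apply: (cinv_continuous ep);rewrite (ctoK ep).
 by apply: filterI;apply: open_nbhs_nbhs;split=> //;exact: cdom_open.
have N2: \forall y \near e p, (e @` cdom e) y.
 by apply: open_nbhs_nbhs;split;[exact: cimg_open|exists p].
apply: filterS2 N1 N2 => y H [p' ep' E];exists p';last exact: E.
by rewrite -E ctoK // in H.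
Qed.

Lemma cimgE q: cimg (c q) = c q @` (cdom (c q) `&` setT).
by rewrite setIT. Qed.

(** Closure under composition is a property of the target space, so that the lemmas on functions on
    M hold at once for scalar and for row-vector values. *)
Definition comp_closed (W: normedModType R): Prop :=
 forall d m k (U: set 'rV[R]_d) (V: set 'rV[R]_m) (f: 'rV[R]_d -> 'rV[R]_m)
  (g: 'rV[R]_m -> W), open U -> open V -> (forall x, U x -> V (f x)) ->
 Ck_on k U f -> Ck_on k V g -> Ck_on k U (g \o f).

Lemma comp_closed_rV m: comp_closed 'rV[R]_m.
by move=> d l k U V f g;exact: Ck_comp. Qed.

Lemma comp_closed_R: comp_closed R.
by move=> d l k U V f g oU oV;exact: Ck_compR. Qed.

Definition msm (W: normedModType R) (O: set M) (g: M -> W): Prop :=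
 forall q, smooth_on (c q @` (cdom (c q) `&` O)) (g \o cinv (c q)).

(** The differential of [g] on the tangent space at [p]. That space is read in [chart_at p], which
    jumps with [p], so smoothness in [p] makes sense only after passing to a fixed chart by
    [mjac_chart]. *)
Definition mjac m (g: M -> 'rV[R]_m) (p: M): 'M[R]_(n + n, m) :=
 'J (g \o cinv (c p)) (c p p).

Lemma msm_mono (W: normedModType R) (O O': set M) (g: M -> W) :
 O' `<=` O -> msm O g -> msm O' g.
move=> OO Hg q k;apply: Ck_mono (Hg q k) => _ [p [? ?] <-].
by exists p => //;split=> //;exact: OO.
Qed.

Lemma smooth_fun_msm (W: normedModType R) (g: M -> W) :
 smooth_fun X g -> msm setT g.
by move=> Hg q;rewrite -cimgE. Qed.

Lemma msm_smooth_fun (W: normedModType R) (g: M -> W) :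
 msm setT g -> smooth_fun X g.
by move=> Hg q;rewrite cimgE. Qed.

Lemma msm_ext (W: normedModType R) (O: set M) (g g': M -> W): open O ->
 (forall p, O p -> g p = g' p) -> msm O g' -> msm O g.
move=> oO E Hg q k;apply: Ck_ext (Hg q k);first exact: chart_image_open.
by move=> _ [p [qp Op] <-] /=;rewrite ctoK // E.
Qed.

Lemma msm_cover (W: normedModType R) (O: set M) (g: M -> W) :
 (forall p, O p -> exists g' O', [/\ open O', O' p, forall x, O' x -> g x = g' x &
   msm O' g']) -> msm O g.
move=> H q k;apply: Ck_local => _ [p [qp Op] <-].
have [g' [ O' [ oO' O'p E Hg']]]:= H p Op.
exists (g' \o cinv (c q)), (c q @` (cdom (c q) `&` O'));split=> //.
- exact: chart_image_open.
- by exists p.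
- by move=> _ [x [qx Ox] <-] /=;rewrite ctoK // E.
- exact: Hg'.
Qed.

Lemma msm_chart q: msm (cdom (c q)) (c q).
by move=> q';exact: transition_smooth. Qed.

Lemma msm_post m (W: normedModType R) (O: set M) (V: set 'rV[R]_m) (g: M -> 'rV[R]_m) (k: 'rV[R]_m -> W) :
 comp_closed W -> open O -> open V -> (forall p, O p -> V (g p)) -> msm O g ->
 smooth_on V k -> msm O (fun p => k (g p)).
move=> HW oO oV OV Hg Hk q l.
apply: (HW _ _ l _ V (g \o cinv (c q)) k) => //;first exact: chart_image_open.
 by move=> _ [p [qp Op] <-] /=;rewrite ctoK //;exact: OV.
exact: Hg.
Qed.

Lemma msm_cst (W: normedModType R) (O: set M) (w: W): msm O (fun=> w).
by move=> q k;exact: Ck_cst. Qed.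

Lemma msmD (W: normedModType R) (O: set M) (f g: M -> W): open O -> msm O f -> msm O g ->
 msm O (fun p => f p + g p).
by move=> oO Hf Hg q k;apply: (CkD _ (Hf q k) (Hg q k));exact: chart_image_open. Qed.

Lemma msmM (O: set M) (f g: M -> R): open O -> msm O f -> msm O g ->
 msm O (fun p => f p * g p).
by move=> oO Hf Hg q k;apply: (CkM _ (Hf q k) (Hg q k));exact: chart_image_open. Qed.

Lemma msmB (O: set M) (f g: M -> R): open O -> msm O f -> msm O g ->
 msm O (fun p => f p - g p).
by move=> oO Hf Hg q k;apply: (CkB _ (Hf q k) (Hg q k));exact: chart_image_open. Qed.

Lemma msm_prod (O: set M) (I: Type) (r: seq I) (P: pred I) (f: I -> M -> R) :
 open O -> (forall i, msm O (f i)) -> msm O (fun p => \prod_(i <- r | P i) f i p).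
move=> oO Hf q k;apply: (@Ck_prod _ _ k _ I r P (fun i y => f i (cinv (c q) y))).
 exact: chart_image_open.
by move=> i;exact: (Hf i q k).
Qed.

Lemma msm_coord m (O: set M) (f: M -> 'rV[R]_m) i: open O -> msm O f ->
 msm O (fun p => f p 0 i: R).
by move=> oO Hf q k;apply: (Ck_coord _ _ _ (Hf q k));exact: chart_image_open. Qed.

Lemma msm_rV m (O: set M) (f: M -> 'rV[R]_m): open O ->
 (forall i, msm O (fun p => f p 0 i: R)) -> msm O f.
move=> oO Hf q k;apply: Ck_rV;first exact: chart_image_open.
by move=> i;exact: (Hf i q k).
Qed.

Lemma msm_mulmx m l (A: 'M[R]_(m, l)) (O: set M) (f: M -> 'rV[R]_m): open O ->
 msm O f -> msm O (fun p => f p *m A).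
by move=> oO Hf q k;apply: Ck_mulmx (Hf q k);exact: chart_image_open. Qed.

Lemma msm_diff (W: normedModType R) (O: set M) (g: M -> W) q p: msm O g -> O p ->
 cdom (c q) p -> differentiable (g \o cinv (c q)) (c q p).
by move=> Hg Op qp;have [H _]:= Hg q 1%N;apply: H;exists p. Qed.

Lemma msm_diff0 (W: normedModType R) (O: set M) (g: M -> W) p: msm O g -> O p ->
 differentiable (g \o cinv (c p)) (c p p).
by move=> Hg Op;apply: (msm_diff Hg Op);exact: chart_at_dom. Qed.

Lemma msm_continuous (W: normedModType R) (O: set M) (g: M -> W) p: open O -> msm O g -> O p ->
 {for p, continuous g}.
move=> oO Hg Op;have cp:= chart_at_dom X p.
have H: {for p, continuous ((g \o cinv (c p)) \o c p)}.
 apply: continuous_comp;first exact: cto_continuous.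
 by apply: differentiable_continuous;exact: msm_diff0 Hg Op.
rewrite /prop_for /continuous_at /= (ctoK cp) in H.
rewrite /prop_for /continuous_at;apply: cvg_trans H;apply: near_eq_cvg.
have: \forall x \near p, cdom (c p) x by apply: open_nbhs_nbhs;split=> //;exact: cdom_open.
by apply: filterS => x px /=;rewrite ctoK.
Qed.

Lemma mjac_chart m (O: set M) (g: M -> 'rV[R]_m) p q: open O -> O p -> msm O g -> cdom (c q) p ->
 mjac g p = mjac (c q) p *m 'J (g \o cinv (c q)) (c q p).
move=> oO Op Hg qp;have cp:= chart_at_dom X p.
have E: c q p = (c q \o cinv (c p)) (c p p) by rewrite /= ctoK.
rewrite /mjac {1}E -(J_comp (f:= c q \o cinv (c p)));last 2 first.
- exact: (msm_diff0 (@msm_chart q) qp).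
- by rewrite -E;exact: msm_diff Hg Op qp.
apply: J_near;last first.
 apply: differentiable_comp;first exact: (msm_diff0 (@msm_chart q) qp).
 by rewrite -E;exact: msm_diff Hg Op qp.
have: \forall y \near c p p, (c p @` (cdom (c p) `&` cdom (c q))) y.
 by apply: open_nbhs_nbhs;split;[apply: chart_image_open;exact: cdom_open|exists p].
by apply: filterS => _ [x [px qx] <-] /=;rewrite !ctoK.
Qed.

Lemma mjac_chart_self p: mjac (c p) p = 1%:M.
rewrite /mjac -[RHS](J_id (c p p));apply: J_near;last exact: (differentiable_lin (@idfun 'rV[R]_(n + n))).
have: \forall y \near c p p, (c p @` cdom (c p)) y.
 by apply: open_nbhs_nbhs;split;[exact: cimg_open|exists p => //;exact: chart_at_dom].
by apply: filterS => _ [x px <-] /=;rewrite ctoK.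
Qed.

Lemma mjac_chart_CR p q: cdom (c q) p ->
 mulI R n *m mjac (c q) p = mjac (c q) p *m mulI R n.
by move=> qp;apply: transition_CR => //;exact: chart_at_dom. Qed.

Lemma mjac_chart_inv p q: cdom (c q) p ->
 mjac (c q) p *m 'J (c p \o cinv (c q)) (c q p) = 1%:M.
move=> qp;rewrite -(mjac_chart (cdom_open (c p)) _ (@msm_chart p) qp) ?mjac_chart_self //.
exact: chart_at_dom.
Qed.

Lemma mjac_chart_unit p q: cdom (c q) p -> mjac (c q) p \in unitmx.
by move=> qp;exact: (mulmx1_unit (mjac_chart_inv qp)).1. Qed.

Lemma mjac_post m l (O: set M) (g: M -> 'rV[R]_m) (k: 'rV[R]_m -> 'rV[R]_l) p :
 msm O g -> O p -> differentiable k (g p) ->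
 mjac (fun x => k (g x)) p = mjac g p *m 'J k (g p).
move=> Hg Op dk;have cp:= chart_at_dom X p.
have E: g p = (g \o cinv (c p)) (c p p) by rewrite /= ctoK.
rewrite /mjac E -J_comp //;first exact: msm_diff0 Hg Op.
by rewrite -E.
Qed.

Lemma mjac_mulmx m l (A: 'M[R]_(m, l)) (O: set M) (g: M -> 'rV[R]_m) p: 
 msm O g -> O p -> mjac (fun x => g x *m A) p = mjac g p *m A.
move=> Hg Op;rewrite (mjac_post (k:= mulmxr A) Hg Op);last exact: differentiable_lin.
by rewrite J_mulmx.
Qed.

Lemma diff_fun_mjac m (O: set M) (g: M -> 'rV[R]_m) p w: msm O g -> O p ->
 diff_fun X g p w = w *m mjac g p.
by move=> Hg Op;rewrite /diff_fun diffJ //;exact: msm_diff0 Hg Op. Qed.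

Section Into.
Context {k: nat} (V: set 'rV[R]_k) (f: 'rV[R]_k -> M).
Hypotheses (oV: open V) (Hf: smooth_into X V f).

Lemma into_open O: open O -> open (V `&` f @^-1` O).
move=> oO;rewrite openE => x [Vx Ox];rewrite /interior /=.
apply: filterI;first exact: open_nbhs_nbhs.
by apply: (Hf.1 x Vx);exact: open_nbhs_nbhs.
Qed.

Lemma into_chart_diff x q: V x -> cdom (c q) (f x) -> differentiable (c q \o f) x.
by move=> Vx qx;have [H _]:= Hf.2 q 1%N;apply: H. Qed.

Lemma comp_into (W: normedModType R) O (g: M -> W): comp_closed W -> open O -> msm O g ->
 smooth_on (V `&` f @^-1` O) (g \o f).
move=> HW oO Hg l;apply: Ck_local => x [Vx Ox].
pose q:= f x;have qx: cdom (c q) (f x) by exact: chart_at_dom.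
pose U:= V `&` f @^-1` (cdom (c q) `&` O).
have oI: open (cdom (c q) `&` O) by apply: openI => //;exact: cdom_open.
have oU: open U by exact: into_open.
exists ((g \o cinv (c q)) \o (c q \o f)), U;split=> //.
 by move=> y [Vy [qy Oy]] /=;rewrite ctoK.
apply: (HW _ _ l _ (c q @` (cdom (c q) `&` O))) => //;first exact: chart_image_open.
 by move=> y [Vy [qy Oy]];exists (f y).
 by apply: Ck_mono (Hf.2 q l) => y [Vy [qy Oy]].
exact: Hg.
Qed.

Lemma into_diff (W: normedModType R) O (g: M -> W) x: comp_closed W -> open O -> msm O g ->
 V x -> O (f x) -> differentiable (g \o f) x.
by move=> HW oO Hg Vx Ox;have [H _]:= comp_into HW oO Hg 1%N;apply: H. Qed.

Lemma into_J m O (g: M -> 'rV[R]_m) x: open O -> msm O g -> V x -> O (f x) ->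
 'J (g \o f) x = diff_into X f x *m mjac g (f x).
move=> oO Hg Vx Ox;have qx: cdom (c (f x)) (f x) by exact: chart_at_dom.
rewrite /diff_into /mjac -(J_comp (f:= c (f x) \o f) (x:= x));last 2 first.
- exact: into_chart_diff.
- exact: msm_diff0 Hg Ox.
apply: J_near;last first.
 apply: differentiable_comp;first exact: into_chart_diff.
 exact: msm_diff0 Hg Ox.
have: \forall y \near x, (V `&` f @^-1` cdom (c (f x))) y.
 by apply: open_nbhs_nbhs;split;[apply: into_open;exact: cdom_open|].
by apply: filterS => y [Vy qy] /=;rewrite ctoK.
Qed.

Lemma into_J_chart x q: V x -> cdom (c q) (f x) ->
 'J (c q \o f) x = diff_into X f x *m mjac (c q) (f x).
by move=> Vx qx;apply: into_J (@msm_chart q) Vx qx;exact: cdom_open. Qed.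

End Into.

Lemma into_mono k (V V': set 'rV[R]_k) (f: 'rV[R]_k -> M): 
 V' `<=` V -> smooth_into X V f -> smooth_into X V' f.
move=> VV Hf;split=> [x Vx|q l];first by apply: Hf.1;exact: VV.
by apply: Ck_mono (Hf.2 q l) => x [Vx qx];split=> //;exact: VV.
Qed.

Lemma diff_into_near k (V: set 'rV[R]_k) (f g: 'rV[R]_k -> M) x: open V -> V x ->
 (forall x, V x -> f x = g x) -> smooth_into X V g -> diff_into X f x = diff_into X g x.
move=> oV Vx E Hg;rewrite /diff_into (E _ Vx);apply: J_near;last first.
 by apply: (into_chart_diff Hg) => //;exact: chart_at_dom.
have: \forall y \near x, V y by exact: open_nbhs_nbhs.
by apply: filterS => y Vy;rewrite /= E.
Qed.

Lemma into_pre k l (U: set 'rV[R]_l) (V: set 'rV[R]_k) (f: 'rV[R]_k -> M)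
  (h: 'rV[R]_l -> 'rV[R]_k): open U -> open V -> (forall x, U x -> V (h x)) ->
 smooth_on U h -> smooth_into X V f -> smooth_into X U (f \o h).
move=> oU oV UV Hh Hf.
have ch x: U x -> {for x, continuous h} by move=> Ux;exact: (Hh 0%N x Ux).
split=> [x Ux|q r].
 by apply: continuous_comp;[exact: ch|apply: Hf.1;exact: UV].
have oW: open (V `&` f @^-1` cdom (c q)) by apply: (into_open oV Hf);exact: cdom_open.
apply: (Ck_comp (V:= V `&` f @^-1` cdom (c q)) (f:= h) (g:= c q \o f)) => //.
- have:= open_preimage_on oU oW ch;congr open.
 by apply/seteqP;split=> x [Ux] /=;[case|move=> H;split=> //;split=> //;exact: UV].
- by move=> x [Ux H];split=> //;exact: UV.
- by apply: Ck_mono (Hh r) => x [].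
- exact: (Hf.2 q r).
Qed.

Lemma diff_into_pre k l (V: set 'rV[R]_k) (f: 'rV[R]_k -> M)
  (h: 'rV[R]_l -> 'rV[R]_k) x: V (h x) -> differentiable h x -> smooth_into X V f ->
 diff_into X (f \o h) x = 'J h x *m diff_into X f (h x).
move=> Vx dh Hf;rewrite /diff_into -(J_comp (g:= c (f (h x)) \o f)) //.
by apply: (into_chart_diff Hf) => //;exact: chart_at_dom.
Qed.

Lemma into_cinv q: smooth_into X (cimg (c q)) (cinv (c q)).
split=> [_ [p qp <-]|q' k];first exact: cinv_continuous.
apply: Ck_mono (transition_smooth X q q' k) => _ [[p qp <-]] /=;rewrite ctoK // => q'p.
by exists p.
Qed.

Lemma diff_into_cinv q p: cdom (c q) p ->
 diff_into X (cinv (c q)) (c q p) = invmx (mjac (c q) p).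
move=> qp;have U:= mjac_chart_unit qp.
rewrite -[LHS](mulmxK U) -[RHS]mul1mx;congr (_ *m _).
have E: cinv (c q) (c q p) = p by rewrite ctoK.
rewrite -{2}E -(into_J_chart (@cimg_open _ _ _ (c q)) (@into_cinv q));last 2 first.
- by exists p.
- by rewrite E.
rewrite -[RHS](J_id (c q p));apply: J_near;last exact: (differentiable_lin (@idfun 'rV[R]_(n + n))).
have: \forall y \near c q p, (c q @` cdom (c q)) y.
 by apply: open_nbhs_nbhs;split;[exact: cimg_open|exists p].
by apply: filterS => _ [x px <-] /=;rewrite ctoK.
Qed.

(** Local coordinates [g] on [O] with inverse [h]. Unlike a chart of the atlas they need not be
    holomorphic, as is the case for the Darboux coordinates below. *)
Definition coord_on (O: set M) (g: M -> 'rV[R]_(n + n)) (h: 'rV[R]_(n + n) -> M): Prop :=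
 [/\ open O, msm O g, open (g @` O), forall x, O x -> h (g x) = x &
   smooth_into X (g @` O) h].

Lemma coord_on_sub O O' g h: coord_on O g h -> open O' -> O' `<=` O -> coord_on O' g h.
move=> [ oO Hg oI hg Hh] oO' OO.
have E: g @` O' = g @` O `&` h @^-1` O'.
 apply/seteqP;split=> [_ [x Ox <-]|_ [[x Ox <-]]] /=.
  by split;[exists x => //;exact: OO|rewrite hg //;exact: OO].
 by rewrite hg // => O'x;exists x.
split=> //;first exact: msm_mono OO Hg.
- by rewrite E;apply: (into_open oI Hh).
- by move=> x Ox;apply: hg;exact: OO.
- by apply: into_mono Hh;rewrite E => x [].
Qed.

Lemma coord_on_inv O g h x: coord_on O g h -> O x ->
 diff_into X h (g x) *m mjac g x = 1%:M.
move=> [ oO Hg oI hg Hh] Ox;rewrite -{2}(hg x Ox) -(into_J oI Hh oO Hg);last 2 first.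
- by exists x.
- by rewrite hg.
rewrite -[RHS](J_id (g x));apply: J_near;last exact: (differentiable_lin (@idfun 'rV[R]_(n + n))).
have: \forall y \near g x, (g @` O) y by apply: open_nbhs_nbhs;split=> //;exists x.
by apply: filterS => _ [z Oz <-] /=;rewrite hg.
Qed.

Lemma coord_on_unit O g h x: coord_on O g h -> O x -> mjac g x \in unitmx.
by move=> H Ox;have /mulmx1_unit[]:= coord_on_inv H Ox. Qed.

(** The inverse function theorem applied to [g] read in the chart at [p]. *)
Lemma coord_exists (O: set M) (g: M -> 'rV[R]_(n + n)) p: open O -> O p -> msm O g ->
 mjac g p \in unitmx -> exists O' h, [/\ O' `<=` O, O' p & coord_on O' g h].
move=> oO Op Hg uJ;have cp:= chart_at_dom X p.
have [V [k [[oV Vp VU oI] [kg sk uV]]]] :=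
 inverse_function (@chart_image_open (c p) _ oO) (ex_intro2 _ _ p (conj cp Op) erefl) (Hg p) uJ.
pose O':= O `&` (cdom (c p) `&` c p @^-1` V).
have oO': open O'.
 apply: openI => //;rewrite openE => x [px Vx];rewrite /interior /=.
 apply: filterI;first by apply: open_nbhs_nbhs;split=> //;exact: cdom_open.
 by apply: (cto_continuous px);exact: open_nbhs_nbhs.
have VE y: V y -> exists2 x, O' x & y = c p x.
 move=> Vy;have [x [px Ox] E]:= VU _ Vy;exists x => //.
 by split=> //;split=> //=;rewrite E.
have IE: g @` O' = (g \o cinv (c p)) @` V.
 apply/seteqP;split=> [_ [x [Ox [px Vx]] <-]|_ [y Vy <-]].
  by exists (c p x) => //=;rewrite ctoK.
 have [x O'x ->]:= VE _ Vy;exists x => //=;rewrite ctoK //.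
 by have [_ []]:= O'x.
exists O', (cinv (c p) \o k);split.
- by move=> x [].
- by split.
split=> //.
- by apply: msm_mono Hg => x [].
- by rewrite IE.
- move=> x [Ox [px Vx]] /=.
 by have:= kg _ Vx;rewrite /= ctoK // => ->;rewrite ctoK.
- rewrite IE;apply: (into_pre oI (@cimg_open _ _ _ (c p)) _ sk (@into_cinv p)).
 move=> _ [y Vy <-];rewrite kg //;have [x O'x ->]:= VE _ Vy.
 by exists x => //;have [_ []]:= O'x.
Qed.

Lemma velocity_comp m (O: set M) (g: M -> 'rV[R]_m) (gam: R -> M) t v: open O -> msm O g ->
 O (gam t) -> is_velocity X gam t v -> is_derive t (1: R) (g \o gam) (v *m mjac g (gam t)).
move=> oO Hg Ot [ct dt];have qt:= chart_at_dom X (gam t).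
have dg:= msm_diff0 Hg Ot.
rewrite /mjac -diffJ //.
have H:= is_derive_comp_diff dt dg.
apply: (near_eq_is_derive _ H).
have: \forall s \near t, cdom (c (gam t)) (gam s).
 by apply: ct;apply: open_nbhs_nbhs;split=> //;exact: cdom_open.
by apply: filterS => s ps /=;rewrite ctoK.
Qed.

Lemma velocity_coord (O: set M) g h (gam: R -> M) t w: coord_on O g h ->
 O (gam t) -> {for t, continuous gam} -> is_derive t (1: R) (g \o gam) w ->
 is_velocity X gam t (w *m diff_into X h (g (gam t))).
move=> [ oO Hg oI hg Hh] Ot ct dt;split=> //;have qt:= chart_at_dom X (gam t).
have dh: differentiable (c (gam t) \o h) (g (gam t)).
 by apply: (into_chart_diff Hh);[exists (gam t)|rewrite hg].
have H:= is_derive_comp_diff dt dh.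
rewrite /diff_into hg // -diffJ //.
apply: (near_eq_is_derive _ H).
have: \forall s \near t, O (gam s) by apply: ct;exact: open_nbhs_nbhs.
by apply: filterS => s Os /=;rewrite hg.
Qed.

(** A self-map given piecewise, near each point by a smooth map [g] into some R^m followed by a
    smooth map back to M. Flows that are explicit in Darboux coordinates and the identity elsewhere
    have this form. *)
Lemma smooth_self_local (phi: M -> M) :
 (forall p, exists m (O: set M) (V: set 'rV[R]_m) (g: M -> 'rV[R]_m) (f: 'rV[R]_m -> M),
  [/\ open O, O p & open V] /\ [/\ msm O g, forall x, O x -> V (g x),
    smooth_into X V f & forall x, O x -> phi x = f (g x)]) ->
 smooth_self X phi.
move=> H q.
have cphi p: {for p, continuous phi}.
 have [m [ O [V [g [f [[ oO Op oV] [Hg OV Hf E]]]]]]]:= H p.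
 have cc: {for p, continuous (f \o g)}.
  by apply: continuous_comp;[exact: (msm_continuous oO Hg)|apply: Hf.1;exact: OV].
 rewrite /prop_for /continuous_at E //;apply: cvg_trans cc;apply: near_eq_cvg.
 have: \forall y \near p, O y by exact: open_nbhs_nbhs.
 by apply: filterS => y Vy;rewrite /= E.
split=> [_ [p qp <-]|q' k].
 by apply: continuous_comp;[exact: cinv_continuous|exact: cphi].
apply: Ck_local => _ [[p qp <-]] /=;rewrite ctoK // => q'p.
have [m [ O [V [g [f [[ oO Op oV] [Hg OV Hf E]]]]]]]:= H p.
have oV':= into_open oV Hf (cdom_open (c q')).
have oO': open (O `&` g @^-1` (V `&` f @^-1` cdom (c q'))).
 rewrite openE => x [Ox Vx];rewrite /interior /=;apply: filterI;first exact: open_nbhs_nbhs.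
 by apply: (msm_continuous oO Hg Ox);exact: open_nbhs_nbhs.
exists ((c q' \o f) \o (g \o cinv (c q))), (c q @` (cdom (c q) `&` (O `&` g @^-1` (V `&` f @^-1` cdom (c q'))))).
have oI:= @chart_image_open (c q) _ oO'.
split=> //.
- exists p => //;split=> //;split=> //;split;first exact: OV.
 by rewrite /preimage /= -E.
- by move=> _ [x [qx [Ox _]] <-] /=;rewrite ctoK // E.
- apply: (Ck_comp (V:= V `&` f @^-1` cdom (c q'))) => //.
 + by move=> _ [x [qx [Ox Vx]] <-];rewrite /= ctoK.
 + by apply: Ck_mono (Hg q k) => _ [x [qx [Ox Vx]] <-];exists x.
 + exact: (Hf.2 q' k).
Qed.

End ManifoldCalculus.

Section SelfMaps.
#[local] Opaque jacobian invmx.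
Context {R n M} (X: complex_manifold R n M).
Local Notation c:= (chart_at X).

Lemma into_local k (V: set 'rV[R]_k) (f: 'rV[R]_k -> M) :
 (forall x, V x -> exists f' U, [/\ open U, U x, forall y, U y -> f y = f' y &
   smooth_into X U f']) -> smooth_into X V f.
move=> H;split=> [x Vx|q l].
 have [f' [U [oU Ux E Hf]]]:= H x Vx.
 have:= Hf.1 x Ux;rewrite /prop_for /continuous_at E // => cf.
 apply: cvg_trans cf;apply: (@near_eq_cvg _ _ (nbhs x)).
 have: \forall y \near x, U y by exact: open_nbhs_nbhs.
 by apply: filterS => y Uy;rewrite E.
apply: Ck_local => x [Vx qx];have [f' [U [oU Ux E Hf]]]:= H x Vx.
exists (c q \o f'), (U `&` f' @^-1` cdom (c q));split.
- by apply: (into_open oU Hf);exact: cdom_open.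
- by split=> //;rewrite /preimage /= -E.
- by move=> y [Uy _] /=;rewrite E.
- exact: (Hf.2 q l).
Qed.

Lemma smooth_self_into (phi: M -> M) k (V: set 'rV[R]_k) (f: 'rV[R]_k -> M): open V ->
 smooth_self X phi -> smooth_into X V f -> smooth_into X V (phi \o f).
move=> oV Hp Hf;apply: into_local => x Vx;pose q:= f x.
have oI:= @cimg_open _ _ _ (c q).
have oU: open (V `&` f @^-1` cdom (c q)) by apply: (into_open oV Hf);exact: cdom_open.
exists ((phi \o cinv (c q)) \o (c q \o f)), (V `&` f @^-1` cdom (c q));split=> //.
- by split=> //;exact: chart_at_dom.
- by move=> y [Vy qy] /=;rewrite ctoK.
- apply: (into_pre oU oI _ _ (Hp q));last exact: (Hf.2 q).
 by move=> y [Vy qy];exists (f y).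
Qed.

Lemma diff_into_self (phi: M -> M) k (V: set 'rV[R]_k) (f: 'rV[R]_k -> M) x: open V ->
 smooth_self X phi -> smooth_into X V f -> V x ->
 diff_into X (phi \o f) x = diff_into X f x *m diff_self X phi (f x).
move=> oV Hp Hf Vx;pose q:= f x;have qx: cdom (c q) (f x) by exact: chart_at_dom.
have oI:= @cimg_open _ _ _ (c q).
have oU: open (V `&` f @^-1` cdom (c q)) by apply: (into_open oV Hf);exact: cdom_open.
have Hc: smooth_into X (V `&` f @^-1` cdom (c q)) ((phi \o cinv (c q)) \o (c q \o f)).
 apply: (into_pre oU oI _ _ (Hp q));last exact: (Hf.2 q).
 by move=> y [Vy qy];exists (f y).
rewrite (diff_into_near (f:= phi \o f) oU (conj Vx qx) _ Hc);last first.
 by move=> y [Vy qy] /=;rewrite ctoK.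
rewrite (diff_into_pre (h:= c q \o f) (f:= phi \o cinv (c q)) _ _ (Hp q)) //.
 by exists (f x).
exact: (into_chart_diff Hf).
Qed.

Lemma smooth_self_msm (phi: M -> M) (W: normedModType R) O (g: M -> W): comp_closed W ->
 smooth_self X phi -> open O -> msm X O g -> msm X (phi @^-1` O) (g \o phi).
move=> HW Hp oO Hg q k;have oI:= @cimg_open _ _ _ (c q).
apply: Ck_mono (comp_into oI (Hp q) HW oO Hg k) => _ [p [qp Op] <-].
by split;[exists p|rewrite /preimage /= ctoK].
Qed.

Lemma smooth_self_continuous (phi: M -> M): smooth_self X phi -> continuous phi.
move=> Hp p;have cp:= chart_at_dom X p.
have H: {for p, continuous ((phi \o cinv (c p)) \o c p)}.
 by apply: continuous_comp;[exact: cto_continuous|apply: (Hp p).1;exists p].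
rewrite /prop_for /continuous_at /= (ctoK cp) in H.
apply: cvg_trans H;apply: (@near_eq_cvg _ _ (nbhs p)).
have: \forall x \near p, cdom (c p) x by apply: open_nbhs_nbhs;split=> //;exact: cdom_open.
by apply: filterS => x px /=;rewrite ctoK.
Qed.

Lemma diff_self_id p: diff_self X id p = 1%:M.
have cp:= chart_at_dom X p.
rewrite /diff_self (diff_into_near (g:= cinv (c p)) (@cimg_open _ _ _ (c p)) _ _ (@into_cinv _ _ _ X p)) //.
by rewrite diff_into_cinv // mjac_chart_self invmx1.
Qed.

Lemma diff_self_comp (phi psi: M -> M) p: smooth_self X phi -> smooth_self X psi ->
 diff_self X (psi \o phi) p = diff_self X phi p *m diff_self X psi (phi p).
move=> H1 H2;have cp:= chart_at_dom X p.
have:= diff_into_self (f:= phi \o cinv (c p)) (@cimg_open _ _ _ (c p)) H2 (H1 p) (x:= c p p).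
rewrite /= ctoK // => H;apply: H;by exists p.
Qed.

Lemma diffeo_unit (phi psi: M -> M) p: cancel phi psi -> smooth_self X phi -> smooth_self X psi ->
 diff_self X phi p \in unitmx.
move=> H H1 H2;have:= diff_self_comp p H1 H2.
have -> : psi \o phi = id by apply/funext => x /=;rewrite H.
by rewrite diff_self_id => /esym E;exact: (mulmx1_unit E).1.
Qed.

Lemma msm_extend (W: normedModType R) (O C: set M) (g: M -> W): open O -> closed C -> C `<=` O ->
 msm X O g -> (forall p, ~ C p -> g p = 0) -> msm X setT g.
move=> oO cC CO Hg g0;apply: msm_cover => p _.
have [Op|nOp]:= pselect (O p);first by exists g, O;split.
exists (fun=> 0), (~` C);split=> //;first exact: closed_openC.
- by move=> /CO.
- exact: msm_cst.
Qed.

Lemma hausdorff_compact_closed (C: set M): compact C -> closed C.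
by apply: compact_closed;exact: cm_hausdorff X. Qed.

Lemma chart_ball p O: open O -> O p -> exists2 r: R, 0 < r &
 closed_ball (c p p) r `<=` c p @` (cdom (c p) `&` O).
move=> oO Op;have cp:= chart_at_dom X p.
have: nbhs (c p p) (c p @` (cdom (c p) `&` O)).
 by apply: open_nbhs_nbhs;split;[exact: chart_image_open|exists p].
move=> /nbhs_ballP[r /= r0 Hr];exists (r / 2);first by rewrite divr_gt0.
move=> y;rewrite closed_ballE ?divr_gt0 // /closed_ball_ /= => H;apply: Hr.
rewrite -ball_normE /ball_ /=;apply: le_lt_trans H _.
by rewrite ltr_pdivrMr // ltr_pMr // ltr1n.
Qed.

Lemma cinv_compact q (K: set 'rV[R]_(n + n)): compact K -> K `<=` cimg (c q) ->
 compact (cinv (c q) @` K).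
move=> cK KI;apply: continuous_compact => //;apply: continuous_in_subspaceT => x.
by rewrite inE => /KI [p qp <-];exact: cinv_continuous.
Qed.

(** The cut-off is applied to the squared Euclidean distance in the chart at [p] and extended by 0
    across the boundary of the chart domain. The extension is smooth because the image [C] of a
    closed ball is compact, hence closed in M. *)
Lemma bump_exists p O: open O -> O p -> exists (b: M -> R) (C: set M),
 [/\ msm X setT b, forall x, 0 <= b x <= 1, \forall x \near p, b x = 1,
   compact C /\ C `<=` O & forall x, ~ C x -> b x = 0].
move=> oO Op;have cp:= chart_at_dom X p;have [r r0 Hr]:= chart_ball oO Op.
pose s (x: M): R:= \sum_i (c p x - c p p) 0 i ^+ 2.
pose C:= cinv (c p) @` closed_ball (c p p) r.
have cC: compact C.
 apply: cinv_compact;first exact: closed_ball_compact.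
 by move=> y /Hr [x [px _] <-];exists x.
pose b x: R:= if x \in cdom (c p) then cutoff (2 / r ^+ 2 * s x) else 0.
have r20: 0 < r ^+ 2 by rewrite exprn_gt0.
have CE x: cdom (c p) x -> ~ C x -> cutoff (2 / r ^+ 2 * s x) = 0.
 move=> px nC;apply: cutoff0;rewrite mulrAC ler_pdivlMr // ler_pM2l // leNgt.
 apply/negP => H;apply: nC;exists (c p x);last by rewrite ctoK.
 rewrite closed_ballE // /closed_ball_ /= distrC;apply: mx_norm_le;first exact: ltW.
 move=> i j;rewrite (ord1 i) -(ler_pXn2r (ltn0Sn 1)) ?nnegrE ?(ltW r0) // -normrX.
 rewrite ger0_norm ?sqr_ge0 //;apply: le_trans (ltW H);rewrite /s (bigD1 j) //= lerDl.
 by apply: sumr_ge0 => l _;exact: sqr_ge0.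
exists b, C;split=> //.
- apply: (@msm_extend R (cdom (c p)) C) => //.
 + exact: cdom_open.
 + exact: hausdorff_compact_closed.
 + by move=> _ [y /Hr [x [px _] <-] <-];rewrite ctoK.
 + apply: (@msm_ext _ _ _ _ _ _ _ (fun x => cutoff (2 / r ^+ 2 * s x))).
  * exact: cdom_open.
  * by move=> x px;rewrite /b mem_set.
  * have: smooth_on setT (fun y: 'rV[R]_(n + n) =>
     cutoff (2 / r ^+ 2 * \sum_i (y - c p p) 0 i ^+ 2)).
    move=> l;apply: Ck_cutoff;first exact: openT.
    apply: CkM;[exact: openT|exact: Ck_cst|].
    apply: Ck_sum;first exact: openT.
    move=> i;have Hi: Ck_on l setT (fun y: 'rV[R]_(n + n) => (y - c p p) 0 i).
     apply: Ck_coord;first exact: openT.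
     apply: CkD;[exact: openT|exact: (Ck_lin l setT (@idfun 'rV[R]_(n + n)))|exact: Ck_cst].
    by apply: CkM => //;exact: openT.
   move=> Hs;apply: (@msm_post _ _ _ X _ R (cdom (c p)) setT (c p) _ _ _ _ _ _ Hs) => //.
   - exact: comp_closed_R.
   - exact: cdom_open.
   - exact: openT.
   - exact: msm_chart.
 + by move=> x nC;rewrite /b;case: ifPn => //;rewrite inE => px;exact: CE.
- by move=> x;rewrite /b;case: ifPn;rewrite ?lexx ?ler01 // cutoff_ge0 cutoff_le1.
- have N1: \forall x \near p, cdom (c p) x.
  by apply: open_nbhs_nbhs;split=> //;exact: cdom_open.
 have r2: 0 < r / (2 * (n + n).+1%:R) by rewrite divr_gt0 // mulr_gt0.
 have N2: \forall x \near p, `|c p x - c p p| <= r / (2 * (n + n).+1%:R).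
  by apply: (continuous_near_le r2) => //;exact: cto_continuous.
 apply: filterS2 N1 N2 => x px H;rewrite /b mem_set //;apply: cutoff1.
 rewrite mulrAC ler_pdivrMr // mul1r.
 have: s x <= \sum_(i < n + n) (r / (2 * (n + n).+1%:R)) ^+ 2.
  apply: ler_sum => i _;rewrite -[leLHS]ger0_norm ?sqr_ge0 // normrX.
  by rewrite ler_pXn2r ?nnegrE ?(ltW r2) //;apply: le_trans H;exact: mx_norm_ge.
 rewrite sumr_const card_ord => H1.
 have H2: (r / (2 * (n + n).+1%:R)) ^+ 2 *+ (n + n) <= r ^+ 2 / 4.
  rewrite expr_div_n exprMn -mulr_natr invfM mulrA -mulrA.
  have -> : (2: R) ^+ 2 = 4 by rewrite -natrX.
  rewrite -mulrA;apply: ler_wpM2l;first exact: ltW.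
  rewrite -mulrA -[leRHS]mulr1;apply: ler_wpM2l;first by rewrite invr_ge0.
  rewrite mulrC ler_pdivrMr ?exprn_gt0 // mul1r.
  rewrite expr2 -natrM ler_nat;apply: leq_trans (leqnSn _) _;exact: leq_pmulr.
 by move: (le_trans H1 H2) r20;move: (s x) (r ^+ 2) => a a';clear;lra.
- by split=> // _ [y /Hr [x [px Ox] <-] <-];rewrite ctoK.
- by move=> x nC;rewrite /b;case: ifPn => //;rewrite inE => px;exact: CE.
Qed.

End SelfMaps.

(** * Riemannian volume: independence of parametrizations and partition of unity *)

Lemma Ck_mxmul (R: realType) d k (U: set 'rV[R]_d) m l o (A: 'rV[R]_d -> 'M[R]_(m, l))
  (B: 'rV[R]_d -> 'M[R]_(l, o)) i j: open U -> (forall i j, Ck_on k U (fun x => A x i j)) ->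
 (forall i j, Ck_on k U (fun x => B x i j)) -> Ck_on k U (fun x => (A x *m B x) i j).
move=> oU sA sB;rewrite (_: (fun x => _) = fun x => \sum_h A x i h * B x h j).
 by apply: Ck_sum => // h;apply: CkM.
by apply/funext => x;rewrite mxE.
Qed.

Lemma conj_mulmx (R: realType) m l o (A: 'M[R]_(m, l)) (B: 'M[R]_(l, o)) (C: 'M[R]_o) :
 A *m (B *m C *m B^T) *m A^T = A *m B *m C *m (A *m B)^T.
by rewrite trmx_mul !mulmxA. Qed.

Section Volume.
#[local] Opaque jacobian invmx.
Context {R n M} (X: kahler_manifold R n M).
Local Notation c:= (chart_at X).

Lemma local_formE p q: cdom (c q) p ->
 mjac X (c q) p *m local_form X (kform X) q (c q p) *m (mjac X (c q) p)^T = kform X p.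
move=> qp;have U:= mjac_chart_unit qp.
rewrite /local_form diff_into_cinv // ctoK // !mulmxA mulmxV // mul1mx -mulmxA -trmx_mul.
by rewrite mulmxV // trmx1 mulmx1.
Qed.

Lemma mulmx_conj_comm m l (N: 'M[R]_(m, l)) (A J: 'M[R]_l) (J': 'M[R]_m): N^T *m J' = J *m N^T ->
 N *m A *m N^T *m J' = N *m (A *m J) *m N^T.
by move=> H;rewrite -!mulmxA H. Qed.

Lemma local_metricE p q: cdom (c q) p ->
 kmetric X p = mjac X (c q) p *m (local_form X (kform X) q (c q p) *m (mulI R n)^T) *m
  (mjac X (c q) p)^T.
move=> qp;have H: (mjac X (c q) p)^T *m (mulI R n)^T = (mulI R n)^T *m (mjac X (c q) p)^T.
 by rewrite -!trmx_mul mjac_chart_CR.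
by rewrite -(mulmx_conj_comm _ H) /kmetric -{1}(local_formE qp).
Qed.

Definition gram k (f: 'rV[R]_k -> M) x: 'M[R]_k :=
 diff_into X f x *m kmetric X (f x) *m (diff_into X f x)^T.

Lemma vol_densityE k (f: 'rV[R]_k -> M) x: vol_density X f x = Num.sqrt (\det (gram f x)).
by []. Qed.

(** [diff_into X h w] is read in the chart at [h w], which varies with [w]. Near a given point
    everything is rewritten in one fixed chart [c q], where the pullback is D G D^T with D the
    Jacobian of [c q \o h]. The lemma serves both the metric and the symplectic form. *)
Lemma pullback_smooth k (V: set 'rV[R]_k) (h: 'rV[R]_k -> M) (om: M -> 'M[R]_(n + n))
  (G: M -> 'rV[R]_(n + n) -> 'M[R]_(n + n)) i j :
 (forall p q, cdom (c q) p -> om p = mjac X (c q) p *m G q (c q p) *m (mjac X (c q) p)^T) ->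
 (forall q i j, smooth_on (cimg (c q)) (fun y => G q y i j)) -> open V -> smooth_into X V h ->
 smooth_on V (fun w => (diff_into X h w *m om (h w) *m (diff_into X h w)^T) i j).
move=> omE sG oV sh k0;apply: Ck_local => w0 Vw0;set q:= h w0.
have qq: cdom (c q) (h w0) by exact: chart_at_dom.
pose U:= V `&` h @^-1` cdom (c q).
have oU: open U by apply: (into_open oV sh);exact: cdom_open.
pose D w:= 'J (c q \o h) w.
exists (fun w => (D w *m G q (c q (h w)) *m (D w)^T) i j), U;split;[exact: oU|by split| |].
 move=> w [Vw qw];apply: (congr1 (fun A: 'M[R]_k => A i j)).
 have E1:= into_J_chart oV sh Vw qw;have E2:= omE _ _ qw.
 apply: (etrans (congr1 (fun K => diff_into X h w *m K *m (diff_into X h w)^T) E2)).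
 apply: (etrans (conj_mulmx _ _ _)).
 exact: (congr1 (fun A => A *m G q (c q (h w)) *m A^T) (esym E1)).
have sD i' j': Ck_on k0 U (fun w => D w i' j') by apply: Ck_J => //;exact: (sh.2 q k0.+1).
apply: Ck_mxmul => //.
 move=> i' j';apply: Ck_mxmul => // i2 j2.
 apply: (Ck_compR (V:= cimg (c q)) (f:= c q \o h) (g:= fun y => G q y i2 j2)) => //.
 - by move=> w [Vw qw];exists (h w).
 - exact: (sh.2 q k0).
 - exact: sG.
by move=> i' j';rewrite (_: (fun x => _) = fun w => D w j' i') //;apply/funext => w;rewrite mxE.
Qed.

Lemma local_form_smooth q i j: smooth_on (cimg (c q)) (fun y => local_form X (kform X) q y i j).
by move=> k;apply: Ck_coord;[exact: cimg_open|exact: (kform_smooth X q k)]. Qed.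

Lemma gram_smooth k (V: set 'rV[R]_k) (h: 'rV[R]_k -> M) i j: open V -> smooth_into X V h ->
 smooth_on V (fun w => gram h w i j).
apply: (pullback_smooth i j local_metricE) => q i' j' k0.
apply: (Ck_mxmul (A:= local_form X (kform X) q) (B:= fun=> (mulI R n)^T)) => [|i2 j2|*].
- exact: cimg_open.
- exact: local_form_smooth.
- exact: Ck_cst.
Qed.

Lemma gram_continuous k V (f: 'rV[R]_k -> M) x: open V -> smooth_into X V f -> V x ->
 {for x, continuous (fun y => \det (gram f y))}.
move=> oV Hf Vx;apply: (Ck_det (k:= 0) oV) => // i j;exact: (gram_smooth i j oV Hf 0%N).
Qed.

Lemma density_continuous k V (f: 'rV[R]_k -> M) x: open V -> smooth_into X V f -> V x ->
 {for x, continuous (vol_density X f)}.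
move=> oV Hf Vx;apply: (@continuous_comp _ _ _ (fun y => \det (gram f y)) Num.sqrt).
 exact: gram_continuous Hf Vx.
exact: sqrt_continuous.
Qed.

Lemma density_pre k V (f: 'rV[R]_k -> M) (h: 'rV[R]_k -> 'rV[R]_k) x: V (h x) ->
 differentiable h x -> smooth_into X V f ->
 vol_density X (f \o h) x = `|\det ('J h x)| * vol_density X f (h x).
move=> Vx dh Hf;rewrite !vol_densityE /gram (diff_into_pre Vx dh Hf) /=.
rewrite trmx_mul -!mulmxA det_mulmx !mulmxA det_mulmx det_tr -!mulmxA [_ * \det ('J h x)]mulrC mulrA.
by rewrite sqrtrM ?sqr_ge0 // -expr2 sqrtr_sqr.
Qed.

Lemma density_near k V (f g: 'rV[R]_k -> M) x: open V -> V x -> smooth_into X V g ->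
 (forall y, V y -> f y = g y) -> vol_density X f x = vol_density X g x.
by move=> oV Vx Hg E;rewrite !vol_densityE /gram (diff_into_near oV Vx E Hg) E.
Qed.

Section Transition.
Context {k: nat} (L: set M) (V V': set 'rV[R]_k) (f f': 'rV[R]_k -> M).
Hypotheses (pf: local_param X L V f) (pf': local_param X L V' f').

Definition overlap (A B: set 'rV[R]_k) (u v: 'rV[R]_k -> M): set 'rV[R]_k :=
 [set x | A x /\ exists2 y, B y & u x = v y].

Lemma overlap_open: open (overlap V V' f f').
have [oV sf _ injf Hf]:= pf;have [oV' sf' _ injf' Hf']:= pf'.
have [ O' oO' E']:= Hf' V' oV' (@subset_refl _ _).
have [ O oO E]:= Hf V oV (@subset_refl _ _).
rewrite (_: overlap _ _ _ _ = V `&` f @^-1` O');first exact: (into_open oV sf).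
apply/seteqP;split=> x [Vx];rewrite /preimage /=.
 move=> [y V'y ->];have: (f' @` V') (f' y) by exists y.
 by rewrite E' => -[].
move=> Ox;split=> //;have: (f @` V) (f x) by exists x.
rewrite E => -[Lx _];have: (f' @` V') (f x) by rewrite E'.
by move=> [y V'y <-];exists y.
Qed.

(** The change of parameters is continuous because both parametrizations have relatively open images
    in [L]. It is smooth because [f'], read in a chart and projected suitably to R^k, becomes a
    local diffeomorphism that can be inverted. *)
Lemma transition_exists: exists h: 'rV[R]_k -> 'rV[R]_k,
 (forall x, overlap V V' f f' x -> V' (h x) /\ f' (h x) = f x) /\
 smooth_on (overlap V V' f f') h.
have [oV sf _ injf Hf]:= pf;have [oV' sf' free' injf' Hf']:= pf'.
have /choice[h Hh]: forall x, exists y, overlap V V' f f' x -> V' y /\ f' y = f x.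
 move=> x;have [[Vx [y V'y E]]|n1]:= pselect (overlap V V' f f' x);last by exists 0.
 by exists y => _;split.
exists h;split=> //;have oU:= overlap_open.
have ch x: overlap V V' f f' x -> {for x, continuous h}.
 move=> Ux;have [Vhx E]:= Hh x Ux;move=> B /=.
 rewrite nbhsE /= => -[W [oW Wx] WB].
 have oWV: open (W `&` V') by exact: openI.
 have [ O oO EO]:= Hf' _ oWV (@subIsetr _ _ _).
 have Ox: O (f x).
  have: (f' @` (W `&` V')) (f x) by rewrite -E;exists (h x).
  by rewrite EO => -[].
 have N1: nbhs x (overlap V V' f f') by exact: open_nbhs_nbhs.
 have N2: nbhs x (f @^-1` O) by apply: (sf.1 x Ux.1);exact: open_nbhs_nbhs.
 apply: filterS2 N1 N2 => z Uz Oz;apply: WB.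
 have [Vhz Ez]:= Hh z Uz.
 have: (f' @` (W `&` V')) (f z).
  rewrite EO;split=> //;have [ O1 oO1 EO1]:= Hf' V' oV' (@subset_refl _ _).
  by have: (f' @` V') (f z) by [rewrite -Ez;exists (h z)];rewrite EO1 => -[].
 by move=> [y [Wy Vy] Ey];rewrite -(injf' y (h z)) // Ez.
move=> l;apply: Ck_local => x Ux;have [Vhx E]:= Hh x Ux.
pose q:= f x;pose F:= c q \o f;pose G:= c q \o f'.
have qx: cdom (c q) (f x) by exact: chart_at_dom.
have qy: cdom (c q) (f' (h x)) by rewrite E.
pose A:= 'J G (h x).
(* B is a right inverse of the Jacobian [A], so y |-> G y B has Jacobian A B = 1 at [h x]. Its local
   inverse [g] expresses [h] as g(F z B). *)
have /row_freeP[B AB]: row_free A.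
 rewrite /A /G (into_J_chart oV' sf') // /row_free mxrankMfree;first exact: (free' _ Vhx).
 by rewrite row_free_unit;exact: mjac_chart_unit.
have oW: open (V' `&` f' @^-1` cdom (c q)) by apply: (into_open oV' sf');exact: cdom_open.
have sG: smooth_on (V' `&` f' @^-1` cdom (c q)) (fun y => G y *m B).
 by move=> m;apply: Ck_mulmx => //;exact: (sf'.2 q m).
have dG: differentiable G (h x) by exact: (into_chart_diff sf').
have uJ: 'J (fun y => G y *m B) (h x) \in unitmx.
 rewrite -[fun y => _]/(mulmxr B \o G) J_comp //;last exact: differentiable_lin.
 by rewrite J_mulmx AB unitmx1.
have [V2 [g [[oV2 V2x V2V oI] [gG sg _]]]]:= inverse_function oW (conj Vhx qy) sG uJ.
pose U2:= overlap V V' f f' `&` ((f @^-1` cdom (c q)) `&` (h @^-1` V2)).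
have oU2: open U2.
 rewrite openE => z [Uz [qz Vz]];rewrite /interior /=.
 apply: filterI;first exact: open_nbhs_nbhs.
 apply: filterI.
  by apply: (sf.1 z Uz.1);apply: open_nbhs_nbhs;split=> //;exact: cdom_open.
 by apply: (ch z Uz);exact: open_nbhs_nbhs.
exists (g \o (fun z => F z *m B)), U2;split=> //.
 move=> z [Uz [qz Vz]] /=;have [_ Ez]:= Hh z Uz.
 by rewrite -[LHS](gG _ Vz) /F /G /= Ez.
apply: (Ck_comp (V:= (fun y => G y *m B) @` V2)) => //.
- move=> z [Uz [qz Vz]];exists (h z) => //;have [_ Ez]:= Hh z Uz.
 by rewrite /F /G /= Ez.
- by apply: Ck_mulmx => //;apply: Ck_mono (sf.2 q l) => z [[Vz _] [qz _]].
Qed.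

End Transition.

Lemma Cc_on k (V K: set 'rV[R]_k) (g: 'rV[R]_k -> R): open V -> compact K -> K `<=` V ->
 (forall x, V x -> {for x, continuous g}) -> (forall x, V x -> ~ K x -> g x = 0) ->
 Cc (fun x => \1_V x * g x).
move=> oV cK KV cg g0.
have cK': closed K by apply: compact_closed cK;exact: norm_hausdorff.
have Z x: ~ K x -> \1_V x * g x = 0.
 move=> nK;rewrite indicE;have [Vx|nV]:= pselect (V x);first by rewrite g0 // mulr0.
 by rewrite memNset // mul0r.
split;last first.
 have [r [_ Hr]]:= compact_bounded cK;have [r' r'0 Hr']: exists2 r': R, 0 < r' & forall x, K x -> `|x| <= r'.
  exists (`|r| + 1);first by rewrite ltr_wpDl.
  by move=> x Kx;apply: Hr => //;rewrite ltr_pwDr // ler_norm.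
 exists (r' + 1);first by rewrite addr_gt0.
 by move=> x xr;apply: Z => /Hr' H;have:= le_trans xr H;rewrite gerDl ler10.
move=> x;have [Vx|nVx]:= pselect (V x).
 have E: \1_V x * g x = g x by rewrite indicE mem_set // mul1r.
 have: {for x, continuous g} := cg x Vx.
 rewrite /prop_for /continuous_at E => H.
 apply: cvg_trans H;apply: (@near_eq_cvg _ _ (nbhs x)).
 have: \forall y \near x, V y by exact: open_nbhs_nbhs.
 by apply: filterS => y Vy;rewrite indicE mem_set // mul1r.
have nK: ~ K x by move/KV.
apply/(@cvgrPdist_le _ _ _ (nbhs x)) => e e0;rewrite (Z x nK).
have: \forall y \near x, (~` K) y by apply: open_nbhs_nbhs;split=> //;exact: closed_openC.
by apply: filterS => y nKy;rewrite Z // subrr normr0 ltW.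
Qed.

(** With two weights, one supported in each parametrized piece, the product lives on the overlap,
    where the transition map and the factor |det J| of the density match the two integrals. *)
Lemma overlap_integral k (L: set M) (V V' K K': set 'rV[R]_k) (f f': 'rV[R]_k -> M)
  (a a': M -> R): local_param X L V f -> local_param X L V' f' -> 
 msm X setT a -> msm X setT a' -> compact K -> K `<=` V -> compact K' -> K' `<=` V' ->
 (forall p, L p -> ~ (f @` K) p -> a p = 0) -> (forall p, L p -> ~ (f' @` K') p -> a' p = 0) ->
 integral_Rn (fun x => \1_V x * (a (f x) * a' (f x) * vol_density X f x)) =
 integral_Rn (fun x => \1_V' x * (a (f' x) * a' (f' x) * vol_density X f' x)).
move=> pf pf' sa sa' cK KV cK' KV' a0 a'0.
have [oV sf _ injf Hf]:= pf;have [oV' sf' _ injf' Hf']:= pf'.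
have [h [hU sh]]:= transition_exists pf pf'.
have [h' [hU' sh']]:= transition_exists pf' pf.
have Lf x: V x -> L (f x).
 have [ O _ E]:= Hf V oV (@subset_refl _ _) => Vx.
 by have: (f @` V) (f x) by [exists x];rewrite E => -[].
have Lf' x: V' x -> L (f' x).
 have [ O _ E]:= Hf' V' oV' (@subset_refl _ _) => Vx.
 by have: (f' @` V') (f' x) by [exists x];rewrite E => -[].
have ca p: {for p, continuous a} by exact: (msm_continuous openT sa).
have ca' p: {for p, continuous a'} by exact: (msm_continuous openT sa').
have cont W g x: open W -> smooth_into X W g -> W x ->
  {for x, continuous (fun x => a (g x) * a' (g x) * vol_density X g x)}.
 move=> oW sg Wx.
 have c1: {for x, continuous (a \o g)} by apply: continuous_comp;[exact: sg.1|exact: ca].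
 have c2: {for x, continuous (a' \o g)} by apply: continuous_comp;[exact: sg.1|exact: ca'].
 exact: (cvgM (cvgM c1 c2) (density_continuous oW sg Wx)).
have fK x: V x -> ~ K x -> a (f x) = 0.
 by move=> Vx nK;apply: a0;[exact: Lf|move=> [y Ky /injf E];apply: nK;rewrite -E //;exact: KV].
have fK' x: V' x -> ~ K' x -> a' (f' x) = 0.
 by move=> Vx nK;apply: a'0;[exact: Lf'|move=> [y Ky /injf' E];apply: nK;rewrite -E //;exact: KV'].
have UU' x: overlap V V' f f' x -> overlap V' V f' f (h x) /\ h' (h x) = x.
 move=> Ux;have [V'x E]:= hU x Ux.
 have Uhx: overlap V' V f' f (h x) by split=> //;exists x => //;exact: Ux.1.
 split=> //;have [Vx E']:= hU' _ Uhx;apply: injf => //;first exact: Ux.1.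
 by rewrite E' E.
have UU x: overlap V' V f' f x -> overlap V V' f f' (h' x) /\ h (h' x) = x.
 move=> Ux;have [Vx E]:= hU' x Ux.
 have Uhx: overlap V V' f f' (h' x) by split=> //;exists x => //;exact: Ux.1.
 split=> //;have [V'x E']:= hU _ Uhx;apply: injf' => //;first exact: Ux.1.
 by rewrite E' E.
have oU:= overlap_open pf pf'.
have dh x: overlap V V' f f' x -> differentiable h x by exact: (sh 1%N).1.
apply: (change_of_variables (V:= overlap V V' f f') (W:= overlap V' V f' f)
 (h:= h) (k':= h')) => //.
- exact: overlap_open pf' pf.
- move=> x Ux;have: Ck_on 0 (overlap V V' f f') (fun z => \det ('J h z)).
  by apply: Ck_det => // i j;apply: Ck_J => //;exact: sh.
 exact.
- by move=> x;exact: (sh' 1%N).1.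
- apply: (Cc_on oV cK KV) => x Vx;first exact: (cont _ _ _ _ oV sf Vx).
 by move=> nK;rewrite fK // !mul0r.
- apply: (Cc_on oV' cK' KV') => x Vx;first exact: (cont _ _ _ _ oV' sf' Vx).
 by move=> nK;rewrite fK' // mulr0 mul0r.
- move=> x nU;rewrite indicE;have [Vx|nV]:= pselect (V x);last by rewrite memNset // mul0r.
 rewrite a'0 ?mulr0 ?mul0r ?mulr0 //;first exact: Lf.
 by move=> [y Ky E];apply: nU;split=> //;exists y => //;exact: KV'.
- move=> x Ux;have [V'x E]:= hU x Ux;rewrite !indicE !mem_set //;last exact: Ux.1.
 have D1: vol_density X f x = vol_density X (f' \o h) x.
  apply: (density_near oU Ux) => [|y Uy];last by have [_ /= ->]:= hU y Uy.
  by apply: (into_pre oU oV' _ sh sf') => y /hU[].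
 rewrite (density_pre V'x (dh _ Ux) sf') in D1;move: D1.
 rewrite E;move: (vol_density X f x) (vol_density X f' (h x)) (a (f x)) (a' (f x)) => t1 t2 t3 t4 ->.
 by ring.
- move=> y nU;have cK'c: closed K' by apply: compact_closed cK';exact: norm_hausdorff.
 have [K'y|nK']:= pselect (K' y);last first.
  have: \forall z \near y, (~` K') z by apply: open_nbhs_nbhs;split=> //;exact: closed_openC.
  apply: filterS => z nKz;rewrite indicE;have [Vz|nV]:= pselect (V' z);last by rewrite memNset // mul0r.
  by rewrite fK' // mulr0 mul0r mulr0.
 (* Near a point of [K'] outside the overlap, [f'] avoids the compact and therefore closed set f(K),
    so the weight [a] vanishes on a whole neighbourhood. *)
 have cfK: closed (f @` K).
  apply: (hausdorff_compact_closed X);apply: continuous_compact => //.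
  by apply: continuous_in_subspaceT => x;rewrite inE => /KV;exact: sf.1.
 have nf: ~ (f @` K) (f' y).
  by move=> [x Kx E];apply: nU;split;[exact: KV'|exists x => //;exact: KV].
 have: \forall z \near y, V' z /\ (~` (f @` K)) (f' z).
  apply: filterI;first by apply: open_nbhs_nbhs;split=> //;exact: KV'.
  apply: (sf'.1 y (KV' _ K'y));apply: open_nbhs_nbhs;split=> //;exact: closed_openC.
 by apply: filterS => z [Vz nz];rewrite a0 ?mul0r ?mulr0 //;exact: Lf'.
Qed.

(** Each sum is refined by inserting the other partition of unity; the resulting double sums agree
    term by term. *)
Lemma is_volume_unique k (L: set M) v v': is_volume X k L v -> is_volume X k L v' -> v = v'.
move=> [m [V [f [rho [pf Hr S1 HK ->]]]]] [m' [V' [f' [rho' [pf' Hr' S1' HK' ->]]]]].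
have /choice[K {}HK]:= HK;have /choice[K' {}HK']:= HK'.
have sr j: msm X setT (rho j) by apply: smooth_fun_msm;exact: (Hr j).1.
have sr' j: msm X setT (rho' j) by apply: smooth_fun_msm;exact: (Hr' j).1.
have split_sum l (W: set 'rV[R]_k) (g: 'rV[R]_k -> M) (a: M -> R) (b: 'I_l -> M -> R) (C: set 'rV[R]_k) :
  local_param X L W g -> msm X setT a -> (forall i, msm X setT (b i)) -> compact C -> C `<=` W ->
  (forall p, L p -> ~ (g @` C) p -> a p = 0) -> (forall p, L p -> \sum_(i < l) b i p = 1) ->
  integral_Rn (fun x => \1_W x * (a (g x) * vol_density X g x)) =
  \sum_(i < l) integral_Rn (fun x => \1_W x * (a (g x) * b i (g x) * vol_density X g x)).
 move=> [oW sg _ injg Hg] sa sb cC CW a0 b1.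
 have Lg x: W x -> L (g x).
  have [ O _ E]:= Hg W oW (@subset_refl _ _) => Wx.
  by have: (g @` W) (g x) by [exists x];rewrite E => -[].
 rewrite -integral_Rn_sum;last first.
  move=> i;apply: (Cc_on oW cC CW) => x Wx.
   have c1: {for x, continuous (a \o g)}.
    by apply: continuous_comp;[exact: sg.1|exact: (msm_continuous openT sa)].
   have c2: {for x, continuous (b i \o g)}.
    by apply: continuous_comp;[exact: sg.1|exact: (msm_continuous openT (sb i))].
   exact: (cvgM (cvgM c1 c2) (density_continuous oW sg Wx)).
  move=> nC;rewrite a0 ?mul0r //;first exact: Lg.
  by move=> [y Cy /injg E];apply: nC;rewrite -E //;exact: CW.
 apply: eq_integral_Rn => x;rewrite -mulr_sumr -mulr_suml -mulr_sumr.
 rewrite !indicE;have [Wx|nW]:= pselect (W x);last by rewrite memNset // !mul0r.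
 by rewrite b1 ?mulr1 //;exact: Lg.
under eq_bigr => j _.
 have [cK KV K0]:= HK j.
 rewrite (split_sum _ _ _ _ _ _ (pf j) (sr j) sr' cK KV K0 S1');over.
under [RHS]eq_bigr => j _.
 have [cK KV K0]:= HK' j.
 rewrite (split_sum _ _ _ _ _ _ (pf' j) (sr' j) sr cK KV K0 S1);over.
rewrite exchange_big /=;apply: eq_bigr => i _;apply: eq_bigr => j _.
have [cK KV K0]:= HK j;have [cK' KV' K0']:= HK' i.
have:= overlap_integral (pf j) (pf' i) (sr j) (sr' i) cK KV cK' KV' K0 K0'.
by move=> H;apply: etrans H _;apply: eq_integral_Rn => x;rewrite (mulrC (rho j _)).
Qed.

Lemma volumeE k (L: set M) v: is_volume X k L v -> volume X k L = v.
move=> Hv;have H:= @getPex _ (is_volume X k L) (ex_intro _ v Hv).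
exact: is_volume_unique H Hv.
Qed.

End Volume.

(** * Existence of partitions of unity and comparison of volumes *)

Section VolumeExistence.
#[local] Opaque jacobian invmx vol_density diff_into.
Context {R n M} (X: kahler_manifold R n M).

(** Near-covering compactness is applied to the filter generated by the finite sequences of points
    of [K], directed by inclusion. *)
Lemma finite_subcover (T: topologicalType) (K: set T) (U: T -> set T): compact K ->
 (forall p, K p -> nbhs p (U p)) ->
 exists s: seq T, (forall p, p \in s -> K p) /\ forall x, K x -> exists2 p, p \in s & U p x.
move=> /compact_near_coveringP cK HU.
pose F (P: set (seq T)):= exists s0: seq T, (forall p, p \in s0 -> K p) /\
 forall s, (forall p, p \in s -> K p) -> {subset s0 <= s} -> P s.
have fF: Filter F.
 split;first by exists [::].
  move=> P Q [s [Ks HP]] [t [Kt HQ]];exists (s ++ t);split.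
   by move=> p;rewrite mem_cat => /orP[/Ks|/Kt].
  move=> r Kr sr;split;[apply: HP|apply: HQ] => // p ps;apply: sr;rewrite mem_cat ps ?orbT //.
 by move=> P Q PQ [s [Ks HP]];exists s;split=> // r Kr sr;apply: PQ;exact: HP.
have [|s [Ks Hs]]:= cK _ F (fun s x => exists2 p, p \in s & U p x) fF.
 move=> x Kx;exists (U x, [set s: seq T | x \in s]) => /=.
  split;first exact: HU.
  exists [:: x];split;first by move=> p;rewrite inE => /eqP ->.
  by move=> s _;apply;rewrite inE.
 by move=> [y s] /= [Uy xs];exists x.
by exists s;split=> //;exact: Hs.
Qed.

Lemma sum_prod_telescope (u: nat -> R) m :
 \sum_(j < m) u j * \prod_(i < j) (1 - u i) = 1 - \prod_(i < m) (1 - u i).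
elim: m => [|m IH];first by rewrite !big_ord0 subrr.
by rewrite !big_ord_recr /= IH;ring.
Qed.

Lemma integral_diff_ge0 k (f g: 'rV[R]_k -> R): Cc f -> Cc g ->
 (forall x, 0 <= f x - g x) -> 0 <= integral_Rn f - integral_Rn g.
by move=> Cf Cg H;rewrite -integral_RnB //;apply: integral_Rn_ge0 => //;exact: CcB. Qed.

Lemma integral_diff_gt0 k (f g: 'rV[R]_k -> R) x: Cc f -> Cc g ->
 (forall x, 0 <= f x - g x) -> 0 < f x - g x -> 0 < integral_Rn f - integral_Rn g.
by move=> Cf Cg H Hx;rewrite -integral_RnB //;apply: integral_Rn_gt0 Hx => //;exact: CcB.
Qed.

Lemma indic_diff_ge0 (T: Type) (V: set T) x (r a b: R): 0 <= r -> (V x -> b <= a) ->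
 0 <= \1_V x * (r * a) - \1_V x * (r * b).
move=> r0 H;rewrite indicE -!mulrBr;have [Vx|nV]:= pselect (V x);last by rewrite memNset // mul0r.
by rewrite mem_set // mul1r mulr_ge0 // subr_ge0 H.
Qed.

Lemma indic_diff_gt0 (T: Type) (V: set T) x (r a b: R): V x -> 0 < r -> b < a ->
 0 < \1_V x * (r * a) - \1_V x * (r * b).
by move=> Vx r0 H;rewrite indicE -!mulrBr mem_set // mul1r mulr_gt0 // subr_gt0. Qed.

(** The weights are rho_j = u_j times the product of (1 - u_i) for i < j, where the bumps u_i equal
    1 on sets covering [L]; the telescoping sum is then 1 on [L]. The property [P] lets the
    parametrizations be taken from a family adapted to the isotopy. *)
Lemma partition_exists k (L: set M) (P: set 'rV[R]_k -> ('rV[R]_k -> M) -> Prop) :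
 compact L -> L !=set0 ->
 (forall p, L p -> exists V f, [/\ local_param X L V f, P V f & (f @` V) p]) ->
 exists (m: nat) (V: 'I_m -> set 'rV[R]_k) (f: 'I_m -> 'rV[R]_k -> M) (rho: 'I_m -> M -> R),
 [/\ forall j, local_param X L (V j) (f j) /\ P (V j) (f j),
   forall j, smooth_fun X (rho j: M -> R^o) /\ forall p, 0 <= rho j p,
   forall p, L p -> \sum_(j < m) rho j p = 1 &
   forall j, exists K: set 'rV[R]_k, [/\ compact K, K `<=` V j &
    forall p, L p -> ~ (f j @` K) p -> rho j p = 0]].
move=> cL [p1 Lp1] HL.
have /choice[G HG]: forall p, exists t: set 'rV[R]_k * ('rV[R]_k -> M) * (M -> R) * set 'rV[R]_k,
 L p -> let: (V, f, b, K):= t in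
 [/\ local_param X L V f, P V f & compact K /\ K `<=` V] /\
 [/\ msm X setT b, forall x, 0 <= b x <= 1, \forall x \near p, b x = 1 &
   forall q, L q -> ~ (f @` K) q -> b q = 0].
 move=> p;have [Lp|nL]:= pselect (L p);last by exists (set0, fun=> p, fun=> 0, set0).
 have [V [f [pf PV [x0 Vx0 fx0]]]]:= HL p Lp.
 have [oV sf _ injf Hf]:= pf.
 have: nbhs x0 V by exact: open_nbhs_nbhs.
 move=> /nbhs_ballP[r /= r0 Hr].
 have r20: 0 < r / 2 by rewrite divr_gt0.
 have KV: closed_ball x0 (r / 2) `<=` V.
  move=> y;rewrite closed_ballE // /closed_ball_ /= => H;apply: Hr.
  rewrite -ball_normE /ball_ /=;apply: le_lt_trans H _.
  by rewrite ltr_pdivrMr // ltr_pMr // ltr1n.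
 have WK: ball x0 (r / 2) `<=` closed_ball x0 (r / 2).
  by move=> y;rewrite closed_ballE // -ball_normE /closed_ball_ /ball_ /= => /ltW.
 have [ O oO EO]:= Hf _ (ball_open x0 (r / 2)) (fun y By => KV _ (WK _ By)).
 have Op: O p.
  have: (f @` ball x0 (r / 2)) p by exists x0 => //;exact: ballxx.
  by rewrite EO => -[].
 have [b [C [sb b01 b1 [cC CO] b0]]]:= bump_exists X oO Op.
 exists (V, f, b, closed_ball x0 (r / 2)) => _;split;split=> //.
  by split=> //;exact: closed_ball_compact.
 move=> q Lq nq;apply: b0 => /CO Oq;apply: nq.
 have: (f @` ball x0 (r / 2)) q by rewrite EO.
 by move=> [y By <-];exists y => //;exact: WK.
pose V p:= (G p).1.1.1;pose f p:= (G p).1.1.2;pose b p:= (G p).1.2;pose K p:= (G p).2.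
have HG' p: L p -> [/\ local_param X L (V p) (f p), P (V p) (f p) & compact (K p) /\ K p `<=` V p] /\
 [/\ msm X setT (b p), forall x, 0 <= b p x <= 1, \forall x \near p, b p x = 1 &
   forall q, L q -> ~ (f p @` K p) q -> b p q = 0].
 by move=> Lp;have:= HG p Lp;rewrite /V /f /b /K;case: (G p) => -[[]].
have [D [DL LD]]:= finite_subcover (U:= fun p => [set x | b p x = 1]) cL
 (fun p Lp => let: And4 _ _ H _:= (HG' p Lp).2 in H).
pose m:= size D;pose pt (j: 'I_m):= tnth (in_tuple D) j.
have Lpt j: L (pt j) by have:= mem_tnth j (in_tuple D) => /DL.
have m0: (0 < m)%N by have [q Dq _]:= LD p1 Lp1;rewrite /m;case: (D) Dq.
pose p0:= pt (Ordinal m0).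
pose u x (i: nat): R:= b (nth p0 D i) x.
pose rho (j: 'I_m) x: R:= u x j * \prod_(i < j) (1 - u x i).
have nL i: L (nth p0 D i).
 have [im|im]:= ltnP i m;last by rewrite nth_default //;exact: Lpt.
 by have:= mem_nth p0 im => /DL.
have ptE (j: 'I_m): nth p0 D j = pt j by rewrite /pt (tnth_nth p0).
have su i: msm X setT (fun x => u x i) by have [_ []]:= HG' _ (nL i).
have u01 i x: 0 <= u x i <= 1 by have [_ [_ + _ _]]:= HG' _ (nL i);exact.
exists m, (fun j => V (pt j)), (fun j => f (pt j)), rho;split.
- by move=> j;have [[]]:= HG' _ (Lpt j).
- move=> j;split.
  apply: msm_smooth_fun;apply: msmM;[exact: openT|exact: su|].
  apply: msm_prod;first exact: openT.
  by move=> i;apply: msmB;[exact: openT|exact: msm_cst|exact: su].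
 move=> p;rewrite mulr_ge0 //;first by have /andP[]:= u01 j p.
 by apply: prodr_ge0 => i _;rewrite subr_ge0;have /andP[]:= u01 i p.
- move=> p Lp;rewrite /rho sum_prod_telescope;have [q Dq Iq]:= LD p Lp.
 have Bq: b q p = 1 by [].
 have qm: (index q D < m)%N by rewrite index_mem.
 rewrite (bigD1 (Ordinal qm)) //= /u nth_index // Bq subrr mul0r subr0 //.
- move=> j;have [[_ _ [cK KV]] [_ _ _ b0]]:= HG' _ (Lpt j).
 by exists (K (pt j));split=> // p Lp np;rewrite /rho /u ptE b0 // mul0r.
Qed.

Lemma diffeo_param k (L: set M) (phi psi: M -> M) V (f: 'rV[R]_k -> M) :
 cancel phi psi -> cancel psi phi -> smooth_self X phi -> smooth_self X psi ->
 local_param X L V f -> local_param X (phi @` L) V (phi \o f).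
move=> H1 H2 s1 s2 [oV sf free injf Hf];split.
- exact: oV.
- exact: smooth_self_into.
- move=> x Vx;rewrite (diff_into_self oV s1 sf Vx) /row_free mxrankMfree;first exact: free.
 by rewrite row_free_unit;exact: diffeo_unit H1 s1 s2.
- by move=> x y Vx Vy /(can_inj H1);exact: injf.
- move=> W oW WV;have [ O oO E]:= Hf W oW WV;exists (psi @^-1` O).
  by apply: open_comp => // x _;exact: smooth_self_continuous s2 _.
 apply/seteqP;split=> [_ [x Wx <-]|_ [[q Lq <-]]].
  have: (f @` W) (f x) by exists x.
  rewrite E => -[Lx Ox];split;first by exists (f x).
  by rewrite /preimage /= H1.
 rewrite /preimage /= H1 => Oq;have: (f @` W) q by rewrite E.
 by move=> [x Wx <-];exists x.
Qed.

(** If f parametrizes a piece of [L], then phi o f parametrizes its image, and the weights are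
    transported by the inverse [psi]. The two volumes are thus sums over the same parameter domains
    with the same weights, and only the densities differ. Strict inequality at one point suffices by
    continuity. *)
Lemma volume_lt k (L: set M) (phi: M -> M): compact L -> L !=set0 -> diffeomorphism X phi ->
 (forall p, L p -> exists V f, [/\ local_param X L V f,
   forall x: 'rV[R]_k, V x -> vol_density X (phi \o f) x <= vol_density X f x & (f @` V) p]) ->
 (exists V f (x: 'rV[R]_k), [/\ local_param X L V f, V x & vol_density X (phi \o f) x < vol_density X f x]) ->
 volume X k (phi @` L) < volume X k L.
move=> cL L0 [psi [H1 H2 s1 s2]] HL [V1 [f1 [x1 [pf1 Vx1 lt1]]]].
have [m [V [f [rho [Hf Hr S1 HK]]]]]:= partition_exists cL L0 HL.
have pf j: local_param X L (V j) (f j) by have []:= Hf j.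
have pf' j:= diffeo_param H1 H2 s1 s2 (pf j).
have vL: is_volume X k L (\sum_(j < m) integral_Rn (fun x =>
  \1_(V j) x * (rho j (f j x) * vol_density X (f j) x))).
 by exists m, V, f, rho;split.
have sr j: msm X setT (rho j) by apply: smooth_fun_msm;exact: (Hr j).1.
have vL': is_volume X k (phi @` L) (\sum_(j < m) integral_Rn (fun x =>
  \1_(V j) x * (rho j (psi ((phi \o f j) x)) * vol_density X (phi \o f j) x))).
 exists m, V, (fun j => phi \o f j), (fun j => rho j \o psi);split=> //.
 - move=> j;split;last by move=> p;exact: (Hr j).2.
  apply: msm_smooth_fun;have:= smooth_self_msm (@comp_closed_R R) s2 openT (sr j).
  by rewrite preimage_setT.
 - by move=> _ [p Lp <-];rewrite -[RHS](S1 p Lp);apply: eq_bigr => j _ /=;rewrite H1.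
 - move=> j;have [K [cK KV K0]]:= HK j;exists K;split=> // _ [p Lp <-] np /=.
  rewrite H1;apply: K0 => // -[x Kx E];apply: np;exists x => //=;by rewrite E.
rewrite (volumeE vL) (volumeE vL') -subr_gt0 -sumrB.
have [K {}HK]:= choice HK.
have Cg j g (a: M -> R): smooth_into X (V j) g -> msm X setT a ->
  (forall x, V j x -> ~ K j x -> a (g x) = 0) ->
  Cc (fun x => \1_(V j) x * (a (g x) * vol_density X g x)).
 move=> sg sa a0;have [oV _ _ _ _]:= pf j;have [cK KV _]:= HK j.
 apply: (Cc_on oV cK KV) => x Vx.
  have c1: {for x, continuous (a \o g)}.
   by apply: continuous_comp;[exact: sg.1|exact: (msm_continuous openT sa)].
  exact: (cvgM c1 (density_continuous oV sg Vx)).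
 by move=> nK;rewrite a0 // mul0r.
have Lf j x: V j x -> L (f j x).
 have [oV _ _ _ Hj]:= pf j;have [ O _ E]:= Hj _ oV (@subset_refl _ _) => Vx.
 by have: (f j @` V j) (f j x) by [exists x];rewrite E => -[].
have rK j x: V j x -> ~ K j x -> rho j (f j x) = 0.
 have [_ _ _ injf _]:= pf j;have [cK KV K0]:= HK j.
 move=> Vx nK;apply: K0;first exact: Lf.
 by move=> [y Ky /injf E];apply: nK;rewrite -E //;exact: KV.
have C1 j: Cc (fun x => \1_(V j) x * (rho j (f j x) * vol_density X (f j) x)).
 by apply: Cg;[have []:= pf j|exact: sr|exact: rK].
have C2 j: Cc (fun x => \1_(V j) x * (rho j (psi ((phi \o f j) x)) * vol_density X (phi \o f j) x)).
 apply: (Cg j (phi \o f j) (rho j \o psi));first by have []:= pf' j.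
  by have:= smooth_self_msm (@comp_closed_R R) s2 openT (sr j);rewrite preimage_setT.
 by move=> x Vx nK /=;rewrite H1;exact: rK.
have D0 j x: 0 <= \1_(V j) x * (rho j (f j x) * vol_density X (f j) x) -
  \1_(V j) x * (rho j (psi ((phi \o f j) x)) * vol_density X (phi \o f j) x).
 have -> : psi ((phi \o f j) x) = f j x:= H1 _.
 apply: indic_diff_ge0;first exact: (Hr j).2.
 by move=> Vx;exact: ((Hf j).2 x Vx).
have I0 j: 0 <= integral_Rn (fun x => \1_(V j) x * (rho j (f j x) * vol_density X (f j) x)) -
  integral_Rn (fun x => \1_(V j) x * (rho j (psi ((phi \o f j) x)) * vol_density X (phi \o f j) x)).
 exact: (integral_diff_ge0 (C1 j) (C2 j) (D0 j)).
have Lp1: L (f1 x1).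
 have [oV _ _ _ Hj]:= pf1;have [ O _ E]:= Hj _ oV (@subset_refl _ _).
 by have: (f1 @` V1) (f1 x1) by [exists x1];rewrite E => -[].
have [j rj]: exists j, 0 < rho j (f1 x1).
 apply: contrapT => Hn;have:= S1 _ Lp1;rewrite big1 => [/eqP|j _];first by rewrite eq_sym oner_eq0.
 apply/eqP;rewrite eq_le (Hr j).2 andbT leNgt;apply/negP => H;apply: Hn;by exists j.
rewrite (bigD1 j) //;apply: ltr_wpDr;first by apply: sumr_ge0 => i _;exact: I0.
have [cK KV K0]:= HK j.
have [y Ky Ey]: (f j @` K j) (f1 x1).
 by apply: contrapT => /(K0 _ Lp1) E;rewrite E ltxx in rj.
have Vy:= KV _ Ky.
apply: (integral_diff_gt0 (C1 j) (C2 j) (D0 j) (x:= y)).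
have -> : psi ((phi \o f j) y) = f j y:= H1 _.
apply: (indic_diff_gt0 Vy);first by rewrite Ey.
(* The strict inequality is known in [f1], the positive weight in [f j]. Passing from one to the
   other multiplies both densities by the same |det J h|, so strictness is preserved. *)
have [h [hU sh]]:= transition_exists pf1 (pf j).
have Ux: overlap V1 (V j) f1 (f j) x1 by split=> //;exists y.
have oU:= overlap_open pf1 (pf j).
have [Vhx E]:= hU _ Ux.
have [oV sf _ injf _]:= pf j;have [_ sf' _ _ _]:= pf' j.
have hy: h x1 = y by apply: injf => //;rewrite E Ey.
have dh: differentiable h x1 by exact: (sh 1%N).1.
have UV x: overlap V1 (V j) f1 (f j) x -> V j (h x) by move=> /hU[].
have D1: vol_density X f1 x1 = `|\det ('J h x1)| * vol_density X (f j) y.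
 rewrite -hy -(density_pre Vhx dh sf);apply: (density_near oU Ux).
  exact: (into_pre oU oV UV sh sf).
 by move=> z /hU[_ /= ->].
have D2: vol_density X (phi \o f1) x1 = `|\det ('J h x1)| * vol_density X (phi \o f j) y.
 rewrite -hy -(density_pre Vhx dh sf');apply: (density_near oU Ux).
  exact: (into_pre oU oV UV sh sf').
 by move=> z /hU[_ /= ->].
move: lt1;rewrite D1 D2 => lt1;rewrite ltNge;apply/negP => le1.
have: `|\det ('J h x1)| * vol_density X (f j) y <= `|\det ('J h x1)| * vol_density X (phi \o f j) y.
 by apply: ler_wpM2l.
by rewrite leNgt lt1.
Qed.

End VolumeExistence.

(** * The torus action, its generators, and an extreme value of the moment map *)

Section TorusAction.
#[local] Opaque jacobian invmx diff_into.
Context {R n M} (X: toric_kahler_manifold R n M).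
Local Notation c:= (chart_at X).
Local Notation J:= (mulI R n).
Local Notation "'a_ xi" := (act X (expi xi)) (at level 8, xi at level 2, format "''a_' xi").

Lemma is_derive_mx m (f: R -> 'rV[R]_m) t (v: 'rV[R]_m) :
 (forall i, is_derive t (1: R) (fun s => f s 0 i) (v 0 i)) -> is_derive t (1: R) f v.
move=> H;have D: derivable f t 1 by apply/derivable_mxP => i j;rewrite (ord1 i);have []:= H j.
split=> //;rewrite derive_mx //;apply/rowP => j;rewrite mxE.
by have [_ <-]:= H j.
Qed.

Lemma is_derive_entry m (f: R -> 'rV[R]_m) t (v: 'rV[R]_m) i :
 is_derive t (1: R) f v -> is_derive t (1: R) (fun s => f s 0 i) (v 0 i).
move=> [D <-];have /derivable_mxP D':= D;split;first exact: D'.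
by rewrite derive_mx // mxE.
Qed.

Lemma is_derive_continuous (W: normedModType R) (f: R -> W) t v :
 is_derive t (1: R) f v -> {for t, continuous f}.
by move=> [D _];apply: differentiable_continuous;exact/derivable1_diffP. Qed.

Lemma derive0_cst (f: R -> R) (a b: R): a <= b ->
 (forall t, a <= t <= b -> is_derive t (1: R) f 0) -> f b = f a.
rewrite le_eqVlt => /orP[/eqP -> //|ab] H.
have [||x _ E]:= @MVT R f (fun=> 0) a b ab.
- by move=> x;rewrite in_itv /= => /andP[/ltW xa /ltW xb];apply: H;rewrite xa.
- apply: continuous_in_subspaceT => x;rewrite inE /= in_itv /= => xab.
 exact: is_derive_continuous (H x xab).
by apply/eqP;rewrite -subr_eq0 E mul0r.
Qed.

Lemma derive0_cst_rV m (f: R -> 'rV[R]_m) (a b: R): a <= b ->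
 (forall t, a <= t <= b -> is_derive t (1: R) f 0) -> f b = f a.
move=> ab H;apply/rowP => i;apply: (derive0_cst (f:= fun s => f s 0 i)) => // t tab.
by have:= is_derive_entry i (H t tab);rewrite mxE.
Qed.

Lemma velocity_into k V (f: 'rV[R]_k -> M) (y: R -> 'rV[R]_k) t w: open V ->
 smooth_into X V f -> V (y t) -> is_derive t (1: R) y w ->
 is_velocity X (f \o y) t (w *m diff_into X f (y t)).
move=> oV sf Vy dy;have cy:= is_derive_continuous dy;split.
 by apply: continuous_comp => //;exact: sf.1.
have dc: differentiable (c (f (y t)) \o f) (y t).
 by apply: (into_chart_diff sf) => //;exact: chart_at_dom.
have:= is_derive_comp_diff dy dc.
by rewrite diffJ.
Qed.

Lemma cstarE (y: 'rV[R]_(n + n)): Cstar R n (toC y) <->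
 \prod_k (y 0 (lshift n k) ^+ 2 + y 0 (rshift n k) ^+ 2) != 0.
split=> [H|/prodf_neq0 H k].
 apply/prodf_neq0 => k _;have:= H k;rewrite !mxE;apply: contra_neq => /eqP.
 by rewrite paddr_eq0 ?sqr_ge0 // !sqrf_eq0 => /andP[/eqP -> /eqP ->].
have:= H k isT;rewrite !mxE;apply: contra_neq => /eqP;rewrite eq_complex /= => /andP[/eqP -> /eqP ->].
by rewrite !expr2 !mul0r addr0.
Qed.

Definition star_set: set 'rV[R]_(n + n):= [set y | Cstar R n (toC y)].

Lemma star_open: open star_set.
pose f (y: 'rV[R]_(n + n)): R:= \prod_k (y 0 (lshift n k) ^+ 2 + y 0 (rshift n k) ^+ 2).
have -> : star_set = f @^-1` [set t | t != 0] by apply/seteqP;split=> y /cstarE.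
have sf: Ck_on 0 setT f.
 have Hc i: Ck_on 0 setT (fun y: 'rV[R]_(n + n) => y 0 i).
  by apply: Ck_coord;[exact: openT|exact: (Ck_lin 0 setT (@idfun 'rV[R]_(n + n)))].
 apply: Ck_prod;first exact: openT.
 by move=> k;apply: CkD;[exact: openT| |];apply: CkM => //;exact: openT.
by apply: (@open_comp _ _ f) => [y _|];[exact: sf|exact: open_neq].
Qed.

Lemma act_dom_open q: open (act_dom X q).
have cl: continuous (@lsubmx R 1 (n + n) (n + n)):= linear_rV_continuous (L:= @lsubmx R 1 (n + n) (n + n)).
have cr: continuous (@rsubmx R 1 (n + n) (n + n)):= linear_rV_continuous (L:= @rsubmx R 1 (n + n) (n + n)).
apply: openI.
 by apply: (@open_comp _ _ (@lsubmx R 1 (n + n) (n + n)) star_set) => [x _|];[exact: cl|exact: star_open].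
by apply: (@open_comp _ _ (@rsubmx R 1 (n + n) (n + n)) (cimg (c q))) => [x _|];[exact: cr|exact: cimg_open].
Qed.

Lemma smooth_affine d m (A: 'M[R]_(d, m)) (v: 'rV[R]_m) (U: set 'rV[R]_d): open U -> 
 smooth_on U (fun x => x *m A + v).
move=> oU k;apply: CkD => //;last exact: Ck_cst.
exact: (Ck_lin k U (mulmxr A)).
Qed.

Lemma differentiable_affine d m (A: 'M[R]_(d, m)) (v: 'rV[R]_m) x :
 differentiable (fun x => x *m A + v) x.
by apply: (smooth_affine A v openT 1%N).1. Qed.

Lemma J_affine d m (A: 'M[R]_(d, m)) (v: 'rV[R]_m) x: 'J (fun x => x *m A + v) x = A.
apply: J_unique;first exact: differentiable_affine.
have [|_ ->]:= @is_diff_eps R _ _ (fun x => x *m A + v) x (mulmxr A) (linear_rV_continuous (L:= mulmxr A)).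
 move=> e e0;apply/nbhs_ballP;exists 1 => //= h _.
 rewrite /= mulmxDl;move: (x *m A) (h *m A) => a b.
 have -> : a + b + v - (a + v) - b = 0 by apply/rowP => i;rewrite !mxE;ring.
 by rewrite normr0 mulr_ge0 // ltW.
by [].
Qed.

Lemma act_into q: smooth_into X (act_dom X q) (act_map X (act X) q).
exact: act_smooth. Qed.

Definition orb q (y: 'rV[R]_(n + n)): M:= act X (toC y) q.

Let orb_h q (y: 'rV[R]_(n + n)): 'rV[R]_((n + n) + (n + n)) :=
 y *m row_mx 1%:M 0 + row_mx 0 (c q q).

Let orb_hE q y: orb_h q y = row_mx y (c q q).
by rewrite /orb_h mul_mx_row mulmx1 mulmx0 add_row_mx addr0 add0r. Qed.

Let orb_dom q y: star_set y -> act_dom X q (orb_h q y).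
move=> Sy;rewrite orb_hE;split;rewrite ?row_mxKl ?row_mxKr //.
by exists q => //;exact: chart_at_dom.
Qed.

Let orbE q: orb q = act_map X (act X) q \o orb_h q.
apply/funext => y;rewrite /= orb_hE /act_map row_mxKl row_mxKr ctoK //;exact: chart_at_dom.
Qed.

Lemma orb_into q: smooth_into X star_set (orb q).
have sh: smooth_on star_set (orb_h q) by apply: smooth_affine;exact: star_open.
rewrite orbE;exact: (into_pre star_open (@act_dom_open q) (@orb_dom q) sh (act_into q)).
Qed.

Lemma orb_CR q y: star_set y -> J *m diff_into X (orb q) y = diff_into X (orb q) y *m J.
move=> Sy;rewrite orbE (diff_into_pre (V:= act_dom X q));last 3 first.
- exact: orb_dom.
- exact: differentiable_affine.
- exact: act_into.
have:= act_CR (orb_dom q Sy);rewrite /orb_h J_affine => H.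
rewrite -mulmxA -H !mulmxA;congr (_ *m _).
by rewrite mul_mx_row mulmx1 mulmx0 mul_row_block !mul1mx !mul0mx !addr0.
Qed.

Let act_h (z x: 'rV[R]_(n + n)): 'rV[R]_((n + n) + (n + n)) :=
 x *m row_mx 0 1%:M + row_mx z 0.

Let act_hE z x: act_h z x = row_mx z x.
by rewrite /act_h mul_mx_row mulmx1 mulmx0 add_row_mx addr0 add0r. Qed.

Definition fromC (z: 'rV[R[i]]_n): 'rV[R]_(n + n) :=
 row_mx (\row_k complex.Re (z 0 k)) (\row_k complex.Im (z 0 k)).

Lemma fromCK z: toC (fromC z) = z.
by apply/rowP => k;rewrite /toC mxE row_mxKl row_mxKr !mxE;case: (z 0 k). Qed.

Let actE q z: act X z \o cinv (c q) = act_map X (act X) q \o act_h (fromC z).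
by apply/funext => x;rewrite /= act_hE /act_map row_mxKl row_mxKr fromCK. Qed.

Let act_domP q z x: Cstar R n z -> cimg (c q) x -> act_dom X q (act_h (fromC z) x).
by move=> Sz Ix;rewrite act_hE;split;rewrite ?row_mxKl ?row_mxKr ?fromCK. Qed.

Lemma act_smooth_self z: Cstar R n z -> smooth_self X (act X z).
move=> Sz q;have oI:= @cimg_open _ _ _ (c q).
have sh: smooth_on (cimg (c q)) (act_h (fromC z)) by exact: smooth_affine.
rewrite actE;exact: (into_pre oI (@act_dom_open q) (fun x => @act_domP q z x Sz) sh (act_into q)).
Qed.

Lemma act_diff_CR z p: Cstar R n z -> J *m diff_self X (act X z) p = diff_self X (act X z) p *m J.
move=> Sz;have Ip: cimg (c p) (c p p) by exists p => //;exact: chart_at_dom.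
rewrite /diff_self actE (diff_into_pre (V:= act_dom X p));last 3 first.
- exact: act_domP.
- exact: differentiable_affine.
- exact: act_into.
have:= act_CR (act_domP Sz Ip);rewrite /act_h J_affine => H.
rewrite -mulmxA -H !mulmxA;congr (_ *m _).
by rewrite mul_mx_row mulmx1 mulmx0 mul_row_block !mul1mx !mul0mx !addr0 !add0r.
Qed.

Lemma Cstar_expi (xi: 'rV[R]_n): Cstar R n (expi xi).
move=> k;rewrite mxE eq_complex /=;apply/negP => /andP[/eqP c0 /eqP s0].
by have:= cos2Dsin2 (xi 0 k);rewrite c0 s0 !expr2 !mul0r addr0 => /eqP;rewrite eq_sym oner_eq0.
Qed.

Lemma expiD (xi eta: 'rV[R]_n): expi (xi + eta) = map2_mx *%R (expi xi) (expi eta).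
apply/rowP => k;rewrite !mxE cosD sinD;apply/eqP;rewrite eq_complex /= eqxx /=.
by rewrite addrC.
Qed.

Lemma expi0: expi (0: 'rV[R]_n) = const_mx 1.
by apply/rowP => k;rewrite !mxE cos0 sin0. Qed.

Lemma torusD xi eta p: 'a_(xi + eta) p = 'a_xi ('a_eta p).
by rewrite expiD actM //;exact: Cstar_expi. Qed.

Lemma torus0 p: 'a_0 p = p.
by rewrite expi0 act1. Qed.

Lemma torusC z xi p: Cstar R n z -> 'a_xi (act X z p) = act X z ('a_xi p).
move=> Sz;rewrite -!actM //;try exact: Cstar_expi.
by congr (act X _ _);apply/rowP => k;rewrite !mxE mulrC.
Qed.

Lemma torus_smooth xi: smooth_self X 'a_xi.
by apply: act_smooth_self;exact: Cstar_expi. Qed.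

Definition expir (xi: 'rV[R]_n): 'rV[R]_(n + n) :=
 row_mx (\row_k cos (xi 0 k)) (\row_k sin (xi 0 k)).

Lemma toC_expir xi: toC (expir xi) = expi xi.
by apply/rowP => k;rewrite /toC mxE row_mxKl row_mxKr !mxE. Qed.

Lemma star_expir xi: star_set (expir xi).
by rewrite /star_set /= toC_expir;exact: Cstar_expi. Qed.

(** The infinitesimal generator of the real torus at [p]: [row_mx 0 xi] is the vector i xi tangent
    to the complex torus at its unit [expir 0]. *)
Definition gen p (xi: 'rV[R]_n): 'rV[R]_(n + n) :=
 row_mx 0 xi *m diff_into X (orb p) (expir 0).

Lemma is_derive_mulr (a t: R): is_derive t (1: R) (fun s: R => s * a) a.
have H:= is_deriveM (is_derive_id t (1: R)) (is_derive_cst a t (1: R)).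
by apply: (is_derive_eq H);rewrite scaler0 add0r;exact: mulr1.
Qed.

Lemma is_derive_subr (a t: R): is_derive t (1: R) (fun s: R => s - a) 1.
have H:= is_deriveB (is_derive_id t (1: R)) (is_derive_cst a t (1: R)).
by apply: (is_derive_eq H);rewrite subr0.
Qed.

Lemma is_derive_expir (xi: 'rV[R]_n): is_derive (0: R) (1: R) (fun s => expir (s *: xi)) (row_mx 0 xi).
apply: is_derive_mx => i;rewrite /expir;have [j ->|j ->]:= split_ordP i.
 rewrite row_mxEl mxE.
 under eq_fun do rewrite row_mxEl !mxE.
 have H:= @is_derive1_comp _ cos (fun s: R => s * xi 0 j) 0 _ _ (is_derive_cos (0 * xi 0 j)) (is_derive_mulr (xi 0 j) 0).
 by apply: (is_derive_eq H);rewrite mul0r sin0 oppr0 mul0r.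
rewrite row_mxEr.
under eq_fun do rewrite row_mxEr !mxE.
have H:= @is_derive1_comp _ sin (fun s: R => s * xi 0 j) 0 _ _ (is_derive_sin (0 * xi 0 j)) (is_derive_mulr (xi 0 j) 0).
by apply: (is_derive_eq H);rewrite mul0r cos0 mul1r.
Qed.

Lemma torus_velocity0 p xi: is_velocity X (fun s: R => 'a_(s *: xi) p) 0 (gen p xi).
have -> : (fun s: R => 'a_(s *: xi) p) = orb p \o (fun s => expir (s *: xi)).
 by apply/funext => s;rewrite /= /orb toC_expir.
have:= velocity_into star_open (orb_into p) (star_expir (0 *: xi)) (is_derive_expir xi).
by rewrite /= scale0r.
Qed.

Lemma velocity_shift (gam: R -> M) t v :
 is_velocity X (fun s => gam (s + t)) 0 v -> is_velocity X gam t v.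
rewrite /is_velocity add0r => -[c0 d0].
have E (T: Type) (f: R -> T): f = (fun s => f (s + t)) \o (fun s => s - t).
 by apply/funext => s /=;rewrite subrK.
split.
 rewrite (E _ gam);apply: continuous_comp;last by rewrite subrr.
 by apply: cvgB;[exact: cvg_id|exact: cvg_cst].
rewrite (E _ (c (gam t) \o gam)).
have H:= is_derive_subr t t.
have d1: differentiable (fun s: R => (c (gam t) \o gam) (s + t)) (t - t).
 by rewrite subrr;have [D _]:= d0;exact/derivable1_diffP.
have:= is_derive_comp_diff H d1.
rewrite -deriveE // subrr;have [_ <-]:= d0;exact.
Qed.

Lemma torus_velocity p xi t: is_velocity X (fun s: R => 'a_(s *: xi) p) t (gen ('a_(t *: xi) p) xi).
apply: velocity_shift;have:= torus_velocity0 ('a_(t *: xi) p) xi;congr is_velocity.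
by apply/funext => s;rewrite scalerDl torusD.
Qed.

Lemma genZ p (s: R) xi: gen p (s *: xi) = s *: gen p xi.
by rewrite /gen scalemxAl scale_row_mx scaler0. Qed.

Lemma genE p xi: gen p xi = xi *m (row_mx 0 1%:M *m diff_into X (orb p) (expir 0)).
by rewrite /gen mulmxA mul_mx_row mulmx0 mulmx1. Qed.

Lemma gen0_delta p xi: (forall k, gen p (delta_mx 0 k) = 0) -> gen p xi = 0.
move=> H;rewrite genE (_: row_mx 0 1%:M *m _ = 0) ?mulmx0 //.
by apply/row_matrixP => k;rewrite rowE row0 -genE.
Qed.

Lemma gen_act z p xi: Cstar R n z ->
 gen (act X z p) xi = gen p xi *m diff_self X (act X z) p.
move=> Sz;have sc:= smooth_self_into star_open (act_smooth_self Sz) (orb_into p).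
have E y: star_set y -> orb (act X z p) y = (act X z \o orb p) y.
 move=> Sy;rewrite /orb /= -!actM //;congr (act X _ _).
 by apply/rowP => k;rewrite !mxE mulrC.
rewrite /gen (diff_into_near star_open (star_expir 0) E sc).
rewrite (diff_into_self star_open (act_smooth_self Sz) (orb_into p) (star_expir 0)) mulmxA.
by rewrite /orb toC_expir expi0 act1.
Qed.

(** By equivariance the generator vanishes along the whole orbit of [q], so the orbit is constant as
    long as it stays in one chart. Dividing [xi] into short steps then fixes [q] for all times. *)
Lemma torus_fixed_step q xi: gen q xi = 0 -> exists2 d: R, 0 < d &
 forall s, `|s| <= d -> 'a_(s *: xi) q = q.
move=> g0;have qq:= chart_at_dom X q.
have c0: {for 0, continuous (fun s: R => 'a_(s *: xi) q)} := (torus_velocity0 q xi).1.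
have: \forall s \near (0: R), cdom (c q) ('a_(s *: xi) q).
 apply: c0;rewrite scale0r torus0;apply: open_nbhs_nbhs;split=> //;exact: cdom_open.
move=> /nbhs_ballP[d /= d0 Hd];exists (d / 2);first by rewrite divr_gt0.
have Hd' s: `|s| <= d / 2 -> cdom (c q) ('a_(s *: xi) q).
 move=> sd;apply: Hd;rewrite -ball_normE /ball_ /= sub0r normrN;apply: le_lt_trans sd _.
 by rewrite ltr_pdivrMr // ltr_pMr // ltr1n.
pose f (s: R):= c q ('a_(s *: xi) q).
have D s: `|s| <= d / 2 -> is_derive s (1: R) f 0.
 move=> sd;have:= velocity_comp (cdom_open (c q)) (@msm_chart _ _ _ X q) (Hd' s sd) (torus_velocity q xi s).
 by rewrite gen_act ?g0 ?mul0mx //;exact: Cstar_expi.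
move=> s sd;rewrite -[LHS](ctoK (Hd' s sd)) -[RHS](ctoK qq);congr (cinv _ _).
have f0: c q q = f 0 by rewrite /f scale0r torus0.
rewrite f0 -/(f s);move: (sd);rewrite ler_norml => /andP[s1 s2].
have [s0|/ltW s0]:= leP 0 s;[|symmetry];apply: derive0_cst_rV => // t /andP[t1 t2];apply: D.
 by rewrite ger0_norm // (le_trans t2).
by rewrite ler0_norm // lerNl (le_trans _ t1).
Qed.

Lemma torus_fixed q xi: gen q xi = 0 -> 'a_xi q = q.
move=> /torus_fixed_step[d d0 Hd].
have [N N0 Nd]: exists2 N: nat, (0 < N)%N & N%:R^-1 <= d.
 exists (Num.truncn d^-1).+1 => //;rewrite invf_ple ?posrE //.
 by apply: ltW;exact: truncnS_gt.
have Hm m: 'a_((m%:R * N%:R^-1) *: xi) q = q.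
 elim: m => [|m IH];first by rewrite mul0r scale0r torus0.
 rewrite -natr1 mulrDl mul1r scalerDl torusD Hd ?IH //.
 by rewrite ger0_norm ?invr_ge0.
by have:= Hm N;rewrite divff ?scale1r // pnatr_eq0 -lt0n.
Qed.

(** The lexicographic order replaces the choice of a generic direction: the coordinates of the
    moment map are maximized one after another, each on the compact set where the previous ones are
    maximal. *)
Lemma lex_max: exists m: 'rV[R]_n, (exists x, moment X x = m) /\ forall (k: 'I_n) x, (forall i: 'I_n, (i < k)%N -> moment X x 0 i = m 0 i) -> moment X x 0 k <= m 0 k.
have mc i: continuous (fun x => moment X x 0 i).
 have sm:= smooth_fun_msm (moment_smooth X).
 by move=> x;exact: (msm_continuous openT (msm_coord i openT sm)).
have H k: (k <= n)%N -> exists m: 'rV[R]_n, (exists x, forall i: 'I_n, (i < k)%N -> moment X x 0 i = m 0 i) /\ forall (j: 'I_n) x, (j < k)%N -> (forall i: 'I_n, (i < j)%N -> moment X x 0 i = m 0 i) -> moment X x 0 j <= m 0 j.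
 elim: k => [_|k IH kn];first by have [x _]:= tk_nonempty X;exists 0;split;[exists x|].
 have [m [[x0 Hx0] Hm]]:= IH (ltnW kn);pose kk:= Ordinal kn.
 pose F:= [set x | forall i: 'I_n, (i < k)%N -> moment X x 0 i = m 0 i].
 have cF: closed F.
  have -> : F = \bigcap_(i in [set i: 'I_n | (i < k)%N]) (fun x => moment X x 0 i) @^-1` [set m 0 i].
   by apply/seteqP;split=> x Hx i ik;exact: Hx.
  apply: closed_bigI => i _;apply: closed_comp => [x _|];first exact: mc.
  exact: closed_eq.
 have cF': compact F by apply: (subclosed_compact cF (tk_compact X)).
 have [z zF zmax]: exists2 z, z \in F & forall t, t \in F -> moment X t 0 kk <= moment X z 0 kk.
  apply: (@compact_EVT_max _ _ (fun x => moment X x 0 kk)) => //;first by exists x0.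
  by apply: continuous_subspaceT;exact: mc.
 exists (\row_i if (i == kk)%N then moment X z 0 kk else m 0 i).
 have E (i: 'I_n): (i < k)%N -> (\row_i if (i == kk)%N then moment X z 0 kk else m 0 i) 0 i = m 0 i.
  by move=> ik;rewrite mxE -val_eqE /= ltn_eqF.
 split.
  exists z => i;rewrite ltnS leq_eqVlt => /orP[/eqP ik|ik].
   by rewrite mxE -val_eqE /= ik eqxx;congr (moment X z 0 _);apply: val_inj.
  by rewrite E //;move: zF;rewrite inE => /(_ i ik).
 move=> j x;rewrite ltnS leq_eqVlt => /orP[/eqP jk|jk] Hx.
  have -> : j = kk by apply: val_inj.
  rewrite mxE eqxx;apply: zmax;rewrite inE => i ik.
  by rewrite Hx ?E // jk.
 rewrite E //;apply: Hm => // i ij;rewrite Hx // E //;exact: ltn_trans ij jk.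
have [m [[x Hx] Hm]]:= H n (leqnn n);exists m;split.
 by exists x;apply/rowP => i;exact: Hx.
by move=> k x' Hx';exact: Hm.
Qed.

Lemma hamiltonian_eq p xi w :
 (w *m mjac X (moment X) p *m xi^T) 0 0 = bilin (kform X p) (gen p xi) w.
rewrite -(moment_hamiltonian w (torus_velocity0 p xi)) (diff_fun_mjac (O:= setT)) //.
by apply: smooth_fun_msm;exact: moment_smooth.
Qed.

Lemma bilin_alt p v w: bilin (kform X p) v w = - bilin (kform X p) w v.
have -> : bilin (kform X p) v w = (v *m kform X p *m w^T)^T 0 0 by rewrite mxE.
by rewrite !trmx_mul trmxK kform_alt mulNmx mulmxN mxE /bilin mulmxA.
Qed.

(** By induction the generators of index i < k vanish at [q], hence along its orbit under the
    complex torus, so these moment coordinates are constant on the curve that moves [q] along the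
    positive real part of the k-th factor. There the k-th coordinate has a maximum at [q]. Its
    derivative is omega(u J, u) with u the velocity, and vanishes only if u = 0. *)
Lemma lex_gen0 (m: 'rV[R]_n) :
 (forall (k: 'I_n) x, (forall i: 'I_n, (i < k)%N -> moment X x 0 i = m 0 i) -> moment X x 0 k <= m 0 k) ->
 forall q, moment X q = m -> forall k, gen q (delta_mx 0 k) = 0.
move=> Hm q mq k;have [l]:= ubnP (val k);elim: l => // l IH in k * => kl.
(* The curve (1, .., 1 + s, .., 1) stays in the complex torus for |s| < 1; J turns its velocity [e]
   into that of the k-th circle. *)
pose e: 'rV[R]_(n + n):= row_mx (delta_mx 0 k) 0.
pose y (s: R): 'rV[R]_(n + n):= s *: e + expir 0.
have dy s: is_derive s (1: R) y e.
 have:= is_derive_segment (expir 0) (expir 0 + e) s.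
 by rewrite [expir 0 + _ - _]addrC addKr;congr is_derive;apply/funext => t;rewrite addrC.
have Sy s: `|s| < 1 -> star_set (y s).
 move=> s1 j;rewrite mxE /y /e /expir scale_row_mx add_row_mx row_mxKl row_mxKr !mxE cos0 sin0.
 rewrite eq_complex /= negb_and;apply/orP;left;apply/eqP => H.
 have: s * (j == k)%:R = -1 by lra.
 case: (j == k) => H1.
  by move: s1;rewrite mulr1 in H1;rewrite H1 normrN normr1 ltxx.
 by move: H1;rewrite mulr0 => /eqP;rewrite eq_sym oppr_eq0 oner_eq0.
pose r s:= orb q (y s).
pose u s:= e *m diff_into X (orb q) (y s).
have vr s: `|s| < 1 -> is_velocity X r s (u s).
 by move=> s1;exact: (velocity_into star_open (orb_into q) (Sy s s1) (dy s)).
have sm:= smooth_fun_msm (moment_smooth X).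
have dm s i: `|s| < 1 -> is_derive s (1: R) (fun s => moment X (r s) 0 i)
  (bilin (kform X (r s)) (gen (r s) (delta_mx 0 i)) (u s)).
 move=> s1;rewrite -hamiltonian_eq trmx_delta -colE mxE.
 by apply: (is_derive_entry (f:= moment X \o r));exact: (velocity_comp openT sm I (vr s s1)).
have r0: r 0 = q by rewrite /r /y scale0r add0r /orb toC_expir expi0 act1.
have Hi (i: 'I_n) s: (i < k)%N -> `|s| < 1 -> moment X (r s) 0 i = m 0 i.
 move=> ik s1;rewrite -mq -r0.
 have D t: `|t| < 1 -> is_derive t (1: R) (fun s => moment X (r s) 0 i) 0.
  move=> t1;have:= dm t i t1.
  have -> : gen (r t) (delta_mx 0 i) = 0.
   by rewrite /r /orb gen_act ?(IH i) ?mul0mx // ?(leq_trans ik) //;exact: (Sy t t1).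
  by rewrite /bilin !mul0mx mxE.
 have [s0|/ltW s0]:= leP 0 s;[|symmetry];apply: (derive0_cst (f:= fun s => moment X (r s) 0 i)) => // t /andP[t1 t2];apply: D.
  by rewrite ger0_norm //;apply: le_lt_trans t2 _;rewrite -(ger0_norm s0).
 by rewrite ler0_norm //;move: s1;rewrite ler0_norm //;apply: le_lt_trans;rewrite lerN2.
have n1: `|0: R| < 1 by rewrite normr0.
have D0:= dm 0 k n1.
have M0: is_derive (0: R) (1: R) (fun s => moment X (r s) 0 k) 0.
 have N1 (t: R): t \in `]-1, 1[ -> `|t| < 1 by rewrite in_itv /= ltr_norml.
 apply: (@derive1_at_max _ _ (-1) 1).
 - by rewrite -subr_ge0 opprK addr_ge0.
 - by move=> t /N1 t1;have []:= dm t k t1.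
 - by rewrite in_itv /= oppr_lt0 ltr01.
 - by move=> t /N1 t1;rewrite r0 mq;apply: Hm => i ik;exact: Hi.
have E0: bilin (kform X q) (gen q (delta_mx 0 k)) (u 0) = 0.
 have:= @derive_val _ _ _ _ _ _ _ D0;rewrite (@derive_val _ _ _ _ _ _ _ M0) r0 => H.
 exact: esym H.
have S0: star_set (y 0) by exact: Sy.
have gu: gen q (delta_mx 0 k) = u 0 *m J.
 rewrite /u -mulmxA -(orb_CR q S0) mulmxA /gen /y /e scale0r add0r;congr (_ *m _).
 by rewrite /mulI mul_row_block mulmx0 mul0mx mulmx1 addr0 mul0mx addr0.
have [u0|u0]:= eqVneq (u 0) 0;first by rewrite gu u0 mul0mx.
by have:= kform_pos X q u0;rewrite bilin_alt -gu E0 oppr0 ltxx.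
Qed.

Lemma fixed_max: exists m: 'rV[R]_n, (exists x, moment X x = m) /\ forall q, moment X q = m -> forall xi, 'a_xi q = q.
have [m [xm Hm]]:= lex_max;exists m;split=> // q qm xi.
by apply: torus_fixed;apply: gen0_delta => k;exact: (lex_gen0 Hm).
Qed.

End TorusAction.

(** * Integrals depending on a parameter *)

Section ParametricIntegral.
#[local] Opaque jacobian invmx.
Context {R: realType} {d: nat}.
Local Notation mu:= (@lebesgue_measure R).

Definition pint (b: R) (G: 'rV[R]_(1 + d) -> R) (y: 'rV[R]_d): R :=
 \int[mu]_(s in `[0, b]) G (scons s y).

Lemma Rint_bound (b C: R) (f: R -> R): 0 < b ->
 (forall s, 0 <= s <= b -> {for s, continuous f}) ->
 (forall s, 0 <= s <= b -> `|f s| <= C) -> `|\int[mu]_(s in `[0, b]) f s| <= C * b.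
move=> b0 cf Cf;have If: mu.-integrable `[0, b] (EFin \o f).
 apply: continuous_compact_integrable;first exact: segment_compact.
 by apply: continuous_in_subspaceT => s;rewrite inE /= in_itv /=;exact: cf.
apply: le_trans (le_normr_Rintegral _ If) _ => //.
have <- : \int[mu]_(s in `[0, b]) C = C * b.
 rewrite Rintegral_cst //;congr (_ * _).
 have:= @lebesgue_measure_itv R `[0, b];rewrite /= lte_fin b0 => ->.
 by rewrite oppr0 adde0.
apply: le_Rintegral => //.
- apply: continuous_compact_integrable;first exact: segment_compact.
 apply: continuous_in_subspaceT => s;rewrite inE /= in_itv /= => sb.
 by apply: (@continuous_comp _ _ _ f (fun t => `|t|));[exact: cf|exact: norm_continuous].
- apply: continuous_compact_integrable;first exact: segment_compact.
 by apply: continuous_subspaceT => t;exact: cst_continuous.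
Qed.

Lemma cont_integrable (b: R) (f: R -> R): (forall s, 0 <= s <= b -> {for s, continuous f}) ->
 mu.-integrable `[0, b] (EFin \o f).
move=> cf;apply: continuous_compact_integrable;first exact: segment_compact.
by apply: continuous_in_subspaceT => s;rewrite inE /= in_itv /=;exact: cf.
Qed.

Lemma Rintegral_sum_cont (b: R) (I: Type) (r: seq I) (f: I -> R -> R) :
 (forall i s, 0 <= s <= b -> {for s, continuous (f i)}) ->
 \int[mu]_(s in `[0, b]) (\sum_(i <- r) f i s) = \sum_(i <- r) \int[mu]_(s in `[0, b]) f i s.
move=> cf;elim: r => [|i r IH].
 under eq_Rintegral do rewrite big_nil.
 by rewrite big_nil Rintegral_cst // mul0r.
have cs s: 0 <= s <= b -> {for s, continuous (fun s => \sum_(j <- r) f j s)}.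
 move=> sb;elim: r {IH} => [|j r IHr].
  by have -> : (fun s => \sum_(j <- [::]) f j s) = fun=> 0;[apply/funext => t;rewrite big_nil|exact: cvg_cst].
 have -> : (fun s => \sum_(i <- j :: r) f i s) = (fun s => f j s + \sum_(i <- r) f i s).
  by apply/funext => t;rewrite big_cons.
 exact: (cvgD (cf j s sb) IHr).
under eq_Rintegral do rewrite big_cons.
rewrite big_cons -IH RintegralD //;first exact: cont_integrable (cf i).
exact: cont_integrable cs.
Qed.

Section Fixed.
Context (b: R) (O: set 'rV[R]_(1 + d)) (U: set 'rV[R]_d).
Hypotheses (b0: 0 < b) (oO: open O) (oU: open U).
Hypothesis UO: forall s y, 0 <= s <= b -> U y -> O (scons s y).

Lemma slice_cont (G: 'rV[R]_(1 + d) -> R) s y: {for row_mx (s%:M: 'rV_1) y, continuous G} ->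
 {for s, continuous (fun s => G (scons s y))}.
move=> cG A /= NA;have:= row_mx_near (cG A NA).
move=> [[P Q] /= [NP NQ] H];apply: filterS NQ => t Qt.
by apply: (H (y, t));split => //;exact: nbhs_singleton.
Qed.

Lemma pint_near (G: 'rV[R]_(1 + d) -> R) y0 e: Ck_on 0 O G -> U y0 -> 0 < e ->
 \forall y \near y0, forall s, 0 <= s <= b ->
  `|G (scons s y) - G (scons s y0)| <= e.
move=> cG Uy0 e0;have e20: 0 < e / 2 by rewrite divr_gt0.
have cK:= @segment_compact R 0 b.
have H: \forall y \near y0, forall s, `[0, b]%classic s ->
  `|G (scons s y) - G (scons s y0)| <= e.
 apply: (compact_near_forall cK) => s;rewrite /= in_itv /= => sb.
 have cs:= cG _ (UO sb Uy0).
 have N1: nbhs (scons s y0) (fun w => `|G w - G (scons s y0)| <= e / 2).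
  exact: (continuous_near_le e20 cs).
 have [[P Q] /= [NP NQ] HN]:= row_mx_near N1.
 exists (Q, P) => //= -[t y] /= [Qt Py].
 have h1:= HN (y, t) (conj Py Qt);have h2:= HN (y0, t) (conj (nbhs_singleton NP) Qt).
 rewrite /= in h1 h2.
 apply: le_trans (ler_distD (G (scons s y0)) _ _) _.
 by rewrite [`|G (row_mx _ y0) - _|]distrC;move: h1 h2;lra.
by apply: filterS H => y Hy s sb;apply: Hy;rewrite /= in_itv.
Qed.

Lemma pint_continuous (G: 'rV[R]_(1 + d) -> R): Ck_on 0 O G -> Ck_on 0 U (pint b G).
move=> cG y0 Uy0;apply/(@cvgrPdist_le _ _ _ (nbhs y0)) => e e0.
have eb: 0 < e / b by rewrite divr_gt0.
have N1:= pint_near cG Uy0 eb;have N2: \forall y \near y0, U y by exact: open_nbhs_nbhs.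
apply: filterS2 N1 N2 => y H Uy;rewrite distrC /pint -RintegralB //;last 2 first.
- by apply: cont_integrable => s sb;apply: slice_cont;apply: cG;exact: UO.
- by apply: cont_integrable => s sb;apply: slice_cont;apply: cG;exact: UO.
have -> : e = e / b * b by rewrite divfK // gt_eqF.
apply: Rint_bound => // s sb;apply: cvgB.
 by apply: slice_cont;apply: cG;exact: UO.
by apply: slice_cont;apply: cG;exact: UO.
Qed.

Definition pderiv (G: 'rV[R]_(1 + d) -> R) (v: 'rV[R]_d) w: R:= 'd G w (row_mx 0 v).

(** The mean value theorem bounds the remainder at each [s] by the oscillation of the [d] partial
    derivatives, which is uniformly small over the compact interval. The constant e / (b (d+1))
    accounts for the [d] terms and the length [b]. *)
Lemma pint_diff (G: 'rV[R]_(1 + d) -> R) y0: Ck_on 1 O G -> U y0 ->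
 differentiable (pint b G) y0 /\ forall v, 'd (pint b G) y0 v = pint b (pderiv G v) y0.
move=> [dG cG] Uy0;have cG0: Ck_on 0 O G by move=> w Ow;apply: differentiable_continuous;exact: dG.
pose A: 'M[R]_(d, 1):= \matrix_(i, j) pint b (pderiv G (delta_mx 0 i)) y0.
pose L: {linear 'rV[R]_d -> R} := mxcoord 0 0 \o mulmxr A.
have int_c v y: U y -> mu.-integrable `[0, b] (EFin \o (fun s => pderiv G v (scons s y))).
 by move=> Uy;apply: cont_integrable => s sb;apply: slice_cont;apply: cG;exact: UO.
have Gsum w v: pderiv G v w = \sum_i v 0 i * pderiv G (delta_mx 0 i) w.
 rewrite /pderiv {1}(row_sum_delta v) -[in LHS](mulmx1 (\sum_i _)) .
 have -> : row_mx 0 ((\sum_i v 0 i *: delta_mx 0 i) *m 1%:M) = \sum_i v 0 i *: row_mx (0: 'rV[R]_1) (delta_mx 0 i).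
  rewrite mulmx1;apply/rowP => j;rewrite summxE;case: (split_ordP j) => k ->.
   by rewrite row_mxEl mxE big1 // => i _;rewrite mxE row_mxEl mxE mulr0.
  by rewrite row_mxEr summxE;apply: eq_bigr => i _;rewrite [in LHS]mxE [in RHS]mxE row_mxEr.
 by rewrite linear_sum;apply: eq_bigr => i _;rewrite linearZ.
have LE v: L v = pint b (pderiv G v) y0.
 rewrite /L /= /mxcoord mxE /pint.
 under [RHS]eq_Rintegral do rewrite Gsum.
 rewrite (Rintegral_sum_cont _ (f:= fun i s => v 0 i * pderiv G (delta_mx 0 i) (scons s y0)));last first.
  move=> i s sb;apply: (@cvgM _ _ (nbhs s));first exact: cvg_cst.
  by apply: slice_cont;apply: cG;exact: UO.
 by apply: eq_bigr => i _;rewrite mxE RintegralZl //;exact: int_c.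
have [||D E]:= @is_diff_eps R _ _ (pint b G) y0 L;last by split=> // v;rewrite E LE.
 exact: linear_rV_continuous.
move=> e e0;pose e':= e / (b * d.+1%:R).
have e'0: 0 < e' by rewrite divr_gt0 // mulr_gt0.
have N i: \forall y \near y0, forall s, 0 <= s <= b ->
  `|pderiv G (delta_mx 0 i) (scons s y) - pderiv G (delta_mx 0 i) (scons s y0)| <= e'.
 exact: (pint_near (cG _) Uy0 e'0).
have NN: \forall y \near y0, U y /\ forall i s, 0 <= s <= b ->
  `|pderiv G (delta_mx 0 i) (scons s y) - pderiv G (delta_mx 0 i) (scons s y0)| <= e'.
 apply: filterI;first exact: open_nbhs_nbhs.
 have FF: Filter (nbhs y0) by exact: nbhs_filter.
 exact: (@filter_forall _ _ _ _ FF N).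
have /nbhs_ballP[r /= r0 Hr]:= NN.
apply/nbhs_ballP;exists r => //= h;rewrite -ball_normE /ball_ /= sub0r normrN => hr.
have yh t: 0 <= t <= 1 -> ball y0 r (y0 + t *: h).
 move=> /andP[t0 t1];rewrite -ball_normE /ball_ /= opprD addrA subrr sub0r normrN normrZ ger0_norm //.
 by apply: le_lt_trans hr;rewrite ler_piMl.
have Uh: U (y0 + h) by have:= yh 1;rewrite scale1r lexx ler01 => /(_ isT) /Hr[].
have i1 y: U y -> mu.-integrable `[0, b] (EFin \o (fun s => G (scons s y))).
 by move=> Uy;apply: cont_integrable => s sb;apply: slice_cont;apply: cG0;exact: UO.
rewrite -[(h *m A) 0 0]/(L h) LE /pint -RintegralB //;[|exact: i1|exact: i1].
rewrite -RintegralB //;last 2 first.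
- apply: (cont_integrable (f:= fun s => G (row_mx (s%:M: 'rV_1) (y0 + h)) - G (scons s y0))) => s sb.
 by apply: cvgB;apply: slice_cont;apply: cG0;exact: UO.
- exact: int_c.
have -> : e * `|h| = (e' * d%:R * `|h| + e' * `|h|) * b.
 have bd: b * d.+1%:R != 0 by rewrite mulf_neq0 ?gt_eqF // pnatr_eq0.
 have -> : (e' * d%:R * `|h| + e' * `|h|) * b = e' * (b * d.+1%:R) * `|h| by rewrite -natr1;ring.
 by rewrite /e' divfK.
apply: Rint_bound => // s sb.
 apply: cvgB;last by apply: slice_cont;apply: cG;exact: UO.
 by apply: cvgB;apply: slice_cont;apply: cG0;exact: UO.
have seg t: row_mx (s%:M: 'rV_1) y0 + t *: (row_mx (s%:M: 'rV_1) (y0 + h) - row_mx (s%:M: 'rV_1) y0) =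
  row_mx (s%:M: 'rV_1) (y0 + t *: h).
 by rewrite opp_row_mx add_row_mx subrr addrAC subrr add0r scale_row_mx scaler0 add_row_mx addr0.
have [|t tb ->]:= @mvt_rV _ _ G (scons s y0) (row_mx (s%:M: 'rV_1) (y0 + h)).
 by move=> t tb;rewrite seg;apply: dG;apply: (UO sb);exact: (Hr _ (yh t tb)).1.
rewrite seg opp_row_mx add_row_mx subrr addrAC subrr add0r -/(pderiv G h _) !Gsum -sumrB.
apply: le_trans (ler_norm_sum _ _ _) _.
apply: (@le_trans _ _ (\sum_(i < d) e' * `|h|)).
 apply: ler_sum => i _;rewrite -mulrBr normrM mulrC.
 by apply: ler_pM => //;[exact: (Hr _ (yh t tb)).2|exact: mx_norm_ge].
have -> : \sum_(i < d) e' * `|h| = e' * d%:R * `|h| by rewrite sumr_const card_ord -mulr_natr;ring.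
by rewrite lerDl mulr_ge0 // ltW.
Qed.

Lemma Ck_pderiv k (G: 'rV[R]_(1 + d) -> R) v: Ck_on k.+1 O G -> Ck_on k O (pderiv G v).
by move=> [_];exact. Qed.

Lemma Ck_pint k (G: 'rV[R]_(1 + d) -> R): Ck_on k O G -> Ck_on k U (pint b G).
elim: k G => [|k IH] G HG;first exact: pint_continuous.
have H1: Ck_on 1 O G.
 by elim: k {IH} HG => // k IHk HG;apply: IHk;exact: CkS.
split=> [y Uy|v];first exact: (pint_diff H1 Uy).1.
apply: (Ck_ext oU (g:= pint b (pderiv G v))).
 by move=> y Uy;exact: (pint_diff H1 Uy).2.
by apply: IH;exact: Ck_pderiv.
Qed.

End Fixed.

End ParametricIntegral.

Section PeriodicShift.
#[local] Opaque jacobian invmx.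
Context {R: realType}.
Local Notation mu:= (@lebesgue_measure R).

Lemma is_derive_addr (t s: R): is_derive s (1: R) (fun s: R => s + t) 1.
by have:= is_derive_subr (- t) s;rewrite opprK. Qed.

Lemma Rint_derive_on (g g': R -> R) (b: R): 0 < b ->
 (forall s, 0 <= s <= b -> is_derive s (1: R) g (g' s)) ->
 (forall s, 0 <= s <= b -> {for s, continuous g'}) ->
 \int[mu]_(s in `[0, b]) g' s = g b - g 0.
move=> b0 dg cg';rewrite /Rintegral (continuous_FTC2 (F:= g)) //.
- by apply: continuous_in_subspaceT => s;rewrite inE /= in_itv /=;exact: cg'.
- have cg s: 0 <= s <= b -> {for s, continuous g} by move=> /dg /is_derive_continuous.
 split.
 + move=> s;rewrite in_itv /= => /andP[s0 sb].
  by have []:= dg s;rewrite ?(ltW s0) ?(ltW sb).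
 + by apply: cvg_at_right_filter;apply: cg;rewrite lexx ltW.
 + by apply: cvg_at_left_filter;apply: cg;rewrite lexx ltW.
- move=> s;rewrite in_itv /= => /andP[s0 sb];rewrite derive1E.
 have D: is_derive s (1: R) g (g' s) by apply: dg;rewrite (ltW s0) (ltW sb).
 exact: (@derive_val _ _ _ _ _ _ _ D).
Qed.

Lemma Rint_derive (g g': R -> R) (b: R): 0 < b ->
 (forall s, is_derive s (1: R) g (g' s)) -> continuous g' ->
 \int[mu]_(s in `[0, b]) g' s = g b - g 0.
by move=> b0 dg cg';apply: Rint_derive_on => // s _;exact: cg'. Qed.

(** The derivative in t of the integral of g(s + t) is the integral of g' over a period, which is 0;
    the integral is therefore constant in t. To differentiate under the integral, g(s + t) is viewed
    as a function [G] of the row (s, t). *)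
Lemma Rint_shift (g g': R -> R) (b: R): 0 < b ->
 (forall s, is_derive s (1: R) g (g' s)) -> continuous g' -> (forall s, g (s + b) = g s) ->
 forall t, \int[mu]_(s in `[0, b]) g (s + t) = \int[mu]_(s in `[0, b]) g s.
move=> b0 dg cg' gb.
pose S: {linear 'rV[R]_(1 + 1) -> R} := mxcoord 0 0 \o mulmxr (col_mx 1%:M 1%:M: 'M[R]_(1 + 1, 1)).
have SE (s: R) (y: 'rV[R]_1): S (scons s y) = s + y 0 0.
 by rewrite /S /= /mxcoord mul_row_col !mulmx1 !mxE eqxx mulr1n.
pose G w:= g (S w).
have dG w: differentiable G w /\ forall v, 'd G w v = S v * g' (S w).
 have d1: differentiable S w by exact: differentiable_lin.
 have d2: differentiable g (S w) by have [D _]:= dg (S w);exact/derivable1_diffP.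
 split;first exact: differentiable_comp.
 move=> v;rewrite diff_compE // diff_linE.
 have -> : S v = S v *: 1 by exact: (esym (mulr1 _)).
 rewrite linearZ /= -deriveE //;have [_ ->]:= dg (S w).
 by rewrite -[S v *: 1]/(S v * 1) mulr1.
have HG: Ck_on 1 setT G.
 split=> [w _|v];first exact: (dG w).1.
 have -> : (fun x => 'd G x v) = fun x => S v * g' (S x) by apply/funext => x;exact: (dG x).2.
 apply: CkM;[exact: openT|exact: Ck_cst|move=> x _].
 apply: (@continuous_comp _ _ _ S g');last exact: cg'.
 exact: linear_rV_continuous.
have TT s y: 0 <= s <= b -> setT y -> setT (row_mx (s%:M: 'rV[R]_1) (y: 'rV[R]_1)) by [].
have DG y: differentiable (pint b G) y /\ forall v, 'd (pint b G) y v = 0.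
 have [D E]:= pint_diff b0 openT TT HG (I: setT y);split=> // v;rewrite E /pint /pderiv.
 under eq_Rintegral do rewrite (dG _).2 !SE.
 have H: \int[mu]_(s in `[0, b]) g' (s + y 0 0) = 0.
  have T s: is_derive s (1: R) (fun s => g (s + y 0 0)) (g' (s + y 0 0)).
   by have:= @is_derive1_comp _ g (fun s: R => s + y 0 0) s _ _ (dg (s + y 0 0)) (is_derive_addr (y 0 0) s);rewrite mulr1.
  have cT: continuous (fun s => g' (s + y 0 0)).
   by apply: cont_comp cg';apply: contD;[exact: cont_id|exact: cont_cst].
  by rewrite (Rint_derive b0 T cT) add0r [b + _]addrC gb subrr.
 rewrite RintegralZl ?H ?mulr0 //.
 have cT: continuous (fun s => g' (s + y 0 0)).
  by apply: cont_comp cg';apply: contD;[exact: cont_id|exact: cont_cst].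
 by apply: cont_integrable => s _;exact: cT.
move=> t.
have H y z: pint b G z = pint b G y.
 have [|s _ E]:= @mvt_rV _ _ (pint b G) y z;first by move=> s _;exact: (DG _).1.
 by apply/eqP;rewrite -subr_eq0 E (DG _).2.
have:= H 0 (t%:M: 'rV_1);rewrite /pint /G.
under eq_Rintegral do rewrite SE mxE eqxx mulr1n.
move=> ->;apply: eq_Rintegral => s _;by rewrite SE mxE addr0.
Qed.

End PeriodicShift.

(** * Averaging over circles and linearization of the action at a fixed point *)

Section Averaging.
#[local] Opaque jacobian invmx diff_into.
Context {R n M} (X: toric_kahler_manifold R n M).
Local Notation c:= (chart_at X).
Local Notation J:= (mulI R n).
Local Notation mu:= (@lebesgue_measure R).
Local Notation "'a_ xi" := (act X (expi xi)) (at level 8, xi at level 2, format "''a_' xi").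

(** The real torus as a subset of R^(2n); its compactness is what tube arguments over the group
    use. *)
Definition torus_set: set 'rV[R]_(n + n) :=
 [set y | forall k, y 0 (lshift n k) ^+ 2 + y 0 (rshift n k) ^+ 2 = 1].

Lemma torus_expir xi: torus_set (expir xi).
by move=> k;rewrite row_mxEl row_mxEr !mxE cos2Dsin2. Qed.

Lemma angle_exists (x y: R): x ^+ 2 + y ^+ 2 = 1 -> exists t, x = cos t /\ y = sin t.
move=> E;have x1: x \in `[-1, 1].
 rewrite in_itv /= -ler_norml -(ler_pXn2r (ltn0Sn 1)) ?nnegrE // expr1n real_normK ?num_real //.
 by rewrite -E lerDl sqr_ge0.
have x1': -1 <= x <= 1 by move: x1;rewrite in_itv.
have S: sin (acos x) = `|y| by rewrite sin_acos // -E addrC addKr sqrtr_sqr.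
have [y0|y0]:= leP 0 y.
 by exists (acos x);rewrite acosK // S ger0_norm.
by exists (- acos x);rewrite cosN sinN acosK // S ltr0_norm // opprK.
Qed.

Lemma torus_setP y: torus_set y -> exists xi, y = expir xi.
move=> H;have /choice[t Ht]:= fun k => angle_exists (H k).
exists (\row_k t k);apply/rowP => i;rewrite /expir;case: (split_ordP i) => k ->.
 by rewrite row_mxEl !mxE;have []:= Ht k.
by rewrite row_mxEr !mxE;have []:= Ht k.
Qed.

Lemma torus_compact: compact torus_set.
apply: (@subclosed_compact _ _ (closed_ball (0: 'rV[R]_(n + n)) 1));last 2 first.
- exact: closed_ball_compact.
- move=> y H;rewrite closed_ballE // /closed_ball_ /= sub0r normrN;apply: mx_norm_le => // i j.
 rewrite (ord1 i) -(ler_pXn2r (ltn0Sn 1)) ?nnegrE // expr1n real_normK ?num_real //.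
 by case: (split_ordP j) => k ->;rewrite -(H k) ?lerDl ?lerDr sqr_ge0.
have -> : torus_set = \bigcap_(k in [set: 'I_n]) (fun y: 'rV[R]_(n + n) =>
  y 0 (lshift n k) ^+ 2 + y 0 (rshift n k) ^+ 2) @^-1` [set 1].
 by apply/seteqP;split=> y H k;[move=> _|];exact: H.
apply: closed_bigI => k _;apply: closed_comp => [y _|];last exact: closed_eq.
have Hc i: Ck_on 0 setT (fun y: 'rV[R]_(n + n) => y 0 i).
 by apply: Ck_coord;[exact: openT|exact: (Ck_lin 0 setT (@idfun 'rV[R]_(n + n)))].
suff: Ck_on 0 setT (fun y: 'rV[R]_(n + n) => y 0 (lshift n k) ^+ 2 + y 0 (rshift n k) ^+ 2) by apply.
by apply: CkD;[exact: openT| |];apply: CkM => //;exact: openT.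
Qed.

Lemma act_near (D: set M) y x: open D -> star_set y -> D (act X (toC y) x) ->
 \forall x' \near x & y' \near y, D (act X (toC y') x').
move=> oD Sy Dx;have xx:= chart_at_dom X x.
pose w0: 'rV[R]_((n + n) + (n + n)):= row_mx y (c x x).
have W0: act_dom X x w0.
 by split;rewrite /w0 ?row_mxKl ?row_mxKr //;exists x.
have E0: act_map X (act X) x w0 = act X (toC y) x by rewrite /act_map row_mxKl row_mxKr ctoK.
have: \forall w \near w0, D (act_map X (act X) x w).
 by apply: ((act_into X x).1 w0 W0);apply: open_nbhs_nbhs;split=> //;rewrite E0.
move=> /nbhs_ballP[r /= r0 Hr].
have N1: \forall x' \near x, cdom (c x) x' /\ ball (c x x) r (c x x').
 apply: filterI;first by apply: open_nbhs_nbhs;split=> //;exact: cdom_open.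
 by apply: (cto_continuous xx);exact: nbhsx_ballx.
exists ([set x' | cdom (c x) x' /\ ball (c x x) r (c x x')], ball y r) => /=.
 by split=> //;exact: nbhsx_ballx.
move=> [x' y'] /= [[x'x bx] by'];have:= Hr (row_mx y' (c x x')).
rewrite /act_map row_mxKl row_mxKr ctoK //;apply.
rewrite -!ball_normE /ball_ /= in bx by' *;rewrite /w0 opp_row_mx add_row_mx.
apply: mx_norm_lt => // i j;case: (split_ordP j) => k ->.
 by rewrite row_mxEl;apply: le_lt_trans by';exact: mx_norm_ge.
by rewrite row_mxEr;apply: le_lt_trans bx;exact: mx_norm_ge.
Qed.

(** The points whose whole torus orbit stays in [D] form an invariant set, open by the tube lemma
    over the compact torus. *)
Lemma invariant_nbhd (D: set M) p: open D -> D p -> (forall xi, 'a_xi p = p) ->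
 exists N: set M, [/\ open N, N p, N `<=` D & forall xi x, N x -> N ('a_xi x)].
move=> oD Dp fp;exists [set x | forall y, torus_set y -> D (act X (toC y) x)];split.
- rewrite openE => x Hx;rewrite /interior /=.
 apply: (compact_near_forall torus_compact) => y Ty.
 have Sy: star_set y by have [xi ->]:= torus_setP Ty;exact: star_expir.
 have [[P Q] /= [NP NQ] H]:= act_near oD Sy (Hx y Ty).
 by exists (Q, P) => //= -[y' x'] /= [? ?];exact: (H (x', y')).
- by move=> y /torus_setP[xi ->];rewrite toC_expir fp.
- by move=> x /(_ _ (torus_expir 0));rewrite toC_expir torus0.
- move=> xi x H y /torus_setP[eta ->];rewrite toC_expir -torusD -toC_expir.
 by apply: H;exact: torus_expir.
Qed.

Section FixedPoint.
Context (p: M) (fp: forall xi, 'a_xi p = p).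

Definition isotropy (xi: 'rV[R]_n): 'M[R]_(n + n):= diff_self X 'a_xi p.
Local Notation rho:= isotropy.

Lemma isotropyD xi eta: rho (xi + eta) = rho xi *m rho eta.
rewrite /rho addrC;have -> : 'a_(eta + xi) = 'a_eta \o 'a_xi.
 by apply/funext => x;rewrite /= torusD.
by rewrite (diff_self_comp _ (torus_smooth X xi) (torus_smooth X eta)) fp.
Qed.

Lemma isotropy0: rho 0 = 1%:M.
rewrite /rho -(diff_self_id X p);congr diff_self;apply/funext => x;exact: torus0.
Qed.

Lemma isotropyC xi eta: rho xi *m rho eta = rho eta *m rho xi.
exact: etrans (esym (isotropyD xi eta)) (etrans (congr1 rho (addrC xi eta)) (isotropyD eta xi)). Qed.

Lemma isotropyN xi: rho xi *m rho (- xi) = 1%:M.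
by rewrite -isotropyD subrr isotropy0. Qed.

Lemma isotropy_CR xi: J *m rho xi = rho xi *m J.
by apply: act_diff_CR;exact: Cstar_expi. Qed.

Lemma bilin_ext m (A B: 'M[R]_m): (forall v w, bilin A v w = bilin B v w) -> A = B.
move=> H;apply/matrixP => i j;have:= H (delta_mx 0 i) (delta_mx 0 j).
by rewrite /bilin -!rowE trmx_delta -!colE !mxE.
Qed.

Lemma isotropy_symp xi: rho xi *m kform X p *m (rho xi)^T = kform X p.
apply: bilin_ext => v w;have:= act_symplectic X xi p v w;rewrite fp => <-.
by rewrite /bilin trmx_mul !mulmxA.
Qed.

Lemma expi_period k (t: R): expi (t *: delta_mx 0 k: 'rV[R]_n) = expi ((t + 2 * pi) *: delta_mx 0 k).
apply/rowP => j;rewrite !mxE;have [jk|jk]:= eqVneq j k;last by rewrite !andbF !mulr0.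
by rewrite !mulr1 mulr_natl cosD2pi sinD2pi.
Qed.

End FixedPoint.

End Averaging.

Lemma diff_intoE (R: realType) (n: nat) (M: topologicalType) (X: complex_manifold R n M) k
 (f: 'rV[R]_k -> M) x q: f x = q -> diff_into X f x = 'J (chart_at X q \o f) x.
by move=> <-. Qed.

Lemma mjacE (R: realType) (n: nat) (M: topologicalType) (X: complex_manifold R n M) m
 (g: M -> 'rV[R]_m) p: mjac X g p = 'J (g \o cinv (chart_at X p)) (chart_at X p p).
by []. Qed.

Lemma mulmx_comm3 (R: realType) m (v: 'rV[R]_m) (J D F Q: 'M[R]_m): J *m D = D *m J ->
 J *m F = F *m J -> J *m Q = Q *m J -> v *m J *m D *m F *m Q = v *m D *m F *m Q *m J.
move=> H1 H2 H3;rewrite -(mulmxA v J D) H1 (mulmxA v D J) -(mulmxA _ J F) H2 (mulmxA _ F J).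
by rewrite -(mulmxA _ J Q) H3 mulmxA.
Qed.

Lemma mulmx_swap (R: realType) m (u: 'rV[R]_m) (A B: 'M[R]_m): A *m B = B *m A ->
 u *m A *m B = u *m B *m A.
by move=> H;rewrite -!mulmxA H. Qed.

Lemma row_scale_mul (R: realType) m (a: R) (u: 'I_m -> R) (w: 'rV[R]_m) (A: 'M[R]_m) j :
 (forall i, w 0 i = a * u i) -> a * (\sum_i u i * A i j) = (w *m A) 0 j.
by move=> H;rewrite mxE mulr_sumr;apply: eq_bigr => i _;rewrite H mulrA. Qed.

Section Average.
#[local] Opaque jacobian invmx diff_into.
Context {R n M} (X: toric_kahler_manifold R n M).
Local Notation c:= (chart_at X).
Local Notation J:= (mulI R n).
Local Notation mu:= (@lebesgue_measure R).
Local Notation "'a_ xi" := (act X (expi xi)) (at level 8, xi at level 2, format "''a_' xi").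

Lemma smooth_expir d (U: set 'rV[R]_d) (f: 'rV[R]_d -> 'rV[R]_n): open U ->
 smooth_on U f -> smooth_on U (fun x => expir (f x)).
move=> oU sf k;apply: Ck_rV => // i;rewrite /expir;have [j ->|j ->]:= split_ordP i.
 have -> : (fun x => row_mx (\row_k0 cos (f x 0 k0)) (\row_k0 sin (f x 0 k0)) 0 (lshift n j)) = fun x => cos (f x 0 j).
  by apply/funext => x;rewrite row_mxEl mxE.
 by apply: Ck_cos => //;apply: Ck_coord => //;exact: sf.
have -> : (fun x => row_mx (\row_k0 cos (f x 0 k0)) (\row_k0 sin (f x 0 k0)) 0 (rshift n j)) = fun x => sin (f x 0 j).
 by apply/funext => x;rewrite row_mxEr mxE.
by apply: Ck_sin => //;apply: Ck_coord => //;exact: sf.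
Qed.

Lemma smooth_row_mx d m1 m2 (U: set 'rV[R]_d) (f: 'rV[R]_d -> 'rV[R]_m1) (g: 'rV[R]_d -> 'rV[R]_m2) :
 open U -> smooth_on U f -> smooth_on U g -> smooth_on U (fun x => row_mx (f x) (g x)).
move=> oU sf sg k;apply: Ck_rV => // i;have [j ->|j ->]:= split_ordP i.
 rewrite (_: (fun x => _) = fun x => f x 0 j);last by apply/funext => x;rewrite row_mxEl.
 by apply: Ck_coord => //;exact: sf.
rewrite (_: (fun x => _) = fun x => g x 0 j);last by apply/funext => x;rewrite row_mxEr.
by apply: Ck_coord => //;exact: sg.
Qed.

Lemma smooth_lin d m (U: set 'rV[R]_d) (L: {linear 'rV[R]_d -> 'rV[R]_m}): smooth_on U L.
by move=> k;exact: Ck_lin. Qed.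

Section Isotropy.
Context (p: M) (fp: forall xi, 'a_xi p = p).
Local Notation rho:= (isotropy X p).

(** The differential at [p] of the action of exp(i xi), rewritten as part of the Jacobian of the
    joint action map in one fixed chart, so that smoothness in [xi] becomes visible. *)
Lemma isotropyE xi: rho xi = row_mx 0 1%:M *m
 'J (c p \o act_map X (act X) p) (row_mx (expir xi) (c p p)).
have pp:= chart_at_dom X p.
pose h (x: 'rV[R]_(n + n)): 'rV[R]_((n + n) + (n + n)):= x *m row_mx 0 1%:M + row_mx (expir xi) 0.
have hE x: h x = row_mx (expir xi) x.
 by rewrite /h mul_mx_row mulmx1 mulmx0 add_row_mx addr0 add0r.
have E: 'a_xi \o cinv (c p) = act_map X (act X) p \o h.
 by apply/funext => x;rewrite /= hE /act_map row_mxKl row_mxKr toC_expir.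
have Dh: act_dom X p (h (c p p)).
 by rewrite hE;split;rewrite ?row_mxKl ?row_mxKr ?toC_expir;[exact: Cstar_expi|exists p].
rewrite /isotropy /diff_self E (diff_into_pre Dh (differentiable_affine _ _ _) (act_into X p)).
have Ep: act_map X (act X) p (row_mx (expir xi) (c p p)) = p.
 by rewrite /act_map row_mxKl row_mxKr toC_expir ctoK // fp.
by rewrite J_affine hE (diff_intoE X Ep).
Qed.

Lemma isotropy_smooth i j: smooth_on setT (fun xi: 'rV[R]_n => rho xi i j).
have pp:= chart_at_dom X p.
have -> : (fun xi: 'rV[R]_n => rho xi i j) = fun xi => \sum_l (row_mx 0 1%:M: 'M[R]_(n + n, (n + n) + (n + n))) i l *
  'J (c p \o act_map X (act X) p) (row_mx (expir xi) (c p p)) l j.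
 by apply/funext => xi;rewrite isotropyE mxE.
move=> k;apply: Ck_sum;first exact: openT.
move=> l;apply: CkM;[exact: openT|exact: Ck_cst|].
pose O:= act_dom X p `&` act_map X (act X) p @^-1` cdom (c p).
have oO: open O by apply: (into_open (@act_dom_open _ _ _ X p) (act_into X p));exact: cdom_open.
apply: (Ck_compR (V:= O) (f:= fun xi: 'rV[R]_n => row_mx (expir xi) (c p p))
 (g:= fun w => 'J (c p \o act_map X (act X) p) w l j)).
- exact: openT.
- move=> xi _;split.
  by split;rewrite ?row_mxKl ?row_mxKr ?toC_expir;[exact: Cstar_expi|exists p].
 by rewrite /preimage /= /act_map row_mxKl row_mxKr toC_expir ctoK // fp.
- apply: smooth_row_mx;[exact: openT| |move=> m;exact: Ck_cst].
 apply: smooth_expir;first exact: openT.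
 exact: (smooth_lin setT (@idfun 'rV[R]_n)).
- by apply: Ck_J => //;exact: ((act_into X p).2 p k.+1).
Qed.

End Isotropy.

#[local] Opaque diff_self isotropy mjac.

Definition slab q (D: set M): set 'rV[R]_(1 + (n + n)) :=
 (@rsubmx R 1 1 (n + n)) @^-1` (c q @` (cdom (c q) `&` D)).

Lemma slab_open q D: open D -> open (slab q D).
move=> oD;apply: open_comp;last exact: chart_image_open.
by move=> w _;exact: (linear_rV_continuous (L:= @rsubmx R 1 1 (n + n))).
Qed.

Definition circle (k: 'I_n) (s: R): 'rV[R]_n:= s *: delta_mx 0 k.

Lemma circleD k s t: circle k (s + t) = circle k s + circle k t.
by rewrite /circle scalerDl. Qed.

Definition fam k q (w: 'rV[R]_(1 + (n + n))): M :=
 'a_(circle k (w 0 0)) (cinv (c q) (rsubmx w)).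

Lemma smooth_circle d k (U: set 'rV[R]_d) (f: 'rV[R]_d -> R): open U -> smooth_on U f ->
 smooth_on U (fun x => circle k (f x)).
move=> oU sf l;apply: Ck_rV => // i.
rewrite (_: (fun x => _) = fun x => f x * (delta_mx 0 k: 'rV[R]_n) 0 i).
 by apply: CkM;[exact: oU|exact: sf|exact: Ck_cst].
by apply/funext => x;rewrite /circle mxE.
Qed.

Lemma fam_into k q: smooth_into X (slab q setT) (fam k q).
have oS:= @slab_open q _ (@openT M).
pose h (w: 'rV[R]_(1 + (n + n))): 'rV[R]_((n + n) + (n + n)):= row_mx (expir (circle k (w 0 0))) (rsubmx w).
have sh: smooth_on (slab q setT) h.
 apply: smooth_row_mx => //;last exact: (smooth_lin _ (@rsubmx R 1 1 (n + n))).
 apply: smooth_expir => //;apply: smooth_circle => // l.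
 by apply: Ck_coord => //;exact: (Ck_lin l _ (@idfun 'rV[R]_(1 + (n + n)))).
have E: fam k q = act_map X (act X) q \o h.
 by apply/funext => w;rewrite /= /act_map /h row_mxKl row_mxKr toC_expir.
rewrite E;apply: (into_pre oS (@act_dom_open _ _ _ X q) _ sh (act_into X q)).
move=> w [x [qx _] Ex];split;rewrite /h ?row_mxKl ?row_mxKr ?toC_expir;first exact: Cstar_expi.
by exists x.
Qed.

Context (p: M) (fp: forall xi, 'a_xi p = p) (N: set M).
Hypotheses (oN: open N) (Np: N p) (aN: forall xi x, N x -> N ('a_xi x)).
Local Notation rho:= (isotropy X p).
Local Notation b:= (2 * pi: R).

Lemma b_gt0: 0 < b. Proof. by rewrite mulr_gt0 // pi_gt0. Qed.

Definition avg_int (f: M -> 'rV[R]_(n + n)) k q j (w: 'rV[R]_(1 + (n + n))): R :=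
 (f (fam k q w) *m rho (- circle k (w 0 0))) 0 j.

Lemma avg_int_smooth f k q j: msm X N f -> smooth_on (slab q N) (avg_int f k q j).
move=> sf;have oS:= @slab_open q _ oN;have oT:= @slab_open q _ (@openT M).
have H1: smooth_on (slab q N) (f \o fam k q).
 move=> l;have:= comp_into oT (@fam_into k q) (@comp_closed_rV R (n + n)) oN sf l.
 apply: Ck_mono => w [x [qx Nx] Ex];split;first by exists x.
 by rewrite /preimage /= /fam -Ex ctoK //;exact: aN.
have H2 i: smooth_on (slab q N) (fun w => rho (- circle k (w 0 0)) i j).
 move=> l;apply: (Ck_compR (V:= setT) (f:= fun w: 'rV[R]_(1 + (n + n)) => - circle k (w 0 0))
   (g:= fun xi => rho xi i j)) => //;last exact: isotropy_smooth.
 have -> : (fun w: 'rV[R]_(1 + (n + n)) => - circle k (w 0 0)) = fun w => circle k (- w 0 0).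
  by apply/funext => w;rewrite /circle scaleNr.
 apply: smooth_circle => // m;apply: CkN => //;apply: Ck_coord => //.
 exact: (Ck_lin m _ (@idfun 'rV[R]_(1 + (n + n)))).
move=> l;rewrite (_: avg_int f k q j = fun w => \sum_i (f \o fam k q) w 0 i * rho (- circle k (w 0 0)) i j).
 apply: Ck_sum => // i;apply: CkM => //;last exact: H2.
 by apply: Ck_coord => //;exact: H1.
by apply/funext => w;rewrite /avg_int mxE.
Qed.

(** Bochner's averaging: the mean over the k-th circle of f(e^(is) x) rho(-s), with rho the isotropy
    representation. Averaging one circle at a time keeps all integrals one-dimensional. *)
Definition avg (f: M -> 'rV[R]_(n + n)) k x: 'rV[R]_(n + n) :=
 \row_j (b^-1 * \int[mu]_(s in `[0, b]) (f ('a_(circle k s) x) *m rho (- circle k s)) 0 j).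

Lemma fam_row k q s y: fam k q (scons s y) = 'a_(circle k s) (cinv (c q) y).
rewrite /fam row_mxKr;congr ('a_(circle k _) _).
rewrite (_: (0: 'I_(1 + (n + n))) = lshift (n + n) 0);last exact: val_inj.
by rewrite (row_mxEl (s%:M: 'rV[R]_1) y) mxE eqxx mulr1n.
Qed.

Lemma avg_int_row f k q j s y: avg_int f k q j (scons s y) =
 (f ('a_(circle k s) (cinv (c q) y)) *m rho (- circle k s)) 0 j.
rewrite /avg_int fam_row;congr ((_ *m rho (- circle k _)) 0 j).
rewrite (_: (0: 'I_(1 + (n + n))) = lshift (n + n) 0);last exact: val_inj.
by rewrite (row_mxEl (s%:M: 'rV[R]_1) y) mxE eqxx mulr1n.
Qed.

Lemma avgE f k q y: avg f k (cinv (c q) y) = \row_j (b^-1 * pint b (avg_int f k q j) y).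
apply/rowP => j;rewrite [LHS]mxE [RHS]mxE /pint;apply: (congr1 (fun t => b^-1 * t));apply: eq_Rintegral => s _.
by rewrite avg_int_row.
Qed.

Lemma slab_row q (y: 'rV[R]_(n + n)) s: (c q @` (cdom (c q) `&` N)) y ->
 slab q N (scons s y).
by move=> Hy;rewrite /slab /preimage /= row_mxKr. Qed.

Lemma avg_smooth f k: msm X N f -> msm X N (avg f k).
move=> sf q l;have oI:= @chart_image_open _ _ _ (c q) _ oN.
rewrite (_: avg f k \o cinv (c q) = fun y => \row_j (b^-1 * pint b (avg_int f k q j) y));last first.
 by apply/funext => y /=;rewrite avgE.
apply: Ck_rV => // j.
rewrite (_: (fun x => _) = fun y => b^-1 * pint b (avg_int f k q j) y);last first.
 by apply/funext => y;rewrite mxE.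
apply: CkM => //;first exact: Ck_cst.
apply: (Ck_pint b_gt0 oI _ (avg_int_smooth k q j sf l)).
by move=> s y _;exact: slab_row.
Qed.

Lemma mjac_self (phi: M -> M) m (O: set M) (g: M -> 'rV[R]_m) x: smooth_self X phi -> open O ->
 msm X O g -> O (phi x) -> mjac X (fun z => g (phi z)) x = diff_self X phi x *m mjac X g (phi x).
move=> sp oO sg Ox;have xx:= chart_at_dom X x.
have H:= into_J (@cimg_open _ _ _ (c x)) (sp x) oO sg (x:= c x x).
rewrite /= ctoK // in H;apply: H => //;by exists x.
Qed.

Lemma avg_pderiv f k x (v: 'rV[R]_(n + n)) j s: msm X N f -> N x ->
 pderiv (avg_int f k x j) v (row_mx (s%:M: 'rV_1) (c x x)) =
 (v *m diff_self X 'a_(circle k s) x *m mjac X f ('a_(circle k s) x) *m rho (- circle k s)) 0 j.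
move=> sf Nx;have xx:= chart_at_dom X x.
have Ix: (c x @` (cdom (c x) `&` N)) (c x x) by exists x.
rewrite /pderiv.
pose h (y: 'rV[R]_(n + n)): 'rV[R]_(1 + (n + n)):= y *m row_mx 0 1%:M + row_mx (s%:M: 'rV_1) 0.
have hE y: h y = row_mx (s%:M: 'rV_1) y.
 by rewrite /h mul_mx_row mulmx1 mulmx0 add_row_mx addr0 add0r.
have Sx: slab x N (h (c x x)) by rewrite hE;exact: slab_row.
have dG: differentiable (avg_int f k x j) (h (c x x)) by apply: (avg_int_smooth k x j sf 1%N).1.
have dh: differentiable h (c x x) by exact: differentiable_affine.
have -> : row_mx 0 v = 'd h (c x x) v :> 'rV[R]_(1 + (n + n)).
 by rewrite diffJ // J_affine mul_mx_row mulmx0 mulmx1.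
rewrite -hE -(diff_compE _ dh dG).
pose g (z: M):= f ('a_(circle k s) z) *m rho (- circle k s).
have sg0: msm X N (fun z => f ('a_(circle k s) z)).
 have:= smooth_self_msm (@comp_closed_rV R (n + n)) (torus_smooth X (circle k s)) oN sf.
 by apply: msm_mono => z;exact: aN.
have sg: msm X N g by exact: msm_mulmx.
rewrite (_: avg_int f k x j \o h = fun y => (g \o cinv (c x)) y 0 j);last first.
 by apply/funext => y;rewrite /= hE avg_int_row.
have dg:= msm_diff0 sg Nx.
have mg: mjac X g x = diff_self X 'a_(circle k s) x *m mjac X f ('a_(circle k s) x) *m rho (- circle k s).
 by rewrite (mjac_mulmx _ sg0 Nx) (mjac_self (torus_smooth X _) oN sf);last exact: aN.
by rewrite (diff_mxcoordE _ _ _ dg) (diffJ _ dg) -mjacE mg !mulmxA.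
Qed.

Lemma avg_mjac f k x (v: 'rV[R]_(n + n)) j: msm X N f -> N x ->
 (v *m mjac X (avg f k) x) 0 j = b^-1 * \int[mu]_(s in `[0, b])
  (v *m diff_self X 'a_(circle k s) x *m mjac X f ('a_(circle k s) x) *m rho (- circle k s)) 0 j.
move=> sf Nx;have xx:= chart_at_dom X x;have oI:= @chart_image_open _ _ _ (c x) _ oN.
have Ix: (c x @` (cdom (c x) `&` N)) (c x x) by exists x.
have HS s y: 0 <= s <= b -> (c x @` (cdom (c x) `&` N)) y -> slab x N (scons s y).
 by move=> _;exact: slab_row.
have [D E]:= pint_diff b_gt0 oI HS (avg_int_smooth k x j sf 1%N) Ix.
have dA:= msm_diff0 (avg_smooth k sf) Nx.
apply: (@etrans _ _ ('d (fun y => (avg f k \o cinv (c x)) y 0 j) (c x x) v)).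
 by rewrite (diff_mxcoordE _ _ _ dA) (diffJ _ dA).
rewrite (_: (fun y => (avg f k \o cinv (c x)) y 0 j) = fun y => b^-1 * pint b (avg_int f k x j) y);last first.
 by apply/funext => y;rewrite /= avgE mxE.
have -> : 'd (fun y => b^-1 * pint b (avg_int f k x j) y) (c x x) v = b^-1 * 'd (pint b (avg_int f k x j)) (c x x) v.
 by rewrite -[fun y => _]/(b^-1 *: pint b (avg_int f k x j)) diffZ.
rewrite E /pint;apply: (congr1 (fun t => b^-1 * t));apply: eq_Rintegral => s _;exact: avg_pderiv.
Qed.

Lemma Rint_mulmx m (g: R -> 'rV[R]_m) (A: 'M[R]_m) j :
 (forall i s, 0 <= s <= b -> {for s, continuous (fun s => g s 0 i)}) ->
 \int[mu]_(s in `[0, b]) (g s *m A) 0 j = \sum_i (\int[mu]_(s in `[0, b]) g s 0 i) * A i j.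
move=> cg;under eq_Rintegral do rewrite mxE.
rewrite (Rintegral_sum_cont _ (f:= fun i s => g s 0 i * A i j)).
 by apply: eq_bigr => i _;rewrite RintegralZr //;apply: cont_integrable => s;exact: cg.
by move=> i s sb;apply: (@cvgM _ _ (nbhs s));[exact: cg|exact: cvg_cst].
Qed.

Lemma Rint_cst (C: R): \int[mu]_(s in `[0, b]) C = C * b.
rewrite Rintegral_cst //;congr (_ * _).
have:= @lebesgue_measure_itv R `[0, b];rewrite /= lte_fin b_gt0 => ->.
by rewrite oppr0 adde0.
Qed.

Lemma avg_cont (f: M -> 'rV[R]_(n + n)) k x j (s: R): msm X N f -> N x ->
 {for s, continuous (fun s => (f ('a_(circle k s) x) *m rho (- circle k s)) 0 j)}.
move=> sf Nx;have xx:= chart_at_dom X x.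
have -> : (fun s => (f ('a_(circle k s) x) *m rho (- circle k s)) 0 j) =
  fun s => avg_int f k x j (row_mx (s%:M: 'rV_1) (c x x)).
 by apply/funext => t;rewrite avg_int_row ctoK.
apply: slice_cont;apply: (avg_int_smooth k x j sf 0%N);apply: slab_row;by exists x.
Qed.

Definition equivariant (f: M -> 'rV[R]_(n + n)) xi: Prop :=
 forall x, N x -> f ('a_xi x) = f x *m rho xi.

(** The torus is commutative, so averaging over one circle keeps the equivariance already obtained
    for the others. *)
Lemma avg_equivariant f k xi: msm X N f -> equivariant f xi -> equivariant (avg f k) xi.
move=> sf Hf x Nx;apply/rowP => j;rewrite [LHS]mxE.
have -> : \int[mu]_(s in `[0, b]) (f ('a_(circle k s) ('a_xi x)) *m rho (- circle k s)) 0 j =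
  \int[mu]_(s in `[0, b]) (f ('a_(circle k s) x) *m rho (- circle k s) *m rho xi) 0 j.
 apply: eq_Rintegral => s _;rewrite torusC;last exact: Cstar_expi.
 rewrite (Hf _ (aN _ Nx));exact: (congr1 (fun u: 'rV[R]_(n + n) => u 0 j)) (mulmx_swap _ (isotropyC fp _ _)).
rewrite (Rint_mulmx (g:= fun s => f ('a_(circle k s) x) *m rho (- circle k s)));last first.
 by move=> i s _;exact: avg_cont.
by apply: row_scale_mul => i;rewrite mxE.
Qed.

(** Moving [x] by t along the circle shifts the periodic integrand by t, at the price of the
    constant factor rho(t). *)
Lemma avg_circle f k t: msm X N f -> equivariant (avg f k) (circle k t).
move=> sf x Nx;have xx:= chart_at_dom X x;apply/rowP => j;rewrite [LHS]mxE.
pose g i s:= (f ('a_(circle k s) x) *m rho (- circle k s)) 0 i.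
have -> : \int[mu]_(s in `[0, b]) (f ('a_(circle k s) ('a_(circle k t) x)) *m rho (- circle k s)) 0 j =
  \int[mu]_(s in `[0, b]) (f ('a_(circle k (s + t)) x) *m rho (- circle k (s + t)) *m rho (circle k t)) 0 j.
 apply: eq_Rintegral => s _;rewrite -torusD -circleD -[in RHS]mulmxA -(isotropyD fp).
 by congr ((_ *m rho _) 0 j);rewrite circleD opprD subrK.
rewrite (Rint_mulmx (g:= fun s => f ('a_(circle k (s + t)) x) *m rho (- circle k (s + t))));last first.
 move=> i s _;apply: (@continuous_comp _ _ _ (fun s => s + t) (g i));last exact: avg_cont.
 by apply: cvgD;[exact: cvg_id|exact: cvg_cst].
apply: row_scale_mul => i;rewrite mxE;apply: (congr1 (fun t => b^-1 * t));symmetry.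
pose e: 'rV[R]_(1 + (n + n)):= row_mx (1%:M: 'rV_1) 0.
pose w (s: R): 'rV[R]_(1 + (n + n)):= row_mx (s%:M: 'rV_1) (c x x).
have Sw s: slab x N (w s) by apply: slab_row;exists x.
have sG:= avg_int_smooth k x i sf.
have gE s: g i s = avg_int f k x i (w s) by rewrite /g avg_int_row ctoK.
have dw s: is_derive s (1: R) w e.
 have:= is_derive_segment (w 0) (w 0 + e) s.
 rewrite [w 0 + e - _]addrC addKr;congr is_derive;apply/funext => r.
 by rewrite /w /e scale_row_mx add_row_mx scaler0 addr0 scalemx1 -raddfD add0r.
have dg s: is_derive s (1: R) (g i) ('d (avg_int f k x i) (w s) e).
 have -> : g i = avg_int f k x i \o w by apply/funext => r;rewrite gE.
 by apply: is_derive_comp_diff (dw s) _;apply: (sG 1%N).1.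
apply: (Rint_shift b_gt0 dg) => [s|s].
 apply: (@slice_cont _ _ (fun w => 'd (avg_int f k x i) w e) s (c x x)).
 by apply: ((sG 1%N).2 e);exact: Sw.
have P r: expi (circle k (r + b)) = expi (circle k r).
 by rewrite /circle -expi_period.
rewrite /g P;congr ((_ *m diff_self X (act X _) p) 0 i).
have N1 r: - circle k r = circle k (- r) by rewrite /circle scaleNr.
by rewrite !N1 -(P (- (s + b))) opprD subrK.
Qed.

(** At the fixed point the integrand of the derivative is rho(s) rho(-s) = 1, so averaging preserves
    the property of being a chart. *)
Lemma avg_mjac_p f k: msm X N f -> mjac X f p = 1%:M -> mjac X (avg f k) p = 1%:M.
move=> sf f1;apply: mx_rV_ext => v;apply/rowP => j;rewrite avg_mjac //.
have -> : \int[mu]_(s in `[0, b]) (v *m diff_self X 'a_(circle k s) p *m mjac X f ('a_(circle k s) p) *m rho (- circle k s)) 0 j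
 = \int[mu]_(s in `[0, b]) v 0 j.
 by apply: eq_Rintegral => s _;rewrite fp f1 mulmx1 -mulmxA (isotropyN fp) mulmx1.
by rewrite Rint_cst mulrC mulfK ?mulmx1 // gt_eqF // b_gt0.
Qed.

Lemma avg_p f k: f p = 0 -> avg f k p = 0.
move=> f0;apply/rowP => j;rewrite [LHS]mxE.
have -> : \int[mu]_(s in `[0, b]) (f ('a_(circle k s) p) *m rho (- circle k s)) 0 j = \int[mu]_(s in `[0, b]) 0.
 by apply: eq_Rintegral => s _;rewrite fp f0 mul0mx mxE.
by rewrite Rint_cst mul0r mulr0 mxE.
Qed.

(** All three factors in the derivative of the integrand commute with J, the action and the isotropy
    representation being holomorphic. *)
Lemma avg_CR f k: msm X N f -> (forall x, N x -> J *m mjac X f x = mjac X f x *m J) ->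
 forall x, N x -> J *m mjac X (avg f k) x = mjac X (avg f k) x *m J.
move=> sf Hf x Nx;have xx:= chart_at_dom X x;apply: mx_rV_ext => v;apply/rowP => j.
rewrite !mulmxA avg_mjac //.
have -> : \int[mu]_(s in `[0, b]) (v *m J *m diff_self X 'a_(circle k s) x *m mjac X f ('a_(circle k s) x) *m rho (- circle k s)) 0 j
 = \int[mu]_(s in `[0, b]) (v *m diff_self X 'a_(circle k s) x *m mjac X f ('a_(circle k s) x) *m rho (- circle k s) *m J) 0 j.
 apply: eq_Rintegral => s _;apply: (congr1 (fun u: 'rV[R]_(n + n) => u 0 j)).
 have C1:= act_diff_CR X x (Cstar_expi (circle k s)).
 have C2:= Hf _ (aN (circle k s) Nx);have C3:= isotropy_CR X p (- circle k s).
 exact: (mulmx_comm3 v C1 C2 C3).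
rewrite (Rint_mulmx (g:= fun s => v *m diff_self X 'a_(circle k s) x *m mjac X f ('a_(circle k s) x) *m rho (- circle k s)));last first.
 move=> i s _.
 have -> : (fun s => (v *m diff_self X 'a_(circle k s) x *m mjac X f ('a_(circle k s) x) *m rho (- circle k s)) 0 i) =
   fun s => pderiv (avg_int f k x i) v (row_mx (s%:M: 'rV_1) (c x x)).
  by apply/funext => r;rewrite avg_pderiv.
 apply: slice_cont;apply: ((avg_int_smooth k x i sf 1%N).2);apply: slab_row;by exists x.
apply: row_scale_mul => i;exact: avg_mjac.
Qed.

End Average.

Section Linearization.
#[local] Opaque jacobian invmx diff_into.
Context {R n M} (X: toric_kahler_manifold R n M).
Local Notation c:= (chart_at X).
Local Notation J:= (mulI R n).
Local Notation "'a_ xi" := (act X (expi xi)) (at level 8, xi at level 2, format "''a_' xi").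

(** The centred holomorphic chart at [p] is averaged over the n circles in turn. The result is still
    holomorphic with identity differential at [p], and intertwines the action with the isotropy
    representation. *)
Lemma linearization p: (forall xi, 'a_xi p = p) -> exists (N: set M) (Z: M -> 'rV[R]_(n + n)),
 [/\ open N, N p & forall xi x, N x -> N ('a_xi x)] /\
 [/\ msm X N Z, Z p = 0, mjac X Z p = 1%:M,
   forall x, N x -> J *m mjac X Z x = mjac X Z x *m J &
   forall xi x, N x -> Z ('a_xi x) = Z x *m isotropy X p xi].
move=> fp;have pp:= chart_at_dom X p.
have [N [oN Np Nc aN]]:= invariant_nbhd (cdom_open (c p)) pp fp.
pose Q (f: M -> 'rV[R]_(n + n)):= [/\ msm X N f, f p = 0, mjac X f p = 1%:M &
 forall x, N x -> J *m mjac X f x = mjac X f x *m J].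
have H (s: seq 'I_n): exists2 f, Q f & forall k t, k \in s -> equivariant X p N f (circle k t).
 elim: s => [|k s [f [sf f0 f1 fJ] Hf]].
  have sc: msm X N (c p) by apply: msm_mono Nc _;exact: msm_chart.
  pose f x:= c p x - c p p.
  have mf x: N x -> mjac X f x = mjac X (c p) x.
   move=> Nx;rewrite (mjac_post (k:= fun y => y - c p p) sc Nx).
    rewrite (_: (fun y => y - c p p) = fun y => y *m 1%:M - c p p).
     by rewrite J_affine mulmx1.
    by apply/funext => y;rewrite mulmx1.
   rewrite (_: (fun y => y - c p p) = fun y => y *m 1%:M - c p p);first exact: differentiable_affine.
   by apply/funext => y;rewrite mulmx1.
  exists f => //;split.
  - by apply: msmD => //;exact: msm_cst.
  - exact: subrr.
  - by rewrite mf // mjac_chart_self.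
  - by move=> x Nx;rewrite mf //;apply: mjac_chart_CR;exact: Nc.
 exists (avg X p f k);first split.
 - exact: avg_smooth.
 - exact: avg_p.
 - by first [exact: (avg_mjac_p fp oN Np aN k sf f1) | exact: (avg_mjac_p fp oN aN k sf f1) | exact: (avg_mjac_p fp oN Np aN sf f1)].
 - exact: avg_CR.
 - move=> l t;rewrite inE => /orP[/eqP ->|ls];first exact: avg_circle.
  by apply: avg_equivariant => //;exact: Hf.
have [Z [sZ Z0 Z1 ZJ] HZ]:= H (enum 'I_n).
exists N, Z;split=> //;split=> // xi.
rewrite (row_sum_delta xi).
elim: (index_enum _) => [|k s IH] x Nx.
 by rewrite big_nil torus0 isotropy0 mulmx1.
have Hk t: equivariant X p N Z (circle k t) by apply: HZ;rewrite mem_enum.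
rewrite big_cons torusD (Hk (xi 0 k) _ (aN _ _ Nx)) (IH x Nx).
exact: etrans (esym (mulmxA _ _ _)) (congr1 (mulmx (Z x)) (etrans (isotropyC fp _ _) (esym (isotropyD fp _ _)))).
Qed.

End Linearization.

(** * Weights of the isotropy representation *)

Section Weights.
#[local] Opaque invmx.
Context {R: realType} {n: nat}.
Local Notation C:= (R[i]).
Local Notation J:= (mulI R n).

Definition cmx (B: 'M[R]_(n + n)): 'M[C]_n :=
 \matrix_(i, j) (B (lshift n i) (lshift n j) +i* B (lshift n i) (rshift n j))%C.

(** The real matrix of right multiplication by [P] on rows x + i y, written as (x | y). [cmx] is its
    inverse on the matrices commuting with J. *)
Definition rmx (P: 'M[C]_n): 'M[R]_(n + n) :=
 block_mx (map_mx (@complex.Re R) P) (map_mx (@complex.Im R) P)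
      (- map_mx (@complex.Im R) P) (map_mx (@complex.Re R) P).

Definition frc (w: 'rV[C]_n): 'rV[R]_(n + n) :=
 row_mx (map_mx (@complex.Re R) w) (map_mx (@complex.Im R) w).

Lemma mulI_row (x y: 'rV[R]_n): row_mx x y *m J = row_mx (- y) x.
by rewrite /mulI mul_row_block !mulmx0 mulmxN !mulmx1 add0r addr0. Qed.

Lemma mulI_sqr: J *m J = - 1%:M.
rewrite /mulI mulmx_block !mulmx0 !mul0mx !mulmx1 !mul1mx !addr0 !add0r.
by rewrite (@scalar_mx_block R n n 1) opp_block_mx !oppr0.
Qed.

Lemma Re_sum (I: Type) (r: seq I) (F: I -> C): complex.Re (\sum_(i <- r) F i) = \sum_(i <- r) complex.Re (F i).
by apply: (big_morph (@complex.Re R)) => // -[a b] [a' b']. Qed.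

Lemma Im_sum (I: Type) (r: seq I) (F: I -> C): complex.Im (\sum_(i <- r) F i) = \sum_(i <- r) complex.Im (F i).
by apply: (big_morph (@complex.Im R)) => // -[a b] [a' b']. Qed.

Lemma ReM (a b: C): complex.Re (a * b) = complex.Re a * complex.Re b - complex.Im a * complex.Im b.
by case: a b => [a a'] [b b']. Qed.

Lemma ImM (a b: C): complex.Im (a * b) = complex.Re a * complex.Im b + complex.Im a * complex.Re b.
by case: a b => [a a'] [b b']. Qed.

Lemma frc_mul (w: 'rV[C]_n) (P: 'M[C]_n): frc (w *m P) = frc w *m rmx P.
rewrite /frc /rmx mul_row_block;congr row_mx;apply/rowP => j;rewrite !mxE ?Re_sum ?Im_sum.
 by rewrite -big_split;apply: eq_bigr => i _;rewrite !mxE ReM mulrN.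
by rewrite -big_split;apply: eq_bigr => i _;rewrite !mxE ImM.
Qed.

Lemma rmx_mul (P Q: 'M[C]_n): rmx (P *m Q) = rmx P *m rmx Q.
rewrite /rmx mulmx_block;congr block_mx;apply/matrixP => i j;rewrite !mxE ?Re_sum ?Im_sum -?sumrN.
- by rewrite -big_split;apply: eq_bigr => k _;rewrite !mxE ReM mulrN.
- by rewrite -big_split;apply: eq_bigr => k _;rewrite !mxE ImM.
- by rewrite -big_split;apply: eq_bigr => k _;rewrite !mxE ImM /=;ring.
- by rewrite -big_split;apply: eq_bigr => k _;rewrite !mxE ReM /=;ring.
Qed.

Lemma rmx1: rmx 1%:M = 1%:M.
rewrite /rmx (@scalar_mx_block R n n 1);congr block_mx;apply/matrixP => i j;rewrite !mxE;
 by case: (i == j) => //=;rewrite oppr0.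
Qed.

Lemma rmx_unit (P: 'M[C]_n): P \in unitmx -> rmx P \in unitmx.
move=> uP;have: rmx P *m rmx (invmx P) = 1%:M by rewrite -rmx_mul mulmxV // rmx1.
by move=> H;exact: (mulmx1_unit H).1.
Qed.

Lemma rmx_CR (P: 'M[C]_n): J *m rmx P = rmx P *m J.
rewrite /rmx /mulI !mulmx_block !mulmx0 !mul0mx !mulmx1 !mul1mx !addr0 !add0r !mulmxN !mulNmx.
by rewrite !mulmx1 !mul1mx.
Qed.

Lemma cmxK (B: 'M[R]_(n + n)): J *m B = B *m J -> rmx (cmx B) = B.
move=> H;have [E1 E2]: dlsubmx B = - ursubmx B /\ drsubmx B = ulsubmx B.
 move: H;rewrite -{1 2}[B]submxK /mulI !mulmx_block !mulmx0 !mul0mx !mulmx1 !mul1mx !addr0 !add0r.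
 by rewrite !mulmxN !mulNmx !mulmx1 !mul1mx => /eq_block_mx[E1 E2 _ _].
rewrite /rmx -[RHS]submxK E1 E2;congr block_mx;apply/matrixP => i j;rewrite !mxE //=.
Qed.

Lemma frc_inj: injective frc.
move=> u v /eq_row_mx[E1 E2];apply/rowP => j.
have:= congr1 (fun Q: 'rV_n => Q 0 j) E1;have:= congr1 (fun Q: 'rV_n => Q 0 j) E2;rewrite !mxE.
by case: (u 0 j) (v 0 j) => [a b] [a' b'] /= -> ->.
Qed.

Lemma rmx_inj: injective rmx.
move=> u v /eq_block_mx[/matrixP E1 /matrixP E2 _ _];apply/matrixP => i j.
have:= E1 i j;have:= E2 i j;rewrite !mxE.
by case: (u i j) (v i j) => [a b] [a' b'] /= -> ->.
Qed.

Lemma frc0: frc 0 = 0.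
by rewrite -[RHS]row_mx0 /frc;congr row_mx;apply/rowP => j;rewrite !mxE. Qed.

Lemma frcZ (a b: R) (w: 'rV[C]_n): frc ((a +i* b)%C *: w) = a *: frc w + b *: (frc w *m J).
rewrite /frc mulI_row !scale_row_mx add_row_mx;congr row_mx;apply/rowP => j;rewrite !mxE.
 by rewrite ReM /= mulrN.
by rewrite ImM /= addrC [b * _ + _]addrC.
Qed.

Section Skew.
Context (om: 'M[R]_(n + n)).
Hypothesis omJ: forall v w, bilin om (v *m J) (w *m J) = bilin om v w.
Hypothesis om_pos: forall v, v != 0 -> 0 < bilin om v (v *m J).

(** J-linear and infinitesimally symplectic: skew-hermitian for the hermitian form attached to
    [om]. *)
Definition skew (A: 'M[R]_(n + n)): Prop :=
 J *m A = A *m J /\ forall v w, bilin om (v *m A) w + bilin om v (w *m A) = 0.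

Lemma bilinDl (A: 'M[R]_(n + n)) u v w: bilin A (u + v) w = bilin A u w + bilin A v w.
by rewrite /bilin !mulmxDl mxE. Qed.

Lemma bilinDr (A: 'M[R]_(n + n)) u v w: bilin A w (u + v) = bilin A w u + bilin A w v.
by rewrite /bilin linearD mulmxDr mxE. Qed.

Lemma bilinZl (A: 'M[R]_(n + n)) a v w: bilin A (a *: v) w = a * bilin A v w.
by rewrite /bilin -!scalemxAl mxE. Qed.

Lemma bilinZr (A: 'M[R]_(n + n)) a v w: bilin A v (a *: w) = a * bilin A v w.
by rewrite /bilin linearZ /= -scalemxAr mxE. Qed.

Lemma bilinJ v w: bilin om (v *m J) w = - bilin om v (w *m J).
by rewrite -(omJ v (w *m J)) -mulmxA mulI_sqr mulmxN mulmx1 -(scaleN1r w) bilinZr mulN1r opprK.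
Qed.

Lemma skew_sub (A: 'M[R]_(n + n)) b: skew A -> skew (A - b *: J).
move=> [AJ As];split;first by rewrite mulmxBr mulmxBl AJ -scalemxAl -scalemxAr.
move=> v w;rewrite !mulmxBr -!scalemxAr -!scaleNr bilinDl bilinDr bilinZl bilinZr bilinJ.
by rewrite addrACA As add0r mulrN addNr.
Qed.

Lemma om_eq0 v: bilin om v (v *m J) = 0 -> v = 0.
by move=> E;apply/eqP;apply: contraT => /om_pos;rewrite E ltxx.
Qed.

(** om(vA, vAJ) = om(vA, (vJ)A) = - om(vAA, vJ) = 0, and positivity gives vA = 0: a skew matrix has
    no nilpotent part at 0. *)
Lemma skew_ker (A: 'M[R]_(n + n)) (v: 'rV[R]_(n + n)): skew A -> v *m A *m A = 0 -> v *m A = 0.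
move=> [AJ As] H;apply: om_eq0;rewrite -mulmxA -AJ mulmxA.
have:= As (v *m A) (v *m J);rewrite H /bilin !mul0mx mxE add0r;exact.
Qed.

(** For a row v with v A = a v + b v J, evaluating the skewness on v and v J leaves a multiple of a
    times om(v, vJ) > 0. *)
Lemma skew_eigen (A: 'M[R]_(n + n)) (w: 'rV[C]_n) (mu: C): skew A -> w != 0 ->
 w *m cmx A = mu *: w -> complex.Re mu = 0.
case: mu => a b [AJ As] w0 /(congr1 frc);rewrite frc_mul cmxK // frcZ => E /=.
have v0: frc w != 0 by apply: contra w0 => /eqP E0;apply/eqP;apply: frc_inj;rewrite E0 frc0.
have:= As (frc w) (frc w *m J);rewrite -mulmxA AJ mulmxA E mulmxDl -!scalemxAl -mulmxA mulI_sqr.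
rewrite mulmxN mulmx1 scalerN bilinDl bilinDr !bilinZl bilinZr -scaleNr bilinZr.
have Z: bilin om (frc w *m J) (frc w *m J) = bilin om (frc w) (frc w) by exact: omJ.
rewrite Z mulNr addrACA subrr addr0 -mulrDr => /eqP;rewrite mulf_eq0 => /orP[/eqP //|].
by rewrite gt_eqF // addr_gt0 // om_pos.
Qed.

(** Generalized eigenvectors are eigenvectors. The eigenvalue is purely imaginary, say i b, so A - b
    J is again skew and [skew_ker] applies. *)
Lemma skew_cker (A: 'M[R]_(n + n)) (w: 'rV[C]_n) (mu: C): skew A ->
 w *m (cmx A - mu%:M) *m (cmx A - mu%:M) = 0 -> w *m (cmx A - mu%:M) = 0.
move=> sA H;have [//|w0]:= eqVneq (w *m (cmx A - mu%:M)) 0.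
have E: w *m (cmx A - mu%:M) *m cmx A = mu *: (w *m (cmx A - mu%:M)).
 by apply/eqP;rewrite -subr_eq0 -mul_mx_scalar -mulmxBr H.
have a0:= skew_eigen sA w0 E;case: mu a0 w0 E H => a b /= -> w0 E H.
have R1 u: frc (u *m (cmx A - (0 +i* b)%C%:M)) = frc u *m (A - b *: J).
 rewrite mulmxBr mul_mx_scalar mulmxBr -scalemxAr -(cmxK sA.1) -frc_mul cmxK;last exact: sA.1.
 have FB (x y: 'rV[C]_n): frc (x - y) = frc x - frc y.
  rewrite /frc opp_row_mx add_row_mx;congr row_mx;apply/rowP => j;rewrite !mxE;
  by case: (x 0 j) (y 0 j) => [? ?] [? ?].
 by rewrite FB frcZ scale0r add0r.
apply: frc_inj;rewrite frc0 R1;apply: skew_ker;first exact: skew_sub.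
by rewrite -!R1 H frc0.
Qed.

End Skew.

End Weights.

Section Diagonalization.
#[local] Opaque invmx.
Context {R: realType} {n': nat}.
Local Notation n:= n'.+1.
Local Notation C:= (R[i]).
Local Notation J:= (mulI R n).
Context (om: 'M[R]_(n + n)).
Hypothesis omJ: forall v w, bilin om (v *m J) (w *m J) = bilin om v w.
Hypothesis om_pos: forall v, v != 0 -> 0 < bilin om v (v *m J).

Lemma annihilator_sqr (A: 'M[R]_(n + n)) (a: C) (q: {poly C}): skew om A ->
 horner_mx (cmx A) (('X - a%:P) * (('X - a%:P) * q)) = 0 -> horner_mx (cmx A) (('X - a%:P) * q) = 0.
move=> sA;rewrite !rmorphM /= rmorphB /= horner_mx_X horner_mx_C => H.
have E: horner_mx (cmx A) q *m (cmx A - a%:M) *m (cmx A - a%:M) = 0.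
 rewrite -[RHS]H -!mulmxE !mulmxA.
 have CC: comm_mx (cmx A - a%:M) (horner_mx (cmx A) q).
  apply: comm_mx_sym;apply: comm_mxB;last exact: comm_mx_scalar.
  by apply: comm_mx_sym;exact: comm_mx_horner.
 by rewrite -(mulmxA _ _ (horner_mx (cmx A) q)) CC mulmxA CC.
rewrite -mulmxE;have -> : (cmx A - a%:M) *m horner_mx (cmx A) q = horner_mx (cmx A) q *m (cmx A - a%:M).
 apply: comm_mx_sym;apply: comm_mxB;last exact: comm_mx_scalar.
 by apply: comm_mx_sym;exact: comm_mx_horner.
apply/row_matrixP => i;rewrite row0 row_mul;apply: (skew_cker omJ om_pos sA).
by rewrite -!row_mul E row0.
Qed.

Lemma annihilator_undup (A: 'M[R]_(n + n)) (rs: seq C) (q: {poly C}): skew om A ->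
 horner_mx (cmx A) ((\prod_(x <- rs) ('X - x%:P)) * q) = 0 ->
 horner_mx (cmx A) ((\prod_(x <- undup rs) ('X - x%:P)) * q) = 0.
move=> sA;elim: rs q => [|x rs IH] q //=;rewrite big_cons => H.
have {}H: horner_mx (cmx A) ((\prod_(y <- undup rs) ('X - y%:P)) * (('X - x%:P) * q)) = 0.
 by apply: IH;rewrite -[RHS]H;congr (horner_mx _ _);rewrite mulrCA mulrA.
case: ifP => [xrs|_];last by rewrite big_cons -[RHS]H;congr (horner_mx _ _);rewrite mulrCA mulrA.
have xu: x \in undup rs by rewrite mem_undup.
rewrite (big_rem x xu) /= -mulrA;apply: annihilator_sqr => //.
by rewrite -[RHS]H (big_rem x xu) /=;congr (horner_mx _ _);ring.
Qed.

Lemma skew_diagonalizable (A: 'M[R]_(n + n)): skew om A ->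
 exists2 P: 'M[C]_n, P \in unitmx & similar_diag P (cmx A).
move=> sA;apply/diagonalizableP.
have [rs E]:= closed_field_poly_normal (char_poly (cmx A)).
exists (undup rs);first exact: undup_uniq.
apply: mxminpoly_min;have:= annihilator_undup (rs:= rs) (q:= 1) sA;rewrite !mulr1;apply.
have:= Cayley_Hamilton (cmx A);rewrite E.
by rewrite (monicP (char_poly_monic _)) scale1r.
Qed.

(** Commuting diagonalizable matrices have a common eigenbasis; [L k j] is the imaginary part of the
    j-th eigenvalue of [As k], the real part being 0 by skewness. *)
Lemma weights (As: 'I_n -> 'M[R]_(n + n)): (forall k, skew om (As k)) ->
 (forall k l, As k *m As l = As l *m As k) ->
 exists (D: 'M[R]_(n + n)) (L: 'M[R]_n), [/\ D \in unitmx, J *m D = D *m J &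
  forall k, As k *m D = D *m (diag_mx (row_mx (row k L) (row k L)) *m J)].
move=> sAs cAs.
pose fs:= [seq cmx (As k) | k <- enum 'I_n].
have H1: {in fs &, forall f g, comm_mx f g}.
 move=> f g /mapP[k _ ->] /mapP[l _ ->];apply: rmx_inj.
 by rewrite !rmx_mul (cmxK (sAs k).1) (cmxK (sAs l).1) cAs.
have H2 f: f \in fs -> exists2 P: 'M[C]_n, P \in unitmx & similar_diag P f.
 by move=> /mapP[k _ ->];exact: skew_diagonalizable.
have [P uP /allP HP]:= (codiagonalizableP fs).1 (conj H1 H2).
have /choice[T HT]: forall k, exists T: 'M[C]_n, [/\ is_diag_mx T,
  P *m cmx (As k) = T *m P & cmx (As k) *m invmx P = invmx P *m T].
 move=> k;exists (P *m cmx (As k) *m invmx P).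
 have /HP: cmx (As k) \in fs by apply: map_f;rewrite mem_enum.
 rewrite /= /similar_to /= conjumx // => d;split=> //;first by rewrite mulmxKV.
 by rewrite -!mulmxA mulKmx.
pose L: 'M[R]_n:= \matrix_(k, j) complex.Im (T k j j).
have T0 k i j: i != j -> T k i j = 0 by have [/is_diag_mxP dT _ _]:= HT k;exact: dT.
have TE k: T k = \matrix_(i, j) (if i == j then (0 +i* L k j)%C else 0).
 apply/matrixP => i j;rewrite [RHS]mxE;have [<-|ij]:= eqVneq i j;last exact: T0.
 have [_ PT _]:= HT k.
 have Ei: row i P *m cmx (As k) = T k i i *: row i P.
  rewrite -row_mul PT row_mul;apply/rowP => l;rewrite [LHS]mxE (bigD1 i) //= big1 => [|m mi].
   by rewrite addr0 !mxE.
  by rewrite mxE T0 ?mul0r // eq_sym.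
 have r0: row i P != 0.
  apply/eqP => r0;have:= congr1 (row i) (mulmxV uP);rewrite row_mul r0 mul0mx row1 => /rowP/(_ i).
  by rewrite !mxE !eqxx => /eqP;rewrite eq_sym oner_eq0.
 by have:= skew_eigen omJ om_pos (sAs k) r0 Ei;rewrite mxE;case: (T k i i) => a b /= ->.
exists (rmx (invmx P)), L;split.
- by apply: rmx_unit;rewrite unitmx_inv.
- exact: rmx_CR.
- move=> k;rewrite -{1}(cmxK (sAs k).1) -rmx_mul.
 have -> : cmx (As k) *m invmx P = invmx P *m T k by have []:= HT k.
 rewrite rmx_mul;congr (_ *m _);rewrite TE /rmx /mulI diag_mx_row mulmx_block.
 rewrite !mulmx0 !mul0mx !mulmx1 !addr0 !add0r mulmxN mulmx1.
 congr block_mx;apply/matrixP => i j;rewrite !mxE;case: eqVneq => [E|_] /=;rewrite ?oppr0 ?mulr1n ?mulr0n ?oppr0 ?E //.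
Qed.

End Diagonalization.

Section MatrixDerivative.
Context {R: realType}.

Definition is_dmx m l (B: R -> 'M[R]_(m, l)) (A: 'M[R]_(m, l)): Prop :=
 forall i j, is_derive (0: R) (1: R) (fun s => B s i j) (A i j).

Lemma is_dmx_unique m l (B: R -> 'M[R]_(m, l)) A A': is_dmx B A -> is_dmx B A' -> A = A'.
move=> H H';apply/matrixP => i j.
by rewrite -(@derive_val _ _ _ _ _ _ _ (H i j)) (@derive_val _ _ _ _ _ _ _ (H' i j)).
Qed.

Lemma is_dmx_ext m l (B B': R -> 'M[R]_(m, l)) A: (forall s, B s = B' s) -> is_dmx B A -> is_dmx B' A.
by move=> /funext <-. Qed.

Lemma is_dmx_cst m l (C: 'M[R]_(m, l)): is_dmx (fun=> C) 0.
by move=> i j;rewrite mxE;exact: is_derive_cst. Qed.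

Lemma is_derive_sum_seq (I: Type) (r: seq I) (f: I -> R -> R) (a: I -> R) (t: R) :
 (forall i, is_derive t (1: R) (f i) (a i)) ->
 is_derive t (1: R) (fun s => \sum_(i <- r) f i s) (\sum_(i <- r) a i).
move=> H;elim: r => [|i r IH].
 rewrite big_nil (_: (fun s => _) = cst 0);first exact: is_derive_cst.
 by apply/funext => s;rewrite big_nil.
rewrite big_cons (_: (fun s => _) = f i + fun s => \sum_(j <- r) f j s);first exact: is_deriveD.
by apply/funext => s;rewrite big_cons.
Qed.

Lemma is_dmx_mulr m l k (B: R -> 'M[R]_(m, l)) A (C: 'M[R]_(l, k)): is_dmx B A ->
 is_dmx (fun s => B s *m C) (A *m C).
move=> H i j;rewrite mxE (_: (fun s => _) = fun s => \sum_k B s i k * C k j);last first.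
 by apply/funext => s;rewrite mxE.
apply: is_derive_sum_seq => h.
rewrite (_: (fun s => _) = C h j *: (fun s => B s i h));last first.
 by apply/funext => s;rewrite mulrC.
by rewrite mulrC;exact: is_deriveZ (H i h).
Qed.

Lemma is_dmx_tr m l (B: R -> 'M[R]_(m, l)) A: is_dmx B A -> is_dmx (fun s => (B s)^T) A^T.
move=> H i j;rewrite mxE (_: (fun s => _) = fun s => B s j i) //.
by apply/funext => s;rewrite mxE.
Qed.

Lemma is_dmx_mull m l k (B: R -> 'M[R]_(m, l)) A (C: 'M[R]_(k, m)): is_dmx B A ->
 is_dmx (fun s => C *m B s) (C *m A).
move=> H;have:= is_dmx_tr (is_dmx_mulr C^T (is_dmx_tr H)).
rewrite trmx_mul !trmxK;congr is_dmx;apply/funext => s;by rewrite trmx_mul !trmxK.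
Qed.

Lemma is_dmx_mul m l k (B: R -> 'M[R]_(m, l)) A (C: R -> 'M[R]_(l, k)) D: is_dmx B A ->
 is_dmx C D -> is_dmx (fun s => B s *m C s) (A *m C 0 + B 0 *m D).
move=> H K i j;rewrite !mxE -big_split /=.
rewrite (_: (fun s => _) = fun s => \sum_k B s i k * C s k j);last first.
 by apply/funext => s;rewrite mxE.
apply: is_derive_sum_seq => h;rewrite addrC.
have:= is_deriveM (H i h) (K h j).
by rewrite /GRing.scale /= [X in _ + X]mulrC.
Qed.

End MatrixDerivative.

(** Evaluating polynomials at a matrix uses the ring of square matrices of successor size; here the
    dimension becomes a variable again. *)
Lemma weights_pos (R: realType) n (om: 'M[R]_(n + n)) (As: 'I_n -> 'M[R]_(n + n)): (0 < n)%N ->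
 (forall v w, bilin om (v *m mulI R n) (w *m mulI R n) = bilin om v w) ->
 (forall v, v != 0 -> 0 < bilin om v (v *m mulI R n)) ->
 (forall k, skew om (As k)) -> (forall k l, As k *m As l = As l *m As k) ->
 exists (D: 'M[R]_(n + n)) (L: 'M[R]_n), [/\ D \in unitmx, mulI R n *m D = D *m mulI R n &
  forall k, As k *m D = D *m (diag_mx (row_mx (row k L) (row k L)) *m mulI R n)].
by case: n om As => [//|n'] om As _ h1 h2 h3 h4;exact: (weights h1 h2 h3 h4). Qed.

Section Weights.
#[local] Opaque jacobian invmx diff_into diff_self isotropy mjac.
Context {R n M} (X: toric_kahler_manifold R n M).
Local Notation c:= (chart_at X).
Local Notation J:= (mulI R n).
Local Notation "'a_ xi" := (act X (expi xi)) (at level 8, xi at level 2, format "''a_' xi").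

Context (p: M) (fp: forall xi, 'a_xi p = p).
Local Notation rho:= (isotropy X p).

Definition iso_der (xi: 'rV[R]_n): 'M[R]_(n + n) :=
 \matrix_(i, j) 'd (fun xi => rho xi i j: R) 0 xi.
Local Notation A:= iso_der.

Lemma iso_derP xi: is_dmx (fun s => rho (s *: xi)) (A xi).
move=> i j;rewrite mxE.
have dr: differentiable (fun xi => rho xi i j: R) ((0: R) *: xi).
 by apply: (isotropy_smooth fp i j 1%N).1.
have dl: is_derive (0: R) (1: R) (fun s: R => s *: xi) xi.
 apply: is_derive_mx => k;rewrite (_: (fun s => _) = fun s: R => s * xi 0 k).
  exact: is_derive_mulr.
 by apply/funext => s;rewrite mxE.
by have:= is_derive_comp_diff dl dr;rewrite scale0r.
Qed.

Lemma iso_derE xi: A xi = \sum_k xi 0 k *: A (delta_mx 0 k).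
apply/matrixP => i j;rewrite mxE summxE {1}(row_sum_delta xi).
rewrite -[(fun xi => _): 'rV[R]_n -> R]/(fun xi => rho xi i j: R) linear_sum /=.
by apply: eq_bigr => k _;rewrite [RHS]mxE [in RHS]mxE linearZ.
Qed.

Lemma iso_der_J xi: J *m A xi = A xi *m J.
apply: (is_dmx_unique (is_dmx_mull J (iso_derP xi))).
apply: is_dmx_ext (is_dmx_mulr J (iso_derP xi)) => s.
by rewrite (isotropy_CR X p).
Qed.

(** The commutation of the representation is differentiated in one argument, then in the other. *)
Lemma iso_der_comm xi eta: A xi *m A eta = A eta *m A xi.
have H t: A xi *m rho (t *: eta) = rho (t *: eta) *m A xi.
 apply: (is_dmx_unique (is_dmx_mulr (rho (t *: eta)) (iso_derP xi))).
 apply: is_dmx_ext (is_dmx_mull (rho (t *: eta)) (iso_derP xi)) => s.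
 exact: (isotropyC fp).
apply: (is_dmx_unique (is_dmx_mull (A xi) (iso_derP eta))).
by apply: is_dmx_ext (is_dmx_mulr (A xi) (iso_derP eta)) => s;rewrite H.
Qed.

Lemma iso_der_skew xi: skew (kform X p) (A xi).
split;first exact: iso_der_J.
have E: A xi *m kform X p + kform X p *m (A xi)^T = 0.
 have H:= is_dmx_mul (is_dmx_mulr (kform X p) (iso_derP xi)) (is_dmx_tr (iso_derP xi)).
 rewrite scale0r (isotropy0 X) trmx1 mulmx1 mul1mx in H.
 apply: (is_dmx_unique H).
 apply: is_dmx_ext (is_dmx_cst (kform X p)) => s.
 by rewrite (isotropy_symp fp).
move=> v w;rewrite /bilin trmx_mul.
have -> : forall (P Q: 'M[R]_1), P 0 0 + Q 0 0 = (P + Q) 0 0 by move=> P Q;rewrite mxE.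
have -> : v *m A xi *m kform X p *m w^T + v *m kform X p *m ((A xi)^T *m w^T) =
 v *m (A xi *m kform X p + kform X p *m (A xi)^T) *m w^T.
 by rewrite mulmxDr mulmxDl !mulmxA.
by rewrite E mulmx0 mul0mx mxE.
Qed.

Lemma weight_chart: (0 < n)%N -> exists (N: set M) (z: M -> 'rV[R]_(n + n)) (L: 'M[R]_n),
 [/\ open N, N p & forall xi x, N x -> N ('a_xi x)] /\
 [/\ msm X N z, z p = 0, mjac X z p \in unitmx,
   forall x, N x -> J *m mjac X z x = mjac X z x *m J &
   forall xi x, N x -> gen X x xi *m mjac X z x =
    z x *m (diag_mx (row_mx (xi *m L) (xi *m L)) *m J)].
move=> n0.
have [D [L [uD JD HL]]]: exists (D: 'M[R]_(n + n)) (L: 'M[R]_n), [/\ D \in unitmx, J *m D = D *m J &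
  forall k, A (delta_mx 0 k) *m D = D *m (diag_mx (row_mx (row k L) (row k L)) *m J)].
 have h1 k:= iso_der_skew (delta_mx 0 k).
 have h2 k l:= iso_der_comm (delta_mx 0 k) (delta_mx 0 l).
 have h3:= kform_J X p;have h4:= @kform_pos _ _ _ X p.
 exact: (weights_pos n0 h3 h4 h1 h2).
have [N [Z [[oN Np aN] [sZ Z0 Z1 ZJ HZ]]]]:= linearization fp.
have mz x: N x -> mjac X (fun x => Z x *m D) x = mjac X Z x *m D by move=> Nx;exact: mjac_mulmx sZ Nx.
exists N, (fun x => Z x *m D), L;split;[by split|split].
- exact: msm_mulmx.
- by rewrite Z0 mul0mx.
- by rewrite mz // Z1 mul1mx.
- move=> x Nx;rewrite mz // mulmxA ZJ // -!mulmxA;apply: (congr1 (mulmx (mjac X Z x)));exact: JD.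
move=> xi x Nx;rewrite mz // mulmxA.
have E: gen X x xi *m mjac X Z x = Z x *m A xi.
 have v0:= torus_velocity0 X x xi.
 have a0: 'a_((0: R) *: xi) x = x by rewrite scale0r torus0.
 have:= velocity_comp (gam:= fun s: R => 'a_(s *: xi) x) oN sZ _ v0.
 rewrite a0 => /(_ Nx) H.
 apply: (is_dmx_unique (B:= fun s: R => Z ('a_(s *: xi) x))).
  by move=> i j;rewrite (ord1 i);exact: is_derive_entry H.
 apply: is_dmx_ext (is_dmx_mull (Z x) (iso_derP xi)) => s.
 by rewrite HZ.
apply: (etrans (congr1 (mulmx^~ D) E)).
apply: (etrans (esym (mulmxA _ _ _)));apply: (etrans _ (mulmxA _ _ _)).
apply: (congr1 (mulmx (Z x)));clear E.
rewrite iso_derE mulmx_suml.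
under eq_bigr do rewrite -scalemxAl HL scalemxAr.
rewrite -mulmx_sumr;apply: (congr1 (mulmx D)).
under eq_bigr do rewrite scalemxAl.
rewrite -mulmx_suml;apply: (congr1 (mulmx^~ J)).
under eq_bigr do rewrite -linearZ /= scale_row_mx.
rewrite -linear_sum /=;apply: congr1;apply/rowP => i;rewrite summxE.
have [j ->|j ->]:= split_ordP i;rewrite ?row_mxEl ?row_mxEr [RHS]mxE;apply: eq_bigr => k _;
 by rewrite ?row_mxEl ?row_mxEr !mxE.
Qed.

End Weights.

(** * Effectiveness of the action and invertibility of the weight matrix *)

Lemma compact_uniform (R: realType) (T: topologicalType) (K: set T) (P: T -> R -> Prop): compact K ->
 (forall y r r', r' <= r -> P y r -> P y r') ->
 (forall y, K y -> exists2 r: R, 0 < r & \forall y' \near y, P y' r) ->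
 exists2 r: R, 0 < r & forall y, K y -> P y r.
move=> cK mono H.
have /choice[f Hf]: forall y, exists r: R, 0 < r /\ (K y -> \forall y' \near y, P y' r).
 by move=> y;have [/H[r r0 Hr]|nK]:= pselect (K y);[exists r|exists 1].
have [s [sK cs]]:= finite_subcover (U:= fun y => [set y' | P y' (f y)]) cK (fun y Ky => (Hf y).2 Ky).
have [r r0 Hr]: exists2 r: R, 0 < r & forall y, y \in s -> r <= f y.
 elim: s {sK cs} => [|y s [r r0 Hr]];first by exists 1.
 exists (Num.min r (f y));first by rewrite lt_min r0 (Hf y).1.
 move=> z;rewrite inE => /orP[/eqP ->|zs];first by rewrite ge_min lexx orbT.
 by apply: le_trans (Hr z zs);rewrite ge_min lexx.
by exists r => // y /cs[z zs];apply: mono;exact: Hr.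
Qed.

Lemma line_meets (R: realType) (W: normedModType R) (x v: W) (A: set W): open A -> A x ->
 exists2 t: R, t != 0 & A (x + t *: v).
move=> oA Ax.
have cv: {for (0: R), continuous (fun t: R => x + t *: v)}.
 by apply: cvgD;[exact: cvg_cst|apply: cvgZ;[exact: cvg_id|exact: cvg_cst]].
have N: nbhs (x + (0: R) *: v) A by rewrite scale0r addr0;exact: open_nbhs_nbhs.
have [d /= d0 Hd]:= cv _ N;exists (d / 2);first by rewrite gt_eqF // divr_gt0.
apply: Hd;rewrite /= sub0r normrN gtr0_norm ?divr_gt0 //;lra.
Qed.

Section Spread.
#[local] Opaque jacobian invmx diff_into diff_self mjac.
Context {R n M} (X: toric_kahler_manifold R n M).
Local Notation c:= (chart_at X).
Local Notation J:= (mulI R n).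
Local Notation "'a_ xi" := (act X (expi xi)) (at level 8, xi at level 2, format "''a_' xi").

Definition fixers (S: set M): set 'rV[R]_(n + n) :=
 [set y | torus_set y /\ forall q, S q -> act X (toC y) q = q].

Lemma torus_star (y: 'rV[R]_(n + n)): torus_set y -> star_set y.
by move=> /torus_setP[xi ->];exact: star_expir. Qed.

Lemma point_closed (q: M): closed [set q].
exact: (compact_closed (cm_hausdorff X) (@compact_set1 _ q)). Qed.

Lemma fixers_compact S: compact (fixers S).
apply: (subclosed_compact _ torus_compact);last by move=> y [].
move=> y Hy.
have Ty: torus_set y.
 by apply: (compact_closed (@norm_hausdorff _ _) torus_compact) => B /Hy[z [[Tz _] Bz]];exists z.
split=> // q Sq;apply: contrapT => Ny.
have oO: open (~` [set q]) by rewrite openC;exact: point_closed.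
have cy:= (orb_into X q).1 y (torus_star Ty).
have N: nbhs y (orb X q @^-1` (~` [set q])) by apply: cy;apply: open_nbhs_nbhs;split.
by have [z [[_ Hz] /= []]]:= Hy _ N;exact: Hz.
Qed.

Lemma fixers_closure S q y: fixers S y -> closure S q -> act X (toC y) q = q.
move=> [Ty Hy] Sq;apply: contrapT => Nq.
have cy: {for q, continuous (act X (toC y))}.
 exact: (smooth_self_continuous (act_smooth_self X (torus_star Ty))).
have [U [V [Uq Vq UV]]]: exists U V: set M, [/\ nbhs (act X (toC y) q) U, nbhs q V & U `&` V = set0].
 have:= cm_hausdorff X;rewrite open_hausdorff => H.
 have /H[[U V] /= [Uq Vq] [oU oV UV]]: act X (toC y) q != q by apply/eqP.
 exists U, V;split;[exact: (@open_nbhs_nbhs M _ U (conj oU (set_mem Uq)))|exact: (@open_nbhs_nbhs M _ V (conj oV (set_mem Vq)))|exact/eqP].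
have Wq: nbhs q (act X (toC y) @^-1` U):= cy U Uq.
have [x [Sx [Ux Vx]]]:= Sq _ (filterI Wq Vq).
have: (U `&` V) x by split=> //;move: Ux => /=;rewrite Hy.
by rewrite UV.
Qed.

Lemma norm_row0 d (v: 'rV[R]_d) m: `|row_mx (0: 'rV[R]_m) v| = `|v|.
apply/eqP;rewrite eq_le;apply/andP;split;apply: mx_norm_le => // i j;rewrite (ord1 i).
 have [k ->|k ->]:= split_ordP j;rewrite ?row_mxEl ?row_mxEr ?mxE ?normr0 //;exact: mx_norm_ge.
by rewrite -(row_mxEr (0: 'rV[R]_m) v);exact: mx_norm_ge.
Qed.

Lemma ball_row d m (y y': 'rV[R]_m) (x x': 'rV[R]_d) (r: R): ball y r y' -> ball x r x' ->
 ball (row_mx y x) r (row_mx y' x').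
move=> [r0 H1] [_ H2];split=> // i j.
by have [k ->|k ->]:= split_ordP j;rewrite ?row_mxEl ?row_mxEr;[exact: H1|exact: H2].
Qed.

Lemma close_arith1 (r a b: R): 0 < r -> a <= 4^-1 * b -> b < r / 2 -> a + b < r.
by move=> *;lra. Qed.

Lemma close_arith2 (r a b e f: R): 0 < r -> a <= 4^-1 * f -> b < r -> e < r / 2 ->
 f <= a + (b + e) -> f <= 4 * r.
by move=> *;lra. Qed.

Section AtPoint.
Context (S: set M) (q: M) (oS: open S) (Sq: closure S q).
Local Notation x0:= (c q q).
Local Notation G:= (c q \o act_map X (act X) q).
Let O:= act_dom X q `&` act_map X (act X) q @^-1` cdom (c q).

Let oO: open O.
by apply: (into_open (@act_dom_open _ _ _ X q) (act_into X q));exact: cdom_open. Qed.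

Let O_fix y: fixers S y -> O (row_mx y x0).
move=> Ky;have qq:= chart_at_dom X q;split.
 split;rewrite ?row_mxKl ?row_mxKr;first exact: (torus_star Ky.1).
 by exists q.
by rewrite /preimage /= /act_map row_mxKl row_mxKr ctoK // (fixers_closure Ky Sq).
Qed.

(** The action map [G (row_mx y _)] is the identity on the open set [S], and [q] is a limit of
    points of [S]. Strict differentiability at [q] compares it with its differential along short
    segments in [S], which forces the differential in the M-direction to be the identity. *)
Lemma fixer_diff1 y (v: 'rV[R]_(n + n)): fixers S y ->
 (row_mx 0 v: 'rV[R]_((n + n) + (n + n))) *m 'J G (row_mx y x0) = v.
move=> Ky;have qq:= chart_at_dom X q.
set A:= 'J _ _;apply/eqP;rewrite -subr_eq0 -normr_eq0.
suff H e: 0 < e -> `|(row_mx 0 v: 'rV[R]_((n + n) + (n + n))) *m A - v| <= e * `|v|.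
 rewrite eq_le normr_ge0 andbT;have [->|v0]:= eqVneq v 0.
  by rewrite row_mx0 mul0mx subr0 normr0.
 apply/ler_addgt0Pr => e e0;rewrite add0r.
 have:= H (e / `|v|);rewrite divfK ?normr_eq0 //;apply.
 by rewrite divr_gt0 // normr_gt0.
move=> e0;have [r r0 [_ Hr]]:= C1_strict oO (O_fix Ky) ((act_into X q).2 q 1%N) e0.
pose U:= cdom (c q) `&` [set x | ball x0 r (c q x)].
have [x [Sx [qx bx]]]: exists x, S x /\ U x.
 apply: Sq;apply: filterI;first by apply: open_nbhs_nbhs;split=> //;exact: cdom_open.
 by apply: (cto_continuous qq);exact: nbhsx_ballx.
have oI:= chart_image_open (e:= c q) oS.
have [t t0 Ht]: exists2 t: R, t != 0 & (c q @` (cdom (c q) `&` S)) (c q x + t *: v) /\ ball x0 r (c q x + t *: v).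
 have [t t0 [H1 H2]]:= line_meets v (openI oI (@ball_open _ _ x0 r)) (conj (ex_intro2 _ _ x (conj qx Sx) erefl) bx).
 by exists t.
have [[x2 [qx2 Sx2] E2] b2]:= Ht.
have G1 z: cdom (c q) z -> S z -> G (row_mx y (c q z)) = c q z.
 by move=> qz Sz;rewrite /= /act_map row_mxKl row_mxKr ctoK // Ky.2.
have:= Hr _ _ (ball_row (ballxx y r0) bx) (ball_row (ballxx y r0) b2).
rewrite -{1}E2 (G1 _ qx Sx) (G1 _ qx2 Sx2) E2 opp_row_mx add_row_mx subrr [c q x + _]addrC addrK.
rewrite -(scaler0 _ t) -scale_row_mx -scalemxAl -scalerBr scale_row_mx scaler0 norm_row0 !normrZ mulrCA.
by rewrite ler_pM2l ?normr_gt0 // distrC.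
Qed.

(** The elements fixing [S] form a compact set, so one radius works for all of them: near [q] each
    differs from the identity by a map that is 1/4-Lipschitz. *)
Lemma fixers_close: exists2 r: R, 0 < r & forall y, fixers S y -> forall x1 x2, ball x0 r x1 -> ball x0 r x2 ->
 [/\ O (row_mx y x1), O (row_mx y x2) &
 `|G (row_mx y x2) - G (row_mx y x1) - (x2 - x1)| <= 4^-1 * `|x2 - x1|].
pose P (y: 'rV[R]_(n + n)) (r: R):= forall x1 x2, ball x0 r x1 -> ball x0 r x2 ->
 [/\ O (row_mx y x1), O (row_mx y x2) &
 `|G (row_mx y x2) - G (row_mx y x1) - (x2 - x1)| <= 4^-1 * `|x2 - x1|].
have PM y r r': r' <= r -> P y r -> P y r'.
 by move=> rr H x1 x2 b1 b2;apply: H;[exact: le_ball rr _ b1|exact: le_ball rr _ b2].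
suff H y: fixers S y -> exists2 r: R, 0 < r & \forall y' \near y, P y' r.
 by have [r r0 Hr]:= @compact_uniform R _ (fixers S) P (@fixers_compact S) PM H;exists r.
move=> Ky.
have e0: 0 < 4^-1 :> R by rewrite invr_gt0.
have [r r0 [rO Hr]]:= C1_strict oO (O_fix Ky) ((act_into X q).2 q 1%N) e0.
exists r => //;have:= nbhsx_ballx y _ r0;apply: filterS => y' by' x1 x2 b1 b2.
have B1:= ball_row by' b1;have B2:= ball_row by' b2.
split;[exact: rO|exact: rO|].
have:= Hr _ _ B1 B2.
by rewrite opp_row_mx add_row_mx subrr norm_row0 fixer_diff1.
Qed.

(** A no-small-subgroups argument. If one step displaces a point by d in the chart, then m steps
    displace it by m d up to an error m |d| / 4, while all iterates stay in a fixed ball; hence d =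
    0. *)
Lemma fixed_near xi: (forall s x, S x -> 'a_(s *: xi) x = x) ->
 \forall x \near q, forall s, 'a_(s *: xi) x = x.
move=> HS;have qq:= chart_at_dom X q.
have [r r0 Hr]:= fixers_close.
have Kf s: fixers S (expir (s *: xi)).
 by split;[exact: torus_expir|move=> x Sx;rewrite toC_expir HS].
have r2: 0 < r / 2 by rewrite divr_gt0.
have N: \forall x \near q, cdom (c q) x /\ ball x0 (r / 2) (c q x).
 apply: filterI;first by apply: open_nbhs_nbhs;split=> //;exact: cdom_open.
 by apply: (cto_continuous qq);exact: nbhsx_ballx.
apply: filterS N => x [qx bx] s.
have bx0:= ballxx x0 r0.
have bxr: ball x0 r (c q x) by apply: (le_ball _ bx);lra.
have GE t z: cdom (c q) z -> G (row_mx (expir (t *: xi)) (c q z)) = c q ('a_(t *: xi) z).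
 by move=> qz;rewrite /= /act_map row_mxKl row_mxKr toC_expir ctoK.
have Gq t: G (row_mx (expir (t *: xi)) x0) = x0.
 by rewrite GE // -(toC_expir (t *: xi)) (fixers_closure (Kf t) Sq).
have dm t: cdom (c q) ('a_(t *: xi) x).
 have [[_ O1] _ _]:= Hr _ (Kf t) _ _ bxr bx0.
 by move: O1;rewrite /preimage /= /act_map row_mxKl row_mxKr toC_expir ctoK.
have nbx: `|c q x - x0| < r / 2 by rewrite distrC;move: bx;rewrite -ball_normE.
have bt t: ball x0 r (c q ('a_(t *: xi) x)).
 have [_ _]:= Hr _ (Kf t) _ _ bx0 bxr;rewrite GE // Gq => H.
 rewrite -ball_normE /= distrC.
 have -> : c q ('a_(t *: xi) x) - x0 = (c q ('a_(t *: xi) x) - x0 - (c q x - x0)) + (c q x - x0) by rewrite subrK.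
 apply: le_lt_trans (ler_normD _ _) _.
 exact: close_arith1 r0 H nbx.
pose u m:= c q ('a_((m%:R * s) *: xi) x).
pose d:= u 1%N - c q x.
have u0: u 0%N = c q x by rewrite /u mul0r scale0r torus0.
have step m: `|u m.+1 - u m - d| <= 4^-1 * `|d|.
 have [_ _]:= Hr _ (Kf (m%:R * s)) _ _ bxr (bt s).
 rewrite !GE // -torusD -scalerDl.
 rewrite /d /u mul1r;have -> : m.+1%:R * s = m%:R * s + s by rewrite -addn1 natrD mulrDl mul1r.
 by [].
have H m: `|u m - c q x - m%:R *: d| <= m%:R * (4^-1 * `|d|).
 elim: m => [|m IH];first by rewrite u0 subrr scale0r subr0 normr0 mul0r.
 have -> : u m.+1 - c q x - m.+1%:R *: d = (u m.+1 - u m - d) + (u m - c q x - m%:R *: d).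
  by rewrite -[m.+1%:R]natr1 scalerDl scale1r;apply/rowP => i;rewrite !mxE;clear;ring.
 apply: le_trans (ler_normD _ _) _.
 rewrite -[m.+1%:R]natr1 mulrDl mul1r [leRHS]addrC;exact: lerD.
have B m: m%:R * `|d| <= 4 * r.
 have:= H m;have:= bt (m%:R * s);rewrite -ball_normE /= => b1 h.
 have: `|m%:R *: d| <= `|u m - c q x - m%:R *: d| + (`|x0 - u m| + `|c q x - x0|).
  have E: m%:R *: d = - (u m - c q x - m%:R *: d) - (x0 - u m) - (c q x - x0).
   by apply/rowP => i;rewrite !mxE;clear;ring.
  rewrite {1}E;apply: le_trans (ler_normB _ _) _;rewrite [leRHS]addrA lerD2r.
  by apply: le_trans (ler_normB _ _) _;rewrite normrN.
 rewrite normrZ ger0_norm // => h2;rewrite mulrCA in h;exact: close_arith2 r0 h b1 nbx h2.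
have d0: d = 0.
 apply/eqP/contraT => dn;have dp: 0 < `|d| by rewrite normr_gt0.
 have:= B (Num.truncn (4 * r / `|d|)).+1.
 rewrite -ler_pdivlMr // leNgt truncnS_gt //.
have E: c q ('a_(s *: xi) x) = c q x by apply/eqP;rewrite -subr_eq0 -d0 /d /u mul1r.
by rewrite -(ctoK (dm s)) E ctoK.
Qed.

End AtPoint.

(** The interior of the set fixed by the one-parameter group is also closed by [fixed_near], hence
    everything by connectedness, and effectiveness applies. *)
Lemma torus_trivial xi: (exists2 S: set M, open S /\ S !=set0 & forall s x, S x -> 'a_(s *: xi) x = x) -> xi = 0.
move=> [S0 [oS0 S00] HS0].
pose F:= [set x | forall s: R, 'a_(s *: xi) x = x].
have E: F° = setT.
 apply: (tk_connected X).
 - by have [x Sx]:= S00;exists x;apply: filterS (open_nbhs_nbhs (conj oS0 Sx)) => y Sy s;exact: HS0.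
 - by exists F°;[exact: open_interior|rewrite setTI].
 - exists F°;last by rewrite setTI.
  move=> q Fq;apply: (fixed_near (@open_interior _ F) Fq) => s x Fx;exact: (interior_subset Fx).
have H s p: 'a_(s *: xi) p = p by have: F p by (apply: interior_subset;rewrite E);exact.
apply/rowP => k;rewrite [RHS]mxE;apply/eqP/contraT => xk.
(* At time pi / xi_k the k-th component of the group element is e^(i pi) = -1, not 1. *)
have:= act_effective (Cstar_expi ((pi / xi 0 k) *: xi)) (H _).
move=> /rowP/(_ k);rewrite !mxE divfK // => /(congr1 (@complex.Re R)) /=.
by rewrite cospi => /eqP;rewrite eq_sym -addr_eq0 -mulr2n pnatr_eq0.
Qed.

(** A vector [xi] with xi L = 0 has zero generator throughout a coordinate neighbourhood, so its
    one-parameter group fixes an open set. *)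
Lemma weight_unit p N (z: M -> 'rV[R]_(n + n)) (L: 'M[R]_n): open N -> N p -> msm X N z ->
 mjac X z p \in unitmx -> (forall xi x, N x -> gen X x xi *m mjac X z x =
  z x *m (diag_mx (row_mx (xi *m L) (xi *m L)) *m J)) -> L \in unitmx.
move=> oN Np sz uz H;have [ O' [h [ON Op Cz]]]:= coord_exists oN Np sz uz.
apply: unitmx_inj => xi xL;apply: torus_trivial;exists O';first by split;[have []:= Cz|exists p].
move=> s x Ox;apply: torus_fixed;rewrite genZ;apply/eqP;rewrite scaler_eq0;apply/orP;right;apply/eqP.
have E: gen X x xi *m mjac X z x = 0.
 by rewrite H ?xL;[rewrite row_mx0 linear0 mul0mx mulmx0|exact: ON].
rewrite -[gen X x xi](mulmxK (coord_on_unit Cz Ox)).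
exact: (etrans (congr1 (mulmx^~ _) E) (mul0mx _ _)).
Qed.

End Spread.

(** * Polydiscs, factorization by |w_j|^2, and frames of generators *)

Section Polydisc.
Context {R: realType} {n: nat}.
Local Notation J:= (mulI R n).
Local Notation mu:= (@lebesgue_measure R).

Definition sq (w: 'rV[R]_(n + n)) (j: 'I_n): R:= w 0 (lshift n j) ^+ 2 + w 0 (rshift n j) ^+ 2.

(** The real inner product in the j-th complex line, Re(w_j conj v_j). Correspondingly [prm j]
    projects to that line, and [disc d] is a polydisc whose radii are square roots of d. *)
Definition ip (w v: 'rV[R]_(n + n)) (j: 'I_n): R :=
 w 0 (lshift n j) * v 0 (lshift n j) + w 0 (rshift n j) * v 0 (rshift n j).

Definition prm (j: 'I_n): 'M[R]_(n + n) :=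
 diag_mx (row_mx (delta_mx 0 j) (delta_mx 0 j)).

Definition disc (d: R): set 'rV[R]_(n + n):= [set w | forall j, sq w j < d].

Lemma prm_l (w: 'rV[R]_(n + n)) j k: (w *m prm j) 0 (lshift n k) = w 0 (lshift n k) * (k == j)%:R.
by rewrite mul_mx_diag mxE row_mxEl mxE eqxx. Qed.

Lemma prm_r (w: 'rV[R]_(n + n)) j k: (w *m prm j) 0 (rshift n k) = w 0 (rshift n k) * (k == j)%:R.
by rewrite mul_mx_diag mxE row_mxEr mxE eqxx. Qed.

Lemma mulIE_l (w: 'rV[R]_(n + n)) k: (w *m J) 0 (lshift n k) = - w 0 (rshift n k).
by rewrite -{1}(hsubmxK w) mulI_row row_mxEl !mxE.
Qed.

Lemma mulIE_r (w: 'rV[R]_(n + n)) k: (w *m J) 0 (rshift n k) = w 0 (lshift n k).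
by rewrite -{1}(hsubmxK w) mulI_row row_mxEr !mxE. Qed.

Lemma sq_ge0 w j: 0 <= sq w j. Proof. by rewrite addr_ge0 // sqr_ge0. Qed.

Lemma sq_eq0 w j: sq w j = 0 -> w *m prm j = 0.
move/eqP;rewrite paddr_eq0 ?sqr_ge0 // !sqrf_eq0 => /andP[/eqP l /eqP r].
apply/rowP => i;have [k ->|k ->]:= split_ordP i;rewrite ?prm_l ?prm_r [RHS]mxE;
 by have [->|_]:= eqVneq k j;rewrite ?l ?r ?mul0r ?mulr0.
Qed.

Lemma Ck_sq d k (U: set 'rV[R]_d) (f: 'rV[R]_d -> 'rV[R]_(n + n)) j: open U ->
 Ck_on k U f -> Ck_on k U (fun x => sq (f x) j).
move=> oU sf;rewrite (_: (fun x => _) = fun x => f x 0 (lshift n j) * f x 0 (lshift n j) +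
  f x 0 (rshift n j) * f x 0 (rshift n j)).
 by apply: CkD => //;apply: CkM => //;exact: Ck_coord.
by apply/funext => x;rewrite /sq !expr2.
Qed.

Lemma Ck_self k d (U: set 'rV[R]_d): Ck_on k U (fun x: 'rV[R]_d => x).
exact: (Ck_lin k U (@idfun 'rV[R]_d)). Qed.

Lemma sq_continuous j: continuous (fun w => sq w j).
by move=> w;apply: (Ck_sq j (@openT _) (Ck_self 0 setT)). Qed.

Lemma disc_open d: open (disc d).
rewrite openE => w Hw;rewrite /interior /=.
have H j: \forall y \near w, sq y j < d.
 have oA: open [set x: R | x < d] by exact: open_lt.
 exact: (@sq_continuous j w _ (open_nbhs_nbhs (conj oA (Hw j)))).
exact: (filter_forall _ H).
Qed.

Lemma disc0 d: 0 < d -> disc d 0.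
by move=> d0 j;rewrite /sq !mxE expr0n /= addr0. Qed.

Lemma disc_sub (O: set 'rV[R]_(n + n)): open O -> O 0 -> exists2 d: R, 0 < d & disc d `<=` O.
move=> oO O0;have /nbhs_ballP[e /= e0 He]: nbhs (0: 'rV[R]_(n + n)) O by exact: open_nbhs_nbhs.
exists (e ^+ 2);first by rewrite exprn_gt0.
move=> w Hw;apply: He;split=> // i k;rewrite (ord1 i).
have H j: `|w 0 (lshift n j)| < e /\ `|w 0 (rshift n j)| < e.
 have:= Hw j;rewrite /sq -(real_normK (num_real (w 0 (lshift n j)))) -(real_normK (num_real (w 0 (rshift n j)))) => h.
 have h1:= sqr_ge0 (w 0 (lshift n j));have h2:= sqr_ge0 (w 0 (rshift n j)).
 have p1:= sqr_ge0 `|w 0 (lshift n j)|;have p2:= sqr_ge0 `|w 0 (rshift n j)|.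
 by split;rewrite -(@ltr_pXn2r _ 2) ?nnegrE ?normr_ge0 ?(ltW e0) //;move: h p1 p2;clear;lra.
rewrite /ball /= mxE sub0r normrN.
by have [j ->|j ->]:= split_ordP k;have []:= H j.
Qed.

Lemma Rint_id: \int[mu]_(s in `[0, 1: R]) s = 2^-1.
have D (s: R): 0 <= s <= 1 -> is_derive s (1: R) (fun s: R => 2^-1 * (s * s)) s.
 move=> _;have:= is_deriveZ (2^-1) (is_deriveM (is_derive_id s (1: R)) (is_derive_id s (1: R))).
 rewrite /GRing.scale /= mulr1 => H;have E: 2^-1 * (s + s) = s by field.
 by rewrite E in H.
have C (s: R): 0 <= s <= 1 -> {for s, continuous (fun s: R => s)} by move=> _;exact: cvg_id.
by rewrite (Rint_derive_on ltr01 D C) mulr0 mulr1 mulr0 subr0 mulr1.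
Qed.

Lemma pos_arith (a b: R): - (b / 4) <= a - 2^-1 * b -> 0 < b -> 0 < a.
by move=> *;lra. Qed.

Section Radial.
Context (r g0: R) (j: 'I_n) (Y g: 'rV[R]_(n + n) -> R).
Hypotheses (g00: 0 < g0) (sY: smooth_on (disc r) Y) (sg: smooth_on (disc r) g).
Hypothesis dY: forall w v, disc r w -> 'd Y w (v *m prm j) = g w * ip w v j.
Hypothesis Y0: forall w, disc r w -> w *m prm j = 0 -> Y w = 0.
Hypothesis gb: forall w, disc r w -> `|g w - g0| <= g0 / 4.

Let gam (w: 'rV[R]_(n + n)) (s: R): 'rV[R]_(n + n):= w + (s - 1) *: (w *m prm j).
Let u (w: 'rV[R]_(n + n)): R:= \int[mu]_(s in `[0, 1]) (s * g (gam w s)).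

Let gam_l w s k: gam w s 0 (lshift n k) = w 0 (lshift n k) * (if k == j then s else 1).
by rewrite /gam mxE mxE prm_l;case: eqP => _ /=;ring. Qed.

Let gam_r w s k: gam w s 0 (rshift n k) = w 0 (rshift n k) * (if k == j then s else 1).
by rewrite /gam mxE mxE prm_r;case: eqP => _ /=;ring. Qed.

Let gam_disc w s: 0 <= s <= 1 -> disc r w -> disc r (gam w s).
move=> /andP[s0 s1] Hw k;apply: le_lt_trans (Hw k);rewrite /sq gam_l gam_r !exprMn -mulrDl.
case: ifP => _;last by rewrite expr1n mulr1.
by rewrite ler_piMr ?sq_ge0 // exprn_ile1.
Qed.

(** Hadamard's lemma in the j-th complex line. Along the path [gam] that multiplies w_j by s, the
    derivative of Y is |w_j|^2 s g, so [u] is the integral of s g over [0, 1]. As g stays within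
    g0/4 of g0, [u] stays within g0/4 of g0/2 and is positive. *)
Lemma radial_factor: exists u: 'rV[R]_(n + n) -> R,
 [/\ smooth_on (disc r) u, forall w, disc r w -> 0 < u w & forall w, disc r w -> Y w = sq w j * u w].
pose T (y: 'rV[R]_(1 + (n + n))): 'rV[R]_(n + n):= gam (rsubmx y) (y 0 0).
pose G (y: 'rV[R]_(1 + (n + n))):= y 0 0 * g (T y).
have sT k: Ck_on k setT T.
 apply: Ck_rV => [|i];first exact: openT.
 have H m: Ck_on k setT (fun y: 'rV[R]_(1 + (n + n)) => rsubmx y 0 m).
  by apply: Ck_coord;[exact: openT|exact: (Ck_lin k setT (@rsubmx R 1 1 (n + n)))].
 have H0: Ck_on k setT (fun y: 'rV[R]_(1 + (n + n)) => y 0 0).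
  by apply: Ck_coord;[exact: openT|exact: Ck_self].
 have [m ->|m ->]:= split_ordP i.
  rewrite (_: (fun x => _) = fun y: 'rV[R]_(1 + (n + n)) => rsubmx y 0 (lshift n m) * (if m == j then y 0 0 else 1)).
   by apply: CkM;[exact: openT|exact: H|case: (m == j);[exact: H0|exact: Ck_cst]].
  by apply/funext => y;rewrite /T gam_l.
 rewrite (_: (fun x => _) = fun y: 'rV[R]_(1 + (n + n)) => rsubmx y 0 (rshift n m) * (if m == j then y 0 0 else 1)).
  by apply: CkM;[exact: openT|exact: H|case: (m == j);[exact: H0|exact: Ck_cst]].
 by apply/funext => y;rewrite /T gam_r.
have oO: open (T @^-1` disc r).
 by apply: open_comp;[move=> y _;exact: (sT 0%N)|exact: disc_open].
have sG: smooth_on (T @^-1` disc r) G.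
 move=> k;apply: CkM => //;first by apply: Ck_coord => //;exact: Ck_self.
 by apply: (Ck_compR (V:= disc r)) => //;apply: Ck_mono (sT k) => y _.
have e0 s y: row_mx (s%:M: 'rV[R]_1) y 0 (0: 'I_(1 + (n + n))) = s.
 rewrite (_: (0: 'I_(1 + (n + n))) = lshift (n + n) 0);last exact: val_inj.
 by rewrite (row_mxEl (s%:M: 'rV[R]_1) y) mxE eqxx mulr1n.
have TE s y: T (scons s y) = gam y s by rewrite /T row_mxKr e0.
have UO s y: 0 <= s <= 1 -> disc r y -> (T @^-1` disc r) (scons s y).
 by move=> s01 Dy;rewrite /preimage /= TE;exact: gam_disc.
have uE y: u y = pint 1 G y.
 by rewrite /u /pint;apply: eq_Rintegral => s _;rewrite /G e0 TE.
have cs w (s: R): disc r w -> 0 <= s <= 1 -> {for s, continuous (fun s: R => s * g (gam w s))}.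
 move=> Dw s01;rewrite (_: (fun s => _) = fun s => G (scons s w)).
  by apply: slice_cont;apply: (sG 0%N);exact: UO.
 by apply/funext => t;rewrite /G e0 TE.
exists u;split.
- move=> k;apply: (@Ck_ext _ _ _ k _ _ (pint 1 G));[exact: disc_open|by move=> w _;exact: uE|].
 have b01: (0: R) < 1 by exact: ltr01.
 have K:= @Ck_pint R (n + n) 1 (T @^-1` disc r) (disc r) b01 (@disc_open r) UO k G (sG k).
 exact K.
- move=> w Dw.
 have I1: \int[mu]_(s in `[0, 1]) (s * g (gam w s) - s * g0) = u w - 2^-1 * g0.
  rewrite RintegralB //.
  + rewrite RintegralZr // ?Rint_id //;apply: cont_integrable => s _;exact: cvg_id.
  + by apply: cont_integrable => s;exact: cs.
  + by apply: cont_integrable => s _;apply: cvgM;[exact: cvg_id|exact: cvg_cst].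
 have:= @Rint_bound _ 1 (g0 / 4) (fun s => s * g (gam w s) - s * g0) ltr01.
 rewrite I1 mulr1 => H.
 have: `|u w - 2^-1 * g0| <= g0 / 4.
  apply: H => s s01.
   by apply: cvgB;[exact: cs|apply: cvgM;[exact: cvg_id|exact: cvg_cst]].
  rewrite -mulrBr normrM;apply: le_trans (gb (gam_disc s01 Dw)).
  by move/andP: s01 => [s0 s1];rewrite ger0_norm // ler_piMl.
 rewrite ler_norml => /andP[h _];exact: pos_arith h g00.
- move=> w Dw.
 have D (s: R): 0 <= s <= 1 -> is_derive s (1: R) (fun s: R => Y (gam w s)) (sq w j * (s * g (gam w s))).
  move=> s01;have Dg:= gam_disc s01 Dw.
  have dg: is_derive s (1: R) (gam w) (w *m prm j).
   apply: is_derive_mx => i.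
   rewrite (_: (fun s => _) = fun s => w 0 i + (s - 1) * (w *m prm j) 0 i);last first.
    by apply/funext => t;rewrite /gam !mxE.
   have:= is_deriveD (is_derive_cst (w 0 i) s (1: R)) (is_deriveM (is_derive_subr 1 s) (is_derive_cst ((w *m prm j) 0 i) s (1: R))).
   by rewrite /GRing.scale /= mulr0 !add0r mulr1.
  have:= is_derive_comp_diff dg ((sY 1%N).1 _ Dg).
  rewrite (dY _ Dg) (_: ip (gam w s) w j = s * sq w j);last first.
   by rewrite /ip gam_l gam_r eqxx /sq;ring.
  by rewrite mulrCA [g _ * _]mulrC mulrCA mulrA [_ * s]mulrC.
 have C (s: R): 0 <= s <= 1 -> {for s, continuous (fun s: R => sq w j * (s * g (gam w s)))}.
  by move=> s01;apply: cvgM;[exact: cvg_cst|exact: cs].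
 have:= Rint_derive_on ltr01 D C.
 rewrite RintegralZl //;last by apply: cont_integrable => s;exact: cs.
 rewrite (_: gam w 1 = w);last by rewrite /gam subrr scale0r addr0.
 rewrite (Y0 (w:= gam w 0)) ?subr0 => [->//||].
  by apply: gam_disc => //;rewrite lexx ler01.
 apply: sq_eq0;rewrite /sq gam_l gam_r eqxx !mulr0 expr0n /= addr0 //.
Qed.

End Radial.

Section Dense.
Context (U: set 'rV[R]_(n + n)) (oU: open U).

(** Points with no vanishing complex coordinate are dense: moving along (1, .., 1) by a small t, the
    real parts vanish for finitely many t only. Polar coordinates may thus be used in identities
    between continuous functions. *)
Lemma dense_eq (f g: 'rV[R]_(n + n) -> R) :
 (forall w, U w -> {for w, continuous f}) -> (forall w, U w -> {for w, continuous g}) ->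
 (forall w, U w -> (forall j, sq w j != 0) -> f w = g w) -> forall w, U w -> f w = g w.
move=> cf cg H w Uw;apply/eqP/contraT => ne.
have oA: open [set x: R | x != 0] by exact: open_neq.
have N: nbhs w (U `&` [set y | f y - g y != 0]).
 apply: filterI;first exact: open_nbhs_nbhs.
 have cfg: {for w, continuous (fun y => f y - g y)} by apply: (@cvgB _ _ _ (nbhs w));[exact: cf|exact: cg].
 have Nd: nbhs (f w - g w) [set x: R | x != 0] by apply: open_nbhs_nbhs;split=> //=;rewrite subr_eq0.
 exact: (cfg _ Nd).
pose v: 'rV[R]_(n + n):= const_mx 1.
have cv: {for (0: R), continuous (fun t: R => w + t *: v)}.
 by apply: cvgD;[exact: cvg_cst|apply: cvgZ;[exact: cvg_id|exact: cvg_cst]].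
have N2: nbhs (w + (0: R) *: v) (U `&` [set y | f y - g y != 0]) by rewrite scale0r addr0.
have [d /= d0 Hd]:= cv _ N2.
have [t t0 Ht]: exists2 t: R, 0 < t < d & forall j, w 0 (lshift n j) + t != 0.
 have: forall s: seq 'I_n, exists2 e: R, 0 < e <= d & forall t, 0 < t < e -> forall j, j \in s -> w 0 (lshift n j) + t != 0.
  elim=> [|j s [e /andP[e0 ed] He]];first by exists d;rewrite ?d0 ?lexx.
  have [wj|wj]:= leP 0 (w 0 (lshift n j)).
   exists e;first by rewrite e0.
   move=> t te k;rewrite inE => /orP[/eqP ->|];last exact: He.
   by rewrite gt_eqF // ltr_wpDl //;case/andP: te.
  exists (Num.min e (- w 0 (lshift n j))).
   by rewrite lt_min e0 oppr_gt0 wj /= ge_min ed.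
  move=> t /andP[t0];rewrite lt_min => /andP[te tw] k;rewrite inE => /orP[/eqP ->|];last first.
   by apply: He;rewrite t0 te.
  by rewrite lt_eqF // -ltrBrDl sub0r.
 move=> /(_ (enum 'I_n))[e /andP[e0 ed] He];exists (e / 2).
  by apply/andP;split;lra.
 by move=> j;apply: He;[apply/andP;split;lra|rewrite mem_enum].
have [Ut /=]: (U `&` [set y | f y - g y != 0]) (w + t *: v).
 by apply: Hd;case/andP: t0 => t0 td;rewrite /= sub0r normrN gtr0_norm.
rewrite (H _ Ut) ?subrr ?eqxx // => j.
rewrite /sq !mxE mulr1 paddr_eq0 ?sqr_ge0 // negb_and sqrf_eq0 (Ht j) //.
Qed.

End Dense.
End Polydisc.

Lemma bilinM (R: realType) m l (D: 'M[R]_(m, l)) (A: 'M[R]_l) v w :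
 bilin (D *m A *m D^T) v w = bilin A (v *m D) (w *m D).
by rewrite /bilin trmx_mul !mulmxA. Qed.

Lemma bilin_suml (R: realType) n (A: 'M[R]_(n + n)) (I: finType) (F: I -> 'rV[R]_(n + n)) w :
 bilin A (\sum_i F i) w = \sum_i bilin A (F i) w.
by rewrite /bilin mulmx_suml mulmx_suml summxE. Qed.

Lemma bilin_sumr (R: realType) n (A: 'M[R]_(n + n)) (I: finType) (F: I -> 'rV[R]_(n + n)) w :
 bilin A w (\sum_i F i) = \sum_i bilin A w (F i).
by rewrite /bilin linear_sum mulmx_sumr summxE. Qed.

Lemma rowZE (R: realType) m (a: R) (u: 'rV[R]_m) i: (a *: u) 0 i = a * u 0 i.
by rewrite mxE. Qed.

Lemma rowNE (R: realType) m (u: 'rV[R]_m) i: (- u) 0 i = - u 0 i.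
by rewrite mxE. Qed.

Section Frames.
Context {R: realType} {n: nat}.
Local Notation J:= (mulI R n).

Lemma bilin_mulI (v w: 'rV[R]_(n + n)): bilin J v w =
 \sum_j (v 0 (lshift n j) * w 0 (rshift n j) - v 0 (rshift n j) * w 0 (lshift n j)).
rewrite /bilin mxE big_split_ord /= -big_split /=;apply: eq_bigr => j _.
by rewrite mulIE_l mulIE_r !mxE;ring.
Qed.

Lemma row_split_ext (v w: 'rV[R]_(n + n)): (forall j, v 0 (lshift n j) = w 0 (lshift n j)) ->
 (forall j, v 0 (rshift n j) = w 0 (rshift n j)) -> v = w.
by move=> H1 H2;apply/rowP => i;have [j ->|j ->]:= split_ordP i. Qed.

Context (om: 'M[R]_(n + n)) (V: 'I_n -> 'rV[R]_(n + n)).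
Hypothesis om_alt: forall v w, bilin om v w = - bilin om w v.
Hypothesis omV: forall j k, bilin om (V j) (V k) = 0.
Hypothesis omVJ: forall j k, bilin om (V j *m J) (V k *m J) = 0.

(** When the spans of the V_k and of the J V_k are both isotropic, the form is determined by its
    contractions with the V_k and the components [ta], [tb] along them. *)
Lemma frame_form (a b: 'rV[R]_(n + n)) (ta sa tb sb: 'I_n -> R) :
 a = \sum_k ta k *: V k + \sum_k sa k *: (V k *m J) ->
 b = \sum_k tb k *: V k + \sum_k sb k *: (V k *m J) ->
 bilin om a b = \sum_k (ta k * bilin om (V k) b - tb k * bilin om (V k) a).
move=> Ea Eb;rewrite sumrB.
have Va c (tc sc: 'I_n -> R) k: c = \sum_k tc k *: V k + \sum_k sc k *: (V k *m J) ->
  bilin om (V k) c = \sum_l sc l * bilin om (V k) (V l *m J).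
 move=> ->;rewrite bilinDr !bilin_sumr [X in X + _]big1 ?add0r => [|l _];last first.
  by rewrite bilinZr omV mulr0.
 by apply: eq_bigr => l _;rewrite bilinZr.
rewrite {1}Ea bilinDl !bilin_suml;congr (_ + _).
 by apply: eq_bigr => k _;rewrite bilinZl.
transitivity (\sum_i \sum_l sa i * (tb l * bilin om (V i *m J) (V l))).
 apply: eq_bigr => i _;rewrite bilinZl {1}Eb bilinDr !bilin_sumr.
 rewrite [X in _ + X]big1 ?addr0 => [|l _];last by rewrite bilinZr omVJ mulr0.
 by rewrite mulr_sumr;apply: eq_bigr => l _;rewrite bilinZr.
rewrite exchange_big -sumrN;apply: eq_bigr => l _ /=.
rewrite (Va _ _ _ l Ea) mulr_sumr -sumrN;apply: eq_bigr => i _.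
by rewrite [bilin om (V l) _]om_alt;ring.
Qed.

(** The standard form in polar components: [pa] is the logarithmic radial derivative and [ta] the
    derivative of the angle, so that this is the sum of r dr wedge dtheta. *)
Lemma polar_form (w A B: 'rV[R]_(n + n)) (pa ta pb tb: 'I_n -> R) :
 (forall j, A 0 (lshift n j) = pa j * w 0 (lshift n j) - ta j * w 0 (rshift n j)) ->
 (forall j, A 0 (rshift n j) = pa j * w 0 (rshift n j) + ta j * w 0 (lshift n j)) ->
 (forall j, B 0 (lshift n j) = pb j * w 0 (lshift n j) - tb j * w 0 (rshift n j)) ->
 (forall j, B 0 (rshift n j) = pb j * w 0 (rshift n j) + tb j * w 0 (lshift n j)) ->
 bilin J A B = \sum_j sq w j * (pa j * tb j - ta j * pb j).
move=> A1 A2 B1 B2;rewrite bilin_mulI;apply: eq_bigr => j _.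
by rewrite A1 A2 B1 B2 /sq;ring.
Qed.

Lemma frame_span (Z: 'M[R]_(n + n)) (z a: 'rV[R]_(n + n)): Z \in unitmx -> J *m Z = Z *m J ->
 (forall j, V j *m Z = z *m prm j *m J) -> (forall j, sq z j != 0) ->
 let t k:= ip (z *m J) (a *m Z) k / sq z k in let s k:= - (ip z (a *m Z) k / sq z k) in
 a = \sum_k t k *: V k + \sum_k s k *: (V k *m J).
move=> uZ ZJ VZ z0 t s.
suff E: a *m Z = (\sum_k t k *: V k + \sum_k s k *: (V k *m J)) *m Z.
 by rewrite -(mulmxK uZ a) E mulmxK.
rewrite mulmxDl !mulmx_suml.
under eq_bigr do rewrite -scalemxAl VZ.
under [X in _ = _ + X]eq_bigr do rewrite -scalemxAl -mulmxA ZJ mulmxA VZ -mulmxA mulI_sqr mulmxN mulmx1.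
set d:= a *m Z in t s *.
apply: row_split_ext => j;rewrite [RHS]mxE !summxE (bigD1 j) //= [X in _ + X + _]big1 => [|k kj].
- rewrite (bigD1 j) //= [X in _ + (_ + X)]big1 => [|k kj].
  rewrite !rowZE rowNE mulIE_l prm_l prm_r eqxx /t /s /ip mulIE_l mulIE_r.
  rewrite (_: true%:R = 1 :> R) //.
  by move: (z0 j);rewrite /sq => zj;field.
 by rewrite rowZE rowNE prm_l eq_sym (negbTE kj) mulr0 oppr0 mulr0.
- by rewrite rowZE mulIE_l prm_r eq_sym (negbTE kj) !mulr0 oppr0 mulr0.
- rewrite (bigD1 j) //= [X in _ + (_ + X)]big1 => [|k kj].
  rewrite !rowZE rowNE mulIE_r prm_l prm_r eqxx /t /s /ip mulIE_l mulIE_r.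
  rewrite (_: true%:R = 1 :> R) //.
  by move: (z0 j);rewrite /sq => zj;field.
 by rewrite rowZE rowNE prm_r eq_sym (negbTE kj) mulr0 oppr0 mulr0.
- by rewrite rowZE mulIE_r prm_l eq_sym (negbTE kj) !mulr0.
Qed.

End Frames.

Section FormInCoordinates.
#[local] Opaque jacobian invmx diff_into diff_self mjac.
Context {R n M} (X: kahler_manifold R n M).
Local Notation c:= (chart_at X).
Local Notation J:= (mulI R n).

Definition formc k (h: 'rV[R]_k -> M) (w: 'rV[R]_k): 'M[R]_k :=
 diff_into X h w *m kform X (h w) *m (diff_into X h w)^T.

Lemma formcE k (h: 'rV[R]_k -> M) w v v' :
 bilin (formc h w) v v' = bilin (kform X (h w)) (v *m diff_into X h w) (v' *m diff_into X h w).
exact: bilinM. Qed.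

Lemma formc_smooth k (V: set 'rV[R]_k) (h: 'rV[R]_k -> M) i j: open V -> smooth_into X V h ->
 smooth_on V (fun w => formc h w i j).
by apply: (pullback_smooth i j _ (local_form_smooth X)) => p q /local_formE. Qed.

Lemma formc_bilin_smooth k (V: set 'rV[R]_k) (h: 'rV[R]_k -> M) a b: open V -> smooth_into X V h ->
 smooth_on V (fun w => bilin (formc h w) a b).
move=> oV sh k0;rewrite /bilin.
apply: (Ck_mxmul (A:= fun w => a *m formc h w) (B:= fun=> b^T)) => //.
 move=> i j;apply: (Ck_mxmul (A:= fun=> a) (B:= formc h)) => //.
  by move=> *;exact: Ck_cst.
 by move=> i1 j1;exact: formc_smooth.
by move=> *;exact: Ck_cst.
Qed.

Lemma dfun_ext O (f g: M -> R) x v: open O -> O x -> (forall p, O p -> f p = g p) -> msm X O g ->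
 diff_fun X f x v = diff_fun X g x v.
move=> oO Ox fg sg;have xx:= chart_at_dom X x;rewrite /diff_fun.
apply: near_eq_diffE;last exact: (msm_diff0 sg Ox).
have oI:= chart_image_open (e:= c x) oO.
have: nbhs (c x x) (c x @` (cdom (c x) `&` O)) by apply: open_nbhs_nbhs;split=> //;exists x.
by apply: filterS => _ [p [px Op] <-] /=;rewrite ctoK // fg.
Qed.

Lemma dfunD O (f g: M -> R) x v: msm X O f -> msm X O g -> O x ->
 diff_fun X (fun p => f p + g p) x v = diff_fun X f x v + diff_fun X g x v.
move=> sf sg Ox;have xx:= chart_at_dom X x;rewrite /diff_fun.
rewrite -[_ \o _]/((f \o cinv (c x)) + (g \o cinv (c x))).
by rewrite diffD /=;[|exact: (msm_diff0 sf Ox)|exact: (msm_diff0 sg Ox)].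
Qed.

Lemma dfunM O (f g: M -> R) x v: msm X O f -> msm X O g -> O x ->
 diff_fun X (fun p => f p * g p) x v = f x * diff_fun X g x v + g x * diff_fun X f x v.
move=> sf sg Ox;have xx:= chart_at_dom X x;rewrite /diff_fun.
rewrite -[_ \o _]/((f \o cinv (c x)) * (g \o cinv (c x))).
rewrite diffM /=;[|exact: (msm_diff0 sf Ox)|exact: (msm_diff0 sg Ox)].
by rewrite !ctoK.
Qed.

Lemma dfun_coord m O (g: M -> 'rV[R]_m) x v i: msm X O g -> O x ->
 diff_fun X (fun p => g p 0 i: R) x v = (v *m mjac X g x) 0 i.
move=> sg Ox;have dg:= msm_diff0 sg Ox.
rewrite /diff_fun -[_ \o _]/(fun y => (g \o cinv (c x)) y 0 i) (diff_mxcoordE _ _ _ dg) (diffJ _ dg).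
by rewrite mjacE.
Qed.

Lemma dfun_into k (V: set 'rV[R]_k) (h: 'rV[R]_k -> M) O (f: M -> R) w v: open V -> smooth_into X V h ->
 open O -> msm X O f -> V w -> O (h w) ->
 'd (f \o h) w v = diff_fun X f (h w) (v *m diff_into X h w).
move=> oV sh oO sf Vw Ow;pose g (p: M): 'rV[R]_1:= \row_i f p.
have sg: msm X O g.
 apply: msm_rV => // i;apply: (msm_ext (g':= f)) => // p _;by rewrite mxE.
have dgh:= into_diff oV sh (@comp_closed_rV R 1) oO sg Vw Ow.
have E1: f \o h = fun y => (g \o h) y 0 0 by apply/funext => y;rewrite /= mxE.
have E2: f = fun p => g p 0 0 by apply/funext => y;rewrite mxE.
rewrite E1 (diff_mxcoordE _ _ _ dgh) (diffJ _ dgh) (into_J oV sh oO sg Vw Ow) [in RHS]E2.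
by rewrite (dfun_coord _ _ sg Ow) mulmxA.
Qed.

End FormInCoordinates.

Lemma disc_near (R: realType) n (A: set 'rV[R]_(n + n)): nbhs (0: 'rV[R]_(n + n)) A ->
 exists2 d: R, 0 < d & disc d `<=` A.
move=> NA;have [d d0 Hd]:= disc_sub (@open_interior _ A) NA.
by exists d => // w /Hd;exact: interior_subset.
Qed.

Lemma prm_decomp (R: realType) n (v: 'rV[R]_(n + n)) j: v *m prm j =
 v 0 (lshift n j) *: delta_mx 0 (lshift n j) + v 0 (rshift n j) *: (delta_mx 0 (lshift n j) *m mulI R n).
apply: row_split_ext => k;rewrite [RHS]mxE !rowZE ?prm_l ?prm_r ?mulIE_l ?mulIE_r !mxE !eqxx /=.
 by rewrite (inj_eq (@lshift_inj _ _)) eq_rlshift;case: eqVneq => [->|_] /=;ring.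
by rewrite eq_rlshift (inj_eq (@lshift_inj _ _));case: eqVneq => [->|_] /=;ring.
Qed.

(** On a plane an alternating form is a multiple of the area form; turning one argument by J changes
    area into inner product. This puts the differential of the moment coordinates in the form
    required by [radial_factor]. *)
Lemma line_form (R: realType) n (F: 'M[R]_(n + n)) (w v: 'rV[R]_(n + n)) j :
 (forall a b, bilin F a b = - bilin F b a) ->
 (forall a b, bilin F (a *m mulI R n) (b *m mulI R n) = bilin F a b) ->
 - bilin F (w *m prm j *m mulI R n) (v *m prm j) =
 bilin F (delta_mx 0 (lshift n j)) (delta_mx 0 (lshift n j) *m mulI R n) * ip w v j.
move=> Fa FJ;rewrite !prm_decomp mulmxDl -!scalemxAl -mulmxA mulI_sqr mulmxN mulmx1.
set d:= delta_mx _ _: 'rV[R]_(n + n);set e:= d *m _.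
have Fdd: bilin F d d = 0 by have:= Fa d d;lra.
have Fee: bilin F e e = 0 by have:= Fa e e;lra.
rewrite bilinDl !bilinDr !bilinZl !bilinZr -[- d]scaleN1r !bilinZl Fdd Fee (Fa e d) /ip.
by ring.
Qed.

(** * Equivariant Darboux coordinates at a fixed point *)

Section NormalForm.
#[local] Opaque jacobian invmx diff_into diff_self mjac kform.
Context {R n M} (X: toric_kahler_manifold R n M).
Local Notation c:= (chart_at X).
Local Notation J:= (mulI R n).

(** The moment map is constant on torus orbits, so its differential vanishes on generators. *)
Lemma gen_isotropic x xi eta: bilin (kform X x) (gen X x xi) (gen X x eta) = 0.
rewrite -hamiltonian_eq.
have sm:= smooth_fun_msm (moment_smooth X).
have:= velocity_comp (gam:= fun s: R => act X (expi (s *: eta)) x) (@openT M) sm I (torus_velocity0 X x eta).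
rewrite scale0r torus0 => H.
have E: gen X x eta *m mjac X (moment X) x = 0.
 apply: (is_dmx_unique (B:= fun s: R => moment X (act X (expi (s *: eta)) x))).
  by move=> i j;rewrite (ord1 i);exact: is_derive_entry H.
 by apply: (is_dmx_ext (B:= fun=> moment X x));[move=> s;rewrite moment_invariant|exact: is_dmx_cst].
by rewrite E mul0mx mxE.
Qed.

Context (q: M) (N: set M) (z: M -> 'rV[R]_(n + n)) (L: 'M[R]_n).
Hypotheses (oN: open N) (Nq: N q) (sz: msm X N z) (z0: z q = 0) (uz: mjac X z q \in unitmx)
 (zJ: forall x, N x -> J *m mjac X z x = mjac X z x *m J)
 (zV: forall xi x, N x -> gen X x xi *m mjac X z x =
    z x *m (diag_mx (row_mx (xi *m L) (xi *m L)) *m J))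
 (uL: L \in unitmx).

(** The generator of weight vector delta_j: it rotates z_j with unit speed and leaves the other
    coordinates fixed. *)
Definition rotgen j x:= gen X x (row j (invmx L)).
Local Notation V:= rotgen.

(** The action coordinate generating, up to sign, the rotation of z_j, normalized to vanish at [q].
    It will be |w_j|^2 / 2 in the Darboux coordinates. *)
Definition radius_half j x: R:= ((moment X q - moment X x) *m (invmx L)^T) 0 j.
Local Notation Y:= radius_half.

Lemma rotgen_z j x: N x -> V j x *m mjac X z x = z x *m prm j *m J.
move=> Nx;rewrite zV // -row_mul mulVmx // -mulmxA;congr (_ *m (_ *m _)).
by rewrite /prm row1.
Qed.

Lemma radius_smooth j: msm X setT (Y j).
have sm:= smooth_fun_msm (moment_smooth X).
apply: (msm_coord (f:= fun x => (moment X q - moment X x) *m (invmx L)^T));first exact: openT.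
rewrite (_: (fun x => _) = fun x => moment X x *m (- (invmx L)^T) + moment X q *m (invmx L)^T).
 by apply: msmD;[exact: openT|apply: msm_mulmx;[exact: openT|exact: sm]|exact: msm_cst].
by apply/funext => x;rewrite mulmxBl mulmxN addrC.
Qed.

Lemma moment_radius x: moment X x = moment X q - (\row_j Y j x) *m L^T.
have -> : \row_j Y j x = (moment X q - moment X x) *m (invmx L)^T.
 by apply/rowP => j;rewrite mxE.
by rewrite -mulmxA -trmx_mul mulmxV // trmx1 mulmx1 opprB addrC subrK.
Qed.

Lemma dradius j x v: diff_fun X (Y j) x v = - bilin (kform X x) (V j x) v.
have sm:= smooth_fun_msm (moment_smooth X).
rewrite -hamiltonian_eq.
have sg: msm X setT (fun x => moment X x *m (- (invmx L)^T)) by apply: msm_mulmx;[exact: openT|exact: sm].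
have E: Y j = fun x => (moment X x *m (- (invmx L)^T)) 0 j + (moment X q *m (invmx L)^T) 0 j.
 by apply/funext => y;rewrite /radius_half mulmxBl mulmxN addrC mxE;congr (_ + _);rewrite !mxE.
have sY': msm X setT (fun x => moment X x *m (- (invmx L)^T) + moment X q *m (invmx L)^T).
 by apply: msmD;[exact: openT|exact: sg|exact: msm_cst].
have -> : Y j = fun x => (moment X x *m (- (invmx L)^T) + moment X q *m (invmx L)^T) 0 j.
 by rewrite E;apply/funext => y;rewrite [RHS]mxE.
rewrite (dfun_coord v j sY' I).
have:= mjac_post (k:= fun y => y *m (- (invmx L)^T) + moment X q *m (invmx L)^T) sm I (differentiable_affine _ _ (moment X x)).
rewrite J_affine => ->;rewrite mulmxN mulmxN rowNE mulmxA.
apply: congr1;rewrite [LHS]mxE [RHS]mxE;apply: eq_bigr => k _.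
by rewrite !mxE.
Qed.

Section Coordinates.
Context (O: set M) (h: 'rV[R]_(n + n) -> M).
Hypotheses (Ch: coord_on X O z h) (ON: O `<=` N) (Oq: O q).
Local Notation I:= (z @` O).
Local Notation F:= (formc X h).

Let oI: open I. Proof. by case: Ch. Qed.
Let sh: smooth_into X I h. Proof. by case: Ch. Qed.
Let hO w: I w -> O (h w). Proof. by case: Ch => _ _ _ H _ [x Ox <-];rewrite H. Qed.
Let zh w: I w -> z (h w) = w. Proof. by case: Ch => _ _ _ H _ [x Ox <-];rewrite H. Qed.

Lemma rotgen_coord j w: I w -> V j (h w) = w *m prm j *m J *m diff_into X h w.
move=> Iw;have Ow:= hO Iw;have H:= coord_on_inv Ch Ow;rewrite (zh Iw) in H.
have H2: mjac X z (h w) *m diff_into X h w = 1%:M by exact: mulmx1C H.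
have E:= rotgen_z j (ON Ow);rewrite (zh Iw) in E.
rewrite -[LHS]mulmx1.
apply: (etrans (congr1 (mulmx (V j (h w))) (esym H2))).
apply: (etrans (mulmxA _ _ _));exact: (congr1 (mulmx^~ (diff_into X h w)) E).
Qed.

Lemma diff_into_J w: I w -> J *m diff_into X h w = diff_into X h w *m J.
move=> Iw;have Ow:= hO Iw;have H:= coord_on_inv Ch Ow;rewrite (zh Iw) in H.
have H2: mjac X z (h w) *m diff_into X h w = 1%:M by exact: mulmx1C H.
have ZJ:= zJ (ON Ow);move: H H2 ZJ;move: (mjac X z (h w)) (diff_into X h w) => A D H H2 ZJ.
have E: D *m (A *m J) *m D = J *m D by rewrite mulmxA H mul1mx.
by rewrite -E -ZJ -!mulmxA H2 mulmx1.
Qed.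

Lemma formc_J w a b: I w -> bilin (F w) (a *m J) (b *m J) = bilin (F w) a b.
move=> Iw;have H:= diff_into_J Iw;rewrite !formcE.
have E (v: 'rV[R]_(n + n)): v *m J *m diff_into X h w = v *m diff_into X h w *m J.
 apply: (etrans (esym (mulmxA _ _ _)));apply: (etrans (congr1 (mulmx v) H));exact: mulmxA.
by rewrite !E kform_J.
Qed.

Lemma formc_alt w a b: bilin (F w) a b = - bilin (F w) b a.
by rewrite !formcE bilin_alt. Qed.

Definition line_metric j (w: 'rV[R]_(n + n)): R :=
 bilin (F w) (delta_mx 0 (lshift n j)) (delta_mx 0 (lshift n j) *m J).

Lemma line_metric_smooth j: smooth_on I (line_metric j).
exact: formc_bilin_smooth.
Qed.

Lemma line_metric_gt0 j w: I w -> 0 < line_metric j w.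
move=> Iw;have H:= diff_into_J Iw;rewrite /line_metric formcE.
set d: 'rV[R]_(n + n):= delta_mx 0 _.
have -> : d *m J *m diff_into X h w = d *m diff_into X h w *m J.
 apply: (etrans (esym (mulmxA _ _ _)));apply: (etrans (congr1 (mulmx d) H));exact: mulmxA.
apply: kform_pos;apply/eqP => E.
have Ow:= hO Iw;have H1:= coord_on_inv Ch Ow;rewrite (zh Iw) in H1.
have: d = 0.
 rewrite -[d]mulmx1;apply: (etrans (congr1 (mulmx d) (esym H1))).
 apply: (etrans (mulmxA _ _ _));apply: (etrans (congr1 (mulmx^~ (mjac X z (h w))) E));exact: mul0mx.
by move=> /rowP/(_ (lshift n j));rewrite !mxE !eqxx => /eqP;rewrite oner_eq0.
Qed.

Lemma dradius_coord j w v: I w -> 'd (Y j \o h) w v = - bilin (F w) (w *m prm j *m J) v.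
move=> Iw;have sY:= radius_smooth j.
rewrite (dfun_into v oI sh (@openT M) sY Iw Logic.I) dradius formcE rotgen_coord //.
Qed.

Lemma radius_comp_smooth j: smooth_on I (Y j \o h).
have:= comp_into oI sh (@comp_closed_R R) (@openT M) (radius_smooth j).
by move=> H k;apply: Ck_mono (H k) => w Iw;split.
Qed.

(** Along the segment from 0 to a point with w_j = 0 the differential of the j-th action coordinate
    vanishes, since the j-th rotation is stationary there. *)
Lemma radius_comp0 j r w: disc r `<=` I -> disc r w -> w *m prm j = 0 -> Y j (h w) = 0.
move=> rI Dw w0.
have Ds s: 0 <= s <= 1 -> disc r (s *: w).
 move=> /andP[s0 s1] k;apply: le_lt_trans (Dw k);rewrite /sq !rowZE !exprMn -mulrDr.
 by rewrite ler_piMl ?sq_ge0 // exprn_ile1.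
have D (s: R): 0 <= s <= 1 -> is_derive s (1: R) (fun s: R => Y j (h (s *: w))) 0.
 move=> s01;have Is:= rI _ (Ds s s01).
 have dg: is_derive s (1: R) (fun s: R => s *: w) w.
  apply: is_derive_mx => i;rewrite (_: (fun s: R => _) = fun s: R => s * w 0 i);first exact: is_derive_mulr.
  by apply/funext => t;rewrite mxE.
 have:= is_derive_comp_diff dg ((radius_comp_smooth j 1%N).1 _ Is).
 rewrite (dradius_coord _ _ Is) -scalemxAl w0 scaler0 mul0mx.
 by rewrite /bilin !mul0mx mxE oppr0.
have:= derive0_cst ler01 D;rewrite scale1r scale0r => ->.
have -> : h 0 = q by rewrite -z0;case: Ch => _ _ _ H _;exact: H.
by rewrite /radius_half subrr mul0mx mxE.
Qed.

End Coordinates.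
End NormalForm.

Section NormalChart.
#[local] Opaque jacobian invmx diff_into diff_self mjac kform.
Context {R n M} (X: toric_kahler_manifold R n M).
Local Notation c:= (chart_at X).
Local Notation J:= (mulI R n).

Lemma msm_open (W: normedModType R) O (g: M -> W) A: open O -> msm X O g -> open A ->
 open (O `&` g @^-1` A).
move=> oO sg oA;rewrite openE => x [Ox Ax];rewrite /interior /=.
apply: filterI;first exact: open_nbhs_nbhs.
by apply: (msm_continuous oO sg Ox);exact: open_nbhs_nbhs.
Qed.

Definition scm (a: 'I_n -> R): 'M[R]_(n + n):= diag_mx (row_mx (\row_j a j) (\row_j a j)).

Lemma scm_l (a: 'I_n -> R) (w: 'rV[R]_(n + n)) j: (w *m scm a) 0 (lshift n j) = w 0 (lshift n j) * a j.
by rewrite mul_mx_diag mxE row_mxEl mxE. Qed.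

Lemma scm_r (a: 'I_n -> R) (w: 'rV[R]_(n + n)) j: (w *m scm a) 0 (rshift n j) = w 0 (rshift n j) * a j.
by rewrite mul_mx_diag mxE row_mxEr mxE. Qed.

Lemma scm_J a: J *m scm a = scm a *m J.
apply: mx_rV_ext => v;rewrite !mulmxA;apply: row_split_ext => j.
 by rewrite scm_l !mulIE_l scm_r mulNr.
by rewrite scm_r !mulIE_r scm_l.
Qed.

Lemma scm_unit a: (forall j, a j != 0) -> scm a \in unitmx.
move=> a0;rewrite unitmxE det_diag unitfE;apply/prodf_neq0 => i _.
by have [j ->|j ->]:= split_ordP i;rewrite ?row_mxEl ?row_mxEr mxE.
Qed.

Lemma sq_scm (a: 'I_n -> R) w j: sq (w *m scm a) j = a j ^+ 2 * sq w j.
by rewrite /sq scm_l scm_r;ring. Qed.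

Section Rescale.
Context (U: set 'rV[R]_(n + n)) (rho: 'I_n -> 'rV[R]_(n + n) -> R) (oU: open U).
Hypothesis srho: forall j, smooth_on U (rho j).
Local Notation theta:= (fun w: 'rV[R]_(n + n) => w *m scm (rho^~ w)).

Lemma rescale_smooth: smooth_on U theta.
move=> k;apply: Ck_rV => // i;have [j ->|j ->]:= split_ordP i.
 rewrite (_: (fun x => _) = fun w: 'rV[R]_(n + n) => w 0 (lshift n j) * rho j w).
  by apply: CkM => //;[apply: Ck_coord => //;exact: Ck_self|exact: srho].
 by apply/funext => w;rewrite scm_l.
rewrite (_: (fun x => _) = fun w: 'rV[R]_(n + n) => w 0 (rshift n j) * rho j w).
 by apply: CkM => //;[apply: Ck_coord => //;exact: Ck_self|exact: srho].
by apply/funext => w;rewrite scm_r.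
Qed.

(** At 0 the derivative of the factor is multiplied by w = 0, so only the real scaling remains; it
    commutes with J. This is why the rescaled coordinates are still complex linear at the fixed
    point. *)
Lemma rescale_J0: U 0 -> 'J theta 0 = scm (rho^~ 0).
move=> U0;have dt:= (rescale_smooth 1%N).1 _ U0.
apply: J_unique => // v.
have H i j: differentiable (fun w: 'rV[R]_(n + n) => w 0 i * rho j w) 0 /\
  'd (fun w: 'rV[R]_(n + n) => w 0 i * rho j w) 0 v = v 0 i * rho j 0.
 have d1: differentiable (fun w: 'rV[R]_(n + n) => w 0 i: R) 0.
  apply: differentiable_mxcoord;exact: (differentiable_lin (@idfun 'rV[R]_(n + n))).
 have d2: differentiable (rho j: _ -> R) 0:= (srho j 1%N).1 _ U0.
 split;first exact: differentiableM.
 rewrite -[fun w => _]/((fun w: 'rV[R]_(n + n) => w 0 i: R) * rho j) diffM //=.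
 have E: 'd (fun w: 'rV[R]_(n + n) => w 0 i: R) 0 v = v 0 i.
  rewrite (diff_mxcoordE _ _ _ (differentiable_lin (@idfun 'rV[R]_(n + n)) 0)).
  by rewrite (diff_linE (@idfun 'rV[R]_(n + n))).
 rewrite -[LHS]/((0: 'rV[R]_(n + n)) 0 i *: 'd (rho j) 0 v + rho j 0 *: 'd (fun w: 'rV[R]_(n + n) => w 0 i: R) 0 v) E.
 by rewrite [(0: 'rV[R]_(n + n)) 0 i]mxE scale0r add0r /GRing.scale /= mulrC.
apply: row_split_ext => j.
 rewrite -(diff_mxcoordE _ _ _ dt) scm_l -(H (lshift n j) j).2.
 by congr ('d _ 0 v);apply/funext => w;rewrite scm_l.
rewrite -(diff_mxcoordE _ _ _ dt) scm_r -(H (rshift n j) j).2.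
by congr ('d _ 0 v);apply/funext => w;rewrite scm_r.
Qed.

End Rescale.

(** The chart is symplectic on all of [O], but its complex linearity is recorded at [q] only: the
    rescaling that makes it symplectic is not holomorphic in general. *)
Definition normal_chart q O W h L (d: R): Prop :=
 [/\ 0 < d, L \in unitmx, coord_on X O W h, O q & W q = 0] /\
 [/\ W @` O = disc d, J *m mjac X W q = mjac X W q *m J,
   forall x, O x -> moment X x = moment X q - (2^-1 *: \row_j sq (W x) j) *m L^T &
   forall w, disc d w -> formc X h w = J].

(** For w = r z with r real, w and z have the same angle, so the angular component of dw is the one
    computed from z, whatever the derivative of r. *)
Lemma polar_arith (al ar wl wr zl zr r dzl dzr dr: R): wl = r * zl -> wr = r * zr ->
 al = zl * dr + r * dzl -> ar = zr * dr + r * dzr -> zl ^+ 2 + zr ^+ 2 != 0 -> r != 0 ->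
 forall P T, P = (wl * al + wr * ar) / (wl ^+ 2 + wr ^+ 2) ->
 T = (- zr * dzl + zl * dzr) / (zl ^+ 2 + zr ^+ 2) ->
 al = P * wl - T * wr /\ ar = P * wr + T * wl.
move=> -> -> -> -> z0 r0 P T -> ->.
have w0: (r * zl) ^+ 2 + (r * zr) ^+ 2 != 0 by rewrite !exprMn -mulrDr mulf_neq0 // expf_neq0.
split;field;rewrite z0 //=.
Qed.

(** The holomorphic coordinates z_j are kept in phase and changed in modulus only, so that |W_j|^2
    becomes twice the action coordinate Y_j. The generators V_k and the vectors J V_k span isotropic
    spaces, and J V_k does not change the phases of z; hence omega is the sum of dY_k wedge d(arg
    z_k), which is the standard form in [W]. *)
Lemma normal_form q: (0 < n)%N -> (forall xi, act X (expi xi) q = q) ->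
 exists O W h L d, normal_chart q O W h L d.
move=> n0 fq.
have [N [z [L [[oN Nq aN] [sz z0 uz zJ zV]]]]]:= weight_chart fq n0.
have uL:= weight_unit oN Nq sz uz zV.
have [ O1 [h1 [ O1N O1q C1]]]:= coord_exists oN Nq sz uz.
have oI1: open (z @` O1) by case: C1.
have I10: (z @` O1) 0 by rewrite -z0;exists q.
have lm0 j: 0 < line_metric X h1 j 0 by exact: (line_metric_gt0 zJ C1 O1N j I10).
have [r r0 Hr]: exists2 r: R, 0 < r & disc r `<=`
  (z @` O1) `&` [set w | forall j, `|line_metric X h1 j w - line_metric X h1 j 0| <= line_metric X h1 j 0 / 4].
 apply: disc_near;apply: filterI;first exact: open_nbhs_nbhs.
 have H j: \forall w \near (0: 'rV[R]_(n + n)), `|line_metric X h1 j w - line_metric X h1 j 0| <= line_metric X h1 j 0 / 4.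
  have e0: 0 < line_metric X h1 j 0 / 4 by rewrite divr_gt0.
  have cl: {for (0: 'rV[R]_(n + n)), continuous (line_metric X h1 j: _ -> R)} by exact: (line_metric_smooth C1 j 0%N).
  exact: (@continuous_near_le R 'rV[R]_(n + n) R _ _ _ _ e0 cl erefl).
 exact: (filter_forall _ H).
pose O2:= O1 `&` z @^-1` disc r.
have O2O1: O2 `<=` O1 by move=> x [].
have oO2: open O2.
 apply: (msm_open (g:= z));[by case: C1|by case: C1|exact: disc_open].
have C2:= coord_on_sub C1 oO2 O2O1.
have O2N: O2 `<=` N by move=> x [/O1N].
have O2q: O2 q by split=> //;rewrite /preimage /= z0;exact: disc0.
have I2: z @` O2 = disc r.
 apply/seteqP;split=> [_ [x [_ Dx] <-]//|w Dw];have [[x O1x E] _]:= Hr _ Dw.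
 by exists x => //;split=> //;rewrite /preimage /= E.
pose Y:= radius_half X q L.
have /choice[u Hu]: forall j, exists u: 'rV[R]_(n + n) -> R,
  [/\ smooth_on (disc r) u, forall w, disc r w -> 0 < u w &
    forall w, disc r w -> Y j (h1 w) = sq w j * u w].
 move=> j;apply: (radial_factor (g0:= line_metric X h1 j 0) (Y:= Y j \o h1) (g:= line_metric X h1 j)).
 - exact: lm0.
 - by have:= radius_comp_smooth q L C2 j;rewrite I2.
 - by have:= line_metric_smooth C2 j;rewrite I2.
 - move=> w v Dw;have Iw: (z @` O2) w by rewrite I2.
  rewrite (dradius_coord q zV uL C2 O2N) // line_form //.
   by move=> a b;exact: formc_alt.
  by move=> a b;exact: (formc_J zJ C2 O2N).
 - move=> w Dw w0;apply: (radius_comp0 z0 zV uL C2 O2N O2q (r:= r)) => //;by rewrite I2.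
 - by move=> w /Hr[].
(* Since Y_j = |z_j|^2 u_j, multiplying z_j by sqrt(2 u_j) gives modulus squared 2 Y_j. *)
pose rho j w:= Num.sqrt (2 * u j w).
have srho j: smooth_on (disc r) (rho j).
 have [su u0 _]:= Hu j;move=> k;apply: Ck_sqrt;first exact: disc_open.
  by move=> w Dw;rewrite mulr_gt0 // u0.
 by apply: CkM;[exact: disc_open|exact: Ck_cst|exact: su].
have rho0 j w: disc r w -> 0 < rho j w.
 by move=> Dw;have [_ u0 _]:= Hu j;rewrite sqrtr_gt0 mulr_gt0 // u0.
have oD:= @disc_open R n r.
pose theta (w: 'rV[R]_(n + n)):= w *m scm (rho^~ w).
have st: smooth_on (disc r) theta by exact: rescale_smooth.
have D0:= disc0 (n:= n) r0.
pose W x:= theta (z x).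
have sz2: msm X O2 z by case: C2.
have Dz x: O2 x -> disc r (z x) by case.
have sW: msm X O2 W by apply: (msm_post (V:= disc r) (@comp_closed_rV R (n + n)) oO2 oD Dz sz2 st).
have mWq: mjac X W q = mjac X z q *m scm (rho^~ 0).
 have dt: differentiable theta (z q) by rewrite z0;exact: (st 1%N).1.
 have:= mjac_post sz2 O2q dt;rewrite z0 (rescale_J0 oD srho D0) //.
have uW: mjac X W q \in unitmx.
 rewrite mWq unitmx_mul;apply/andP;split;first exact: uz.
 by apply: scm_unit => j;rewrite gt_eqF // rho0.
have [ O3 [h3 [ O3O2 O3q C3]]]:= coord_exists oO2 O2q sW uW.
have W0: W q = 0 by rewrite /W z0 /theta mul0mx.
have oI3: open (W @` O3) by case: C3.
have [d d0 Hd]:= disc_sub oI3 (ex_intro2 _ _ q O3q W0).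
pose O:= O3 `&` W @^-1` disc d.
have OO3: O `<=` O3 by move=> x [].
have oO: open O by apply: (msm_open (g:= W));[by case: C3|by case: C3|exact: disc_open].
have C:= coord_on_sub C3 oO OO3.
have Oq: O q by split=> //;rewrite /preimage /= W0;exact: disc0.
have IW: W @` O = disc d.
 apply/seteqP;split=> [_ [x [_ Dx] <-]//|w Dw];have [x O3x E]:= Hd _ Dw.
 by exists x => //;split=> //;rewrite /preimage /= E.
have OO2: O `<=` O2 by move=> x /OO3 /O3O2.
have YE x j: O2 x -> Y j x = sq (z x) j * u j (z x).
 move=> Ox;have [_ _ H]:= Hu j;rewrite -H;last exact: Dz.
 by case: C2 => _ _ _ -> .
have rhoE j w: disc r w -> rho j w ^+ 2 = 2 * u j w.
 by move=> Dw;have [_ u0 _]:= Hu j;rewrite sqr_sqrtr // mulr_ge0 // ltW // u0.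
have sqW x j: O2 x -> sq (W x) j = 2 * Y j x.
 by move=> Ox;have Dx:= Dz _ Ox;rewrite sq_scm (rhoE j _ Dx) (YE _ j Ox);ring.
exists O, W, h3, L, d;split;[by split|split].
- exact: IW.
- rewrite mWq mulmxA zJ //;have S:= scm_J (rho^~ 0);move: S;clear.
 by move: (scm _) (mjac _ _ _) => A B S;rewrite -mulmxA S mulmxA.
- move=> x Ox;rewrite (moment_radius X q uL x);congr (_ - _ *m _).
 apply/rowP => j;rewrite !mxE sqW ?mulrA ?mulVf ?mul1r //;exact: OO2.
move=> w Dw;apply: bilin_ext => a b.
have sh3: smooth_into X (disc d) h3 by rewrite -IW;case: C.
(* The polar computation needs all coordinates nonzero; the identity extends by continuity. *)
apply: (dense_eq (@disc_open R n d) (f:= fun w => bilin (formc X h3 w) a b) (g:= fun=> bilin J a b)) => //.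
- by move=> w' Dw';apply: (formc_bilin_smooth a b (@disc_open R n d) sh3 0%N).
- exact: (@Ck_cst R _ R 0 (disc d) (bilin J a b)).
clear w Dw;move=> w Dw wn0.
have [x Ox Ew]: (W @` O) w by rewrite IW.
have hx: h3 w = x by rewrite -Ew;case: C => _ _ _ -> .
have O2x:= OO2 _ Ox;have Nx:= O2N _ O2x;have Dzx:= Dz _ O2x.
have zn0 j: sq (z x) j != 0.
 by apply: contra_neq (wn0 j);rewrite -Ew sq_scm => ->;rewrite mulr0.
have inv: diff_into X h3 w *m mjac X W x = 1%:M by rewrite -Ew;exact: coord_on_inv C Ox.
rewrite formcE hx.
have aE (v: 'rV[R]_(n + n)): v *m diff_into X h3 w *m mjac X W x = v.
 exact: (etrans (esym (mulmxA _ _ _)) (etrans (congr1 (mulmx v) inv) (mulmx1 v))).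
move: (a *m diff_into X h3 w) (b *m diff_into X h3 w) (aE a) (aE b) => a' b' Ea Eb.
have uZ:= coord_on_unit C2 O2x.
pose V j:= rotgen X L j x.
have VZ j: V j *m mjac X z x = z x *m prm j *m J by exact: (rotgen_z zV uL j Nx).
(* [t v k] is the derivative of arg z_k along [v], and [s v k] is minus that of log |z_k|. *)
pose t (v: 'rV[R]_(n + n)) k:= ip (z x *m J) (v *m mjac X z x) k / sq (z x) k.
pose s (v: 'rV[R]_(n + n)) k:= - (ip (z x) (v *m mjac X z x) k / sq (z x) k).
have fr v: v = \sum_k t v k *: V k + \sum_k s v k *: (V k *m J).
 have H:= frame_span v uZ (zJ _ Nx) VZ zn0.
 exact H.
have omV j k: bilin (kform X x) (V j) (V k) = 0 by exact: gen_isotropic.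
have omVJ j k: bilin (kform X x) (V j *m J) (V k *m J) = 0 by rewrite kform_J.
rewrite (frame_form (fun v w => bilin_alt X x v w) omV omVJ (fr a') (fr b')).
(* The contraction of omega with V_k is - dY_k, so [pr v k] is dY_k(v) / |W_k|^2, the logarithmic
   derivative of |W_k|. *)
pose pr v k:= - bilin (kform X x) (V k) v / sq w k.
have sr j: msm X O2 (fun p => rho j (z p)).
 exact: (msm_post (V:= disc r) (@comp_closed_R R) oO2 oD Dz sz2 (srho j)).
have sc (i: 'I_(n + n)): msm X O2 (fun p => z p 0 i: R) by exact: msm_coord.
have sWc (i: 'I_(n + n)): msm X O2 (fun p => W p 0 i: R) by exact: msm_coord.
have key v j: (v *m mjac X W x) 0 (lshift n j) = pr v j * w 0 (lshift n j) - t v j * w 0 (rshift n j) /\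
  (v *m mjac X W x) 0 (rshift n j) = pr v j * w 0 (rshift n j) + t v j * w 0 (lshift n j).
 have Hl: (v *m mjac X W x) 0 (lshift n j) = z x 0 (lshift n j) * diff_fun X (fun p => rho j (z p)) x v +
   rho j (z x) * (v *m mjac X z x) 0 (lshift n j).
  have E1:= dfun_coord v (lshift n j) sW O2x;have E2:= dfun_coord v (lshift n j) sz2 O2x.
  have E3:= dfunM v (sc (lshift n j)) (sr j) O2x;rewrite E2 in E3.
  apply: (etrans (esym E1));apply: (etrans _ E3).
  by apply: (congr1 (fun f: M -> R => diff_fun X f x v));apply/funext => p;rewrite /W scm_l.
 have Hr': (v *m mjac X W x) 0 (rshift n j) = z x 0 (rshift n j) * diff_fun X (fun p => rho j (z p)) x v +
   rho j (z x) * (v *m mjac X z x) 0 (rshift n j).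
  have E1:= dfun_coord v (rshift n j) sW O2x;have E2:= dfun_coord v (rshift n j) sz2 O2x.
  have E3:= dfunM v (sc (rshift n j)) (sr j) O2x;rewrite E2 in E3.
  apply: (etrans (esym E1));apply: (etrans _ E3).
  by apply: (congr1 (fun f: M -> R => diff_fun X f x v));apply/funext => p;rewrite /W scm_r.
 have HY: - bilin (kform X x) (V j) v = w 0 (lshift n j) * (v *m mjac X W x) 0 (lshift n j) +
   w 0 (rshift n j) * (v *m mjac X W x) 0 (rshift n j).
  rewrite -(dradius X q L j x v).
  have sY: msm X O2 (Y j) by apply: msm_mono (radius_smooth X q L j).
  have E: diff_fun X (fun p => Y j p + Y j p) x v =
    diff_fun X (fun p => W p 0 (lshift n j) * W p 0 (lshift n j) + W p 0 (rshift n j) * W p 0 (rshift n j)) x v.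
   apply: (dfun_ext v oO2 O2x);last by apply: msmD => //;exact: msmM.
   by move=> p Op;have:= sqW p j Op;rewrite /sq !expr2 => ->;ring.
  rewrite (dfunD v sY sY O2x) in E.
  rewrite (dfunD v (msmM oO2 (sWc _) (sWc _)) (msmM oO2 (sWc _) (sWc _)) O2x) in E.
  rewrite !(dfunM v (sWc _) (sWc _) O2x) !(dfun_coord v _ sW O2x) Ew in E.
  move: E;move: (diff_fun _ _ _ _) ((v *m _) 0 _) ((v *m _) 0 _) (w 0 _) (w 0 _);clear => D A B p p' E.
  lra.
 have rn0: rho j (z x) != 0 by rewrite gt_eqF // rho0.
 have wl: w 0 (lshift n j) = rho j (z x) * z x 0 (lshift n j) by rewrite -Ew /W scm_l mulrC.
 have wr: w 0 (rshift n j) = rho j (z x) * z x 0 (rshift n j) by rewrite -Ew /W scm_r mulrC.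
 have HP:= congr1 (fun t => t / sq w j) HY.
 have HT: t v j = (- z x 0 (rshift n j) * (v *m mjac X z x) 0 (lshift n j) +
   z x 0 (lshift n j) * (v *m mjac X z x) 0 (rshift n j)) / sq (z x) j.
  by rewrite /t /ip (mulIE_l (z x) j) (mulIE_r (z x) j).
 exact: (polar_arith wl wr Hl Hr' (zn0 j) rn0 HP HT).
rewrite (polar_form (w:= w) (pa:= pr a') (ta:= t a') (pb:= pr b') (tb:= t b')).
- apply: eq_bigr => j _;rewrite /pr;move: (wn0 j);move: (sq w j) (bilin _ _ _) (bilin _ _ _) (t a' j) (t b' j);clear.
 by move=> e A B ta tb e0;field.
- by move=> j;rewrite -{1}Ea;exact: (key a' j).1.
- by move=> j;rewrite -{1}Ea;exact: (key a' j).2.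
- by move=> j;rewrite -{1}Eb;exact: (key b' j).1.
- by move=> j;rewrite -{1}Eb;exact: (key b' j).2.
Qed.

End NormalChart.

(** * Rotation flows of functions of the squared radii *)

Section Rotations.
Context {R: realType} {n: nat}.
Local Notation J:= (mulI R n).

Definition rotv (th: 'I_n -> R) (y: 'rV[R]_(n + n)): 'rV[R]_(n + n) :=
 y *m scm (fun j => cos (th j)) + y *m J *m scm (fun j => sin (th j)).

Lemma rotv_l th y j: rotv th y 0 (lshift n j) =
 y 0 (lshift n j) * cos (th j) - y 0 (rshift n j) * sin (th j).
by rewrite /rotv mxE !scm_l mulIE_l mulNr. Qed.

Lemma rotv_r th y j: rotv th y 0 (rshift n j) =
 y 0 (rshift n j) * cos (th j) + y 0 (lshift n j) * sin (th j).
by rewrite /rotv mxE !scm_r mulIE_r. Qed.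

Lemma sq_rotv th y j: sq (rotv th y) j = sq y j.
rewrite /sq rotv_l rotv_r -[RHS]mulr1 -(cos2Dsin2 (th j));ring.
Qed.

Lemma rotvD th th' y: rotv (fun j => th j + th' j) y = rotv th (rotv th' y).
by apply: row_split_ext => j;rewrite ?rotv_l ?rotv_r ?rotv_l ?rotv_r cosD sinD;ring.
Qed.

Lemma rotv0 y: rotv (fun=> 0) y = y.
by apply: row_split_ext => j;rewrite ?rotv_l ?rotv_r cos0 sin0;ring.
Qed.

Lemma rotv_ext th th' y: th =1 th' -> rotv th y = rotv th' y.
by move=> /funext ->. Qed.

Lemma Ck_rotv d k (U: set 'rV[R]_d) (th: 'I_n -> 'rV[R]_d -> R) (f: 'rV[R]_d -> 'rV[R]_(n + n)) :
 open U -> (forall j, Ck_on k U (th j)) -> Ck_on k U f -> Ck_on k U (fun x => rotv (th^~ x) (f x)).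
move=> oU sth sf;apply: Ck_rV => // i;have [j ->|j ->]:= split_ordP i.
 rewrite (_: (fun x: 'rV[R]_d => _) = fun x => f x 0 (lshift n j) * cos (th j x) - f x 0 (rshift n j) * sin (th j x)).
  by apply: CkB => //;apply: CkM => //;try (by apply: Ck_coord);[exact: Ck_cos|exact: Ck_sin].
 by apply/funext => x;rewrite rotv_l.
rewrite (_: (fun x: 'rV[R]_d => _) = fun x => f x 0 (rshift n j) * cos (th j x) + f x 0 (lshift n j) * sin (th j x)).
 by apply: CkD => //;apply: CkM => //;try (by apply: Ck_coord);[exact: Ck_cos|exact: Ck_sin].
by apply/funext => x;rewrite rotv_r.
Qed.

Lemma is_derive_rotv (k: 'I_n -> R) y t: is_derive t (1: R) (fun s: R => rotv (fun j => s * k j) y)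
 (rotv (fun j => t * k j) y *m scm k *m J).
have dc j: is_derive t (1: R) (fun s => cos (s * k j)) (- sin (t * k j) * k j).
 exact: (is_derive1_comp (is_derive_cos _) (is_derive_mulr (k j) t)).
have ds j: is_derive t (1: R) (fun s => sin (s * k j)) (cos (t * k j) * k j).
 exact: (is_derive1_comp (is_derive_sin _) (is_derive_mulr (k j) t)).
apply: is_derive_mx => i;have [j ->|j ->]:= split_ordP i.
 rewrite mulIE_l scm_r rotv_r.
 rewrite (_: (fun s: R => _) = (y 0 (lshift n j) \*: (fun s => cos (s * k j))) - (y 0 (rshift n j) \*: (fun s => sin (s * k j))));last first.
  by apply/funext => s;rewrite rotv_l.
 rewrite (_: - _ = y 0 (lshift n j) *: (- sin (t * k j) * k j) - y 0 (rshift n j) *: (cos (t * k j) * k j)).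
  exact: (is_deriveB (is_deriveZ _ (dc j)) (is_deriveZ _ (ds j))).
 by rewrite /GRing.scale /=;ring.
rewrite mulIE_r scm_l rotv_l.
rewrite (_: (fun s: R => _) = (y 0 (rshift n j) \*: (fun s => cos (s * k j))) + (y 0 (lshift n j) \*: (fun s => sin (s * k j))));last first.
 by apply/funext => s;rewrite rotv_r.
rewrite (_: _ * k j = y 0 (rshift n j) *: (- sin (t * k j) * k j) + y 0 (lshift n j) *: (cos (t * k j) * k j)).
 exact: (is_deriveD (is_deriveZ _ (dc j)) (is_deriveZ _ (ds j))).
by rewrite /GRing.scale /=;ring.
Qed.

Definition sqv (y: 'rV[R]_(n + n)): 'rV[R]_n:= \row_j sq y j.

Lemma sqv_rotv th y: sqv (rotv th y) = sqv y.
by apply/rowP => j;rewrite !mxE sq_rotv. Qed.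

Lemma Ck_sqv k (U: set 'rV[R]_(n + n)): open U -> Ck_on k U sqv.
move=> oU;apply: Ck_rV => // j;rewrite (_: (fun x => _) = fun y => sq y j).
 by apply: Ck_sq => //;exact: Ck_self.
by apply/funext => y;rewrite mxE.
Qed.

Lemma diff_sqv y v: 'd sqv y v = \row_j (2 * ip y v j).
have ds: differentiable sqv y by apply: (Ck_sqv 1 (@openT _)).1.
have dl: is_derive (0: R) (1: R) (fun s: R => y + s *: v) v.
 by have:= is_derive_segment y (y + v) 0;rewrite [y + v - y]addrC addKr.
have:= is_derive_comp_diff (g:= sqv) dl;rewrite scale0r addr0 => /(_ ds) H.
apply/rowP => j;have Hj:= is_derive_entry j H.
rewrite -(@derive_val _ _ _ _ _ _ _ Hj) mxE.
have -> : (fun s: R => (sqv \o (fun s: R => y + s *: v)) s 0 j) =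
 fun s => sq y j + s * (2 * ip y v j) + s * (s * sq v j).
 by apply/funext => s;rewrite /= mxE /sq /ip !mxE;ring.
have T1: is_derive (0: R) (1: R) (fun s => sq y j + s * (2 * ip y v j)) (0 + 2 * ip y v j).
 exact: (is_deriveD (is_derive_cst (sq y j) 0 (1: R)) (is_derive_mulr (2 * ip y v j) 0)).
have T2: is_derive (0: R) (1: R) (fun s => s * (s * sq v j)) (0 *: sq v j + (0 * sq v j) *: 1).
 exact: (is_deriveM (is_derive_id 0 (1: R)) (is_derive_mulr (sq v j) 0)).
have T:= is_deriveD T1 T2.
by rewrite (@derive_val _ _ _ _ _ _ _ T) scale0r mul0r scale0r !addr0 add0r.
Qed.

End Rotations.

Section RotationFlow.
#[local] Opaque jacobian invmx diff_into diff_self mjac kform.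
Context {R n M} (X: kahler_manifold R n M).
Local Notation c:= (chart_at X).
Local Notation J:= (mulI R n).

Context (O: set M) (g: M -> 'rV[R]_(n + n)) (h: 'rV[R]_(n + n) -> M) (F: 'rV[R]_n -> R) (K: set 'rV[R]_n).
Hypotheses (cM: compact [set: M]) (Cg: coord_on X O g h)
 (Hform: forall y, (g @` O) y -> formc X h y = J) (sF: smooth_on setT F)
 (cK: compact (sqv @^-1` K)) (KO: sqv @^-1` K `<=` g @` O) (clK: closed K)
 (F0: forall s, ~ K s -> F s = 0).

Let oO: open O. Proof. by case: Cg. Qed.
Let oI: open (g @` O). Proof. by case: Cg. Qed.
Let sg: msm X O g. Proof. by case: Cg. Qed.
Let sh: smooth_into X (g @` O) h. Proof. by case: Cg. Qed.
Let hg x: O x -> h (g x) = x. Proof. by case: Cg => _ _ _ H _;exact: H. Qed.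
Let hO y: (g @` O) y -> O (h y). Proof. by move=> [x Ox <-];rewrite hg. Qed.
Let gh y: (g @` O) y -> g (h y) = y. Proof. by move=> [x Ox <-];rewrite hg. Qed.

(** In Darboux coordinates a function F of the |y_j|^2 generates rotations of y_j with speed 2
    dF/ds_j. The speeds are constant along orbits, so the flow is explicit. *)
Definition freq (y: 'rV[R]_(n + n)) j: R:= 2 * 'd F (sqv y) (delta_mx 0 j).

Lemma freq_rotv th y: freq (rotv th y) = freq y.
by apply/funext => j;rewrite /freq sqv_rotv. Qed.

Lemma freq0 y: ~ K (sqv y) -> freq y = fun=> 0.
move=> nK;apply/funext => j;rewrite /freq.
have oK: open (~` K) by rewrite openC.
have -> : 'd F (sqv y) (delta_mx 0 j) = 'd (fun _: 'rV[R]_n => 0: R) (sqv y) (delta_mx 0 j).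
 apply: near_eq_diffE;last exact: differentiable_cst.
 have: nbhs (sqv y) (~` K) by apply: open_nbhs_nbhs.
 by apply: filterS => s /F0.
by rewrite diff_cst mulr0.
Qed.

Lemma freq_smooth j (U: set 'rV[R]_(n + n)): open U -> smooth_on U (fun y => freq y j).
move=> oU k;apply: CkM => //;first exact: Ck_cst.
apply: (Ck_compR (V:= setT) (f:= sqv) (g:= fun s => 'd F s (delta_mx 0 j))) => //;first exact: Ck_sqv.
exact: ((sF k.+1).2 (delta_mx 0 j)).
Qed.

Let C:= h @` (sqv @^-1` K).

Let cC: compact C.
apply: continuous_compact => //;apply: continuous_in_subspaceT => y;rewrite inE => Ky.
exact: (sh.1 y (KO Ky)).
Qed.

Let clC: closed C. Proof. exact: compact_closed (cm_hausdorff X) cC. Qed.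

Let CO: C `<=` O. Proof. by move=> _ [y Ky <-];apply: hO;exact: KO. Qed.

Let notC x: O x -> ~ C x -> ~ K (sqv (g x)).
by move=> Ox nC Ks;apply: nC;exists (g x) => //;exact: hg. Qed.

(** Outside the coordinate domain the flow is the identity. Both descriptions agree off the compact
    set [C], where the frequencies vanish. *)
Definition rotflow (t: R) (x: M): M :=
 if x \in O then h (rotv (fun j => t * freq (g x) j) (g x)) else x.

Let rotO t x: O x -> (g @` O) (rotv (fun j => t * freq (g x) j) (g x)).
move=> Ox;have [Ks|nK]:= pselect (K (sqv (g x))).
 by apply: KO;rewrite /preimage /= sqv_rotv.
rewrite (rotv_ext (th':= fun=> 0));last by move=> j;rewrite freq0 ?mulr0.
by rewrite rotv0;exists x.
Qed.

Lemma rotflow_in t x: O x -> rotflow t x = h (rotv (fun j => t * freq (g x) j) (g x)).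
by move=> Ox;rewrite /rotflow mem_set. Qed.

Lemma rotflow_out t x: ~ C x -> rotflow t x = x.
move=> nC;rewrite /rotflow;case: ifPn => // /set_mem Ox.
rewrite (rotv_ext (th':= fun=> 0));last by move=> j;rewrite freq0 ?mulr0 //;exact: notC.
by rewrite rotv0 hg.
Qed.

Lemma rotflow_O t x: O x -> O (rotflow t x) /\ g (rotflow t x) = rotv (fun j => t * freq (g x) j) (g x).
by move=> Ox;rewrite rotflow_in //;split;[apply: hO|apply: gh];exact: rotO. Qed.

Lemma rotflowD s t x: rotflow (s + t) x = rotflow s (rotflow t x).
have [Ox|nO]:= pselect (O x);last first.
 have nC: ~ C x by move/CO.
 by rewrite !rotflow_out.
have [Oy gy]:= rotflow_O t Ox.
rewrite (rotflow_in s Oy) gy freq_rotv -rotvD rotflow_in //;congr h;apply: rotv_ext => j.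
by rewrite mulrDl.
Qed.

Lemma rotflow0 x: rotflow 0 x = x.
rewrite /rotflow;case: ifPn => // /set_mem Ox.
by rewrite (rotv_ext (th':= fun=> 0)) ?rotv0 ?hg // => j;rewrite mul0r.
Qed.

Lemma rotflow_smooth t: smooth_self X (rotflow t).
apply: smooth_self_local => p;have [Op|nO]:= pselect (O p).
 exists (n + n)%N, O, (g @` O), (fun x => rotv (fun j => t * freq (g x) j) (g x)), h.
 split;[by split|split].
 - apply: (msm_post (V:= g @` O) (k:= fun y => rotv (fun j => t * freq y j) y) (@comp_closed_rV R (n + n))) => //.
  move=> k;apply: (Ck_rotv (th:= fun j y => t * freq y j) (f:= fun y => y)) => //;last exact: Ck_self.
  by move=> j;apply: CkM => //;[exact: Ck_cst|exact: freq_smooth].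
 - by move=> x Ox;exact: rotO.
 - exact: sh.
 - by move=> x Ox;exact: rotflow_in.
have nC: ~ C p by move/CO.
have oC: open (~` C) by rewrite openC.
exists (n + n)%N, (cdom (c p) `&` ~` C), (cimg (c p)), (c p), (cinv (c p)).
split;[split|split].
- by apply: openI => //;exact: cdom_open.
- by split=> //;exact: chart_at_dom.
- exact: cimg_open.
- by apply: msm_mono (msm_chart X p) => x [].
- by move=> x [px _];exists x.
- exact: into_cinv.
- by move=> x [px nCx];rewrite rotflow_out // ctoK.
Qed.

(** The sign comes from the convention omega(X_H, .) = dH together with the form [J] and the
    counterclockwise rotation [rotv]. *)
Definition rotham (x: M): R:= if x \in O then - F (sqv (g x)) else 0.

Lemma rotham_smooth: msm X setT rotham.
apply: (msm_extend oO clC CO).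
 apply: (msm_ext (g':= fun x => - F (sqv (g x)))) => // [x Ox|];first by rewrite /rotham mem_set.
 apply: (msm_post (V:= setT) (k:= fun y => - F (sqv y)) (@comp_closed_R R)) => //;first exact: openT.
 move=> k;apply: CkN;first exact: openT.
 by apply: (Ck_compR (V:= setT) (f:= sqv) (g:= F));[exact: openT|by []|apply: Ck_sqv;exact: openT|exact: sF].
move=> x nC;rewrite /rotham;case: ifPn => // /set_mem Ox.
by rewrite F0 ?oppr0 //;exact: notC.
Qed.

Lemma rotham_diff y v: (g @` O) y -> diff_fun X rotham (h y) (v *m diff_into X h y) = - \sum_j freq y j * ip y v j.
move=> Iy.
rewrite -(dfun_into v oI sh oO (msm_mono (@subsetT _ _) rotham_smooth) Iy (hO Iy)).
have d1: differentiable sqv y by apply: (Ck_sqv 1 (@openT _)).1.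
have d2: differentiable F (sqv y) by apply: (sF 1%N).1.
have -> : 'd (rotham \o h) y v = 'd (fun y => - F (sqv y)) y v.
 apply: near_eq_diffE.
  have: nbhs y (g @` O) by apply: open_nbhs_nbhs.
  by apply: filterS => y' Iy' /=;rewrite /rotham mem_set ?gh //;exact: hO.
 apply: differentiableN;exact: (differentiable_comp d1 d2).
have dc: differentiable (F \o sqv) y by exact: differentiable_comp.
rewrite -[fun y => _]/(- (F \o sqv)) diffN //= -[LHS]/(- 'd (F \o sqv) y v) (diff_compE _ d1 d2) diff_sqv.
apply: congr1;rewrite {1}(row_sum_delta (\row_j (2 * ip y v j))) linear_sum /=.
by apply: eq_bigr => j _;rewrite linearZ /= mxE /freq /GRing.scale /=;ring.
Qed.

(** In the coordinates the velocity is y J scaled by the frequencies, and its contraction with the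
    standard form is minus the sum of freq_j times the radial inner products, which is the
    differential of [rotham]. *)
Lemma rotflow_velocity t x: exists2 v, is_velocity X (fun s => rotflow s x) t v &
 forall w, bilin (kform X (rotflow t x)) v w = diff_fun X (rotham: M -> R^o) (rotflow t x) w.
have [Ox|nO]:= pselect (O x);last first.
 have nC: ~ C x by move/CO.
 have oC: open (~` C) by rewrite openC.
 have E: (fun s => rotflow s x) = fun=> x by apply/funext => s;rewrite rotflow_out.
 exists 0;first by rewrite E;split;[exact: cvg_cst|exact: is_derive_cst].
 move=> w;rewrite rotflow_out // /bilin !mul0mx mxE.
 rewrite -[RHS]/(diff_fun X rotham x w) (dfun_ext (g:= fun=> 0) w oC nC).
 - by rewrite /diff_fun -[_ \o _]/(fun _: 'rV[R]_(n + n) => 0: R) diff_cst.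
 - move=> p nCp;rewrite /rotham;case: ifPn => // /set_mem Op.
  by rewrite F0 ?oppr0 //;exact: notC.
 - exact: msm_cst.
pose y s:= rotv (fun j => s * freq (g x) j) (g x).
have [Ot gt]:= rotflow_O t Ox.
have gE: g \o (fun s => rotflow s x) = y by apply/funext => s;have []:= rotflow_O s Ox.
have dy:= is_derive_rotv (freq (g x)) (g x) t.
have Iy: (g @` O) (y t) by exact: rotO.
have cont: {for t, continuous (fun s => rotflow s x)}.
 rewrite (_: (fun s => rotflow s x) = h \o y);last by apply/funext => s;rewrite /= rotflow_in.
 by apply: continuous_comp;[exact: is_derive_continuous dy|exact: sh.1].
have:= velocity_coord Cg (gam:= fun s => rotflow s x) Ot cont.
rewrite gE => /(_ _ dy) vel.
eexists;first exact: vel.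
move=> w;rewrite gt -[RHS]/(diff_fun X rotham (rotflow t x) w) (rotflow_in t Ox) -/(y t).
have inv: mjac X g (h (y t)) *m diff_into X h (y t) = 1%:M.
 have:= coord_on_inv Cg (hO Iy);rewrite (gh Iy) => H;exact: mulmx1C H.
have Ew: w *m mjac X g (h (y t)) *m diff_into X h (y t) = w.
 exact: (etrans (esym (mulmxA _ _ _)) (etrans (congr1 (mulmx w) inv) (mulmx1 w))).
move: (w *m mjac X g (h (y t))) Ew => w' <-.
rewrite rotham_diff // -formcE Hform // bilin_mulI -sumrN;apply: eq_bigr => j _.
have -> : freq (y t) = freq (g x) by exact: freq_rotv.
by rewrite mulIE_l mulIE_r scm_l scm_r /ip -/(y t);ring.
Qed.

Lemma rotflow_Ham: Ham_c X (rotflow 1).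
split.
 exists (rotflow (- 1));split;[| |exact: rotflow_smooth|exact: rotflow_smooth].
  by move=> x;rewrite -rotflowD addNr rotflow0.
 by move=> x;rewrite -rotflowD addrN rotflow0.
exists (fun=> rotham), rotflow, 1;split => //.
- move=> q k;apply: (Ck_compR (V:= cimg (c q)) (f:= @rsubmx R 1 1 (n + n)) (g:= fun y => rotham (cinv (c q) y))).
 + have o1: open [set y: 'rV[R]_(1 + (n + n)) | - 1 < lsubmx y 0 0 < 1 + 1].
   rewrite (_: mkset _ = (fun y: 'rV[R]_(1 + (n + n)) => lsubmx y 0 0) @^-1` `](- 1), (1 + 1)[);last first.
    by apply/seteqP;split=> y;rewrite /preimage /= in_itv.
   apply: open_comp;last exact: interval_open.
   move=> y _;apply: (Ck_coord 0 0 (@openT _) (Ck_lin 0 setT (@lsubmx R 1 1 (n + n)))) => //.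
  have o2: open [set y: 'rV[R]_(1 + (n + n)) | cimg (c q) (rsubmx y)].
   apply: (@open_comp _ _ (@rsubmx R 1 1 (n + n)) (cimg (c q)));last exact: cimg_open.
   by move=> y _;exact: (linear_rV_continuous (L:= @rsubmx R 1 1 (n + n))).
  exact: openI o1 o2.
 + by move=> y [].
 + exact: (Ck_lin k _ (@rsubmx R 1 1 (n + n))).
 + by have:= rotham_smooth q k;rewrite -cimgE.
- exists (`[0, 1] `*` [set: M]);first by apply: compact_setX => //;exact: segment_compact.
 by move=> t p t01 [];split=> //=;rewrite in_itv.
- by move=> t p _;exact: rotflow_velocity.
- by split=> //;apply/funext => x;rewrite rotflow0.
Qed.

End RotationFlow.

(** * The twist of the first two coordinates by the phase of the third *)

Section DirectionalDerivative.
Context {R: realType} {V: normedModType R}.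

(** Differentiability together with the value along one direction. Bundling them allows implicit
    differentiation: both sides of an identity are differentiated by the rules and compared by
    [isd_uniq]. *)
Definition isd (f: V -> R) (w v: V) (a: R): Prop:= differentiable f w /\ 'd f w v = a.

Lemma isdM f g w v a b: isd f w v a -> isd g w v b -> isd (fun w => f w * g w) w v (f w * b + g w * a).
move=> [df <-] [dg <-];split;first exact: differentiableM.
by rewrite -[fun w => _]/(f * g) diffM.
Qed.

Lemma isdD f g w v a b: isd f w v a -> isd g w v b -> isd (fun w => f w + g w) w v (a + b).
move=> [df <-] [dg <-];split;first exact: differentiableD.
by rewrite -[fun w => _]/(f + g) diffD.
Qed.

Lemma isdB f g w v a b: isd f w v a -> isd g w v b -> isd (fun w => f w - g w) w v (a - b).
move=> [df <-] [dg <-];split;first exact: differentiableB.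
by rewrite -[fun w => _]/(f - g) diffB.
Qed.

Lemma isdZ f w v a (k: R): isd f w v a -> isd (fun w => k * f w) w v (k * a).
move=> [df <-];split;first exact: (differentiableZ k df).
by rewrite -[fun w => _]/(k *: f) diffZ.
Qed.

Lemma isd_near f g w v a: (\forall w' \near w, f w' = g w') -> isd g w v a -> isd f w v a.
move=> fg [dg <-].
have gf: \forall w' \near w, g w' = f w' by apply: filterS fg.
by split;[exact: near_eq_differentiable gf dg|exact: near_eq_diffE].
Qed.

Lemma isd_uniq f w v a b: isd f w v a -> isd f w v b -> a = b.
by move=> [_ <-] [_ <-]. Qed.

Lemma isd_eq f w v a b: b = a -> isd f w v a -> isd f w v b.
by move=> ->. Qed.

End DirectionalDerivative.

Section Twist.
Context {R: realType} {n: nat} (i0 i1 i2: 'I_n).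
Hypotheses (n01: i1 != i0) (n02: i2 != i0) (n12: i2 != i1).
Local Notation J:= (mulI R n).
Local Notation V:= 'rV[R]_(n + n).

Definition ph (w: V): R:= Num.sqrt (sq w i2).
Definition pc (w: V): R:= w 0 (lshift n i2) / ph w.
Definition ps (w: V): R:= w 0 (rshift n i2) / ph w.
Definition kap: R:= (Num.sqrt 2)^-1.

Definition tax (w: V): R:= w 0 (lshift n i0) * pc w - w 0 (rshift n i0) * ps w.
Definition tay (w: V): R:= w 0 (lshift n i0) * ps w + w 0 (rshift n i0) * pc w.
Definition trr (w: V): R:= Num.sqrt (sq w i2 - sq w i0).

(* With e = w_2/|w_2| and a = w_0 e, the twist sends (w_0, w_1, w_2) to
   ((a + w_1)/sqrt 2, (a - w_1)/sqrt 2, e sqrt(|w_2|^2 - |w_0|^2)). *)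
Definition twist_re (w: V) (j: 'I_n): R :=
 if j == i0 then kap * (tax w + w 0 (lshift n i1))
 else if j == i1 then kap * (tax w - w 0 (lshift n i1))
 else if j == i2 then pc w * trr w else w 0 (lshift n j).
Definition twist_im (w: V) (j: 'I_n): R :=
 if j == i0 then kap * (tay w + w 0 (rshift n i1))
 else if j == i1 then kap * (tay w - w 0 (rshift n i1))
 else if j == i2 then ps w * trr w else w 0 (rshift n j).
Definition twist (w: V): V:= row_mx (\row_j twist_re w j) (\row_j twist_im w j).

(** For y in the image of the twist, [uax] and [uay] are the real and imaginary parts of a = (y_0 +
    y_1)/sqrt 2. The inverse then takes w_0 = a conj(e), w_1 = (y_0 - y_1)/sqrt 2 and |w_2|^2 =
    |y_2|^2 + |a|^2, where e is the phase of y_2. *)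
Definition uax (y: V): R:= kap * (y 0 (lshift n i0) + y 0 (lshift n i1)).
Definition uay (y: V): R:= kap * (y 0 (rshift n i0) + y 0 (rshift n i1)).
Definition urr (y: V): R:= Num.sqrt (sq y i2 + uax y * uax y + uay y * uay y).

Definition untwist_re (y: V) (j: 'I_n): R :=
 if j == i0 then uax y * pc y + uay y * ps y
 else if j == i1 then kap * (y 0 (lshift n i0) - y 0 (lshift n i1))
 else if j == i2 then pc y * urr y else y 0 (lshift n j).
Definition untwist_im (y: V) (j: 'I_n): R :=
 if j == i0 then uay y * pc y - uax y * ps y
 else if j == i1 then kap * (y 0 (rshift n i0) - y 0 (rshift n i1))
 else if j == i2 then ps y * urr y else y 0 (rshift n j).
Definition untwist (y: V): V:= row_mx (\row_j untwist_re y j) (\row_j untwist_im y j).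

Definition tdom: set V:= [set w | sq w i0 < sq w i2].
Definition udom: set V:= [set y | 0 < sq y i2].

Lemma twist_l w j: twist w 0 (lshift n j) = twist_re w j.
by rewrite /twist row_mxEl mxE. Qed.
Lemma twist_r w j: twist w 0 (rshift n j) = twist_im w j.
by rewrite /twist row_mxEr mxE. Qed.
Lemma untwist_l y j: untwist y 0 (lshift n j) = untwist_re y j.
by rewrite /untwist row_mxEl mxE. Qed.
Lemma untwist_r y j: untwist y 0 (rshift n j) = untwist_im y j.
by rewrite /untwist row_mxEr mxE. Qed.

Lemma kap2: kap * kap = 2^-1.
by rewrite /kap -invfM -expr2 sqr_sqrtr. Qed.

Lemma tdom_u w: tdom w -> udom w.
by move=> H;apply: le_lt_trans H;exact: sq_ge0. Qed.

Lemma ph_gt0 w: udom w -> 0 < ph w.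
by move=> H;rewrite sqrtr_gt0. Qed.

Lemma ph2 w: udom w -> ph w * ph w = w 0 (lshift n i2) * w 0 (lshift n i2) + w 0 (rshift n i2) * w 0 (rshift n i2).
by move=> H;rewrite -expr2 sqr_sqrtr ?sq_ge0 // /sq !expr2. Qed.

Lemma pc_ph w: udom w -> pc w * ph w = w 0 (lshift n i2).
by move=> H;rewrite /pc divfK // gt_eqF // ph_gt0. Qed.
Lemma ps_ph w: udom w -> ps w * ph w = w 0 (rshift n i2).
by move=> H;rewrite /ps divfK // gt_eqF // ph_gt0. Qed.

Lemma pcs w: udom w -> pc w * pc w + ps w * ps w = 1.
move=> H;have p0: ph w != 0 by rewrite gt_eqF // ph_gt0.
have:= ph2 H;rewrite -(pc_ph H) -(ps_ph H) => E.
apply: (mulIf p0);apply: (mulIf p0);rewrite mul1r [RHS]E;ring.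
Qed.

Lemma trr_gt0 w: tdom w -> 0 < trr w.
by move=> H;rewrite sqrtr_gt0 subr_gt0. Qed.

Lemma trr2 w: tdom w -> trr w * trr w = sq w i2 - sq w i0.
by move=> H;rewrite -expr2 sqr_sqrtr // subr_ge0 ltW. Qed.

Lemma urr2 y: urr y * urr y = sq y i2 + uax y * uax y + uay y * uay y.
by rewrite -expr2 sqr_sqrtr // -!expr2 !addr_ge0 ?sqr_ge0 ?sq_ge0.
Qed.

Let e10: (i1 == i0) = false. Proof. exact: negbTE. Qed.
Let e20: (i2 == i0) = false. Proof. exact: negbTE. Qed.
Let e21: (i2 == i1) = false. Proof. exact: negbTE. Qed.
Let e0:= eqxx i0.
Let e1:= eqxx i1.
Let e2:= eqxx i2.
Let ee:= (e10, e20, e21, e0, e1, e2).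

(** Uniqueness of the polar decomposition: used to see that neither the twist nor its inverse
    changes the phase of w_2. *)
Lemma polar_phase (w: V) (a b r: R): 0 < r -> a * a + b * b = 1 -> w 0 (lshift n i2) = a * r ->
 w 0 (rshift n i2) = b * r -> [/\ sq w i2 = r * r, pc w = a & ps w = b].
move=> r0 ab wl wr;have E: sq w i2 = r * r.
 by rewrite /sq wl wr -[RHS]mul1r -ab;ring.
have p: ph w = r by rewrite /ph E -expr2 sqrtr_sqr gtr0_norm.
by split=> //;rewrite /pc /ps p ?wl ?wr mulfK // gt_eqF.
Qed.

Lemma twist_phase w: tdom w -> [/\ sq (twist w) i2 = trr w * trr w, pc (twist w) = pc w & ps (twist w) = ps w].
move=> H;apply: polar_phase;[exact: trr_gt0|exact: pcs (tdom_u H)| |].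
 by rewrite twist_l /twist_re !ee.
by rewrite twist_r /twist_im !ee.
Qed.

Lemma twist_dom w: tdom w -> udom (twist w).
by move=> H;have [E _ _]:= twist_phase H;rewrite /udom /= E mulr_gt0 // trr_gt0. Qed.

Lemma kapD (a b: R): kap * (kap * (a + b) + kap * (a - b)) = a.
by rewrite -mulrDr mulrA kap2;field. Qed.
Lemma kapB (a b: R): kap * (kap * (a + b) - kap * (a - b)) = b.
by rewrite -mulrBr mulrA kap2;field. Qed.

Lemma uax_twist w: uax (twist w) = tax w.
by rewrite /uax !twist_l /twist_re !ee kapD. Qed.
Lemma uay_twist w: uay (twist w) = tay w.
by rewrite /uay !twist_r /twist_im !ee kapD. Qed.

Lemma ta2 w: udom w -> tax w * tax w + tay w * tay w = sq w i0.
by move=> H;rewrite /tax /tay /sq -[RHS]mulr1 -(pcs H);ring. Qed.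

Lemma twistK w: tdom w -> untwist (twist w) = w.
move=> H;have [E1 E2 E3]:= twist_phase H;have U:= tdom_u H.
have rE: urr (twist w) = ph w.
 rewrite /urr E1 trr2 // uax_twist uay_twist -addrA ta2 // subrK //.
have K:= pcs U.
apply: row_split_ext => j;rewrite ?untwist_l ?untwist_r /untwist_re /untwist_im rE ?E2 ?E3 ?uax_twist ?uay_twist.
 case: eqVneq => [->|j0];first by rewrite /tax /tay -[RHS]mulr1 -K;ring.
 case: eqVneq => [->|j1];first by rewrite !twist_l /twist_re !ee kapB.
 case: eqVneq => [->|j2];first exact: pc_ph.
 by rewrite twist_l /twist_re (negbTE j0) (negbTE j1) (negbTE j2).
case: eqVneq => [->|j0];first by rewrite /tax /tay -[RHS]mulr1 -K;ring.
case: eqVneq => [->|j1];first by rewrite !twist_r /twist_im !ee kapB.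
case: eqVneq => [->|j2];first exact: ps_ph.
by rewrite twist_r /twist_im (negbTE j0) (negbTE j1) (negbTE j2).
Qed.

Lemma untwist_phase y: udom y -> [/\ sq (untwist y) i2 = urr y * urr y, pc (untwist y) = pc y & ps (untwist y) = ps y].
move=> H;apply: polar_phase;[|exact: pcs H| |].
- by rewrite sqrtr_gt0 -addrA ltr_pwDl // -!expr2 addr_ge0 ?sqr_ge0.
- by rewrite untwist_l /untwist_re !ee.
- by rewrite untwist_r /untwist_im !ee.
Qed.

Lemma untwist_sq0 y: udom y -> sq (untwist y) i0 = uax y * uax y + uay y * uay y.
move=> H;rewrite /sq untwist_l untwist_r /untwist_re /untwist_im !ee.
by rewrite -[RHS]mulr1 -(pcs H);ring.
Qed.

Lemma untwist_sq1 y: sq (untwist y) i1 = 2^-1 *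
 ((y 0 (lshift n i0) - y 0 (lshift n i1)) ^+ 2 + (y 0 (rshift n i0) - y 0 (rshift n i1)) ^+ 2).
by rewrite /sq untwist_l untwist_r /untwist_re /untwist_im !ee -kap2;ring. Qed.

Lemma untwist_sq j y: j != i0 -> j != i1 -> j != i2 -> sq (untwist y) j = sq y j.
by move=> h0 h1 h2;rewrite /sq untwist_l untwist_r /untwist_re /untwist_im (negbTE h0) (negbTE h1) (negbTE h2).
Qed.

Lemma untwist_dom y: udom y -> tdom (untwist y).
move=> H;have [E _ _]:= untwist_phase H.
by rewrite /tdom /= E urr2 untwist_sq0 // -addrA ltrDr.
Qed.

Lemma untwistK y: udom y -> twist (untwist y) = y.
move=> H;have [E1 E2 E3]:= untwist_phase H;have K:= pcs H.
have ax: tax (untwist y) = uax y.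
 rewrite /tax E2 E3 untwist_l untwist_r /untwist_re /untwist_im !ee -[RHS]mulr1 -K;ring.
have ay: tay (untwist y) = uay y.
 rewrite /tay E2 E3 untwist_l untwist_r /untwist_re /untwist_im !ee -[RHS]mulr1 -K;ring.
have rE: trr (untwist y) = ph y.
 by rewrite /trr E1 urr2 untwist_sq0 //;apply: (congr1 Num.sqrt);ring.
apply: row_split_ext => j;rewrite ?twist_l ?twist_r /twist_re /twist_im rE ?E2 ?E3 ?ax ?ay.
 case: eqVneq => [->|j0];first by rewrite untwist_l /untwist_re !ee kapD.
 case: eqVneq => [->|j1];first by rewrite untwist_l /untwist_re !ee kapB.
 case: eqVneq => [->|j2];first exact: pc_ph.
 by rewrite untwist_l /untwist_re (negbTE j0) (negbTE j1) (negbTE j2).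
case: eqVneq => [->|j0];first by rewrite untwist_r /untwist_im !ee kapD.
case: eqVneq => [->|j1];first by rewrite untwist_r /untwist_im !ee kapB.
case: eqVneq => [->|j2];first exact: ps_ph.
by rewrite untwist_r /untwist_im (negbTE j0) (negbTE j1) (negbTE j2).
Qed.

Lemma udom_open: open udom.
rewrite (_: udom = (fun w => sq w i2) @^-1` [set x | 0 < x]) //.
by apply: open_comp;[move=> w _;exact: sq_continuous|exact: open_gt].
Qed.

Lemma tdom_open: open tdom.
rewrite (_: tdom = (fun w => sq w i2 - sq w i0) @^-1` [set x | 0 < x]);last first.
 by apply/seteqP;split=> w;rewrite /tdom /preimage /= subr_gt0.
apply: open_comp;last exact: open_gt.
by move=> w _;apply: (@cvgB _ _ _ (nbhs w));exact: sq_continuous.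
Qed.

Lemma Ck_entry k (U: set V) i: open U -> Ck_on k U (fun w: V => w 0 i).
by move=> oU;apply: Ck_coord => //;exact: Ck_self. Qed.

Lemma Ck_ph k: Ck_on k udom ph.
apply: Ck_sqrt;[exact: udom_open|by []|].
by apply: Ck_sq;[exact: udom_open|exact: Ck_self].
Qed.

Lemma Ck_pcs k: Ck_on k udom pc /\ Ck_on k udom ps.
have oU:= udom_open.
have H: Ck_on k udom (fun w => (ph w)^-1).
 by apply: CkV => //;[move=> w Uw;rewrite gt_eqF // ph_gt0|exact: Ck_ph].
by split;apply: CkM => //;exact: Ck_entry.
Qed.

Lemma twist_smooth: smooth_on tdom twist.
move=> k;have oT:= tdom_open;have [Hc Hs]:= Ck_pcs k.
have {}Hc: Ck_on k tdom pc by apply: Ck_mono Hc => w;exact: tdom_u.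
have {}Hs: Ck_on k tdom ps by apply: Ck_mono Hs => w;exact: tdom_u.
have Hr: Ck_on k tdom trr.
 apply: Ck_sqrt => //;first by move=> w Tw;rewrite subr_gt0.
 by apply: CkB => //;apply: Ck_sq => //;exact: Ck_self.
have Hx: Ck_on k tdom tax by apply: CkB => //;apply: CkM => //;exact: Ck_entry.
have Hy: Ck_on k tdom tay by apply: CkD => //;apply: CkM => //;exact: Ck_entry.
apply: Ck_rV => // i;have [j ->|j ->]:= split_ordP i.
 rewrite (_: (fun x => _) = fun w => twist_re w j);last by apply/funext => w;rewrite twist_l.
 rewrite /twist_re;case: (j == i0).
  by apply: CkM => //;[exact: Ck_cst|apply: CkD => //;exact: Ck_entry].
 case: (j == i1).
  by apply: CkM => //;[exact: Ck_cst|apply: CkB => //;exact: Ck_entry].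
 by case: (j == i2);[exact: CkM|exact: Ck_entry].
rewrite (_: (fun x => _) = fun w => twist_im w j);last by apply/funext => w;rewrite twist_r.
rewrite /twist_im;case: (j == i0).
 by apply: CkM => //;[exact: Ck_cst|apply: CkD => //;exact: Ck_entry].
case: (j == i1).
 by apply: CkM => //;[exact: Ck_cst|apply: CkB => //;exact: Ck_entry].
by case: (j == i2);[exact: CkM|exact: Ck_entry].
Qed.

Lemma untwist_smooth: smooth_on udom untwist.
move=> k;have oT:= udom_open;have [Hc Hs]:= Ck_pcs k.
have Hx: Ck_on k udom uax.
 by apply: CkM => //;[exact: Ck_cst|apply: CkD => //;exact: Ck_entry].
have Hy: Ck_on k udom uay.
 by apply: CkM => //;[exact: Ck_cst|apply: CkD => //;exact: Ck_entry].
have Hr: Ck_on k udom urr.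
 apply: Ck_sqrt => //;first by move=> y Uy;rewrite -addrA ltr_pwDl // -!expr2 addr_ge0 ?sqr_ge0.
 by do 2!(apply: CkD => //;last exact: CkM);apply: Ck_sq => //;exact: Ck_self.
apply: Ck_rV => // i;have [j ->|j ->]:= split_ordP i.
 rewrite (_: (fun x => _) = fun w => untwist_re w j);last by apply/funext => w;rewrite untwist_l.
 rewrite /untwist_re;case: (j == i0).
  by apply: CkD => //;exact: CkM.
 case: (j == i1).
  by apply: CkM => //;[exact: Ck_cst|apply: CkB => //;exact: Ck_entry].
 by case: (j == i2);[exact: CkM|exact: Ck_entry].
rewrite (_: (fun x => _) = fun w => untwist_im w j);last by apply/funext => w;rewrite untwist_r.
rewrite /untwist_im;case: (j == i0).
 by apply: CkB => //;exact: CkM.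
case: (j == i1).
 by apply: CkM => //;[exact: Ck_cst|apply: CkB => //;exact: Ck_entry].
by case: (j == i2);[exact: CkM|exact: Ck_entry].
Qed.

(** Implicit differentiation of r^2 = x^2 + y^2, p r = x and s r = y: the modulus and phase of w_2
    are differentiated without expanding the square root. *)
Lemma twist_arith1 (x y vx vy p s r dr dp ds: R): r != 0 -> p * p + s * s = 1 -> p * r = x -> s * r = y ->
 r * dr + r * dr = x * vx + x * vx + (y * vy + y * vy) -> p * dr + r * dp = vx -> s * dr + r * ds = vy ->
 [/\ dr = p * vx + s * vy, dp = - s * ((p * vy - s * vx) / r) & ds = p * ((p * vy - s * vx) / r)].
move=> r0 K <- <- h1 h2 h3.
have D: dr = p * vx + s * vy.
 by apply: (mulfI r0);apply: (mulfI (x:= 2));[rewrite pnatr_eq0|lra].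
split=> //;apply: (mulfI r0).
 have -> : r * dp = vx * 1 - p * dr by rewrite -h2;ring.
 by rewrite D -K;field.
have -> : r * ds = vy * 1 - s * dr by rewrite -h3;ring.
by rewrite D -K;field.
Qed.

(* Invariance of dx /\ dy summed over the planes of w_0 and w_2, where p and s are
   the cosine and sine of the phase of w_2. *)
Lemma twist_arith2 (x1 y1 vx1 vy1 vx1' vy1' vx3 vy3 vx3' vy3' p s r q: R): r != 0 -> q != 0 -> p * p + s * s = 1 ->
 let t:= (p * vy3 - s * vx3) / r in let t':= (p * vy3' - s * vx3') / r in
 let sg:= (r * (p * vx3 + s * vy3) - (x1 * vx1 + y1 * vy1)) / q in
 let sg':= (r * (p * vx3' + s * vy3') - (x1 * vx1' + y1 * vy1')) / q in
 (vx1 * p - vy1 * s - (x1 * s + y1 * p) * t) * (vx1' * s + vy1' * p + (x1 * p - y1 * s) * t') -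
 (vx1 * s + vy1 * p + (x1 * p - y1 * s) * t) * (vx1' * p - vy1' * s - (x1 * s + y1 * p) * t') +
 ((p * sg + q * (- s * t)) * (s * sg' + q * (p * t')) - (s * sg + q * (p * t)) * (p * sg' + q * (- s * t'))) =
 (vx1 * vy1' - vy1 * vx1') + (vx3 * vy3' - vy3 * vx3').
move=> r0 q0 K t t' sg sg'.
transitivity ((p * p + s * s) * (vx1 * vy1' - vy1 * vx1') + (p * p + s * s) * (p * p + s * s) * (vx3 * vy3' - vy3 * vx3')).
 by rewrite /t /t' /sg /sg';field;rewrite r0 q0.
by rewrite K !mul1r.
Qed.

(** The unitary mixing of a and w_1 preserves the sum of their area forms; combined with the
    invariance for w_0 and w_2. *)
Lemma twist_arith3 (k a a' b b' x x' y y' g1 g2 f1 f2: R): k * k = 2^-1 ->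
 a * b' - b * a' + (g1 - g2) = x * y' - y * x' + (f1 - f2) -> forall u u' z z': R,
 k * (a + u) * (k * (b' + z')) - k * (b + z) * (k * (a' + u')) +
 k * (a - u) * (k * (b' - z')) - k * (b - z) * (k * (a' - u')) + g1 - g2 =
 x * y' - y * x' + u * z' - z * u' + f1 - f2.
move=> kk H u u' z z'.
transitivity (2 * (k * k) * (a * b' - b * a' + (u * z' - z * u')) + (g1 - g2));first ring.
by rewrite kk mulfV ?pnatr_eq0 // mul1r addrAC H;ring.
Qed.

Lemma twist_arith4 (c s dc ds t x y vx vy: R): dc = - s * t -> ds = c * t ->
 vx * c - vy * s - (x * s + y * c) * t = x * dc + c * vx - (y * ds + s * vy) /\
 vx * s + vy * c + (x * c - y * s) * t = x * ds + s * vx + (y * dc + c * vy).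
by move=> -> ->;split;ring. Qed.

Section TwistDiff.
Context (w: V) (Tw: tdom w).
Let Uw:= tdom_u Tw.
Local Notation "'D' f v" := ('d (f: V -> R) w v: R) (at level 10, f at level 9, v at level 9).

Let dph v: isd ph w v (D ph v). Proof. by split=> //;exact: (Ck_ph 1).1. Qed.
Let dpc v: isd pc w v (D pc v). Proof. by split=> //;exact: (Ck_pcs 1).1.1. Qed.
Let dps v: isd ps w v (D ps v). Proof. by split=> //;exact: (Ck_pcs 1).2.1. Qed.
Let de i v: isd (fun w: V => w 0 i: R) w v (v 0 i).
split;first by apply: differentiable_mxcoord;exact: (differentiable_lin (@idfun V)).
rewrite (diff_mxcoordE _ _ _ (differentiable_lin (@idfun V) w)).
by rewrite (diff_linE (@idfun V)).
Qed.
Let drr v: isd trr w v (D trr v).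
have H: Ck_on 1 tdom trr.
 have oT:= tdom_open;apply: Ck_sqrt => //;first by move=> w' Tw';rewrite subr_gt0.
 by apply: CkB => //;apply: Ck_sq => //;exact: Ck_self.
by split=> //;exact: H.1.
Qed.

Let tau (v: V): R:= (pc w * v 0 (rshift n i2) - ps w * v 0 (lshift n i2)) / ph w.

Lemma near_tdom (P: V -> Prop): (forall w', tdom w' -> P w') -> \forall w' \near w, P w'.
move=> H;have: nbhs w tdom by apply: open_nbhs_nbhs;split;[exact: tdom_open|exact: Tw].
by apply: filterS => w' /H.
Qed.

Let diff_phase v: [/\ D ph v = pc w * v 0 (lshift n i2) + ps w * v 0 (rshift n i2),
 D pc v = - ps w * tau v & D ps v = pc w * tau v].
have r0: ph w != 0 by rewrite gt_eqF // ph_gt0.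
have H1:= isd_uniq (isdM (dph v) (dph v)) (isd_near (near_tdom (fun w' T => ph2 (tdom_u T)))
 (isdD (isdM (de (lshift n i2) v) (de (lshift n i2) v)) (isdM (de (rshift n i2) v) (de (rshift n i2) v)))).
have H2:= isd_uniq (isdM (dpc v) (dph v)) (isd_near (near_tdom (fun w' T => pc_ph (tdom_u T))) (de (lshift n i2) v)).
have H3:= isd_uniq (isdM (dps v) (dph v)) (isd_near (near_tdom (fun w' T => ps_ph (tdom_u T))) (de (rshift n i2) v)).
exact: (twist_arith1 r0 (pcs Uw) (pc_ph Uw) (ps_ph Uw) H1 H2 H3).
Qed.

Let diff_trr v: D trr v = (ph w * (pc w * v 0 (lshift n i2) + ps w * v 0 (rshift n i2)) -
 (w 0 (lshift n i0) * v 0 (lshift n i0) + w 0 (rshift n i0) * v 0 (rshift n i0))) / trr w.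
have r0: trr w != 0 by rewrite gt_eqF // trr_gt0.
have sqE (u: V): tdom u -> trr u * trr u = u 0 (lshift n i2) * u 0 (lshift n i2) + u 0 (rshift n i2) * u 0 (rshift n i2) -
  (u 0 (lshift n i0) * u 0 (lshift n i0) + u 0 (rshift n i0) * u 0 (rshift n i0)).
 by move=> /trr2 ->;rewrite /sq !expr2.
pose e i:= isdM (de i v) (de i v).
have E:= isd_uniq (isdM (drr v) (drr v)) (isd_near (near_tdom sqE)
 (isdB (isdD (e (lshift n i2)) (e (rshift n i2))) (isdD (e (lshift n i0)) (e (rshift n i0))))).
apply: (mulfI r0);rewrite mulrCA mulfV // mulr1.
move: E;rewrite -(pc_ph Uw) -(ps_ph Uw).
move: (pc w) (ps w) (ph w) (trr w * _) => a b q r E.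
apply: (mulfI (x:= 2));first by rewrite pnatr_eq0.
by rewrite mulrDl mul1r E;ring.
Qed.

Let dax v: isd tax w v (v 0 (lshift n i0) * pc w - v 0 (rshift n i0) * ps w -
 (w 0 (lshift n i0) * ps w + w 0 (rshift n i0) * pc w) * tau v).
have [_ Ec Es]:= diff_phase v.
apply: isd_eq (isdB (isdM (de (lshift n i0) v) (dpc v)) (isdM (de (rshift n i0) v) (dps v))).
exact: (twist_arith4 _ _ _ _ Ec Es).1.
Qed.

Let day v: isd tay w v (v 0 (lshift n i0) * ps w + v 0 (rshift n i0) * pc w +
 (w 0 (lshift n i0) * pc w - w 0 (rshift n i0) * ps w) * tau v).
have [_ Ec Es]:= diff_phase v.
apply: isd_eq (isdD (isdM (de (lshift n i0) v) (dps v)) (isdM (de (rshift n i0) v) (dpc v))).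
exact: (twist_arith4 _ _ _ _ Ec Es).2.
Qed.

Lemma twist_diff v j :
 (v *m 'J twist w) 0 (lshift n j) = (if j == i0 then kap * (D tax v + v 0 (lshift n i1))
   else if j == i1 then kap * (D tax v - v 0 (lshift n i1))
   else if j == i2 then pc w * D trr v + trr w * D pc v else v 0 (lshift n j)) /\
 (v *m 'J twist w) 0 (rshift n j) = (if j == i0 then kap * (D tay v + v 0 (rshift n i1))
   else if j == i1 then kap * (D tay v - v 0 (rshift n i1))
   else if j == i2 then ps w * D trr v + trr w * D ps v else v 0 (rshift n j)).
have dT: differentiable twist w by apply: (twist_smooth 1).1.
rewrite -(diffJ _ dT) -!(diff_mxcoordE _ _ _ dT).
rewrite (_: (fun y => twist y 0 (lshift n j)) = fun w => twist_re w j);last by apply/funext => y;rewrite twist_l.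
rewrite (_: (fun y => twist y 0 (rshift n j)) = fun w => twist_im w j);last by apply/funext => y;rewrite twist_r.
have [_ Ex]:= dax v;have [_ Ey]:= day v.
rewrite /twist_re /twist_im;split.
 case: (j == i0);first exact: (etrans (isdZ kap (isdD (dax v) (de (lshift n i1) v))).2 (congr1 (fun t => kap * (t + v 0 (lshift n i1))) (esym Ex))).
 case: (j == i1);first exact: (etrans (isdZ kap (isdB (dax v) (de (lshift n i1) v))).2 (congr1 (fun t => kap * (t - v 0 (lshift n i1))) (esym Ex))).
 case: (j == i2);first exact: (isdM (dpc v) (drr v)).2.
 exact: (de (lshift n j) v).2.
case: (j == i0);first exact: (etrans (isdZ kap (isdD (day v) (de (rshift n i1) v))).2 (congr1 (fun t => kap * (t + v 0 (rshift n i1))) (esym Ey))).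
case: (j == i1);first exact: (etrans (isdZ kap (isdB (day v) (de (rshift n i1) v))).2 (congr1 (fun t => kap * (t - v 0 (rshift n i1))) (esym Ey))).
case: (j == i2);first exact: (isdM (dps v) (drr v)).2.
exact: (de (rshift n j) v).2.
Qed.

(** In action-angle variables the twist replaces theta_0 by theta_0 + theta_2 and I_2 by I_2 - I_0,
    which preserves I_0 dtheta_0 + I_2 dtheta_2; it is followed by a unitary map of the first two
    coordinates. The computation is done in Cartesian coordinates because w_0 and w_1 may vanish. *)
Lemma twist_symplectic: 'J twist w *m J *m ('J twist w)^T = J.
apply: bilin_ext => v v';rewrite bilinM !bilin_mulI.
have H j:= twist_diff v j;have H' j:= twist_diff v' j.
rewrite (bigD1 i0) // (bigD1 i1) // (bigD1 i2) /=;last by rewrite n02 n12.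
rewrite [RHS](bigD1 i0) // [X in _ = _ + X](bigD1 i1) // [X in _ = _ + (_ + X)](bigD1 i2) /=;last by rewrite n02 n12.
rewrite !addrA;congr (_ + _);last first.
 apply: eq_bigr => j /andP[/andP[h0 h1] h2].
 by rewrite !(H j).1 !(H j).2 !(H' j).1 !(H' j).2 (negbTE h0) (negbTE h1) (negbTE h2).
rewrite !(H _).1 !(H _).2 !(H' _).1 !(H' _).2 !ee {H H'}.
have r0: ph w != 0 by rewrite gt_eqF // ph_gt0.
have q0: trr w != 0 by rewrite gt_eqF // trr_gt0.
have A:= twist_arith2 (w 0 (lshift n i0)) (w 0 (rshift n i0)) (v 0 (lshift n i0)) (v 0 (rshift n i0))
 (v' 0 (lshift n i0)) (v' 0 (rshift n i0)) (v 0 (lshift n i2)) (v 0 (rshift n i2)) (v' 0 (lshift n i2)) (v' 0 (rshift n i2))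
 r0 q0 (pcs Uw).
have [_ Ec Es]:= diff_phase v;have [_ Ec' Es']:= diff_phase v'.
have Ex:= (dax v).2;have Ey:= (day v).2;have Ex':= (dax v').2;have Ey':= (day v').2.
have Er:= diff_trr v;have Er':= diff_trr v'.
rewrite /= -/(tau v) -/(tau v') -Ex -Ey -Ex' -Ey' -Er -Er' -Ec -Es -Ec' -Es' in A.
apply: (twist_arith3 kap2 A).
Qed.

End TwistDiff.
End Twist.

(** * The cut-off half-turn and its effect on product tori *)

Lemma sum_sq_arith (R: realType) (a b x y: R): 2^-1 * ((a + b) ^+ 2 + (x + y) ^+ 2) <= a ^+ 2 + x ^+ 2 + (b ^+ 2 + y ^+ 2).
have h1:= sqr_ge0 (a - b);have h2:= sqr_ge0 (x - y).
have -> : a ^+ 2 + x ^+ 2 + (b ^+ 2 + y ^+ 2) = 2^-1 * ((a + b) ^+ 2 + (x + y) ^+ 2) + 2^-1 * ((a - b) ^+ 2 + (x - y) ^+ 2) by field.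
by rewrite lerDl mulr_ge0 // addr_ge0.
Qed.

Lemma diff_sq_arith (R: realType) (a b x y: R): 2^-1 * ((a - b) ^+ 2 + (x - y) ^+ 2) <= a ^+ 2 + x ^+ 2 + (b ^+ 2 + y ^+ 2).
by have:= sum_sq_arith a (- b) x (- y);rewrite !sqrrN. Qed.

Lemma bound_arith (R: realType) (a b e f y0 y1 y2 d u v: R): 0 < a -> 0 < b -> 0 < e -> 0 < f ->
 20 * (a + b + e + f) < d -> y0 <= 2 * (2 * (a + b + a)) -> y1 <= 2 * (2 * (a + b + b)) ->
 y2 <= 2 * (2 * (e - a)) -> u <= y0 + y1 -> v <= 2 * (2 * (a + b + f)) ->
 [/\ u < d, y2 + u < d & v < d].
by move=> *;split;lra. Qed.

Lemma sq_arith (R: realType) (k ax ay x y a b e S: R): k * k = 2^-1 -> ax * ax + ay * ay = a -> x ^+ 2 + y ^+ 2 = b ->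
 0 < a -> 0 < b -> 0 < e -> S = k * k * ((ax + x) ^+ 2 + (ay + y) ^+ 2) \/ S = k * k * ((ax - x) ^+ 2 + (ay - y) ^+ 2) ->
 S < 2 * (a + b + e).
move=> -> Ha Hb a0 b0 e0.
have h1:= sum_sq_arith ax x ay y;have h2:= diff_sq_arith ax x ay y.
have E: ax ^+ 2 + ay ^+ 2 + (x ^+ 2 + y ^+ 2) = a + b by rewrite Hb -Ha !expr2.
by rewrite E in h1 h2;move=> [->|->];lra.
Qed.

Lemma ratio_le1 (R: realType) (e s: R): 0 < e -> s < e / 4 -> 4 / e * s <= 1.
by move=> e0 h;rewrite mulrAC ler_pdivrMr // mul1r;lra. Qed.

Lemma ratio_ge2 (R: realType) (b s: R): 0 < b -> 2 * b < s -> 2 <= b^-1 * s.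
by move=> b0 h;rewrite mulrC ler_pdivlMr // ltW. Qed.

Lemma ratio_ge2' (R: realType) (e s: R): 0 < e -> e / 2 < s -> 2 <= 4 / e * s.
by move=> e0 h;rewrite mulrAC ler_pdivlMr //;lra. Qed.

Lemma sum_arith (R: realType) (a b e: R): 0 < a -> 0 < b -> 0 < e -> e < 2 * (a + b + e).
by move=> *;lra. Qed.

Section TwistFlow.
#[local] Opaque jacobian invmx diff_into diff_self mjac kform.
Context {R n M} (X: toric_kahler_manifold R n M).
Local Notation J:= (mulI R n).
Context (i0 i1 i2: 'I_n).
Hypotheses (n01: i1 != i0) (n02: i2 != i0) (n12: i2 != i1).
Local Notation tw:= (twist i0 i1 i2).
Local Notation ut:= (untwist i0 i1 i2).
Local Notation td:= (@tdom R n i0 i2).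
Local Notation ud:= (@udom R n i2).

(** The inverse of a symplectic matrix is symplectic; applied to the Jacobians of the twist and its
    inverse. *)
Lemma untwist_J y: ud y -> 'J ut y *m J *m ('J ut y)^T = J.
move=> Uy;have Tw:= untwist_dom n02 n12 Uy.
have S:= twist_symplectic n01 n02 n12 Tw.
have du: differentiable ut y by apply: (untwist_smooth i0 i1 i2 1%N).1.
have dt: differentiable tw (ut y) by apply: (twist_smooth i0 i1 i2 1%N).1.
have E: 'J ut y *m 'J tw (ut y) = 1%:M.
 rewrite -(J_comp du dt) -[RHS](J_id y);apply: J_near;last exact: (differentiable_lin (@idfun 'rV[R]_(n + n))).
 have: nbhs y ud by apply: open_nbhs_nbhs;split=> //;exact: udom_open.
 by apply: filterS => y' Uy' /=;rewrite untwistK.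
rewrite -{1}S;move: E;move: ('J ut y) ('J tw (ut y)) => A B E.
by rewrite conj_mulmx E mul1mx trmx1 mulmx1.
Qed.

Context (q: M) (O: set M) (W: M -> 'rV[R]_(n + n)) (h: 'rV[R]_(n + n) -> M) (L: 'M[R]_n) (d: R).
Hypothesis NC: normal_chart X q O W h L d.

Let Cw: coord_on X O W h. Proof. by case: NC => [[]]. Qed.
Let IW: W @` O = disc d. Proof. by case: NC => _ []. Qed.
Let FW w: disc d w -> formc X h w = J. Proof. by case: NC => _ [_ _ _ H];exact: H. Qed.
Let oO: open O. Proof. by case: Cw. Qed.
Let sW: msm X O W. Proof. by case: Cw. Qed.
Let hW x: O x -> h (W x) = x. Proof. by case: Cw => _ _ _ H _;exact: H. Qed.
Let sh: smooth_into X (disc d) h. Proof. by rewrite -IW;case: Cw. Qed.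
Let hO w: disc d w -> O (h w). Proof. by rewrite -IW => -[x Ox <-];rewrite hW. Qed.
Let Wh w: disc d w -> W (h w) = w. Proof. by rewrite -IW => -[x Ox <-];rewrite hW. Qed.
Let DW x: O x -> disc d (W x). Proof. by move=> Ox;rewrite -IW;exists x. Qed.

Let OY:= O `&` W @^-1` td.
Let Y x:= tw (W x).
Let hY y:= h (ut y).

Lemma twist_image: Y @` OY = ud `&` ut @^-1` disc d.
apply/seteqP;split=> [_ [x [Ox Tx] <-]|y [Uy Dy]].
 by split;[exact: twist_dom|rewrite /preimage /= /Y twistK //;exact: DW].
exists (h (ut y));last by rewrite /Y Wh // untwistK.
by split;[exact: hO|rewrite /preimage /= Wh //;exact: untwist_dom].
Qed.

Lemma twist_coord: coord_on X OY Y hY.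
have oOY: open OY by apply: msm_open => //;exact: tdom_open.
have OYO: OY `<=` O by move=> x [].
have oU:= @udom_open R n i2.
have oI: open (Y @` OY).
 rewrite twist_image;apply: open_preimage_on => //;first exact: disc_open.
 exact: (untwist_smooth i0 i1 i2 0%N).
split=> //.
- apply: (msm_post (V:= td) (@comp_closed_rV R (n + n)) oOY) => //;first exact: tdom_open.
 + by move=> x [].
 + exact: msm_mono OYO sW.
 + exact: twist_smooth.
- by move=> x [Ox Tx];rewrite /hY /Y twistK // hW.
- apply: (into_pre oI (@disc_open R n d) _ _ sh).
  by rewrite twist_image => y [].
 by move=> k;apply: Ck_mono (untwist_smooth i0 i1 i2 k) => y;rewrite twist_image => -[].
Qed.

Lemma twist_formc y: (Y @` OY) y -> formc X hY y = J.
rewrite twist_image => -[Uy Dy].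
have du: differentiable ut y by apply: (untwist_smooth i0 i1 i2 1%N).1.
have Dy': disc d (ut y):= Dy.
have dE:= diff_into_pre Dy' du sh.
have F:= FW Dy;have U:= untwist_J Uy.
rewrite -[LHS]/(diff_into X (h \o ut) y *m kform X (h (ut y)) *m (diff_into X (h \o ut) y)^T).
rewrite dE -conj_mulmx;apply: (etrans _ U).
exact: (congr1 (fun A => 'J ut y *m A *m ('J ut y)^T) F).
Qed.

Context (r: 'I_n -> R).
Hypotheses (r0: forall j, 0 < r j) (r02: r i0 < r i2)
 (rd: forall j, 20 * (r i0 ^+ 2 + r i1 ^+ 2 + r i2 ^+ 2 + r j ^+ 2) < d).

Definition polar (r: 'I_n -> R) (th: 'rV[R]_n): 'rV[R]_(n + n) :=
 row_mx (\row_j (r j * cos (th 0 j))) (\row_j (r j * sin (th 0 j))).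

Lemma polar_l r' th j: polar r' th 0 (lshift n j) = r' j * cos (th 0 j).
by rewrite /polar row_mxEl mxE. Qed.

Lemma polar_r r' th j: polar r' th 0 (rshift n j) = r' j * sin (th 0 j).
by rewrite /polar row_mxEr mxE. Qed.

Lemma sq_polar r' th j: sq (polar r' th) j = r' j ^+ 2.
by rewrite /sq polar_l polar_r -[RHS]mulr1 -(cos2Dsin2 (th 0 j));ring. Qed.

(** The value of |y_2|^2 on the twisted torus. The numbers [bnd j] below are strict upper bounds for
    |y_j|^2 on it, so the cut-offs equal 1 near the torus. *)
Let E:= r i2 ^+ 2 - r i0 ^+ 2.
Let bnd j:= if j == i2 then 2 * E else 2 * (r i0 ^+ 2 + r i1 ^+ 2 + r j ^+ 2).

Let E0: 0 < E.
by rewrite subr_gt0 ltr_pXn2r ?nnegrE ?ltW. Qed.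

Let bnd0 j: 0 < bnd j.
rewrite /bnd;case: ifP => _;first by rewrite mulr_gt0.
by rewrite mulr_gt0 // addr_gt0 ?exprn_gt0 // addr_gt0 ?exprn_gt0.
Qed.

(** Near the torus this is (pi/2) |y_0|^2, of frequency pi: the half-turn of y_0 = (a + w_1)/sqrt 2
    sends a to - w_1 and w_1 to - a. The factor with [1 - cutoff] vanishes for |y_2|^2 <= E/4, away
    from y_2 = 0, where the phase e is undefined. *)
Definition twist_ham (s: 'rV[R]_n): R :=
 (pi / 2) * s 0 i0 * ((1 - cutoff (4 / E * s 0 i2)) * \prod_j cutoff ((bnd j)^-1 * s 0 j)).

Let K:= [set s: 'rV[R]_n | (forall j, s 0 j <= 2 * bnd j) /\ E / 4 <= s 0 i2].

Lemma twist_ham_smooth: smooth_on setT twist_ham.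
move=> k;have oT:= @openT 'rV[R]_n.
have He j: Ck_on k setT (fun s: 'rV[R]_n => s 0 j) by apply: Ck_coord => //;exact: Ck_self.
have Hc (a: R) j: Ck_on k setT (fun s: 'rV[R]_n => cutoff (a * s 0 j)).
 by apply: Ck_cutoff => //;apply: CkM => //;exact: Ck_cst.
apply: CkM => //;first by apply: CkM => //;exact: Ck_cst.
apply: CkM => //;first by apply: CkB => //;exact: Ck_cst.
by apply: Ck_prod.
Qed.

Lemma twist_ham0 s: ~ K s -> twist_ham s = 0.
move=> nK;rewrite /twist_ham.
have [H|/existsNP[j /negP]]:= pselect (forall j, s 0 j <= 2 * bnd j).
 have: ~~ (E / 4 <= s 0 i2) by apply/negP => H';apply: nK.
 rewrite -ltNge => hs;rewrite cutoff1 ?subrr ?mul0r ?mulr0 //.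
 exact: ratio_le1 E0 hs.
rewrite -ltNge => hs;rewrite (bigD1 j) //= (@cutoff0 _ ((bnd j)^-1 * s 0 j)) ?mul0r ?mulr0 //.
exact: ratio_ge2 (bnd0 j) hs.
Qed.

Lemma K_closed: closed K.
have He j: continuous (fun s: 'rV[R]_n => s 0 j: R).
 by move=> s;apply: (Ck_coord 0 j (@openT _) (Ck_self 0 setT)).
have -> : K = (\bigcap_(j in [set: 'I_n]) ((fun s: 'rV[R]_n => s 0 j) @^-1` [set x | x <= 2 * bnd j])) `&`
  (fun s: 'rV[R]_n => s 0 i2) @^-1` [set x | E / 4 <= x].
 by apply/seteqP;split=> s [H1 H2];split=> // j;[move=> _;exact: H1|exact: (H1 j Logic.I)].
apply: closedI;last by apply: preimage_closed;[move=> s _;exact: He|exact: closed_ge].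
by apply: closed_bigI => j _;apply: preimage_closed;[move=> s _;exact: He|exact: closed_le].
Qed.

Lemma K_compact: compact (sqv @^-1` K).
pose B:= 1 + \sum_j 2 * bnd j.
have B1: 1 <= B by rewrite lerDl;apply: sumr_ge0 => j _;rewrite mulr_ge0 // ltW.
have B0: 0 < B by apply: lt_le_trans B1.
apply: (subclosed_compact _ (closed_ball_compact (x:= 0: 'rV[R]_(n + n)) B0)).
 apply: preimage_closed;last exact: K_closed.
 by move=> y _;apply: (Ck_sqv 0 (@openT _)).
move=> y [Hy _];rewrite closed_ballE // /closed_ball_ /= sub0r normrN.
apply: mx_norm_le;first exact: ltW.
have Hb (x z: R) j: x ^+ 2 + z ^+ 2 <= 2 * bnd j -> `|x| <= B.
 move=> hx;rewrite -(@ler_pXn2r _ 2) ?nnegrE ?normr_ge0 ?(ltW B0) // real_normK ?num_real //.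
 apply: (@le_trans _ _ B);last by rewrite ler_eXnr.
 have: 2 * bnd j <= B.
  rewrite /B (bigD1 j) //=;have: 0 <= \sum_(i | i != j) 2 * bnd i by apply: sumr_ge0 => i _;rewrite mulr_ge0 // ltW.
  by move=> h0;rewrite addrCA lerDl addr_ge0.
 by apply: le_trans;apply: le_trans hx;rewrite lerDl sqr_ge0.
move=> i k;rewrite (ord1 i);have [j ->|j ->]:= split_ordP k.
 by apply: (Hb _ (y 0 (rshift n j)) j);have:= Hy j;rewrite mxE.
by apply: (Hb _ (y 0 (lshift n j)) j);have:= Hy j;rewrite mxE /sq addrC.
Qed.

(** The support, carried back by the inverse twist, must lie in the polydisc of the chart. On it
    |w_0|^2 and |w_1|^2 are at most 12 (r_0^2 + r_1^2), and |w_2|^2 exceeds this by at most 4 (r_2^2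
    - r_0^2); the factor 20 in the assumption on the radii is enough for all coordinates. *)
Lemma K_image: sqv @^-1` K `<=` Y @` OY.
rewrite twist_image => y [Hy1 Hy2];rewrite mxE in Hy2.
have Uy: ud y by apply: lt_le_trans Hy2;rewrite divr_gt0.
have H j: sq y j <= 2 * bnd j by have:= Hy1 j;rewrite mxE.
split=> // j.
have h0:= H i0;have h1:= H i1;have h2:= H i2.
rewrite /bnd eqxx ![_ == i2]eq_sym (negbTE n02) (negbTE n12) in h0 h1 h2.
have a2: uax i0 i1 y * uax i0 i1 y + uay i0 i1 y * uay i0 i1 y <= sq y i0 + sq y i1.
 have -> : uax i0 i1 y * uax i0 i1 y + uay i0 i1 y * uay i0 i1 y = kap * kap *
   ((y 0 (lshift n i0) + y 0 (lshift n i1)) ^+ 2 + (y 0 (rshift n i0) + y 0 (rshift n i1)) ^+ 2).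
  by rewrite /uax /uay;ring.
 rewrite kap2 /sq;exact: sum_sq_arith.
have b2: sq (ut y) i1 <= sq y i0 + sq y i1.
 by rewrite untwist_sq1 // /sq;exact: diff_sq_arith.
have [e2 _ _]:= untwist_phase n02 n12 Uy.
have e0:= untwist_sq0 i0 i1 Uy.
have rd':= rd j;have rj:= exprn_gt0 2 (r0 j);have g0:= exprn_gt0 2 (r0 i0);have g1:= exprn_gt0 2 (r0 i1);have g2:= exprn_gt0 2 (r0 i2).
have hj: j != i2 -> sq y j <= 2 * (2 * (r i0 ^+ 2 + r i1 ^+ 2 + r j ^+ 2)).
 by move=> j2;have:= H j;rewrite /bnd (negbTE j2).
have [->|j0]:= eqVneq j i0.
 by rewrite e0;have []:= bound_arith g0 g1 g2 rj rd' h0 h1 h2 a2 (lexx _).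
have [->|j1]:= eqVneq j i1.
 by have []:= bound_arith g0 g1 g2 rj rd' h0 h1 h2 b2 (lexx _).
have [->|j2]:= eqVneq j i2.
 by rewrite e2 urr2 -addrA;have []:= bound_arith g0 g1 g2 rj rd' h0 h1 h2 a2 (lexx _).
by rewrite untwist_sq //;have []:= bound_arith g0 g1 g2 rj rd' h0 h1 h2 a2 (hj j2).
Qed.

Lemma twist_ham_near (t: 'rV[R]_n): t 0 i2 = E -> (forall j, j != i2 -> t 0 j < bnd j) ->
 \forall s \near t, twist_ham s = (pi / 2) * (s: 'rV[R]_n) 0 i0.
move=> t2 Ht.
have He j: continuous (fun s: 'rV[R]_n => s 0 j: R).
 by move=> s;apply: (Ck_coord 0 j (@openT _) (Ck_self 0 setT)).
have N1 j: \forall s \near t, (s: 'rV[R]_n) 0 j < bnd j.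
 have H: t 0 j < bnd j.
  by have [->|j2]:= eqVneq j i2;[rewrite t2 /bnd eqxx ltr_pMl // ltr1n|exact: Ht].
 exact: (He j t [set x | x < bnd j] (open_nbhs_nbhs (conj (@open_lt _ _) H))).
have N2: \forall s \near t, E / 2 < (s: 'rV[R]_n) 0 i2.
 have H: E / 2 < t 0 i2 by rewrite t2 ltr_pdivrMr // ltr_pMr // ltr1n.
 exact: (He i2 t [set x | E / 2 < x] (open_nbhs_nbhs (conj (@open_gt _ _) H))).
have N3: \forall s \near t, forall j, (s: 'rV[R]_n) 0 j < bnd j by exact: (filter_forall _ N1).
have FF: Filter (nbhs t) by exact: (@nbhs_filter 'rV[R]_n t).
have N4:= @filterI _ (nbhs t) FF _ _ N3 N2.
apply: (@filterS _ (nbhs t) FF _ _ _ N4) => s [H1 H2];rewrite /twist_ham.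
rewrite cutoff0;last exact: ratio_ge2' E0 H2.
rewrite big1 ?subr0 ?mulr1 // => j' _;rewrite cutoff1 // mulrC ler_pdivrMr // mul1r ltW //;exact: H1.
Qed.

Lemma twist_freq (y: 'rV[R]_(n + n)) j: sq y i2 = E -> (forall j, j != i2 -> sq y j < bnd j) ->
 freq twist_ham y j = if j == i0 then pi else 0.
move=> y2 Hy;rewrite /freq.
pose l (s: 'rV[R]_n): R:= (pi / 2) * s 0 i0.
have dl v: isd l (sqv y) v (pi / 2 * v 0 i0).
 apply: (isdZ (f:= fun s: 'rV[R]_n => s 0 i0));split.
  by apply: differentiable_mxcoord;exact: (differentiable_lin (@idfun 'rV[R]_n)).
 rewrite (diff_mxcoordE _ _ _ (differentiable_lin (@idfun 'rV[R]_n) (sqv y))).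
 by rewrite (diff_linE (@idfun 'rV[R]_n)).
have N: \forall s \near sqv y, twist_ham s = l s.
 by apply: twist_ham_near;[rewrite mxE|move=> j' /Hy;rewrite mxE].
have [_ ->]:= isd_near N (dl (delta_mx 0 j)).
rewrite mxE eqxx /= eq_sym;case: (j == i0);last by rewrite !mulr0.
by rewrite mulr1 mulrCA mulfV ?mulr1 // pnatr_eq0.
Qed.

Definition swap_r j:= if j == i0 then r i1 else if j == i1 then r i0 else
 if j == i2 then Num.sqrt (E + r i1 ^+ 2) else r j.

(** The linear part of the action on angles: (th_0, th_1) becomes (th_1 - th_2, th_0 + th_2). It is
    an involution, so its determinant is 1 or -1 and it does not affect densities. *)
Definition shear: 'M[R]_n:= \matrix_(i, j)
 (if j == i0 then (i == i1)%:R - (i == i2)%:R else if j == i1 then (i == i0)%:R + (i == i2)%:R else (i == j)%:R).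

Definition shift: 'rV[R]_n:= \row_j (if (j == i0) || (j == i1) then pi else 0).

Lemma sum_delta (th: 'rV[R]_n) k: \sum_i th 0 i * (i == k)%:R = th 0 k.
rewrite (bigD1 k) //= eqxx mulr1 big1 ?addr0 // => i /negbTE ->;exact: mulr0.
Qed.

Lemma shearE (th: 'rV[R]_n) j: (th *m shear) 0 j =
 if j == i0 then th 0 i1 - th 0 i2 else if j == i1 then th 0 i0 + th 0 i2 else th 0 j.
rewrite mxE;under eq_bigr do rewrite mxE.
case: (j == i0);first by under eq_bigr do rewrite mulrBr;rewrite sumrB !sum_delta.
case: (j == i1);first by under eq_bigr do rewrite mulrDr;rewrite big_split /= !sum_delta.
exact: sum_delta.
Qed.

Lemma shear_det: `|\det shear| = 1.
have S: shear *m shear = 1%:M.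
 apply: mx_rV_ext => v;apply/rowP => j;rewrite mulmxA mulmx1 !shearE.
 rewrite (negbTE n01) (negbTE n02) (negbTE n12) !eqxx.
 case: eqVneq => [->|_];first by ring.
 by case: eqVneq => [->|_] //;ring.
have:= congr1 determinant S;rewrite det_mulmx det1 => D.
have: `|\det shear| * `|\det shear| = 1 by rewrite -normrM D normr1.
move=> H;have: `|\det shear| ^+ 2 = 1 ^+ 2 by rewrite expr2 H expr1n.
by move/eqP;rewrite eqrXn2 ?normr_ge0 // => /eqP.
Qed.

Lemma polar_phase2 th: [/\ pc i2 (polar r th) = cos (th 0 i2) & ps i2 (polar r th) = sin (th 0 i2)].
have []:= @polar_phase R n i2 (polar r th) (cos (th 0 i2)) (sin (th 0 i2)) (r i2).
- exact: r0.
- by rewrite -!expr2 cos2Dsin2.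
- by rewrite polar_l mulrC.
- by rewrite polar_r mulrC.
by [].
Qed.

Lemma polar_tdom th: td (polar r th).
by rewrite /tdom /= !sq_polar ltr_pXn2r ?nnegrE ?ltW. Qed.

(** After the half-turn the new a is - w_1 and the new w_1 is - w_0 e. Undoing the twist multiplies
    the new a by conj(e), which gives the angles th_1 - th_2 + pi and th_0 + th_2 + pi, and restores
    |w_2|^2 = E + r_1^2. *)
Lemma twist_polar th: ut (rotv (fun j => if j == i0 then pi else 0) (tw (polar r th))) =
 polar swap_r (th *m shear + shift).
have [pcE psE]:= polar_phase2 th.
set w:= polar r th in pcE psE *;set y:= tw w;set y':= rotv _ y.
have Tw:= polar_tdom th;have Uw:= tdom_u Tw.
have y0l: y' 0 (lshift n i0) = - y 0 (lshift n i0) by rewrite rotv_l eqxx cospi sinpi;ring.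
have y0r: y' 0 (rshift n i0) = - y 0 (rshift n i0) by rewrite rotv_r eqxx cospi sinpi;ring.
have yl j: j != i0 -> y' 0 (lshift n j) = y 0 (lshift n j) by move=> /negbTE h';rewrite rotv_l h' cos0 sin0;ring.
have yr j: j != i0 -> y' 0 (rshift n j) = y 0 (rshift n j) by move=> /negbTE h';rewrite rotv_r h' cos0 sin0;ring.
have [t2 t3 t4]:= twist_phase n02 n12 Tw.
have [p2 p3 p4]: [/\ sq y' i2 = trr i0 i2 w * trr i0 i2 w, pc i2 y' = cos (th 0 i2) & ps i2 y' = sin (th 0 i2)].
 have sE: sq y' i2 = sq y i2 by rewrite /sq yl ?yr.
 have phE: ph i2 y' = ph i2 y by rewrite /ph sE.
 by split;[rewrite sE t2|rewrite /pc phE yl // -/(pc i2 y) t3|rewrite /ps phE yr // -/(ps i2 y) t4].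
have ax: uax i0 i1 y' = - w 0 (lshift n i1).
 rewrite /uax y0l yl // !twist_l /twist_re !eqxx (negbTE n01).
 by rewrite -[RHS](congr1 -%R (kapB (tax i0 i2 w) (w 0 (lshift n i1))));ring.
have ay: uay i0 i1 y' = - w 0 (rshift n i1).
 rewrite /uay y0r yr // !twist_r /twist_im !eqxx (negbTE n01).
 by rewrite -[RHS](congr1 -%R (kapB (tay i0 i2 w) (w 0 (rshift n i1))));ring.
have rE: urr i0 i1 i2 y' = swap_r i2.
 rewrite /urr p2 trr2 // ax ay /swap_r (negbTE n02) (negbTE n12) eqxx;apply: (congr1 Num.sqrt).
 have sw1:= sq_polar r th i1;rewrite /sq in sw1;rewrite !sq_polar -sw1 -/w /E;ring.
apply: row_split_ext => j;rewrite ?untwist_l ?untwist_r ?polar_l ?polar_r /untwist_re /untwist_im p3 p4 ax ay rE [(th *m shear + shift) 0 j]mxE shearE [shift 0 j]mxE.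
 case: eqVneq => [->|j0].
  by rewrite /= cosDpi cosB /swap_r eqxx !polar_l !polar_r;ring.
 case: eqVneq => [->|j1].
  rewrite /= y0l (yl i1) // !twist_l /twist_re !eqxx (negbTE n01) cosDpi cosD /swap_r (negbTE n01) eqxx.
  rewrite -[LHS](_: - (kap * (kap * (tax i0 i2 w + w 0 (lshift n i1)) + kap * (tax i0 i2 w - w 0 (lshift n i1)))) = _);last by ring.
  by rewrite kapD /tax pcE psE !polar_l !polar_r;ring.
 rewrite /= addr0 /swap_r (negbTE j0) (negbTE j1).
 case: eqVneq => [->|j2];first by rewrite eqxx (negbTE n02) (negbTE n12) mulrC.
 by rewrite yl // twist_l /twist_re (negbTE j0) (negbTE j1) (negbTE j2) polar_l.
case: eqVneq => [->|j0].
 by rewrite /= sinDpi sinB /swap_r eqxx !polar_l !polar_r;ring.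
case: eqVneq => [->|j1].
 rewrite /= y0r (yr i1) // !twist_r /twist_im !eqxx (negbTE n01) sinDpi sinD /swap_r (negbTE n01) eqxx.
 rewrite -[LHS](_: - (kap * (kap * (tay i0 i2 w + w 0 (rshift n i1)) + kap * (tay i0 i2 w - w 0 (rshift n i1)))) = _);last by ring.
 by rewrite kapD /tay pcE psE !polar_l !polar_r;ring.
rewrite /= addr0 /swap_r (negbTE j0) (negbTE j1).
case: eqVneq => [->|j2];first by rewrite eqxx (negbTE n02) (negbTE n12) mulrC.
by rewrite yr // twist_r /twist_im (negbTE j0) (negbTE j1) (negbTE j2) polar_r.
Qed.

Lemma twist_isotopy: compact [set: M] -> exists (phi: M -> M) (C: set M), [/\ Ham_c X phi,
 closed C, C `<=` O, forall x, ~ C x -> phi x = x &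
 forall th, disc d (polar r th) -> phi (h (polar r th)) = h (polar swap_r (th *m shear + shift))].
move=> cM;have Ct:= twist_coord.
exists (rotflow OY Y hY twist_ham 1), (hY @` (sqv @^-1` K)).
have OYO: OY `<=` O by move=> x [].
split.
- exact: (rotflow_Ham cM Ct twist_formc twist_ham_smooth K_compact K_image K_closed twist_ham0).
- apply: (compact_closed (cm_hausdorff X));apply: continuous_compact;last exact: K_compact.
 apply: continuous_in_subspaceT => y;rewrite inE => Ky.
 by case: Ct => _ _ _ _ [+ _];apply;exact: K_image.
- move=> _ [y Ky <-];apply: OYO;have [x Ox <-]:= K_image Ky.
 by case: Ct => _ _ _ -> .
- by move=> x nC;exact: (rotflow_out Ct K_closed twist_ham0).
move=> th Dth;have OYx: OY (h (polar r th)).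
 by split;[exact: hO|rewrite /preimage /= Wh //;exact: polar_tdom].
rewrite (rotflow_in _ _ _ _ OYx) /Y Wh // /hY -twist_polar;congr (h (ut _)).
apply: rotv_ext => j;rewrite mul1r;apply: twist_freq.
 have [-> _ _]:= twist_phase n02 n12 (polar_tdom th).
 by rewrite trr2 ?sq_polar //;exact: polar_tdom.
move=> j' j2';rewrite /bnd (negbTE j2').
have g0:= exprn_gt0 2 (r0 i0);have g1:= exprn_gt0 2 (r0 i1);have gj:= exprn_gt0 2 (r0 j').
have K0:= ta2 i0 (tdom_u (polar_tdom th));rewrite sq_polar in K0.
have K1:= sq_polar r th i1;rewrite /sq in K1.
set w:= polar r th in K0 K1 *.
have [->|j0]:= eqVneq j' i0.
 rewrite /sq twist_l twist_r /twist_re /twist_im eqxx;apply: (sq_arith kap2 K0 K1 g0 g1 g0);left.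
 by ring.
have [->|j1]:= eqVneq j' i1.
 rewrite /sq twist_l twist_r /twist_re /twist_im (negbTE n01) eqxx;apply: (sq_arith kap2 K0 K1 g0 g1 g1);right.
 by ring.
rewrite /sq twist_l twist_r /twist_re /twist_im (negbTE j0) (negbTE j1) (negbTE j2') -/(sq w j') sq_polar.
exact: sum_arith.
Qed.

End TwistFlow.

(** * Product tori: parametrization by angles and density near the fixed point *)

Lemma det_near1 (R: realType) n (e: R): 0 < e -> exists2 eta: R, 0 < eta &
 forall B: 'M[R]_n, (forall i j, `|B i j - (i == j)%:R| <= eta) -> `|\det B - 1| <= e.
move=> e0;pose f (x: 'rV[R]_(n * n)): R:= \det (vec_mx x: 'M[R]_n).
have cf: {for mxvec (1%:M: 'M[R]_n), continuous f}.
 apply: (Ck_det (k:= 0) (@openT _)) => // i j.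
 rewrite (_: (fun x => _) = fun x: 'rV[R]_(n * n) => x 0 (mxvec_index i j));last first.
  by apply/funext => x;rewrite [vec_mx _ _ _]mxE.
 by apply: Ck_coord;[exact: openT|exact: Ck_self].
have f1: f (mxvec 1%:M) = 1 by rewrite /f mxvecK det1.
have /nbhs_ballP[r /= r0 Hr]: nbhs (mxvec 1%:M: 'rV[R]_(n * n)) [set x | `|f x - 1| <= e].
 exact: (continuous_near_le e0 cf f1).
exists (r / 2);first by rewrite divr_gt0.
move=> B HB;have:= Hr (mxvec B);rewrite /= /f mxvecK;apply.
split=> // i k;rewrite (ord1 i);case/mxvec_indexP: k => i' j'.
rewrite !mxvecE /ball /= distrC [1%:M _ _]mxE;apply: le_lt_trans (HB i' j') _.
by rewrite ltr_pdivrMr // ltr_pMr // ltr1n.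
Qed.

Lemma rot_solve (R: realType) (wl wr c s r ca sa re im: R): c ^+ 2 + s ^+ 2 = 1 ->
 re = r * ca -> im = r * sa -> re = wl * c + wr * s -> im = wr * c - wl * s ->
 wl = r * (c * ca - s * sa) /\ wr = r * (s * ca + c * sa).
move=> cs E1 E2 E3 E4.
have -> : r * (c * ca - s * sa) = c * (r * ca) - s * (r * sa) by ring.
have -> : r * (s * ca + c * sa) = s * (r * ca) + c * (r * sa) by ring.
rewrite -E1 -E2 E3 E4;split.
 by rewrite -[LHS]mulr1 -cs;ring.
by rewrite -[LHS]mulr1 -cs;ring.
Qed.

Section Polar.
Context {R: realType} {n: nat}.

Lemma polar_smooth (r: 'I_n -> R) (U: set 'rV[R]_n): open U -> smooth_on U (polar r).
move=> oU k;have He j: Ck_on k U (fun s: 'rV[R]_n => s 0 j) by apply: Ck_coord => //;exact: Ck_self.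
apply: Ck_rV => // i;have [j ->|j ->]:= split_ordP i.
 rewrite (_: (fun x => _) = fun th: 'rV[R]_n => r j * cos (th 0 j));last by apply/funext => th;rewrite polar_l.
 by apply: CkM => //;[exact: Ck_cst|exact: Ck_cos].
rewrite (_: (fun x => _) = fun th: 'rV[R]_n => r j * sin (th 0 j));last by apply/funext => th;rewrite polar_r.
by apply: CkM => //;[exact: Ck_cst|exact: Ck_sin].
Qed.

(** Its rows are the unit tangent vectors in the angular directions; they are orthonormal for the
    standard metric. *)
Definition phase_mx (th: 'rV[R]_n): 'M[R]_(n, n + n) :=
 row_mx (diag_mx (\row_j - sin (th 0 j))) (diag_mx (\row_j cos (th 0 j))).

Lemma polar_J (r: 'I_n -> R) th: 'J (polar r) th = diag_mx (\row_j r j) *m phase_mx th.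
have dp: differentiable (polar r) th by apply: (polar_smooth r (@openT _) 1%N).1.
apply: J_unique => // v.
have dl: is_derive (0: R) (1: R) (fun s: R => th + s *: v) v.
 by have:= is_derive_segment th (th + v) 0;rewrite [th + v - th]addrC addKr.
have H:= is_derive_comp_diff (g:= polar r) dl;rewrite scale0r addr0 in H.
have {}H:= H dp.
have lin j: is_derive (0: R) (1: R) (fun s: R => th 0 j + s * v 0 j) (v 0 j).
 have:= is_deriveD (is_derive_cst (th 0 j) 0 (1: R)) (is_derive_mulr (v 0 j) 0).
 by rewrite add0r.
rewrite mulmxA /phase_mx mul_mx_row;apply: row_split_ext => j.
 rewrite row_mxEl !mul_mx_diag !mxE.
 have Hj:= is_derive_entry (lshift n j) H.
 rewrite -(@derive_val _ _ _ _ _ _ _ Hj).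
 have dc: is_derive (0: R) (1: R) (fun s: R => cos (th 0 j + s * v 0 j)) (- sin (th 0 j + 0 * v 0 j) * v 0 j).
  exact: (is_derive1_comp (is_derive_cos _) (lin j)).
 have T:= is_deriveZ (r j) dc.
 rewrite (_: (fun s: R => _) = r j \*: (fun s: R => cos (th 0 j + s * v 0 j)));last first.
  by apply/funext => s;rewrite /= polar_l !mxE.
 by rewrite (@derive_val _ _ _ _ _ _ _ T) mul0r addr0 /GRing.scale /=;ring.
rewrite row_mxEr !mul_mx_diag !mxE.
have Hj:= is_derive_entry (rshift n j) H.
rewrite -(@derive_val _ _ _ _ _ _ _ Hj).
have ds: is_derive (0: R) (1: R) (fun s: R => sin (th 0 j + s * v 0 j)) (cos (th 0 j + 0 * v 0 j) * v 0 j).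
 exact: (is_derive1_comp (is_derive_sin _) (lin j)).
have T:= is_deriveZ (r j) ds.
rewrite (_: (fun s: R => _) = r j \*: (fun s: R => sin (th 0 j + s * v 0 j)));last first.
 by apply/funext => s;rewrite /= polar_r !mxE.
by rewrite (@derive_val _ _ _ _ _ _ _ T) mul0r addr0 /GRing.scale /=;ring.
Qed.

Lemma phase_conj th (A: 'M[R]_(n + n)) i j: (phase_mx th *m A *m (phase_mx th)^T) i j =
 sin (th 0 i) * sin (th 0 j) * A (lshift n i) (lshift n j) - sin (th 0 i) * cos (th 0 j) * A (lshift n i) (rshift n j)
 - cos (th 0 i) * sin (th 0 j) * A (rshift n i) (lshift n j) + cos (th 0 i) * cos (th 0 j) * A (rshift n i) (rshift n j).
have Rd (B: 'M[R]_n) (e: 'I_n -> R): (B *m diag_mx (\row_j e j)) i j = B i j * e j.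
 by rewrite mul_mx_diag mxE [X in _ * X]mxE.
have Ld (B: 'M[R]_n) (e: 'I_n -> R): (diag_mx (\row_j e j) *m B) i j = e i * B i j.
 by rewrite mul_diag_mx mxE [X in X * _]mxE.
have D (B C: 'M[R]_n): (B + C) i j = B i j + C i j by rewrite mxE.
rewrite -[A in LHS]submxK /phase_mx tr_row_mx !tr_diag_mx mul_row_block mul_row_col D !Rd !D !Ld.
have -> : ulsubmx A i j = A (lshift n i) (lshift n j) by rewrite !mxE.
have -> : ursubmx A i j = A (lshift n i) (rshift n j) by rewrite !mxE.
have -> : dlsubmx A i j = A (rshift n i) (lshift n j) by rewrite !mxE.
have -> : drsubmx A i j = A (rshift n i) (rshift n j) by rewrite !mxE.
ring.
Qed.

Lemma phase_orth th: phase_mx th *m (phase_mx th)^T = 1%:M.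
apply/matrixP => i j;have:= phase_conj th 1%:M i j;rewrite mulmx1 => ->;rewrite !mxE.
rewrite !(inj_eq (@lshift_inj _ _)) !(inj_eq (@rshift_inj _ _)) eq_lrshift eq_rlshift.
case: eqVneq => [->|_] /=;last by ring.
by rewrite !mulr0 !mulr1 !subr0 -!expr2 addrC cos2Dsin2.
Qed.

(** Each entry of the conjugated matrix combines four entries of A - 1 with coefficients products of
    sines and cosines, whence the factor 4. *)
Lemma phase_near th (A: 'M[R]_(n + n)) (eta: R): (forall i j, `|A i j - (i == j)%:R| <= eta) ->
 forall i j, `|(phase_mx th *m A *m (phase_mx th)^T) i j - (i == j)%:R| <= 4 * eta.
move=> HA i j.
have -> : (phase_mx th *m A *m (phase_mx th)^T) i j - (i == j)%:R =
  (phase_mx th *m (A - 1%:M) *m (phase_mx th)^T) i j.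
 have Bij (B C: 'M[R]_n): (B - C) i j = B i j - C i j by rewrite !mxE.
 by rewrite mulmxBr mulmxBl mulmx1 phase_orth Bij [1%:M i j]mxE.
rewrite phase_conj.
have H i' j': `|(A - 1%:M) i' j'| <= eta.
 by rewrite (_: (A - 1%:M) i' j' = A i' j' - (i' == j')%:R) ?HA // !mxE.
have e0: 0 <= eta:= le_trans (normr_ge0 _) (H (lshift n i) (lshift n i)).
have T (x y a: R): `|x| <= 1 -> `|y| <= 1 -> `|a| <= eta -> `|x * y * a| <= eta.
 move=> hx hy ha;rewrite !normrM -[leRHS]mul1r.
 apply: (ler_pM (mulr_ge0 (normr_ge0 x) (normr_ge0 y)) (normr_ge0 a) _ ha).
 by rewrite -[leRHS]mulr1;exact: (ler_pM (normr_ge0 x) (normr_ge0 y) hx hy).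
have c1 t: `|cos t: R| <= 1 by rewrite ler_norml cos_geN1 cos_le1.
have s1 t: `|sin t: R| <= 1 by rewrite ler_norml sin_geN1 sin_le1.
have -> : 4 * eta = eta + eta + eta + eta by ring.
apply: le_trans (ler_normD _ _) _;apply: lerD;last exact: T.
apply: le_trans (ler_normB _ _) _;apply: lerD;last exact: T.
apply: le_trans (ler_normB _ _) _;apply: lerD;exact: T.
Qed.

Lemma polar_exists (w: 'rV[R]_(n + n)) (r: 'I_n -> R): (forall j, 0 < r j) -> (forall j, sq w j = r j ^+ 2) ->
 exists th, w = polar r th.
move=> r0 Hw.
have /choice[t Ht]: forall j, exists t, w 0 (lshift n j) = r j * cos t /\ w 0 (rshift n j) = r j * sin t.
 move=> j;have rn: r j != 0 by rewrite gt_eqF.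
 have [|t [E1 E2]]:= @angle_exists R (w 0 (lshift n j) / r j) (w 0 (rshift n j) / r j).
  by rewrite !exprMn -mulrDl -/(sq w j) Hw exprVn mulfV // expf_neq0.
 by exists t;split;rewrite -?E1 -?E2 mulrC divfK.
exists (\row_j t j);apply: row_split_ext => j;rewrite ?polar_l ?polar_r mxE;by have []:= Ht j.
Qed.

(* Rotating by - th_j makes the angle near th_j readable by the arctangent of im/re. *)
Definition rot_re (th: 'rV[R]_n) (w: 'rV[R]_(n + n)) j: R :=
 w 0 (lshift n j) * cos (th 0 j) + w 0 (rshift n j) * sin (th 0 j).
Definition rot_im (th: 'rV[R]_n) (w: 'rV[R]_(n + n)) j: R :=
 w 0 (rshift n j) * cos (th 0 j) - w 0 (lshift n j) * sin (th 0 j).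
Definition angle (th: 'rV[R]_n) (w: 'rV[R]_(n + n)): 'rV[R]_n :=
 \row_j (th 0 j + atan (rot_im th w j / rot_re th w j)).

Lemma angle_polar th r th': (forall j, 0 < r j) -> ball th 1 th' ->
 (forall j, 0 < rot_re th (polar r th') j) /\ angle th (polar r th') = th'.
move=> r0 [_ B].
have re j: rot_re th (polar r th') j = r j * cos (th' 0 j - th 0 j).
 by rewrite /rot_re polar_l polar_r cosB;ring.
have im j: rot_im th (polar r th') j = r j * sin (th' 0 j - th 0 j).
 by rewrite /rot_im polar_l polar_r sinB;ring.
have I j: th' 0 j - th 0 j \in `](- (pi / 2)), (pi / 2)[.
 have:= B 0 j;rewrite /ball /= distrC ltr_norml in_itv /= => /andP[h1 h2].
 have p2:= @pi_ge2 R;by apply/andP;split;lra.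
have cp j: 0 < cos (th' 0 j - th 0 j).
 by apply: cos_gt0_pihalf;move: (I j);rewrite in_itv.
split=> [j|];first by rewrite re mulr_gt0.
apply/rowP => j;rewrite mxE re im -mulf_div mulfV ?gt_eqF // mul1r -/(tan _) tanK ?I //.
by rewrite addrC subrK.
Qed.

Lemma polar_angle th w r: (forall j, 0 < r j) -> (forall j, sq w j = r j ^+ 2) ->
 (forall j, 0 < rot_re th w j) -> w = polar r (angle th w).
move=> r0 Hw Hre.
have key j: rot_re th w j = r j * cos (atan (rot_im th w j / rot_re th w j)) /\
       rot_im th w j = r j * sin (atan (rot_im th w j / rot_re th w j)).
 set u:= _ / _;have p:= Hre j;have rn: rot_re th w j != 0 by rewrite gt_eqF.
 have E: rot_re th w j ^+ 2 + rot_im th w j ^+ 2 = r j ^+ 2.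
  by rewrite -Hw /sq -[RHS]mulr1 -(cos2Dsin2 (th 0 j)) /rot_re /rot_im;ring.
 have iu: rot_im th w j = u * rot_re th w j by rewrite /u divfK.
 have cg: 0 < cos (atan u).
  by apply: cos_gt0_pihalf;rewrite atan_gtNpi2 atan_ltpi2.
 have su: sin (atan u) = u * cos (atan u).
  by rewrite -{2}(atanK u) /tan divfK // gt_eqF.
 have c2: cos (atan u) ^+ 2 * (1 + u ^+ 2) = 1.
  by rewrite -[RHS](cos2Dsin2 (atan u)) su;ring.
 have H: rot_re th w j = r j * cos (atan u).
  have H2: rot_re th w j ^+ 2 = (r j * cos (atan u)) ^+ 2.
   rewrite exprMn -E iu -[LHS]mul1r -c2;ring.
  by apply/eqP;rewrite -(@eqrXn2 _ 2) // ?ltW ?mulr_gt0 // H2.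
 by split=> //;rewrite iu su H;ring.
apply: row_split_ext => j;rewrite ?polar_l ?polar_r [angle th w 0 j]mxE.
 by rewrite cosD;exact: (rot_solve (cos2Dsin2 (th 0 j)) (key j).1 (key j).2 erefl erefl).1.
by rewrite sinD;exact: (rot_solve (cos2Dsin2 (th 0 j)) (key j).1 (key j).2 erefl erefl).2.
Qed.

Lemma angle_open th (U: set 'rV[R]_n): open U ->
 open [set w | (forall j, 0 < rot_re th w j) /\ U (angle th w)].
move=> oU;rewrite openE => w [Hre Uw];rewrite /interior /=.
have cre j: continuous (fun w => rot_re th w j).
 move=> w';apply: (CkD (k:= 0) (@openT _)) => //;apply: CkM;try exact: openT;try exact: Ck_cst;
  apply: Ck_coord;try exact: openT;exact: Ck_self.
have cim j: continuous (fun w => rot_im th w j).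
 move=> w';apply: (CkB (k:= 0) (@openT _)) => //;apply: CkM;try exact: openT;try exact: Ck_cst;
  apply: Ck_coord;try exact: openT;exact: Ck_self.
have N1 w': (forall j, 0 < rot_re th w' j) -> \forall w'' \near w', forall j, 0 < rot_re th w'' j.
 move=> Hw;have N0 j: \forall w'' \near w', 0 < rot_re th w'' j.
  exact: (cre j w' [set x | 0 < x] (open_nbhs_nbhs (conj (@open_gt _ _) (Hw j)))).
 exact: (filter_forall _ N0).
pose V:= [set w: 'rV[R]_(n + n) | forall j, 0 < rot_re th w j].
have oV: open V by rewrite openE => w';exact: N1.
have ca: Ck_on 0 V (angle th).
 apply: Ck_rV => // j;rewrite (_: (fun w => _) = fun w => th 0 j + atan (rot_im th w j / rot_re th w j));last first.
  by apply/funext => w';rewrite mxE.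
 move=> w' Vw';apply: (CkD (k:= 0) oV (Ck_cst 0 V (th 0 j))) => // w2 Vw2.
 apply: (@continuous_comp _ _ _ (fun w => rot_im th w j / rot_re th w j) atan);last exact: continuous_atan.
 have n0: rot_re th w2 j != 0 by rewrite gt_eqF //;exact: Vw2.
 exact: (cvgM (cim j w2) (cvgV n0 (cre j w2))).
have N2: nbhs w (angle th @^-1` U) by apply: (ca w Hre);apply: open_nbhs_nbhs.
exact: (@filterI _ (nbhs w) (@nbhs_filter _ w) _ _ (N1 w Hre) N2).
Qed.

End Polar.

Lemma mulI_tr (R: realType) n: (mulI R n)^T = - mulI R n.
by rewrite /mulI tr_block_mx !trmx0 linearN /= !trmx1 opp_block_mx !oppr0 opprK. Qed.

Lemma conj_comm (R: realType) m (D N J: 'M[R]_m): D *m N = 1%:M -> J *m N = N *m J -> D *m J = J *m D.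
move=> DN JN;have ND:= mulmx1C DN.
by rewrite -[D *m J]mulmx1 -ND mulmxA -(mulmxA D J) JN !mulmxA DN mul1mx.
Qed.

Section PolarCharts.
#[local] Opaque jacobian invmx diff_into diff_self mjac kform.
Context {R n M} (X: toric_kahler_manifold R n M).
Local Notation c:= (chart_at X).
Local Notation J:= (mulI R n).

Context (q: M) (O: set M) (W: M -> 'rV[R]_(n + n)) (h: 'rV[R]_(n + n) -> M) (L: 'M[R]_n) (d: R).
Hypothesis NC: normal_chart X q O W h L d.

Lemma normal_smooth: smooth_into X (disc d) h.
by have [[_ _ [_ _ _ _ +] _ _] [<-]]:= NC. Qed.

Lemma normal_WO x: O x -> disc d (W x).
by have [_ [<- _ _ _]]:= NC => Ox;exists x. Qed.

Lemma normal_hO w: disc d w -> O (h w) /\ W (h w) = w.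
have [[_ _ [_ _ _ hW _] _ _] [WO _ _ _]]:= NC.
by rewrite -WO => -[x Ox <-];rewrite hW.
Qed.

(** At the fixed point the coordinates are both symplectic and complex linear, so the metric
    omega(., J .) is the standard one there. *)
Lemma gram_normal0: gram X h 0 = 1%:M.
have [[d0 _ CO Oq Wq] [_ JN _ FJ]]:= NC.
have DN:= coord_on_inv CO Oq;rewrite Wq in DN.
set D:= diff_into X h 0 in DN;have ND:= mulmx1C DN.
have DJ: D *m J = J *m D.
 exact: conj_comm DN JN.
have -> : gram X h 0 = D *m (kform X (h 0) *m J^T) *m D^T by [].
have -> : D *m (kform X (h 0) *m J^T) *m D^T = D *m kform X (h 0) *m (D *m J)^T.
 by rewrite trmx_mul !mulmxA.
have F0:= FJ 0 (disc0 d0);rewrite DJ trmx_mul mulmxA -/D.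
apply: (etrans (congr1 (fun t => t *m J^T) F0)).
by rewrite mulI_tr mulmxN mulI_sqr opprK.
Qed.

(** The Gram matrix in angles is diag(r) A diag(r), with A the metric conjugated by [phase_mx].
    Hence its determinant is the squared product of the radii times det A, and A is close to 1
    uniformly in the angles. The error is relative, which is what allows small radii. *)
Lemma density_bound: exists2 delta: R, 0 < delta <= d &
 forall (r: 'I_n -> R) th, (forall j, 0 < r j) -> (forall j, r j ^+ 2 < delta) ->
 `|\det (gram X (h \o polar r) th) - (\prod_j r j) ^+ 2| <= 8^-1 * (\prod_j r j) ^+ 2.
have [[d0 _ _ _ _] _]:= NC;have sh:= normal_smooth.
have e0: (0: R) < 8^-1 by rewrite invr_gt0.
have [eta eta0 Heta]:= @det_near1 R n _ e0.
have eta40: 0 < eta / 4 by rewrite divr_gt0.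
have H ij: \forall w \near (0: 'rV[R]_(n + n)), `|gram X h w ij.1 ij.2 - (ij.1 == ij.2)%:R| <= eta / 4.
 apply: (continuous_near_le (f:= fun w => gram X h w ij.1 ij.2) eta40).
  exact: (gram_smooth ij.1 ij.2 (@disc_open R n d) sh 0%N 0 (disc0 d0)).
 by rewrite gram_normal0 mxE.
have /nbhs_ballP[rho /= rho0 Hrho]: \forall w \near (0: 'rV[R]_(n + n)), forall ij, `|gram X h w ij.1 ij.2 - (ij.1 == ij.2)%:R| <= eta / 4.
 exact: (filter_forall _ H).
have rho20: 0 < rho ^+ 2 by rewrite exprn_gt0.
exists (Num.min d (rho ^+ 2));first by rewrite lt_min d0 rho20 ge_min lexx.
move=> r th r0 rd;set w:= polar r th.
have wd: disc d w by move=> j;rewrite sq_polar;apply: lt_le_trans (rd j) _;rewrite ge_min lexx.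
have wb: ball 0 rho w.
 split=> // i j;rewrite /ball /= ord1 mxE sub0r normrN.
 have k (a b: R) (j': 'I_n): a ^+ 2 + b ^+ 2 = r j' ^+ 2 -> `|a| < rho /\ `|b| < rho.
  move=> E;have lt: r j' ^+ 2 < rho ^+ 2 by apply: lt_le_trans (rd j') _;rewrite ge_min lexx orbT.
  by split;rewrite -(ltr_pXn2r (n:= 2)) ?nnegrE ?normr_ge0 ?ltW // real_normK ?num_real //;
   apply: le_lt_trans lt;rewrite -E ?lerDl ?lerDr sqr_ge0.
 have [j' ->|j' ->]:= split_ordP j;have E:= sq_polar r th j';[exact: (k _ _ _ E).1|exact: (k _ _ _ E).2].
have dp: differentiable (polar r) th by apply: (polar_smooth r (@openT _) 1%N).1.
set A:= phase_mx th *m gram X h w *m (phase_mx th)^T.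
have GA: \det (gram X (h \o polar r) th) = (\prod_j r j) ^+ 2 * \det A.
 have E: gram X (h \o polar r) th = diag_mx (\row_j r j) *m A *m diag_mx (\row_j r j).
  rewrite /gram (diff_into_pre wd dp sh) polar_J /=.
  apply: (etrans (esym (conj_mulmx _ _ _)));apply: (etrans (esym (conj_mulmx _ _ _))).
  by rewrite tr_diag_mx.
 rewrite E !det_mulmx !det_diag;have -> : \prod_i (\row_j r j) 0 i = \prod_j r j :> R.
  by apply: eq_bigr => j _;rewrite mxE.
 by ring.
have AH: `|\det A - 1| <= 8^-1.
 apply: Heta => i j;apply: le_trans (_: 4 * (eta / 4) <= _);last by rewrite mulrC divfK.
 by apply: phase_near => i' j';exact: (Hrho w wb (i', j')).
rewrite GA -[X in _ - X]mulr1 -mulrBr normrM ger0_norm ?sqr_ge0 // mulrC.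
by rewrite ler_wpM2r ?sqr_ge0.
Qed.

Lemma normal_sq x (s: 'rV[R]_n): O x ->
 moment X x = moment X q - (2^-1 *: s) *m L^T -> forall j, sq (W x) j = s 0 j.
have [[_ uL _ _ _] [_ _ mE _]]:= NC => Ox;rewrite mE // => /subrI E j.
have uLT: L^T \in unitmx by rewrite unitmx_tr.
have:= congr1 (fun t => t *m invmx L^T) E;rewrite !mulmxK // => /scalerI;rewrite invr_eq0 pnatr_eq0 => /(_ isT) <-.
by rewrite mxE.
Qed.

(** Injectivity and openness come from the local inverse [angle]; the immersion property from the
    orthonormality of [phase_mx]. Inside [O] the fibre over [a] is exactly the product torus,
    because the weight matrix is invertible. *)
Lemma polar_param (r: 'I_n -> R) th0 a: (forall j, 0 < r j) -> (forall j, r j ^+ 2 < d) ->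
 a = moment X q - (2^-1 *: \row_j r j ^+ 2) *m L^T ->
 local_param X (moment X @^-1` [set a]) (ball th0 1) (h \o polar r).
move=> r0 rd aE;have sh:= normal_smooth.
have [[_ uL CO _ _] [WO _ mE _]]:= NC;have [ oO sW _ hW _]:= CO.
have pd th: disc d (polar r th) by move=> j;rewrite sq_polar.
have op: open (ball th0 1) by exact: ball_open.
have dp th: differentiable (polar r) th by apply: (polar_smooth r (@openT _) 1%N).1.
have inj x y: ball th0 1 x -> ball th0 1 y -> h (polar r x) = h (polar r y) -> x = y.
 move=> Bx By E;rewrite -(angle_polar r0 Bx).2 -(angle_polar r0 By).2.
 by rewrite -(normal_hO (pd x)).2 E (normal_hO (pd y)).2.
split=> //.
- apply: (into_pre (V:= disc d) (f:= h) (h:= polar r) op (@disc_open R n d)) => //.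
 exact: polar_smooth.
- move=> th _;have DN:= coord_on_inv CO (normal_hO (pd th)).1;rewrite (normal_hO (pd th)).2 in DN.
 set N:= mjac _ _ _ in DN.
 apply/row_freeP;exists (N *m (phase_mx th)^T *m diag_mx (\row_j (r j)^-1)).
 rewrite (diff_into_pre (pd th) (dp th) sh) polar_J !mulmxA.
 apply: (etrans (congr1 (fun t => t *m (phase_mx th)^T *m diag_mx (\row_j (r j)^-1)) (esym (mulmxA _ _ _)))).
 apply: (etrans (congr1 (fun t => diag_mx (\row_j r j) *m phase_mx th *m t *m (phase_mx th)^T *m diag_mx (\row_j (r j)^-1)) DN)).
 rewrite mulmx1 -(mulmxA (diag_mx _)) phase_orth mulmx1;apply/matrixP => i j.
 rewrite mul_diag_mx [LHS]mxE [X in X * _]mxE [X in _ * X]mxE [X in _ * (X *+ _)]mxE [RHS]mxE.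
 by case: eqVneq => [->|_];rewrite ?mulr0n ?mulr0 ?mulr1n ?mulfV // gt_eqF.
- move=> W' oW' sW'.
 (* In the coordinates this is the set where the angles relative to [th0] are readable and lie in
    [W']; intersected with the fibre it is the image of [W']. *)
 exists (O `&` W @^-1` [set w | (forall j, 0 < rot_re th0 w j) /\ W' (angle th0 w)]).
  by apply: msm_open => //;exact: angle_open.
 apply/seteqP;split=> x.
  move=> [th W'th <-];have [Oh Wh]:= normal_hO (pd th).
  have [re an]:= angle_polar r0 (sW' _ W'th).
  split;last by split=> //=;rewrite Wh an.
  rewrite /= mE // Wh aE;congr (_ - (_ *: _) *m _).
  by apply/rowP => j;rewrite !mxE sq_polar.
 move=> [/= ma [Ox [re an]]];exists (angle th0 (W x)) => //.
 have sx: forall j, sq (W x) j = r j ^+ 2.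
  by move=> j;rewrite (normal_sq Ox (s:= \row_j r j ^+ 2)) ?mxE // ma.
 by rewrite /= -(polar_angle r0 sx re) hW.
Qed.

End PolarCharts.

(** * The choice of the radii *)

Lemma near_gt0 (R: realType) n (f: 'rV[R]_n -> R) x: {for x, continuous f} -> 0 < f x ->
 \forall y \near x, 0 < f y.
by move=> cf fx;apply: (cf [set t | 0 < t]);exact: (open_nbhs_nbhs (conj (@open_gt _ _) fx)). Qed.

Lemma mulmx_entry_continuous (R: realType) n m (A: 'M[R]_(n, m)) j :
 continuous (fun x: 'rV[R]_n => (x *m A) 0 j).
move=> x;apply: (Ck_mxmul (k:= 0) (A:= fun y: 'rV[R]_n => y) (B:= fun=> A) 0 j (@openT _)) => //.
 by move=> i' j';apply: Ck_coord;[exact: openT|exact: Ck_self].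
by move=> i' j';exact: Ck_cst.
Qed.

(** The hyperplanes are avoided one at a time while the set stays open and nonempty: moving by a
    small multiple of c^T changes the pairing with c by that multiple of |c|^2 > 0. *)
Lemma avoid_hyperplanes (R: realType) n (cs: seq 'cV[R]_n) (U: set 'rV[R]_n): open U -> U !=set0 ->
 (forall c, c \in cs -> c != 0) -> exists2 x, U x & forall c, c \in cs -> (x *m c) 0 0 != 0.
elim: cs U => [|c cs IH] U oU [x Ux] H;first by exists x.
have cc:= @mulmx_entry_continuous R n 1 c 0.
pose U':= U `&` [set y: 'rV[R]_n | (y *m c) 0 0 != 0].
have oU': open U'.
 by apply: openI => //;apply: (@open_comp _ _ (fun y: 'rV[R]_n => (y *m c) 0 0) [set t | t != 0]);
  [move=> y _;exact: cc|exact: open_neq].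
have U'0: U' !=set0.
 have [E|ne]:= eqVneq ((x *m c) 0 0) 0;last by exists x.
 have cl: (fun t: R => x + t *: c^T) @ (0: R) --> x + (0: R) *: c^T.
  by apply: cvgD;[exact: cvg_cst|exact: scalel_continuous].
 rewrite scale0r addr0 in cl.
 have /nbhs_ballP[e /= e0 He]:= cl _ (open_nbhs_nbhs (conj oU Ux)).
 exists (x + (e / 2) *: c^T);split.
  apply: He;rewrite /ball /= sub0r normrN gtr0_norm ?divr_gt0 //.
  by rewrite ltr_pdivrMr // ltr_pMr // ltr1n.
 rewrite /= mulmxDl -scalemxAl mxE E add0r mxE mulf_neq0 //.
  by rewrite gt_eqF ?divr_gt0.
 have c0:= H c (mem_head _ _);apply: contra c0 => /eqP;rewrite mxE => S0.
 apply/eqP/colP => j;rewrite [RHS]mxE.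
 have:= @psumr_eq0P R _ predT (fun j => c^T 0 j * c j 0) _ S0 j isT.
 rewrite mxE => /(_ _)/eqP;rewrite mulf_eq0 orbb => H0;apply/eqP/H0.
 by move=> k _;rewrite mxE -expr2 sqr_ge0.
have [y [Uy ny] Hy]:= IH U' oU' U'0 (fun c' h => H c' (mem_behead (s:= c :: cs) h)).
by exists y => // c';rewrite inE => /orP[/eqP->|/Hy].
Qed.

Section Wedge.
Context {R: realType} {n: nat} (i0 i1 i2: 'I_n).
Hypotheses (n01: i1 != i0) (n02: i2 != i0) (n12: i2 != i1).

(** For x_j = r_j^2 the last inequality is 9 (x_2 - x_0 + x_1) < 7 x_2. As the isotopy multiplies
    the squared product of the radii by (x_2 - x_0 + x_1)/x_2, that product falls below 7/9 of its
    value. The conditions are invariant under positive scaling. *)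
Definition wedge: set 'rV[R]_n:= [set x | [/\ forall j, 0 < x 0 j, x 0 i0 < x 0 i2 &
 2 * x 0 i2 + 9 * x 0 i1 < 9 * x 0 i0]].

Lemma wedge_open: open wedge.
have cx j: continuous (fun x: 'rV[R]_n => x 0 j).
 by move=> x;apply: (Ck_coord (k:= 0) 0 j (@openT _) (Ck_self 0 setT)).
rewrite openE => x [x0 x02 x12];rewrite /interior /=.
have N0 (j: 'I_n): nbhs x (fun y: 'rV[R]_n => 0 < y 0 j).
 by apply: (near_gt0 (f:= fun y: 'rV[R]_n => y 0 j)) => //;exact: cx.
have N1: nbhs x (fun y: 'rV[R]_n => forall j, 0 < y 0 j) by exact: (filter_forall _ N0).
have N2: nbhs x (fun y: 'rV[R]_n => 0 < y 0 i2 - y 0 i0).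
 apply: (near_gt0 (f:= fun y: 'rV[R]_n => y 0 i2 - y 0 i0));last by rewrite subr_gt0.
 exact: (cvgB (cx i2 x) (cx i0 x)).
have N3: nbhs x (fun y: 'rV[R]_n => 0 < 9 * y 0 i0 - (2 * y 0 i2 + 9 * y 0 i1)).
 apply: (near_gt0 (f:= fun y: 'rV[R]_n => 9 * y 0 i0 - (2 * y 0 i2 + 9 * y 0 i1)));last by rewrite subr_gt0.
 have C (a: R) j: Ck_on 0 setT (fun y: 'rV[R]_n => a * y 0 j).
  by apply: CkM;[exact: openT|exact: Ck_cst|move=> y _;exact: cx].
 by apply: (CkB (k:= 0) (@openT _)) => //;apply: (CkD (k:= 0) (@openT _)).
apply: filterS3 N1 N2 N3 => y h1 h2 h3;split=> //;by rewrite -subr_gt0.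
Qed.

Lemma wedge_nonempty: wedge !=set0.
(* Here x_0 = 2, x_1 = 1, x_2 = 4, and 2 * 4 + 9 * 1 = 17 < 18 = 9 * 2. *)
exists (\row_j if j == i0 then 2 else if j == i2 then 4 else 1);split=> [j||];rewrite !mxE ?eqxx.
- by case: ifP => // _;case: ifP.
- by rewrite (negbTE n02);lra.
- by rewrite (negbTE n02) (negbTE n01) eq_sym (negbTE n12);lra.
Qed.

Lemma swap_prod (r: 'I_n -> R): (forall j, 0 < r j) -> r i0 < r i2 ->
 (\prod_j swap_r i0 i1 i2 r j) ^+ 2 * r i2 ^+ 2 = (\prod_j r j) ^+ 2 * (r i2 ^+ 2 - r i0 ^+ 2 + r i1 ^+ 2).
move=> r0 r02.
have split3 (f: 'I_n -> R): \prod_j f j = f i0 * (f i1 * (f i2 * \prod_(j | [&& j != i0, j != i1 & j != i2]) f j)).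
 rewrite (bigD1 i0) //= (bigD1 i1) //= (bigD1 i2) /=;last by rewrite n02 n12.
 by do 3 congr (_ * _);apply: eq_bigl => j;rewrite andbA.
have E0: 0 <= r i2 ^+ 2 - r i0 ^+ 2 + r i1 ^+ 2.
 by rewrite addr_ge0 ?sqr_ge0 // subr_ge0 ler_pXn2r ?nnegrE ?ltW.
rewrite !split3 /swap_r eqxx (negbTE n01) eqxx (negbTE n02) (negbTE n12) eqxx.
rewrite [X in (_ * (_ * (_ * X))) ^+ 2 * _ = _](eq_bigr r) => [|j /and3P[a b e]];last first.
 by rewrite (negbTE a) (negbTE b) (negbTE e).
by rewrite !exprMn sqr_sqrtr //;ring.
Qed.

(** D and D' stand for the Gram determinants, P and P' for the squared products of the radii, before
    and after: D' <= 9/8 P' < 7/8 P <= D. *)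
Lemma ratio_lt (D D' P P' x0 x1 x2: R): 0 < P -> 0 < x2 -> 2 * x2 + 9 * x1 < 9 * x0 ->
 P' * x2 = P * (x2 - x0 + x1) -> `|D - P| <= 8^-1 * P -> `|D' - P'| <= 8^-1 * P' -> D' < D /\ 0 < D.
move=> P0 x20 w E;rewrite !ler_norml => /andP[d1 d2] /andP[d3 d4].
have H: 9 * P' < 7 * P.
 rewrite -(ltr_pM2r x20);have -> : 9 * P' * x2 = P * (9 * (x2 - x0 + x1)) by rewrite -mulrA E;ring.
 by rewrite [7 * P]mulrC -mulrA ltr_pM2l //;lra.
by split;lra.
Qed.

End Wedge.

Lemma local_param_sub (R: realType) n (M: topologicalType) (X: complex_manifold R n M) k L
  (V V': set 'rV[R]_k) (f: 'rV[R]_k -> M): open V' -> V' `<=` V -> local_param X L V f -> local_param X L V' f.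
move=> oV' VV [_ sf fr inj im];split=> //.
- exact: into_mono sf.
- by move=> x /VV;exact: fr.
- by move=> x y /VV Vx /VV Vy;exact: inj.
- by move=> W oW WV;apply: im => // x /WV /VV.
Qed.

Lemma moment_continuous (R: realType) n (M: topologicalType) (X: toric_kahler_manifold R n M) :
 continuous (moment X).
by move=> x;apply: (msm_continuous (O:= setT) (@openT _) (smooth_fun_msm (moment_smooth X))). Qed.

Section Swap.
#[local] Opaque jacobian invmx diff_into diff_self mjac kform.
Context {R n M} (X: toric_kahler_manifold R n M).
Context (i0 i1 i2: 'I_n) (n01: i1 != i0) (n02: i2 != i0) (n12: i2 != i1).
Context (q: M) (O: set M) (W: M -> 'rV[R]_(n + n)) (h: 'rV[R]_(n + n) -> M) (L: 'M[R]_n) (d delta: R).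
Hypothesis NC: normal_chart X q O W h L d.
Hypothesis bound: forall (r: 'I_n -> R) th, (forall j, 0 < r j) -> (forall j, r j ^+ 2 < delta) ->
 `|\det (gram X (h \o polar r) th) - (\prod_j r j) ^+ 2| <= 8^-1 * (\prod_j r j) ^+ 2.

Lemma swap_density (r: 'I_n -> R) th th': wedge i0 i1 i2 (\row_j r j ^+ 2) -> (forall j, 0 < r j) ->
 (forall j, r j ^+ 2 < delta) ->
 vol_density X (h \o polar (swap_r i0 i1 i2 r)) th' < vol_density X (h \o polar r) th.
move=> [_];rewrite !mxE => w02 w12 r0 rd.
have r02: r i0 < r i2 by move: w02;rewrite ltr_pXn2r ?nnegrE ?ltW.
have p1:= exprn_gt0 2 (r0 i1).
have e0: 0 < r i2 ^+ 2 - r i0 ^+ 2 + r i1 ^+ 2 by lra.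
have s0 j: 0 < swap_r i0 i1 i2 r j.
 rewrite /swap_r;case: ifP => // _;case: ifP => // _;case: ifP => // _;by rewrite sqrtr_gt0.
have sd j: swap_r i0 i1 i2 r j ^+ 2 < delta.
 rewrite /swap_r;case: ifP => // _;case: ifP => // _;case: ifP => // _.
 rewrite sqr_sqrtr ?ltW //;apply: lt_trans (rd i2);lra.
have P0: 0 < (\prod_j r j) ^+ 2 by rewrite exprn_gt0 // prodr_gt0.
have [H1 H2]:= ratio_lt P0 (exprn_gt0 2 (r0 i2)) w12 (swap_prod n01 n02 n12 r0 r02) (bound th r0 rd) (bound th' s0 sd).
by rewrite !vol_densityE ltr_sqrt.
Qed.

(** The squared radii depend affinely on the moment value, so every value near the given one is
    attained at a point of a nearby product torus in the chart. *)
Lemma normal_interior (x: 'rV[R]_n): (forall j, 0 < x 0 j < d) ->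
 interior (moment_polytope X) (moment X q - (2^-1 *: x) *m L^T).
move=> xd;have [[_ uL _ _ _] [_ _ mE _]]:= NC;have uLT: L^T \in unitmx by rewrite unitmx_tr.
set m:= moment X q;set a:= m - _.
pose s (b: 'rV[R]_n):= (2 *: (m - b)) *m invmx L^T.
have sa: s a = x by rewrite /s /a subKr -!scalemxAl scalerA divff ?pnatr_eq0 // scale1r mulmxK.
have sE b j: s b 0 j = 2 * (m *m invmx L^T) 0 j - 2 * (b *m invmx L^T) 0 j.
 by rewrite /s -scalemxAl mulmxBl mxE [X in _ * X]mxE [X in _ * (_ + X)]mxE mulrBr.
have cs j: {for a, continuous (fun b => s b 0 j)}.
 rewrite (_: (fun b => _) = fun b => 2 * (m *m invmx L^T) 0 j - 2 * (b *m invmx L^T) 0 j);last exact/funext.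
 apply: (CkB (k:= 0) (@openT _)) => //;first exact: Ck_cst.
 apply: CkM;[exact: openT|exact: Ck_cst|by move=> b _;exact: mulmx_entry_continuous].
have N1 j: \forall b \near a, 0 < s b 0 j.
 by apply: near_gt0 => //;rewrite sa;have /andP[]:= xd j.
have N2 j: \forall b \near a, 0 < d - s b 0 j.
 apply: (near_gt0 (f:= fun b => d - s b 0 j));last by rewrite sa subr_gt0;have /andP[]:= xd j.
 exact: (cvgB (cvg_cst d) (cs j)).
have N j: \forall b \near a, 0 < s b 0 j /\ 0 < d - s b 0 j.
 exact: (@filterI _ (nbhs a) (@nbhs_filter _ a) _ _ (N1 j) (N2 j)).
have NN: \forall b \near a, forall j, 0 < s b 0 j /\ 0 < d - s b 0 j by exact: (filter_forall _ N).
rewrite /interior /=;apply: (@filterS _ (nbhs a) (@nbhs_filter _ a) _ _ _ NN) => b Hb.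
pose r j:= Num.sqrt (s b 0 j).
have r2 j: r j ^+ 2 = s b 0 j by rewrite sqr_sqrtr // ltW //;have []:= Hb j.
have wd: disc d (polar r 0) by move=> j;rewrite sq_polar r2 -subr_gt0;have []:= Hb j.
have [Oh Wh]:= normal_hO NC wd.
exists (h (polar r 0)) => //;rewrite mE // Wh -/m.
have -> : \row_j sq (polar r 0) j = s b by apply/rowP => j;rewrite mxE sq_polar r2.
by rewrite -scalemxAl /s mulmxKV // scalerA mulVf // scale1r subKr.
Qed.

End Swap.

(** * A shrinking family of fibres *)

Section Shrink.
#[local] Opaque jacobian invmx diff_into diff_self mjac kform.
Context {R n M} (X: toric_kahler_manifold R n M).

Lemma moment_fibre_compact a: compact (moment X @^-1` [set a]).
apply: (subclosed_compact _ (tk_compact X)) => //;apply: closed_comp.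
 by move=> x _;exact: moment_continuous.
exact: (compact_closed (@norm_hausdorff _ _) (@compact_set1 _ a)).
Qed.

(** The compact fibre over the extreme value [m] consists of fixed points, so finitely many normal
    charts cover it. The complement of these charts has a closed moment image not containing [m], so
    they also contain all fibres over a ball around [m]. *)
Lemma corner_cover: (0 < n)%N -> exists (m: 'rV[R]_n) (s: seq M) (O: M -> set M) (W: M -> M -> 'rV[R]_(n + n))
  (h: M -> 'rV[R]_(n + n) -> M) (L: M -> 'M[R]_n) (d: M -> R) (rho: R),
 [/\ 0 < rho, exists q0, q0 \in s,
   forall q, q \in s -> normal_chart X q (O q) (W q) (h q) (L q) (d q) /\ moment X q = m &
   forall x, ball m rho (moment X x) -> exists2 q, q \in s & O q x].
move=> n0;have [m [[x0 mx0] fixm]]:= fixed_max X.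
have /choice[t Ht]: forall q, exists t: set M * (M -> 'rV[R]_(n + n)) * ('rV[R]_(n + n) -> M) * 'M[R]_n * R,
  moment X q = m -> normal_chart X q t.1.1.1.1 t.1.1.1.2 t.1.1.2 t.1.2 t.2.
 move=> q;have [mq|nq]:= pselect (moment X q = m).
  by have [ O [W [h [L [d NC]]]]]:= normal_form n0 (fixm q mq);exists (O, W, h, L, d).
 by exists (set0, fun=> 0, fun=> x0, 0, 0).
pose O q:= (t q).1.1.1.1.
pose F:= moment X @^-1` [set m].
have cF: compact F by exact: moment_fibre_compact.
have nO q: F q -> nbhs q (O q).
 by move=> /Ht [[_ _ [ oO _ _ _ _] Oq _] _];exact: open_nbhs_nbhs.
have [s [sF sO]]:= finite_subcover cF nO.
have [q0 q0s _]:= sO x0 mx0.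
pose U:= [set x | exists2 q, q \in s & O q x].
have oU: open U.
 rewrite openE => x [q qs Oqx];have [[_ _ [ oO _ _ _ _] _ _] _]:= Ht q (sF q qs).
 have: nbhs x (O q) by apply: open_nbhs_nbhs.
 by apply: filterS => y Oy;exists q.
have cK: compact (moment X @` (~` U)).
 apply: continuous_compact;first exact/continuous_subspaceT/moment_continuous.
 apply: (subclosed_compact _ (tk_compact X)) => //;exact: open_closedC.
have clK: closed (moment X @` (~` U)) by apply: compact_closed cK;exact: norm_hausdorff.
have nm: nbhs m (~` (moment X @` (~` U))).
 apply: open_nbhs_nbhs;split;first exact: closed_openC.
 by move=> [x nUx mx];apply: nUx;exact: sO.
have [rho /= rho0 Hrho]:= (iffLR (nbhs_ballP _ _) nm).
exists m, s, O, (fun q => (t q).1.1.1.2), (fun q => (t q).1.1.2), (fun q => (t q).1.2), (fun q => (t q).2), rho;split=> //.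
- by exists q0.
- by move=> q qs;split;[exact: Ht (sF q qs)|exact: sF].
- by move=> x /Hrho nx;apply: contrapT => nU;apply: nx;exists x.
Qed.

(** The matrices [T] translate squared radii in one chart into those in another; their columns are
    nonzero, so finitely many hyperplanes have to be avoided inside the open wedge. *)
Lemma good_direction (i0 i1 i2: 'I_n) (Ts: seq 'M[R]_n): i1 != i0 -> i2 != i0 -> i2 != i1 ->
 (forall T, T \in Ts -> T \in unitmx) ->
 exists2 x: 'rV[R]_n, wedge i0 i1 i2 x & forall T j, T \in Ts -> (x *m T) 0 j != 0.
move=> n01 n02 n12 uT.
have [|x Ux Hx]:= @avoid_hyperplanes R n [seq col j T | T <- Ts, j <- enum 'I_n] (wedge i0 i1 i2)
  (@wedge_open R n i0 i1 i2) (wedge_nonempty n01 n02 n12).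
 move=> c /allpairsP[[T j] /= [TTs _ ->]];apply/eqP => C0.
 have:= congr1 (mulmx (invmx T)) C0;rewrite colE mulKmx ?uT // mulmx0 => /matrixP/(_ j 0).
 by rewrite !mxE !eqxx => /eqP;rewrite oner_eq0.
exists x => // T j TTs;have:= Hx (col j T).
rewrite (_: (x *m col j T) 0 0 = (x *m T) 0 j);last by rewrite !mxE;apply: eq_bigr => k _;rewrite mxE.
by apply;apply/allpairsP;exists (T, j);rewrite mem_enum.
Qed.

Lemma small_scale (m v x: 'rV[R]_n) (rho delta d: R) (i0 i1 i2: 'I_n): 0 < rho -> 0 < delta -> 0 < d ->
 (forall j, 0 < x 0 j) -> exists2 t0: R, 0 < t0 & forall t, 0 < t <= t0 ->
 [/\ ball m rho (m - t *: v), forall j, (t *: x) 0 j < delta &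
   forall j, 20 * ((t *: x) 0 i0 + (t *: x) 0 i1 + (t *: x) 0 i2 + (t *: x) 0 j) < d].
move=> rho0 delta0 d0 x0;pose S:= 1 + \sum_j `|v 0 j| + \sum_j x 0 j.
have v0: 0 <= \sum_j `|v 0 j| by apply: sumr_ge0.
have xs0: 0 <= \sum_j x 0 j by apply: sumr_ge0 => j _;exact: ltW.
have S0: 0 < S by rewrite /S;lra.
have vS j: `|v 0 j| <= S.
 have: `|v 0 j| <= \sum_j `|v 0 j| by rewrite (bigD1 j) //= lerDl sumr_ge0.
 by rewrite /S;lra.
have xS j: x 0 j <= S.
 have: x 0 j <= \sum_j x 0 j by rewrite (bigD1 j) //= lerDl sumr_ge0 // => k _;exact: ltW.
 by rewrite /S;lra.
pose e:= Num.min rho (Num.min delta d).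
have e0: 0 < e by rewrite !lt_min rho0 delta0 d0.
have [er ed ed']: [/\ e <= rho, e <= delta & e <= d] by rewrite /e !ge_min !lexx !orbT.
(* Any constant above 80 would do: the last condition multiplies a sum of four entries, each at most
   t S, by 20. *)
exists (e / (100 * S)) => [|t /andP[t0 tle]];first by rewrite divr_gt0 // mulr_gt0.
have tS: 100 * (t * S) <= e.
 by move: tle;rewrite ler_pdivlMr ?mulr_gt0 // mulrCA.
have txS j: t * x 0 j <= t * S by rewrite ler_pM2l.
have tvS j: t * `|v 0 j| <= t * S by rewrite ler_pM2l.
have tS0: 0 < t * S by rewrite mulr_gt0.
split=> [|j|j].
- split=> // i j;rewrite (ord1 i) /ball /= !mxE opprB addrCA subrr addr0 normrM gtr0_norm //.
 by have:= tvS j;lra.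
- by rewrite mxE;have:= txS j;lra.
- by rewrite !mxE;have:= txS j;have:= txS i0;have:= txS i1;have:= txS i2;lra.
Qed.

Context (i0 i1 i2: 'I_n) (n01: i1 != i0) (n02: i2 != i0) (n12: i2 != i1).
Context (m: 'rV[R]_n) (s: seq M) (O: M -> set M) (W: M -> M -> 'rV[R]_(n + n))
  (h: M -> 'rV[R]_(n + n) -> M) (L: M -> 'M[R]_n) (d: M -> R) (q0: M) (delta: R).
Hypothesis q0s: q0 \in s.
Hypothesis NC: forall q, q \in s -> normal_chart X q (O q) (W q) (h q) (L q) (d q) /\ moment X q = m.
Hypothesis db: 0 < delta <= d q0.
Hypothesis bound: forall (r: 'I_n -> R) th, (forall j, 0 < r j) -> (forall j, r j ^+ 2 < delta) ->
 `|\det (gram X (h q0 \o polar r) th) - (\prod_j r j) ^+ 2| <= 8^-1 * (\prod_j r j) ^+ 2.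

(** On the part of the fibre in the chart at [q0] the isotopy maps one product torus to another with
    strictly smaller density. Elsewhere it is the identity, so [volume_lt] applies to the whole
    fibre, whatever its other parts are. *)
Lemma shrinking_fibre (x: 'rV[R]_n) (a:= m - (2^-1 *: x) *m (L q0)^T) (F:= moment X @^-1` [set a]) :
 wedge i0 i1 i2 x -> (forall q j, q \in s -> (x *m ((L q0)^T *m invmx (L q)^T)) 0 j != 0) ->
 (forall y, moment X y = a -> exists2 q, q \in s & O q y) ->
 (forall j, x 0 j < delta) -> (forall j, 20 * (x 0 i0 + x 0 i1 + x 0 i2 + x 0 j) < d q0) ->
 [/\ toric_fibre X F, F !=set0 & ~ hamiltonian_volume_minimizing X F].
move=> wx gx cx xd x20;have [x0 x02 x12]:= wx;have [NC0 m0]:= NC q0s.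
have /andP[delta0 deltad]:= db.
pose r j:= Num.sqrt (x 0 j).
have r0 j: 0 < r j by rewrite sqrtr_gt0.
have r2 j: r j ^+ 2 = x 0 j by rewrite sqr_sqrtr // ltW.
have rx: \row_j r j ^+ 2 = x by apply/rowP => j;rewrite mxE r2.
have wr: wedge i0 i1 i2 (\row_j r j ^+ 2) by rewrite rx.
have r02: r i0 < r i2 by rewrite ltr_sqrt.
have rdelta j: r j ^+ 2 < delta by rewrite r2.
have rd j: r j ^+ 2 < d q0 by apply: lt_le_trans (rdelta j) _.
have ra: a = moment X q0 - (2^-1 *: \row_j r j ^+ 2) *m (L q0)^T by rewrite m0 rx.
have r20 j: 20 * (r i0 ^+ 2 + r i1 ^+ 2 + r i2 ^+ 2 + r j ^+ 2) < d q0 by rewrite !r2.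
have [phi [C [Hphi clC CO phiC phir]]]:= twist_isotopy n01 n02 n12 NC0 r0 r02 r20 (tk_compact X).
have pd th: disc (d q0) (polar r th) by move=> j;rewrite sq_polar.
have sh:= normal_smooth NC0.
have P0 th:= polar_param NC0 th r0 rd ra.
have cF: compact F by exact: moment_fibre_compact.
have Fp th: F (h q0 (polar r th)).
 have [Oh Wh]:= normal_hO NC0 (pd th);have [_ [_ _ mE _]]:= NC0.
 rewrite /F /= mE // Wh ra;congr (_ - (_ *: _) *m _).
 by apply/rowP => j;rewrite !mxE sq_polar.
have F0: F !=set0 by exists (h q0 (polar r 0)).
pose th' th:= th *m shear i0 i1 i2 + shift i0 i1: 'rV[R]_n.
pose r':= swap_r i0 i1 i2 r.
have s0 j: r' j ^+ 2 < d q0.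
 rewrite /r' /swap_r;case: ifP => // _;case: ifP => // _;case: ifP => // _.
 rewrite sqr_sqrtr ?r2;last by have:= x0 i1;lra.
 by have:= rd i2;have:= x0 i1;rewrite r2;lra.
have sd th: disc (d q0) (polar r' th) by move=> j;rewrite sq_polar.
have dl th: vol_density X (phi \o (h q0 \o polar r)) th < vol_density X (h q0 \o polar r) th.
 have sg: smooth_into X setT (h q0 \o polar r').
  apply: (into_pre (V:= disc (d q0)) (f:= h q0) (h:= polar r') (@openT _) (@disc_open R n (d q0))) => //.
  exact: (polar_smooth r' (@openT _)).
 have dth: differentiable th' th.
  exact: differentiable_affine.
 have sg': smooth_into X setT ((h q0 \o polar r') \o th').
  apply: (into_pre (V:= setT) (f:= h q0 \o polar r') (h:= th') (@openT _) (@openT _)) => //.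
  exact: smooth_affine openT.
 have E: vol_density X (phi \o (h q0 \o polar r)) th = vol_density X ((h q0 \o polar r') \o th') th.
  apply: (density_near (V:= setT) (@openT _) _ sg') => // y _;exact: phir.
 have E2: vol_density X ((h q0 \o polar r') \o th') th =
   `|\det ('J th' th)| * vol_density X (h q0 \o polar r') (th' th).
  exact: (density_pre (V:= setT) I dth sg).
 have E3: `|\det ('J th' th)| = 1.
  exact: (etrans (congr1 (fun A: 'M[R]_n => `|\det A|) (J_affine (shear i0 i1 i2) (shift i0 i1) th)) (shear_det n01 n02 n12)).
 rewrite E E2 E3 mul1r.
 exact: (swap_density n01 n02 n12 bound th (th' th) wr r0 rdelta).
have vl: volume X n (phi @` F) < volume X n F.
 apply: volume_lt => //;first exact: Hphi.1.
  (* A point in the chart at [q0] is parametrized by its polar angles there. At any other point a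
     polar parametrization from another chart is shrunk so as to avoid the closed support [C] of
     [phi], and the density does not change. *)
  move=> p Fp';have [ O0p|nO0p]:= pselect (O q0 p).
   have sp: forall j, sq (W q0 p) j = r j ^+ 2.
    by move=> j;rewrite (normal_sq NC0 O0p (s:= x)) ?r2 // m0.
   have [th Eth]:= polar_exists r0 sp.
   have [[_ _ [_ _ _ hW _] _ _] _]:= NC0.
   exists (ball th 1), (h q0 \o polar r);split;[exact: P0|by move=> y _;exact: (ltW (dl y))|].
   by exists th;[exact: ballxx|rewrite /= -Eth hW].
  have [q qs Oqp]:= cx p Fp';have [NCq mq]:= NC qs.
  have [[_ uL [_ _ _ hW _] _ _] [WO _ mE _]]:= NCq.
  have uLT: (L q)^T \in unitmx by rewrite unitmx_tr.
  (* The same moment value read in the chart at [q]: [y] is the row of squared radii there. It is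
     nonnegative on the fibre and has no zero entry by the choice of [x]. *)
  pose y:= x *m ((L q0)^T *m invmx (L q)^T).
  have ya: a = moment X q - (2^-1 *: y) *m (L q)^T.
   by rewrite mq /a /y -!scalemxAl mulmxA mulmxKV.
  have sy j: sq (W q p) j = y 0 j by rewrite (normal_sq NCq Oqp (s:= y)) // -ya.
  have y0 j: 0 < y 0 j by rewrite lt_def gx // -sy /sq addr_ge0 ?sqr_ge0.
  pose u j:= Num.sqrt (y 0 j).
  have u0 j: 0 < u j by rewrite sqrtr_gt0.
  have u2 j: u j ^+ 2 = y 0 j by rewrite sqr_sqrtr // ltW.
  have su j: sq (W q p) j = u j ^+ 2 by rewrite u2.
  have ud j: u j ^+ 2 < d q by rewrite -su;exact: (normal_WO NCq Oqp).
  have uy: \row_j u j ^+ 2 = y by apply/rowP => j;rewrite mxE u2.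
  have [th Eth]:= polar_exists u0 su.
  have P:= polar_param NCq th u0 ud (etrans ya (congr1 (fun z => moment X q - (2^-1 *: z) *m (L q)^T) (esym uy))).
  have [oV sV _ _ _]:= P.
  pose V:= ball th (1: R) `&` (h q \o polar u) @^-1` (~` C).
  have oV': open V by apply: (into_open oV sV);exact: closed_openC.
  have P': local_param X F V (h q \o polar u) by apply: local_param_sub P => // z [].
  exists V, (h q \o polar u);split;first exact: P'.
   move=> z Vz;rewrite le_eqVlt;apply/orP;left;apply/eqP.
   have [_ sV' _ _ _]:= P'.
   by apply: (density_near oV' Vz sV') => z' [_ nC];rewrite /= phiC.
  have Ep: h q (polar u th) = p by rewrite -Eth hW.
  exists th => //;split;first exact: ballxx.
  by rewrite /preimage /= Ep => /CO.
 by exists (ball 0 1), (h q0 \o polar r), 0;split;[exact: P0|exact: ballxx|exact: dl].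
split=> //;last by move=> /(_ phi Hphi);rewrite leNgt vl.
exists a => //;rewrite ra;rewrite rx;apply: (normal_interior NC0) => j.
by rewrite x0 (lt_le_trans (xd j)).
Qed.

End Shrink.

Theorem theorem6 (R : realType) (n : nat) (M : topologicalType)
    (X : toric_kahler_manifold R n M) (hn : (3 <= n)%N) :
  (exists L : set M, toric_fibre X L /\ ~ hamiltonian_volume_minimizing X L) /\
  infinite_set [set L : set M |
    toric_fibre X L /\ ~ hamiltonian_volume_minimizing X L].
Proof.
have n0: (0 < n)%N by exact: leq_trans hn.
have n1: (1 < n)%N by exact: leq_trans hn.
pose i0:= Ordinal n0;pose i1:= Ordinal n1;pose i2:= Ordinal hn.
have [m [s [ O [W [h [L [d [rho [rho0 [q0 q0s] NC cov]]]]]]]]]:= corner_cover X n0.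
have [NC0 m0]:= NC q0 q0s.
have [delta db bound]:= density_bound NC0.
have /andP[delta0 deltad]:= db.
have d0: 0 < d q0 by exact: lt_le_trans deltad.
have uL q: q \in s -> (L q)^T \in unitmx.
 by move=> qs;have [[[_ u _ _ _] _] _]:= NC q qs;rewrite unitmx_tr.
(* One direction serves all scales: both the wedge and the hyperplane conditions are invariant under
   multiplication by t > 0. *)
have [|x wx gx]:= @good_direction R n i0 i1 i2 [seq (L q0)^T *m invmx (L q)^T | q <- s] isT isT isT.
 by move=> T /mapP[q qs ->];rewrite unitmx_mul unitmx_inv !uL.
have [x0 x02 x12]:= wx.
pose v:= (2^-1 *: x) *m (L q0)^T.
have v0: v != 0.
 apply/eqP => E;have:= congr1 (fun z => (z *m invmx (L q0)^T) 0 i0) E.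
 rewrite /= mulmxK ?uL // mul0mx !mxE => /eqP.
 by rewrite mulf_eq0 invr_eq0 pnatr_eq0 /= gt_eqF.
have [t0 t00 Ht]:= small_scale m v i0 i1 i2 rho0 delta0 d0 x0.
pose F t:= moment X @^-1` [set m - t *: v].
have main t: 0 < t <= t0 -> [/\ toric_fibre X (F t), F t !=set0 & ~ hamiltonian_volume_minimizing X (F t)].
 move=> tt;have [b1 b2 b3]:= Ht t tt;have /andP[tp _]:= tt.
 have tv: t *: v = (2^-1 *: (t *: x)) *m (L q0)^T by rewrite /v -!scalemxAl scalerA mulrC -scalerA.
 rewrite /F tv;apply: (shrinking_fibre (i0:= i0) (i1:= i1) (i2:= i2) isT isT isT q0s NC db bound) => //.
 - split=> [j||];rewrite !mxE ?mulr_gt0 ?ltr_pM2l //.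
  by rewrite !(mulrCA _ t) -mulrDr ltr_pM2l.
 - move=> q j qs;rewrite -scalemxAl mxE mulf_neq0 //;first by rewrite gt_eqF.
  by apply: gx;apply/mapP;exists q.
 - by move=> y my;apply: cov;rewrite my -tv.
split.
 have tt: 0 < t0 <= t0 by rewrite t00 lexx.
 by have [H1 _ H2]:= main t0 tt;exists (F t0).
(* These fibres are nonempty and lie over distinct values m - t v, since v is nonzero; hence they
   are distinct sets. *)
pose f (k: nat):= F (t0 / k.+1%:R).
have tk k: 0 < t0 / k.+1%:R <= t0.
 by rewrite divr_gt0 ?ltr0Sn //= ler_pdivrMr ?ltr0Sn // ler_pMr // ler1n.
have finj: injective f.
 move=> k l E;have [_ [y Fy] _]:= main _ (tk k).
 have Fy': f l y by rewrite -E.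
 have /eqP: (t0 / k.+1%:R) *: v = (t0 / l.+1%:R) *: v.
  by apply: (@subrI _ m);rewrite -[LHS]Fy -[RHS]Fy'.
 rewrite -subr_eq0 -scalerBl scaler_eq0 (negbTE v0) orbF subr_eq0 => /eqP/(mulfI (lt0r_neq0 t00))/invr_inj/eqP.
 by rewrite eqr_nat eqSS => /eqP.
move=> fin.
have: finite_set (f @^-1` [set L: set M | toric_fibre X L /\ ~ hamiltonian_volume_minimizing X L]).
 by apply: finite_preimage fin => k l _ _;exact: finj.
rewrite (_: f @^-1` _ = setT);first exact: infinite_nat.
by apply/seteqP;split=> // k _;have [H1 _ H2]:= main _ (tk k).
Qed.
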